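(* Let $p\in\{1,\dots,7\}$ and let $j\ge1$ be fixed. Let $(\lambda_j,u_j)$ be the $j$-th exact eigenpair of $-\Delta u=\lambda u$ in $\Omega=(0,1)^d$, $u=0$ on $\partial\Omega$, and let $(\tilde\lambda_j^h,\tilde u_j^h)$ be the corresponding approximate eigenpair of the $p$-th order maximum-continuity isogeometric discretization with the optimally blended quadrature rule $O_p$. Assume that $u_j$ and $\tilde u_j^h$ are normalized by $b(u_j,u_j)=1$ and $\tilde b_h(\tilde u_j^h,\tilde u_j^h)=1$, and that their signs are chosen such that $b(u_j,\tilde u_j^h)>0$. Then for all sufficiently small $h$, $$|u_j-\tilde u_j^h|_{1,\Omega}\le C\,h^p,$$ where $C$ is a constant independent of $h$.
   Context: **Continuous problem.** Let $d\in\{1,2,3\}$, $\Omega=(0,1)^d$. The exact eigenpairs $(\lambda_j,u_j)$, $u_j\in H^1_0(\Omega)$, satisfy $a(u_j,v)=\lambda_j b(u_j,v)$ for all $v\in H_0^1(\Omega)$, where $a(w,v)=\int_\Omega\nabla w\cdot\nabla v$ and $b(w,v)=\int_\Omega wv$; $0<\lambda_1<\lambda_2\le\lambda_3\le\cdots$ and the $u_j$ are $L^2(\Omega)$-orthonormal. $|\cdot|_{1,\Omega}$ is the $H^1(\Omega)$-seminorm. **Mesh and space.** For positive integers $N_1,\dots,N_d$ put $h_k=1/N_k$; $\overline\Omega$ carries the uniform tensor-product mesh $\mathcal T_h$ with $\prod_k N_k$ elements with nodes $(h_1n_1,\dots,h_dn_d)$, $0\le n_k\le N_k$, and $h=\sqrt{\sum_k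 h_k^2}$ (for $d=1$, $h=h_1$). $V_h\subset H_0^1(\Omega)$ is spanned by tensor products of one-dimensional B-splines of degree $p$ on this mesh with non-repeated knots (maximum continuity $C^{p-1}$). **Quadrature.** In one dimension $G_m$ and $GL_m$ denote the $m$-point Gauss–Legendre and Gauss–Lobatto rules, mapped affinely to each element. Linear combinations $\tau\mathcal Q_1+(1-\tau)\mathcal Q_2$ of rules are called blended rules; in several dimensions the tensor product of the one-dimensional rule is used. The optimally blended rule $O_p$ is: - $p=1$: $\tfrac12G_2+\tfrac12GL_2$; - $p=2$: $\tfrac13G_3+\tfrac23GL_3$ (equivalently $2G_3-G_2$); - $p=3$: $-\tfrac32G_4+\tfrac52GL_4$ (equivalently $\tfrac{13}{3}G_4-\tfrac{10}{3}G_3$); - $p=4$: $-\tfrac{79}{5}G_5+\tfrac{84}{5}GL_5$ (equivalently $22G_5-21G_4$); - $p=5$: $-174G_6+175GL_6$ (equivalently $211G_6-210G_5$); - $p=6$: $-\tfrac{91177}{35}G_7+\tfrac{91212}{35}GL_7$ (equivalently $\tfrac{30414}{10}G_7-\tfrac{30404}{10}G_6$); - $p=7$: $-\tfrac{105103}{2}G_8+\tfrac{105105}{2}GL_8$ (equivalently $60061G_8-60060G_7$). **Discrete problem.** $\tilde a_h,\tilde b_h$ are $a,b$ with the integral over each element replaced by the rule $O_p$. The approximate eigenpairs $(\tilde\lambda_j^h,\tilde u_j^h)$, $\tilde u_j^h\in V_h$, satisfy $\tilde a_h(\tilde u_j^h,v_h)=\tilde\lambda_j^h\,\tilde b_h(\tilde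 u_j^h,v_h)$ for all $v_h\in V_h$; they are sorted in ascending order and paired with the exact ones.
   Formalization: For a multiple eigenvalue the claim fails for an arbitrary u_j in the eigenspace; here u_j is the normalized L² projection of the approximate eigenfunction onto the eigenspace of λ_j (proved to exist for small h); for simple λ_j this is just the sign condition. *)

(* Defs.v *)
From HB Require Import structures.
From mathcomp Require Import all_boot all_order all_algebra.
From mathcomp Require Import polyrcf.
From mathcomp Require Import all_classical all_reals all_analysis.

Set Implicit Arguments.
Unset Strict Implicit.
Unset Printing Implicit Defensive.

Import Order.TTheory GRing.Theory Num.Theory.
Import numFieldNormedType.Exports.

Local Open Scope classical_set_scope.
Local Open Scope ring_scope.

(** The sigma-algebra generated by the coordinates, as the library does for
    tuples. *)
Section measurable_rV.
Context {d} {T : sigmaRingType d} {n : nat}.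

Definition rV_coord (i : 'I_n) (x : 'rV[T]_n) : T := x ord0 i.

Let rV_set0 : g_sigma_preimage rV_coord set0.
Proof. exact: sigma_algebra0. Qed.

Let rV_setC A : g_sigma_preimage rV_coord A ->
  g_sigma_preimage rV_coord (~` A).
Proof. exact: sigma_algebraC. Qed.

Let rV_bigcup (F : (set 'rV[T]_n)^nat) :
  (forall i, g_sigma_preimage rV_coord (F i)) ->
  g_sigma_preimage rV_coord (\bigcup_i (F i)).
Proof. exact: sigma_algebra_bigcup. Qed.

HB.instance Definition _ := @isMeasurable.Build (measure_tuple_display d)
  'rV[T]_n (g_sigma_preimage rV_coord) rV_set0 rV_setC rV_bigcup.

End measurable_rV.

Section measurable_rV_fun.
Context d1 d2 (T1 : measurableType d1) (T2 : measurableType d2).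

Lemma measurable_coord n (i : 'I_n) :
  measurable_fun [set: 'rV[T2]_n] (fun x => x ord0 i).
Proof.
move=> _ Y mY; rewrite setTI; apply: sub_sigma_algebra => /=.
rewrite -bigcup_seq/=; exists i => /=; first by rewrite mem_index_enum.
by exists Y => //; rewrite setTI.
Qed.

Lemma measurable_fun_rV n (f : T1 -> 'rV[T2]_n) :
  (forall i, measurable_fun [set: T1] (fun x => f x ord0 i)) ->
  measurable_fun [set: T1] f.
Proof.
move=> mf _ B.
suff : g_sigma_preimage (@rV_coord _ T2 n) `<=`
    [set A | measurable (f @^-1` A)].
  by move=> + mB => /(_ B mB); rewrite setTI.
apply: smallest_sub.
  split.
  - by rewrite /= preimage_set0.
  - by move=> A /= mA; rewrite setTD preimage_setC; exact: measurableC.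
  - by move=> F /= mF; rewrite preimage_bigcup; exact: bigcupT_measurable.
rewrite -bigcup_seq => A [i _ [Y mY <-]] /=.
by rewrite setTI -[X in measurable X]setTI; exact: mf.
Qed.

End measurable_rV_fun.

Section lebesgue_rV.
Context {R : realType}.

Definition rV_cons n (x : measurableTypeR R * 'rV[R]_n) :
    'rV[R]_n.+1 :=
  row_mx (const_mx x.1 : 'rV_1) x.2.

Definition rV_uncons n (v : 'rV[R]_n.+1) :
    measurableTypeR R * 'rV[R]_n :=
  (v ord0 ord0, \row_i v ord0 (lift ord0 i)).

Lemma rV_consK n : cancel (@rV_cons n) (@rV_uncons n).
Proof.
move=> [x y]; congr pair.
  transitivity (row_mx (const_mx x : 'rV_1) y ord0 (lshift n ord0)).
    by congr (row_mx _ _ _ _); exact: val_inj.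
  by rewrite row_mxEl mxE.
apply/rowP => i; rewrite mxE -[RHS](row_mxEr (const_mx x : 'rV_1)).
by congr (row_mx _ _ _ _); exact: val_inj.
Qed.

Lemma measurable_rV_cons n : measurable_fun setT (@rV_cons n).
Proof.
apply: measurable_fun_rV => i; have [j ->|j ->] := split_ordP (i : 'I_(1 + n)).
  rewrite (_ : (fun x => _) = fst :> (_ -> measurableTypeR R)).
    exact: measurable_fst.
  by apply/funext => x; apply: etrans (row_mxEl _ _ _ _) _; rewrite mxE.
rewrite (_ : (fun x => _) = (fun y : 'rV[R]_n => y ord0 j) \o snd).
  exact: (measurableT_comp (measurable_coord j) measurable_snd).
by apply/funext => x; exact: row_mxEr.
Qed.

Lemma measurable_rV_uncons n : measurable_fun setT (@rV_uncons n).
Proof.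
apply: measurable_fun_pair; first exact: measurable_coord.
apply: measurable_fun_rV => i.
by under eq_fun do rewrite mxE; exact: measurable_coord.
Qed.

Section step.
Context n (m : {sigma_finite_measure set 'rV[R]_n -> \bar R}).

Definition rV_step : set 'rV[R]_n.+1 -> \bar R :=
  pushforward (lebesgue_measure \x m)%E (@rV_cons n).

Let step0 : rV_step set0 = 0%E.
Proof. by rewrite /rV_step /pushforward preimage_set0 measure0. Qed.

Let step_ge0 A : (0 <= rV_step A)%E.
Proof. by rewrite /rV_step /pushforward; exact: measure_ge0. Qed.

Let step_sigma_additive : semi_sigma_additive rV_step.
Proof.
move=> F mF tF mUF; rewrite /rV_step /pushforward preimage_bigcup.
have mpre A : measurable A -> measurable (@rV_cons n @^-1` A).
  by move=> mA; rewrite -[X in measurable X]setTI; exact: measurable_rV_cons.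
apply: measure_semi_sigma_additive.
- by move=> i; exact: mpre.
- apply/trivIsetP => /= i j _ _ ij; rewrite -preimage_setI.
  by move/trivIsetP : tF => /(_ _ _ _ _ ij) ->//; rewrite preimage_set0.
- by rewrite -preimage_bigcup; exact: mpre.
Qed.

HB.instance Definition _ := isMeasure.Build _ _ _ rV_step
  step0 step_ge0 step_sigma_additive.

Let step_sigma_finite : sigma_finite setT rV_step.
Proof.
have /sigma_finiteP[F [TF ndF Foo]] := sigma_finiteT (@lebesgue_measure R).
have /sigma_finiteP[G [TG ndG Goo]] := sigma_finiteT m.
exists (fun k => @rV_uncons n @^-1` (F k `*` G k)).
  rewrite -preimage_bigcup (_ : \bigcup_k (F k `*` G k) = setT) ?preimage_setT//.
  apply/seteqP; split=> // -[x y] _.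
  have [i _ Fx] : (\bigcup_i F i) x by rewrite -TF.
  have [k _ Gy] : (\bigcup_i G i) y by rewrite -TG.
  exists (maxn i k) => //; split.
  - by move: x Fx; exact/subsetPset/ndF/leq_maxl.
  - by move: y Gy; exact/subsetPset/ndG/leq_maxr.
move=> k; have [mF Fk] := Foo k; have [mG Gk] := Goo k.
have mFG : measurable (F k `*` G k) by exact: measurableX.
split.
  by rewrite -[X in measurable X]setTI; exact: measurable_rV_uncons.
rewrite /rV_step /pushforward -comp_preimage (_ : _ \o _ = id).
  by rewrite preimage_id product_measure1E// lte_mul_pinfty// ge0_fin_numE.
by apply/funext => x; exact: rV_consK.
Qed.

HB.instance Definition _ := Measure_isSigmaFinite.Build _ _ _ rV_step
  step_sigma_finite.

End step.

Fixpoint lebesgue_rV n :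
    {sigma_finite_measure set 'rV[R]_n -> \bar R} :=
  match n with
  | 0 => \d_(0 : 'rV[R]_0)
  | n'.+1 => rV_step (lebesgue_rV n')
  end.

End lebesgue_rV.

Section continuous_problem.
Context {R : realType} (d : nat).
Implicit Types (u v w phi : 'rV[R]_d -> R) (g : 'I_d -> 'rV[R]_d -> R).

Definition Omega : set 'rV[R]_d := [set x | forall k, 0 < x ord0 k < 1].

Definition bform u v : R := \int[lebesgue_rV d]_(x in Omega) (u x * v x).

Definition L2 u : Prop :=
  measurable_fun Omega u /\
  (lebesgue_rV d).-integrable Omega (fun x => (u x ^+ 2)%:E).

Definition partial (k : 'I_d) u : 'rV[R]_d -> R :=
  fun x => 'D_(delta_mx ord0 k) u x.

(** [foldr partial phi s] is the iterated partial derivative of [phi] along the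
    directions listed in [s]. *)
Definition smooth phi : Prop := forall s : seq 'I_d,
  continuous (foldr partial phi s) /\
  forall k x, derivable (foldr partial phi s) x (delta_mx ord0 k).

Definition test_function phi : Prop :=
  smooth phi /\
  exists K : set 'rV[R]_d,
    [/\ compact K, K `<=` Omega & forall x, ~ K x -> phi x = 0].

(** [H01_gradient u g]: [u] lies in the closure of the test functions for the
    H^1 norm and [g] is its (weak) gradient; [g] is unique almost everywhere. *)
Definition H01_gradient u g : Prop :=
  [/\ L2 u, forall k, L2 (g k) &
    exists phi : nat -> 'rV[R]_d -> R,
      [/\ forall n, test_function (phi n),
          bform (phi n \- u) (phi n \- u) @[n --> \oo] --> (0 : R) &
          forall k, bform (partial k (phi n) \- g k) (partial k (phi n) \- g k)
            @[n --> \oo] --> (0 : R)]].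

Definition H01 u : Prop := exists g, H01_gradient u g.

(** The default value is used only outside H^1_0. *)
Definition grad u : 'I_d -> 'rV[R]_d -> R :=
  xget (fun _ _ => 0) (H01_gradient u).

Definition aform u v : R := \sum_(k < d) bform (grad u k) (grad v k).

Definition H1_seminorm u : R := Num.sqrt (aform u u).

Definition eigen (l : R) u : Prop :=
  H01 u /\ forall v, H01 v -> aform u v = l * bform u v.

(** An enumeration of all the eigenpairs, with multiplicity: the last clause
    leaves no eigenfunction out. *)
Definition eigensystem (lam : nat -> R) (us : nat -> 'rV[R]_d -> R) : Prop :=
  [/\ forall i, eigen (lam i) (us i),
      forall i j, bform (us i) (us j) = (i == j)%:R,
      {homo lam : i j / (i <= j)%N >-> i <= j} &
      forall l w, eigen l w -> (forall i, bform w (us i) = 0) -> bform w w = 0].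

(** Indices start from 0: [j] stands for the (j+1)-st eigenpair. *)
Definition eigenpair (j : nat) (l : R) v : Prop :=
  exists lam us, [/\ eigensystem lam us, lam j = l & us j = v].

(** Pairing of a discrete eigenfunction [v] with an eigenfunction [u] of [l]. For
    a simple eigenvalue it is the sign condition [0 < bform u v]. Otherwise [u] has to
    be selected in the eigenspace, as the direction of the L^2 projection of [v]:
    [v] is orthogonal to the eigenfunctions of [l] which are orthogonal to [u]. *)
Definition paired (l : R) u v : Prop :=
  0 < bform u v /\ forall w, eigen l w -> bform u w = 0 -> bform v w = 0.

End continuous_problem.

Section quadrature.
Context {R : realType}.

(** Lists of (node, weight), on the reference interval [-1, 1]. *)
Definition rule := seq (R * R).

Definition legendre (m : nat) : {poly R} :=
  ((2 ^ m * m`!)%:R)^-1 *: ((('X^2 - 1) ^+ m)^`(m))%R.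

Definition interpolatory (xs : seq R) : rule :=
  [seq (x, \int[lebesgue_measure]_(t in `[(-1 : R), 1])
             \prod_(y <- xs | y != x) ((t - y) / (x - y))) | x <- xs].

Definition gauss_legendre (m : nat) : rule :=
  interpolatory (rootsR (legendre m)).

Definition gauss_lobatto (m : nat) : rule :=
  interpolatory (-1 :: rcons (rootsR (legendre m.-1)^`()) 1).

Definition blend (tau : R) (q1 q2 : rule) : rule :=
  [seq (xw.1, tau * xw.2) | xw <- q1] ++
  [seq (xw.1, (1 - tau) * xw.2) | xw <- q2].

(** The last two fractions are 91177/35 and 105103/2; numerals are unary. *)
Definition optimal_tau (p : nat) : R :=
  match p with
  | 1 => 1 / 2
  | 2 => 1 / 3
  | 3 => - (3 / 2)
  | 4 => - (79 / 5)
  | 5 => - 174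
  | 6 => - ((91 * 1000 + 177) / 35)
  | 7 => - ((105 * 1000 + 103) / 2)
  | _ => 0
  end.

Definition optimal_rule (p : nat) : rule :=
  blend (optimal_tau p) (gauss_legendre p.+1) (gauss_lobatto p.+1).

End quadrature.

Section discrete_problem.
Context {R : realType} (d : nat) (N : 'I_d -> nat) (p : nat).

(** Open uniform knot vector 0, ..., 0, 1/n, ..., (n-1)/n, 1, ..., 1, with the
    end knots repeated p+1 times. *)
Definition knot (n i : nat) : R := (minn (i - p) n)%:R / n%:R.

(** Cox-de Boor recursion for the polynomial to which the [i]-th B-spline of degree
    [q] restricts on the element [e/n, (e+1)/n], which is the knot span [e + p].
    As [0^-1 = 0], the terms with a vanishing denominator drop out. *)
Fixpoint bspline_piece (n e q i : nat) : {poly R} :=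
  match q with
  | 0 => ((i == e + p)%N)%:R
  | q'.+1 =>
      (knot n (i + q) - knot n i)^-1 *:
        (('X - (knot n i)%:P) * bspline_piece n e q' i) +
      (knot n (i + q).+1 - knot n i.+1)^-1 *:
        (((knot n (i + q).+1)%:P - 'X) * bspline_piece n e q' i.+1)
  end.

(** The point 1 is attributed to the last element. *)
Definition element_of (n : nat) (x : R) : nat :=
  minn (Num.truncn (x * n%:R)) n.-1.

Definition bspline (n i : nat) (x : R) : R :=
  (bspline_piece n (element_of n x) p i).[x].

(** Indices of the B-splines vanishing on the boundary: of the n + p univariate
    B-splines only the first and the last one do not vanish at 0 and 1, whence the
    successors below. *)
Definition Vh_index := {dffun forall k : 'I_d, 'I_(N k + p - 2)}.

(** An element of V_h is given by its coefficients. *)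
Definition Vh := Vh_index -> R.

Definition Vh_fun (c : Vh) (x : 'rV[R]_d) : R :=
  \sum_(i : Vh_index) c i * \prod_(k < d) bspline (N k) (i k).+1 (x ord0 k).

Definition element := {dffun forall k : 'I_d, 'I_(N k)}.

Definition Vh_val (c : Vh) (e : element) (x : 'rV[R]_d) : R :=
  \sum_(i : Vh_index) c i *
    \prod_(k < d) (bspline_piece (N k) (e k) p (i k).+1).[x ord0 k].

(** On the closed element, boundary nodes included. *)
Definition Vh_partial (l : 'I_d) (c : Vh) (e : element) (x : 'rV[R]_d) : R :=
  \sum_(i : Vh_index) c i *
    \prod_(k < d) (let f := bspline_piece (N k) (e k) p (i k).+1 in
                   if k == l then f^`() else f).[x ord0 k].

Definition quadrature (F : element -> 'rV[R]_d -> R) : R :=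
  let O := @optimal_rule R p in
  \sum_(e : element) \sum_(q : {ffun 'I_d -> 'I_(size O)})
    (\prod_(k < d) ((nth (0, 0) O (q k)).2 / (2 * (N k)%:R))) *
    F e (\row_k (((e k)%:R + (1 + (nth (0, 0) O (q k)).1) / 2) / (N k)%:R)).

Definition bform_h (c c' : Vh) : R :=
  quadrature (fun e x => Vh_val c e x * Vh_val c' e x).

Definition aform_h (c c' : Vh) : R :=
  quadrature (fun e x => \sum_(l < d) Vh_partial l c e x * Vh_partial l c' e x).

(** [#|Vh_index|] is the dimension of V_h, so that no eigenpair is missing. *)
Definition discrete_eigensystem (lam : 'I_#|{: Vh_index}| -> R)
    (c : 'I_#|{: Vh_index}| -> Vh) : Prop :=
  [/\ forall i v, aform_h (c i) v = lam i * bform_h (c i) v,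
      forall i j, bform_h (c i) (c j) = (i == j)%:R &
      {homo lam : i j / (i <= j)%N >-> i <= j}].

Definition discrete_eigenpair (j : nat) (l : R) (v : Vh) : Prop :=
  exists lam c i,
    [/\ discrete_eigensystem lam c, nat_of_ord i = j, lam i = l & c i = v].

Definition mesh_size : R := Num.sqrt (\sum_(k < d) (N k)%:R ^- 2).

End discrete_problem.

(* Main.v *)
Require Import Defs.
From mathcomp Require Import all_boot all_order all_algebra.
From mathcomp Require Import polyrcf polyorder cauchyreals ring lra zify.
From mathcomp Require Import all_classical all_reals all_analysis.
From mathcomp Require Import measurable_realfun.

(** By tensor products everything reduces to one dimension. The rule [O_p] is exact in degree less
    than 2p and overestimates the integral of a polynomial of degree 2p by a positive multiple of
    its leading coefficient. So the discrete stiffness form is exact, and the discrete mass form is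
    the exact one plus a nonnegative defect, which is O(n^-2) relatively to the stiffness form and
    O(n^-2p) on spline approximations of the sines. Such splines are the trial functions of the
    upper bounds for the discrete eigenvalues; the lower bounds come from a spectral gap inequality
    for continuous piecewise smooth functions. Up to O(h^p), the trial functions of an eigenspace
    lie in the span of the discrete eigenfunctions of the same cluster, so that conversely [uh] is
    O(h^p)-close, in both forms, to an exact eigenfunction [v]. The pairing makes
    [uh - b(u, uh) u] orthogonal to the eigenspace, hence at most as large as [uh - v], and the
    normalizations give [b(u, uh) = 1 + O(h^p)]. *)

Set Implicit Arguments.
Unset Strict Implicit.
Unset Printing Implicit Defensive.

Import Order.TTheory GRing.Theory Num.Theory.
Import numFieldNormedType.Exports.
Local Open Scope classical_set_scope.
Local Open Scope ring_scope.

(** * Bilinear forms and their tensor products *)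

(** Eigenvalues of the cube may be multiple, and a mesh with unequal [N k] may split a multiple
    eigenvalue in an arbitrary manner, so a trial function cannot be attached to a single discrete
    eigenfunction. Whole groups of equal exact eigenvalues are compared instead. These are integer
    multiples of [pi ^+ 2], so half of [pi ^+ 2] is a gap on both sides whatever the multiplicity.
    On a cell the mass defect is a constant times the squared top coefficient of the spline times
    [n^-(2p+1)]. For an arbitrary spline this coefficient can be of order [n^p], which leaves only
    the relative bound [n^-2]; it stays bounded for splines that approximate a smooth function, and
    the approximation argument has to carry this bound along. The crude bound serves to separate the
    eigenvalues, the fine one to get the rate. The space H^1_0 is given as a closure, without traces
    or compactness. Weak gradients are identified by testing against products of sines, and the
    completeness of these products also shows that they exhaust the eigenfunctions. *)

Section forms.
Context {R : realFieldType}.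

(** Common source of the Cauchy-Schwarz inequalities for matrices, finite sums and integrals; the
    forms are only semidefinite, so [c = 0] has to be covered. *)
Lemma discriminant (a b c : R) : 0 <= c ->
  (forall t, 0 <= a + 2 * t * b + t ^+ 2 * c) -> b ^+ 2 <= a * c.
Proof.
rewrite le_eqVlt => /predU1P[<- h|c0 h].
  rewrite mulr0; have [->|b0] := eqVneq b 0; first by rewrite expr0n.
  (* For [c = 0] the polynomial is affine; this is the point where it takes the value -1. *)
  have := h (- (a + 1) / (2 * b)); rewrite mulr0 addr0.
  have -> : a + 2 * (- (a + 1) / (2 * b)) * b = - 1 by field.
  by rewrite oppr_ge0 ler10.
have c1 : c != 0 by rewrite gt_eqF.
have := h (- b / c).
have -> : a + 2 * (- b / c) * b + (- b / c) ^+ 2 * c = a - b ^+ 2 / c by field.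
by rewrite subr_ge0 ler_pdivrMr.
Qed.

Section fixed_index.
Context {I : finType}.
Implicit Types (G H : I -> I -> R) (x y z : I -> R).

Definition mform G x y : R := \sum_i \sum_j G i j * (x i * y j).
Definition sym G := forall i j, G i j = G j i.
Definition psd G := forall x, 0 <= mform G x x.
Definition basis_vec (i : I) : I -> R := fun j => (j == i)%:R.

Lemma mformC G x y : sym G -> mform G x y = mform G y x.
Proof.
move=> sG; rewrite /mform exchange_big /=; apply: eq_bigr => i _; apply: eq_bigr => j _.
by rewrite sG (mulrC (x _)).
Qed.

Lemma eq_mform G x x' y y' : x =1 x' -> y =1 y' -> mform G x y = mform G x' y'.
Proof. by move=> e e'; apply: eq_bigr => i _; apply: eq_bigr => j _; rewrite e e'. Qed.

Lemma mformDl G x y z : mform G (fun i => x i + y i) z = mform G x z + mform G y z.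
Proof.
rewrite /mform -big_split; apply: eq_bigr => i _; rewrite -big_split /=.
by apply: eq_bigr => j _; ring.
Qed.

Lemma mformZl G c x z : mform G (fun i => c * x i) z = c * mform G x z.
Proof.
rewrite /mform mulr_sumr; apply: eq_bigr => i _; rewrite mulr_sumr.
by apply: eq_bigr => j _; ring.
Qed.

Lemma mform_suml G (K : Type) (r : seq K) (P : pred K) (a : K -> R) (X : K -> I -> R) z :
  mform G (fun i => \sum_(k <- r | P k) a k * X k i) z = \sum_(k <- r | P k) a k * mform G (X k) z.
Proof.
rewrite /mform; under eq_bigr => i _ do under eq_bigr => j _ do rewrite mulr_suml mulr_sumr.
under eq_bigr => i _ do rewrite exchange_big /=.
rewrite exchange_big /=; apply: eq_bigr => k _.
rewrite mulr_sumr; apply: eq_bigr => i _; rewrite mulr_sumr.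
by apply: eq_bigr => j _; ring.
Qed.

Lemma mform_sumr G (K : Type) (r : seq K) (P : pred K) (a : K -> R) (X : K -> I -> R) z :
  sym G -> mform G z (fun i => \sum_(k <- r | P k) a k * X k i) = \sum_(k <- r | P k) a k * mform G z (X k).
Proof. by move=> sG; rewrite mformC// mform_suml; apply: eq_bigr => k _; rewrite mformC. Qed.

Lemma mformDr G x y z : sym G -> mform G z (fun i => x i + y i) = mform G z x + mform G z y.
Proof. by move=> sG; rewrite !(mformC z)// mformDl. Qed.

Lemma mformZr G c x z : sym G -> mform G z (fun i => c * x i) = c * mform G z x.
Proof. by move=> sG; rewrite !(mformC z)// mformZl. Qed.

Lemma mform_addG G H x y : mform (fun i j => G i j + H i j) x y = mform G x y + mform H x y.
Proof.
rewrite /mform -big_split; apply: eq_bigr => i _; rewrite -big_split /=.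
by apply: eq_bigr => j _; rewrite mulrDl.
Qed.

Lemma mform_scaleG G c x y : mform (fun i j => c * G i j) x y = c * mform G x y.
Proof.
rewrite /mform mulr_sumr; apply: eq_bigr => i _; rewrite mulr_sumr.
by apply: eq_bigr => j _; rewrite -mulrA.
Qed.

Lemma mform_subG G H x y : mform (fun i j => G i j - H i j) x y = mform G x y - mform H x y.
Proof.
rewrite -mulN1r -mform_scaleG -mform_addG; apply: eq_bigr => i _; apply: eq_bigr => j _.
by rewrite mulN1r.
Qed.

Lemma mform_sumG (K : Type) (r : seq K) (P : pred K) (F : K -> I -> I -> R) x y :
  mform (fun i j => \sum_(k <- r | P k) F k i j) x y = \sum_(k <- r | P k) mform (F k) x y.
Proof.
rewrite /mform; under eq_bigr => i _ do under eq_bigr => j _ do rewrite mulr_suml.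
under eq_bigr => i _ do rewrite exchange_big /=.
by rewrite exchange_big.
Qed.

Lemma eq_mformG G H x y : (forall i j, G i j = H i j) -> mform G x y = mform H x y.
Proof. by move=> e; apply: eq_bigr => i _; apply: eq_bigr => j _; rewrite e. Qed.

Lemma mform_rank1 (f g : I -> R) x y :
  mform (fun i j => f i * g j) x y = (\sum_i x i * f i) * (\sum_j y j * g j).
Proof.
rewrite /mform mulr_suml; apply: eq_bigr => i _; rewrite mulr_sumr.
by apply: eq_bigr => j _; ring.
Qed.

Lemma mform_quad G x y t : sym G ->
  mform G (fun i => x i + t * y i) (fun i => x i + t * y i) =
  mform G x x + 2 * t * mform G x y + t ^+ 2 * mform G y y.
Proof. by move=> sG; rewrite mformDl !mformDr// !mformZl !mformZr// (mformC y x)//; ring. Qed.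

Lemma mform_CS G x y : sym G -> psd G -> mform G x y ^+ 2 <= mform G x x * mform G y y.
Proof.
move=> sG pG; apply: discriminant => [|t]; first exact: pG.
by rewrite -mform_quad//; exact: pG.
Qed.

Lemma mform_basisl G i y : mform G (basis_vec i) y = \sum_j G i j * y j.
Proof.
rewrite /mform (bigD1 i)//= [X in _ + X]big1 ?addr0; last first.
  by move=> k /negbTE ki; rewrite big1// => j _; rewrite /basis_vec ki mul0r mulr0.
by apply: eq_bigr => j _; rewrite /basis_vec eqxx mul1r.
Qed.

Lemma mform_basis G i j : mform G (basis_vec i) (basis_vec j) = G i j.
Proof.
rewrite mform_basisl (bigD1 j)//= big1 ?addr0 /basis_vec ?eqxx ?mulr1//.
by move=> k /negbTE ->; rewrite mulr0.
Qed.

(** Weights stand in for square roots, so the decomposition exists over any ordered field; indexing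
    by [nat] lets decompositions of different matrices be padded to a common length. *)
Definition sos G := exists (M : nat) (w : nat -> R) (v : nat -> I -> R),
  (forall m, 0 <= w m) /\ forall i j, G i j = \sum_(m < M) w m * (v m i * v m j).

(** Symmetric Gaussian elimination: a nonzero diagonal entry splits off a rank-one square, and the
    Schur complement is again semidefinite by Cauchy-Schwarz. The induction is on the number of
    nonzero diagonal entries. *)
Lemma psd_sos G : sym G -> psd G -> sos G.
Proof.
have [n] := ubnP #|[pred i | G i i != 0]|; elim: n G => // n IH G; rewrite ltnS => hn sG pG.
have diag H : psd H -> forall i, 0 <= H i i by move=> pH i; rewrite -mform_basis.
have [i0 hi0|h0] := pickP [pred i | G i i != 0]; last first.
  (* With a zero diagonal, Cauchy-Schwarz forces the whole matrix to vanish. *)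
  exists 0%N, (fun=> 0), (fun _ _ => 0); split=> // i j; rewrite big_ord0.
  have := mform_CS (basis_vec i) (basis_vec j) sG pG; rewrite !mform_basis.
  by have := h0 i => /negbFE/eqP -> ; rewrite mul0r => h; apply/eqP; rewrite -sqrf_eq0 eq_le h sqr_ge0.
pose a := G i0 i0; have a0 : 0 < a by rewrite lt_neqAle eq_sym diag// andbT.
pose G' i j := G i j - a^-1 * (G i0 i * G i0 j).
have sG' : sym G' by move=> i j; rewrite /G' sG (mulrC (G i0 i)).
have pG' : psd G'.
  move=> x; rewrite /G' mform_subG mform_scaleG mform_rank1 -expr2.
  have -> : \sum_i x i * G i0 i = mform G (basis_vec i0) x.
    by rewrite mform_basisl; apply: eq_bigr => i _; rewrite mulrC.
  rewrite subr_ge0 mulrC ler_pdivrMr// mulrC.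
  by have := mform_CS (basis_vec i0) x sG pG; rewrite mform_basis.
have [|M [w [v [w0 hv]]]] := IH G' _ sG' pG'.
  apply: leq_trans hn; apply: proper_card.
  apply/properP; split; last first.
    by exists i0; [exact: hi0|rewrite inE /G' -/a mulKf ?(gt_eqF a0)// subrr eqxx].
  (* Elimination only decreases diagonal entries and keeps them nonnegative, so zero entries stay
     zero. *)
  apply/fintype.subsetP => i; rewrite !inE; apply: contra_neq => Gi.
  apply/eqP; rewrite eq_le diag// andbT /G' Gi sub0r oppr_le0 mulr_ge0 ?invr_ge0 ?(ltW a0)//.
  by rewrite -expr2 sqr_ge0.
exists M.+1, (fun m => if (m < M)%N then w m else a^-1), (fun m => if (m < M)%N then v m else G i0).
split=> [m|i j]; first by case: ifP => _; rewrite ?w0// invr_ge0 ltW.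
rewrite big_ord_recr /= ltnn; under eq_bigr => m _ do rewrite ltn_ord.
by rewrite -hv /G' subrK.
Qed.

End fixed_index.

Lemma prod_telescope d (a b : 'I_d -> R) :
  \prod_(k < d) b k - \prod_(k < d) a k =
  \sum_(l < d) \prod_(k < d) (if (k < l)%N then b k else if k == l then b k - a k else a k).
Proof.
elim: d a b => [|d IH] a b; first by rewrite !big_ord0 subrr.
rewrite big_ord_recl [\prod_(k < d.+1) a k]big_ord_recl big_ord_recl.
set pb := \prod_(i < d) b _; set pa := \prod_(i < d) a _.
have -> : b ord0 * pb - a ord0 * pa = (b ord0 - a ord0) * pa + b ord0 * (pb - pa) by ring.
congr (_ + _).
  by rewrite big_ord_recl /=; congr (_ * _); apply: eq_bigr => k _.
rewrite /pb /pa IH mulr_sumr; apply: eq_bigr => l _; rewrite big_ord_recl /=; congr (_ * _).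
Qed.

Section tensor.
Variables (d : nat) (m : 'I_d -> nat).
Local Notation ix := {dffun forall k : 'I_d, 'I_(m k)}.
Implicit Types (A B D : forall k, 'I_(m k) -> 'I_(m k) -> R).

Definition tform A (i j : ix) : R := \prod_(k < d) A k (i k) (j k).

Lemma tform_sym A : (forall k, sym (A k)) -> sym (tform A).
Proof. by move=> h i j; apply: eq_bigr => k _; rewrite h. Qed.

(** Gram decompositions of the factors multiply out, by distributivity, to a Gram decomposition of
    the tensor product. *)
Lemma tform_psd A : (forall k, sym (A k)) -> (forall k, psd (A k)) -> psd (tform A).
Proof.
move=> sA pA x.
have /fin_all_exists[M] := fun k => psd_sos (sA k) (pA k).
move=> /fin_all_exists[w] /fin_all_exists[v] hv.
(* Padding with zero weights gives all factors the same number of squares, so that products of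
   squares are indexed by functions into one ['I_N]. *)
pose N := (\sum_k M k)%N.
pose w' k r := if (r < M k)%N then w k r else 0.
have w0 k r : 0 <= w' k r by rewrite /w'; case: ifP => // _; exact: (hv k).1.
have hA k i j : A k i j = \sum_(r < N) w' k r * (v k r i * v k r j).
  rewrite (hv k).2 (big_ord_widen_cond N xpredT (fun r => w k r * (v k r i * v k r j))).
    by rewrite big_mkcond /=; apply: eq_bigr => r _; rewrite /w'; case: ifP => //; rewrite mul0r.
  by rewrite /N (bigD1 k)//= leq_addr.
have -> : mform (tform A) x x = \sum_(f : {ffun 'I_d -> 'I_N}) (\prod_k w' k (f k)) *
     (\sum_(i : ix) x i * \prod_k v k (f k) (i k)) ^+ 2.
  transitivity (mform (fun i j : ix => \sum_(f : {ffun 'I_d -> 'I_N}) (\prod_k w' k (f k)) *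
      ((\prod_k v k (f k) (i k)) * (\prod_k v k (f k) (j k)))) x x).
    apply: eq_mformG => i j; rewrite /tform.
    under eq_bigr => k _ do rewrite hA.
    by rewrite bigA_distr_bigA /=; apply: eq_bigr => f _; rewrite -!big_split.
  by rewrite mform_sumG; apply: eq_bigr => f _; rewrite mform_scaleG mform_rank1 expr2.
by apply: sumr_ge0 => f _; apply: mulr_ge0; rewrite ?sqr_ge0 ?prodr_ge0.
Qed.

Lemma tform_sub A B x :
  mform (tform B) x x - mform (tform A) x x =
  \sum_(l < d) mform (tform (fun k => if (k < l)%N then B k else
       if k == l then fun i j => B k i j - A k i j else A k)) x x.
Proof.
rewrite -mform_subG -mform_sumG; apply: eq_mformG => i j.
rewrite /tform prod_telescope; apply: eq_bigr => l _; apply: eq_bigr => k _.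
by case: ifP => //; case: ifP.
Qed.

Lemma tform_le A B x : (forall k, sym (A k)) -> (forall k, sym (B k)) ->
  (forall k, psd (A k)) -> (forall k y, mform (A k) y y <= mform (B k) y y) ->
  mform (tform A) x x <= mform (tform B) x x.
Proof.
move=> sA sB pA AB; rewrite -subr_ge0 tform_sub; apply: sumr_ge0 => l _; apply: tform_psd => k.
  by case: ifP => // _; case: ifP => // _ i j; rewrite sA sB.
case: ifP => [_ y|_]; first exact: le_trans (pA k y) (AB k y).
by case: ifP => // _ y; rewrite mform_subG subr_ge0.
Qed.

Definition tsubst (l : 'I_d) D B : forall k, 'I_(m k) -> 'I_(m k) -> R :=
  fun k => if k == l then D k else B k.

(** In the telescoped difference the untouched factors [A] are enlarged to [B]; each term then
    carries [D] in one direction and [B] in the others, which is the shape of the stiffness form. *)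
Lemma tform_sub_le A B D x : (forall k, sym (A k)) -> (forall k, sym (B k)) -> (forall k, sym (D k)) ->
  (forall k, psd (A k)) -> (forall k y, mform (A k) y y <= mform (B k) y y) ->
  (forall k y, mform (B k) y y - mform (A k) y y <= mform (D k) y y) ->
  mform (tform B) x x - mform (tform A) x x <= \sum_(l < d) mform (tform (tsubst l D B)) x x.
Proof.
move=> sA sB sD pA AB BAD; rewrite tform_sub; apply: ler_sum => l _; apply: tform_le => k.
- by case: ifP => // _; case: ifP => // _ i j; rewrite sA sB.
- by rewrite /tsubst; case: ifP.
- case: ifP => [_ y|_]; first exact: le_trans (pA k y) (AB k y).
  by case: ifP => // _ y; rewrite mform_subG subr_ge0.
- move=> y; rewrite /tsubst; case: ltnP => kl.
    by have -> : (k == l) = false by apply/negbTE; rewrite neq_ltn kl.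
  by case: ifP => // _; rewrite mform_subG.
Qed.

Definition tvec (f : forall k, 'I_(m k) -> R) (i : ix) : R := \prod_(k < d) f k (i k).

Lemma mform_rank1_tensor (f : forall k, 'I_(m k) -> R) x y :
  mform (tform (fun k i j => f k i * f k j)) x y =
  (\sum_i x i * tvec f i) * (\sum_i y i * tvec f i).
Proof.
by rewrite -mform_rank1; apply: eq_mformG => i j; rewrite /tform /tvec -big_split.
Qed.

End tensor.

Lemma kernel_exists m (F : 'I_m.+1 -> 'I_m -> R) :
  exists2 y : 'I_m.+1 -> R, (exists k, y k != 0) & forall l, \sum_k y k * F k l = 0.
Proof.
pose A : 'M[R]_(m.+1, m) := \matrix_(k, l) F k l.
have hA : kermx A != 0.
  apply: contraTneq (rank_leq_col A) => /eqP; rewrite -mxrank_eq0 mxrank_ker.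
  by rewrite subn_eq0 -ltnNge.
have [i hi] : exists i, row i (kermx A) != 0.
  by apply/existsP; apply: contraR hA => /existsPn h; apply/eqP/row_matrixP => i; rewrite row0; apply/eqP; have := h i; rewrite negbK.
exists (fun k => kermx A i k).
  apply/existsP; apply: contraR hi => /existsPn h; apply/eqP/rowP => k.
  by rewrite mxE [RHS]mxE; apply/eqP; have := h k; rewrite negbK.
move=> l; have /matrixP/(_ i l) := mulmx_ker A; rewrite !mxE => h.
by apply: etrans h; apply: eq_bigr => k _; rewrite [A k l]mxE.
Qed.

(** From [2 |a b| <= a^2 + b^2]. The crude factor [m] is affordable because [m] counts eigenvalues
    up to a fixed one, whatever the mesh. *)
Lemma quad_pert m (e : 'I_m -> 'I_m -> R) (eps : R) (y : 'I_m -> R) :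
  (forall k l, `|e k l| <= eps) ->
  `|\sum_k \sum_l e k l * (y k * y l)| <= m%:R * eps * \sum_k y k ^+ 2.
Proof.
move=> he; apply: le_trans (ler_norm_sum _ _ _) _.
apply: (@le_trans _ _ (\sum_k \sum_l (eps / 2 * y k ^+ 2 + eps / 2 * y l ^+ 2))).
  apply: ler_sum => k _; apply: le_trans (ler_norm_sum _ _ _) _; apply: ler_sum => l _.
  have e0 : 0 <= eps := le_trans (normr_ge0 _) (he k l).
  rewrite normrM; apply: le_trans (ler_wpM2r (normr_ge0 _) (he k l)) _.
  rewrite normrM -mulrDr -mulrA ler_wpM2l//.
  have := sqr_ge0 (`|y k| - `|y l|); rewrite sqrrB !real_normK ?num_real// mulr2n.
  set a := _ * _; lra.
under eq_bigr => k _ do rewrite big_split /= -mulr_sumr.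
rewrite big_split /= sumr_const card_ord -!mulr_sumr exchange_big /= sumr_const card_ord.
have e1 t : eps / 2 * (t *+ m) + eps / 2 * t *+ m = m%:R * eps * t by rewrite -[t *+ m]mulr_natl -[X in _ + X]mulr_natl; field.
by rewrite e1.
Qed.

End forms.

Lemma sum_CS (R : realFieldType) (K : finType) (P : pred K) (a b : K -> R) :
  (\sum_(k | P k) a k * b k) ^+ 2 <= (\sum_(k | P k) a k ^+ 2) * \sum_(k | P k) b k ^+ 2.
Proof.
apply: discriminant => [|t]; first by apply: sumr_ge0 => k _; rewrite sqr_ge0.
rewrite !mulr_sumr -!big_split; apply: sumr_ge0 => k _ /=.
by have := sqr_ge0 (a k + t * b k); congr (0 <= _); ring.
Qed.

(** The ratio [l / (l - la)] relates a component of a vector to the same component of its residual.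
    It is monotone on each side of the gap and largest in modulus at [la + g]. *)
Lemma shifted_ratio_le (R : realFieldType) (la g l : R) : 0 < la -> 0 < g -> 0 < l ->
  l <= la - g \/ la + g <= l -> l != la /\ `|l / (l - la)| <= (la + g) / g.
Proof.
move=> la0 g0 l0 [h|h].
  have d0 : 0 < la - l by lra.
  split; first by rewrite lt_eqF//; lra.
  rewrite -[l - la]opprB invrN mulrN normrN ger0_norm ?(divr_ge0 (ltW l0) (ltW d0))//.
  rewrite ler_pdivrMr// mulrAC ler_pdivlMr//.
  have := mulr_gt0 la0 g0; nra.
have d0 : 0 < l - la by lra.
split; first by rewrite gt_eqF//; lra.
rewrite ger0_norm ?(divr_ge0 (ltW l0) (ltW d0))// ler_pdivrMr// mulrAC ler_pdivlMr//.
nra.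
Qed.

Section gram_flip.
Context {R : realFieldType} (K L : finType) (P : pred K) (Q : pred L) (X : K -> L -> R).

(* The Frobenius norms of [X X^T - 1] and [X^T X - 1] differ by the difference of the
   numbers of rows and columns. *)
Lemma gram_flip (eps : R) : (#|Q| <= #|P|)%N ->
  (forall k k', P k -> P k' -> `|\sum_(i | Q i) X k i * X k' i - (k == k')%:R| <= eps) ->
  forall i i', Q i -> Q i' ->
  `|\sum_(k | P k) X k i * X k i' - (i == i')%:R| <= #|P|%:R * eps.
Proof.
move=> QP hX.
pose g k k' := \sum_(i | Q i) X k i * X k' i.
pose h i i' := \sum_(k | P k) X k i * X k i'.
have expand (T : finType) (S : pred T) (f : T -> T -> R) :
  \sum_(i | S i) \sum_(i' | S i') (f i i' - (i == i')%:R) ^+ 2 =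
  \sum_(i | S i) \sum_(i' | S i') f i i' ^+ 2 - 2 * \sum_(i | S i) f i i + #|S|%:R.
  transitivity (\sum_(i | S i) (\sum_(i' | S i') f i i' ^+ 2 - 2 * f i i + 1)).
    apply: eq_bigr => i Si; rewrite (bigD1 i)//= [X in _ = X - _ + _](bigD1 i)//= eqxx.
    rewrite (eq_bigr (fun i' => f i i' ^+ 2)); first by rewrite mulr1n; ring.
    by move=> i' /andP[_]; rewrite eq_sym => /negbTE ->; rewrite subr0.
  by rewrite big_split sumrB -mulr_sumr sumr_const.
have swap : \sum_(i | Q i) \sum_(i' | Q i') h i i' ^+ 2 = \sum_(k | P k) \sum_(k' | P k') g k k' ^+ 2.
  transitivity (\sum_(i | Q i) \sum_(i' | Q i') \sum_(k | P k) \sum_(k' | P k')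
      X k i * X k i' * (X k' i * X k' i')).
    apply: eq_bigr => i _; apply: eq_bigr => i' _; rewrite expr2 mulr_suml.
    by apply: eq_bigr => k _; rewrite mulr_sumr.
  transitivity (\sum_(k | P k) \sum_(k' | P k') \sum_(i | Q i) \sum_(i' | Q i')
      X k i * X k i' * (X k' i * X k' i')).
    under eq_bigr => i _ do rewrite exchange_big /=.
    rewrite exchange_big /=; apply: eq_bigr => k _.
    under eq_bigr => i _ do rewrite exchange_big /=.
    by rewrite exchange_big /=.
  apply: eq_bigr => k _; apply: eq_bigr => k' _; rewrite expr2 mulr_suml.
  by apply: eq_bigr => i _; rewrite mulr_sumr; apply: eq_bigr => i' _; ring.
have tr : \sum_(i | Q i) h i i = \sum_(k | P k) g k k by rewrite exchange_big.
have key : \sum_(i | Q i) \sum_(i' | Q i') (h i i' - (i == i')%:R) ^+ 2 <=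
   \sum_(k | P k) \sum_(k' | P k') (g k k' - (k == k')%:R) ^+ 2.
  by rewrite !expand swap tr lerD2l ler_nat.
have bound : \sum_(k | P k) \sum_(k' | P k') (g k k' - (k == k')%:R) ^+ 2 <= (#|P|%:R * eps) ^+ 2.
  apply: (@le_trans _ _ (\sum_(k | P k) \sum_(k' | P k') eps ^+ 2)).
    apply: ler_sum => k Pk; apply: ler_sum => k' Pk'.
    rewrite -[(_ - _) ^+ 2]real_normK ?num_real// lerXn2r ?nnegrE ?hX//.
    exact: le_trans (normr_ge0 _) (hX _ _ Pk Pk').
  by rewrite !sumr_const exprMn -mulrnA -natrX mulr_natl mulnn.
move=> i i' Qi Qi'.
have [k Pk] : exists k, P k.
  have : (0 < #|P|)%N by apply: leq_trans QP; apply/card_gt0P; exists i.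
  by move=> /card_gt0P[k]; exists k.
have e0 : 0 <= #|P|%:R * eps by rewrite mulr_ge0//; exact: le_trans (normr_ge0 _) (hX _ _ Pk Pk).
rewrite -(@ler_pXn2r _ 2)// ?nnegrE// real_normK ?num_real//.
apply: le_trans (le_trans key bound); rewrite (bigD1 i)//= (bigD1 i')//= -addrA lerDl.
by rewrite addr_ge0// sumr_ge0// => *; rewrite ?sumr_ge0// => *; rewrite sqr_ge0.
Qed.

End gram_flip.

(** * Rayleigh quotients and clusters of eigenvalues *)

Section core.
Context {R : realFieldType} (I : finType) (GA GB : I -> I -> R).
Hypotheses (sA : sym GA) (sB : sym GB).
Local Notation A := (mform GA).
Local Notation B := (mform GB).
Variables (c : 'I_#|I| -> I -> R) (lh : 'I_#|I| -> R).
Hypothesis eigc : forall i v, A (c i) v = lh i * B (c i) v.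
Hypothesis orth : forall i j, B (c i) (c j) = (i == j)%:R.
Hypothesis lh_mono : {homo lh : i j / (i <= j)%N >-> i <= j}.

(** Orthonormality says [M *m (G *m M^T) = 1] for a square matrix [M], so the two factors commute
    and the eigenvectors form a basis. *)
Lemma coord_expand v i : v i = \sum_k B v (c k) * c k i.
Proof.
pose M : 'M[R]_#|I| := \matrix_(k, l) c k (enum_val l).
pose G : 'M[R]_#|I| := \matrix_(k, l) GB (enum_val k) (enum_val l).
have eM : M *m (G *m M^T) = 1%:M.
  apply/matrixP => k l; rewrite !mxE -orth /mform.
  rewrite (reindex (@enum_val I I)) /=; last exact: onW_bij (@enum_val_bij I).
  apply: eq_bigr => a _; rewrite !mxE mulr_sumr.
  rewrite [RHS](reindex (@enum_val I I)) /=; last exact: onW_bij (@enum_val_bij I).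
  by apply: eq_bigr => b _; rewrite !mxE; ring.
pose w : 'rV[R]_#|I| := \row_l v (enum_val l).
have := mulmx1C eM => /(congr1 (fun X => (w *m X) ord0 (enum_rank i))).
rewrite mulmx1 [RHS]mxE enum_rankK => <-; rewrite mulmxA mxE; apply: eq_bigr => k _.
rewrite [M _ _]mxE enum_rankK; congr (_ * _); rewrite mulmxA mxE /mform exchange_big /=.
rewrite [RHS](reindex (@enum_val I I)) /=; last exact: onW_bij (@enum_val_bij I).
apply: eq_bigr => b _; rewrite !mxE mulr_suml.
rewrite [RHS](reindex (@enum_val I I)) /=; last exact: onW_bij (@enum_val_bij I).
by apply: eq_bigr => a _; rewrite !mxE; ring.
Qed.

Lemma parsevalB v w : B v w = \sum_k B v (c k) * B w (c k).
Proof.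
rewrite [LHS](@eq_mform _ _ GB _ (fun i => \sum_k B v (c k) * c k i) _ w)//.
  by rewrite mform_suml; apply: eq_bigr => k _; rewrite (mformC _ w).
by move=> i; exact: coord_expand.
Qed.

Lemma parsevalA v w : A v w = \sum_k lh k * (B v (c k) * B w (c k)).
Proof.
rewrite [LHS](@eq_mform _ _ GA _ (fun i => \sum_k B v (c k) * c k i) _ w)//.
  by rewrite mform_suml; apply: eq_bigr => k _; rewrite eigc (mformC _ w)//; ring.
by move=> i; exact: coord_expand.
Qed.

Lemma coord_comb (y : 'I_#|I| -> R) k : B (fun i => \sum_l y l * c l i) (c k) = y k.
Proof.
rewrite mform_suml (bigD1 k)//= orth eqxx mulr1 big1 ?addr0// => l /negbTE lk.
by rewrite orth lk mulr0.
Qed.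

Lemma mform_comb m G (r : 'I_m -> I -> R) (y : 'I_m -> R) : sym G ->
  mform G (fun i => \sum_k y k * r k i) (fun i => \sum_k y k * r k i) =
  \sum_k \sum_l mform G (r k) (r l) * (y k * y l).
Proof.
move=> sG; rewrite mform_suml; apply: eq_bigr => k _; rewrite mform_sumr// mulr_sumr.
by apply: eq_bigr => l _; ring.
Qed.

(* Courant-Fischer, with the span of the first [K+1] trial vectors. *)
Lemma minmax_upper K (i : 'I_#|I|) (r : 'I_K.+1 -> I -> R) (la eB eA : R) :
  nat_of_ord i = K ->
  0 <= lh i ->
  (forall k l, `|B (r k) (r l) - (k == l)%:R| <= eB) ->
  (exists2 mu : 'I_K.+1 -> R, (forall k, mu k <= la) &
     forall k l, `|A (r k) (r l) - mu k * (k == l)%:R| <= eA) ->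
  lh i * (1 - K.+1%:R * eB) <= la + K.+1%:R * eA.
Proof.
move=> iK li hB [mu mula hA].
have hK : (K <= #|I|)%N by rewrite -iK ltnW.
(* There are [K + 1] unknowns and [K] conditions: some combination of the trial vectors is
   orthogonal to the first [K] eigenvectors, hence has Rayleigh quotient at least [lh i]. *)
have [y [k0 yk0] hy] := kernel_exists (fun k l => B (r k) (c (widen_ord hK l))).
pose w i := \sum_k y k * r k i.
have xw (l : 'I_#|I|) : (l < K)%N -> B w (c l) = 0.
  move=> lK; rewrite mform_suml -[RHS](hy (Ordinal lK)); apply: eq_bigr => k _.
  by congr (_ * B _ (c _)); exact: val_inj.
have S0 : 0 < \sum_k y k ^+ 2.
  rewrite (bigD1 k0)//= ltr_pwDl ?exprn_even_gt0// sumr_ge0// => k _; exact: sqr_ge0.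
set S := \sum_k y k ^+ 2 in S0 *.
have h1 : lh i * B w w <= A w w.
  rewrite parsevalA parsevalB mulr_sumr; apply: ler_sum => l _.
  have [lK|Kl] := ltnP l K; first by rewrite xw// mul0r !mulr0.
  by apply: ler_wpM2r; [rewrite -expr2 sqr_ge0|apply: lh_mono; rewrite iK].
have hBw : (1 - K.+1%:R * eB) * S <= B w w.
  have -> : B w w = S + \sum_k \sum_l (B (r k) (r l) - (k == l)%:R) * (y k * y l).
    rewrite mform_comb// -big_split; apply: eq_bigr => k _ /=.
    rewrite (eq_bigr (fun l => (k == l)%:R * (y k * y l) + (B (r k) (r l) - (k == l)%:R) * (y k * y l))).
      rewrite big_split /=; congr (_ + _); rewrite (bigD1 k)//= eqxx mul1r big1 ?addr0//.
      by move=> l; rewrite eq_sym => /negbTE ->; rewrite mul0r.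
    by move=> l _; ring.
  have := quad_pert y hB; rewrite -/S ler_norml => /andP[+ _]; lra.
have hAw : A w w <= (la + K.+1%:R * eA) * S.
  have -> : A w w = (\sum_k mu k * y k ^+ 2) + \sum_k \sum_l (A (r k) (r l) - mu k * (k == l)%:R) * (y k * y l).
    rewrite mform_comb// -big_split; apply: eq_bigr => k _ /=.
    rewrite (eq_bigr (fun l => mu k * (k == l)%:R * (y k * y l) + (A (r k) (r l) - mu k * (k == l)%:R) * (y k * y l))).
      rewrite big_split /=; congr (_ + _); rewrite (bigD1 k)//= eqxx mulr1 big1 ?addr0//.
      by move=> l; rewrite eq_sym => /negbTE ->; rewrite mulr0 mul0r.
    by move=> l _; ring.
  have : \sum_k mu k * y k ^+ 2 <= la * S.
    by rewrite mulr_sumr; apply: ler_sum => k _; apply: ler_wpM2r; rewrite ?sqr_ge0.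
  have := quad_pert y hA; rewrite -/S ler_norml => /andP[_ +]; lra.
rewrite -(ler_pM2r S0) -mulrA; apply: le_trans hAw; apply: le_trans h1.
exact: ler_wpM2l.
Qed.

(** Dual of the previous bound: some combination of the first [J + 1] eigenvectors is annihilated by
    all the functionals [ell], and its Rayleigh quotient is at most [lh i]. *)
Lemma minmax_lower J (i : 'I_#|I|) (ell : 'I_J -> I -> R) (La : R) :
  nat_of_ord i = J ->
  (forall w, (forall k, \sum_a w a * ell k a = 0) -> La * B w w <= A w w) ->
  La <= lh i.
Proof.
move=> iJ h; have hJ : (J < #|I|)%N by rewrite -iJ.
have [y [k0 yk0] hy] := kernel_exists (fun k l => \sum_a c (widen_ord hJ k) a * ell l a).
pose w a := \sum_k y k * c (widen_ord hJ k) a.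
have := h w; have -> : B w w = \sum_k y k ^+ 2.
  rewrite /w mform_comb//; apply: eq_bigr => k _; rewrite (bigD1 k)//= orth eqxx mul1r.
  rewrite big1 ?addr0// => l lk; rewrite orth -val_eqE /= val_eqE eq_sym (negbTE lk) mul0r//.
have -> : A w w = \sum_k lh (widen_ord hJ k) * y k ^+ 2.
  rewrite /w mform_comb//; apply: eq_bigr => k _; rewrite (bigD1 k)//= eigc orth eqxx mulr1.
  rewrite big1 ?addr0// => l lk; rewrite eigc orth -val_eqE /= val_eqE eq_sym (negbTE lk) mulr0 mul0r//.
have S0 : 0 < \sum_k y k ^+ 2.
  rewrite (bigD1 k0)//= ltr_pwDl ?exprn_even_gt0// sumr_ge0// => k _; exact: sqr_ge0.
move=> h2; rewrite -(ler_pM2r S0); apply: le_trans (h2 _) _ => [l|].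
  rewrite -[RHS](hy l); under eq_bigr => a _ do rewrite mulr_suml.
  by rewrite exchange_big /=; apply: eq_bigr => k _; rewrite mulr_sumr; apply: eq_bigr => a _; rewrite mulrA.
rewrite mulr_sumr; apply: ler_sum => k _; apply: ler_wpM2r; rewrite ?sqr_ge0//.
by apply: lh_mono; rewrite iJ /= -ltnS.
Qed.

Section cluster.
(** The indices from [J0] to [J - 1] form the cluster of the exact eigenvalue [la], which [g]
    separates from the rest of the spectrum; [eps] measures the orthonormality of the trial vectors
    and [eta] their residual in the dual norm of [A]. *)
Variables (J0 J : nat) (r : 'I_J -> I -> R) (la mu g eps eta : R).
Hypothesis mu0 : 0 < mu.
Hypothesis la0 : 0 < la.
Hypothesis g0 : 0 < g.
Hypothesis coer : forall v, mu * B v v <= A v v.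
Hypothesis low : forall i : 'I_#|I|, (i < J0)%N -> lh i <= la - g.
Hypothesis mid : forall i : 'I_#|I|, (i < J)%N -> lh i <= la + g.
Hypothesis high : forall i : 'I_#|I|, (J <= i)%N -> la + g <= lh i.
Hypothesis gram : forall k l, `|B (r k) (r l) - (k == l)%:R| <= eps.
Hypothesis resid : forall k : 'I_J, (J0 <= k)%N -> forall v,
  (A (r k) v - la * B (r k) v) ^+ 2 <= eta ^+ 2 * A v v.

Let P (k : 'I_J) := (J0 <= k)%N.
Let Q (i : 'I_#|I|) := (J0 <= i < J)%N.
Let x (k : 'I_J) i := B (r k) (c i).
Let kap := (la + g) / g.

Lemma lh_ge i : mu <= lh i.
Proof. by have := coer (c i); rewrite eigc orth eqxx !mulr1. Qed.

Lemma lh_gt0 i : 0 < lh i. Proof. exact: lt_le_trans (lh_ge i). Qed.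

Lemma ratio_bound i : ~~ Q i -> lh i != la /\ `|lh i / (lh i - la)| <= kap.
Proof.
rewrite /Q negb_and -ltnNge -leqNgt => iQ; apply: shifted_ratio_le => //; first exact: lh_gt0.
by case/orP: iQ => [/low|/high]; [left|right].
Qed.

(** The residual is tested with the off-cluster part of [r k], each component rescaled by
    [lh i / (lh i - la)]. This turns the left side into the energy [S] and costs at most a factor
    [kap ^+ 2] in the energy of the test vector, so [S ^+ 2 <= (eta * kap) ^+ 2 * S]. *)
Lemma off_cluster k : P k -> \sum_(i | ~~ Q i) lh i * x k i ^+ 2 <= (eta * kap) ^+ 2.
Proof.
move=> Pk; set S := \sum_(i | _) _.
have S0 : 0 <= S by apply: sumr_ge0 => i _; rewrite mulr_ge0 ?sqr_ge0// ltW// lh_gt0.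
pose w a := \sum_i (if Q i then 0 else lh i * x k i / (lh i - la)) * c i a.
have xw i : B w (c i) = if Q i then 0 else lh i * x k i / (lh i - la) by rewrite coord_comb.
have := resid Pk w.
have -> : A (r k) w - la * B (r k) w = S.
  rewrite parsevalA parsevalB mulr_sumr -sumrB /S [RHS]big_mkcond /=; apply: eq_bigr => i _.
  rewrite xw -/(x k i); case: ifP => [|/negbT Qi]; first by rewrite !mulr0 subrr.
  have [/eqP ne _] := ratio_bound Qi; field; apply/eqP => h; apply: ne; apply/eqP.
  by rewrite -subr_eq0 h.
have hw : A w w <= kap ^+ 2 * S.
  rewrite parsevalA mulr_sumr /S [leRHS]big_mkcond /=; apply: ler_sum => i _.
  rewrite xw; case: ifP => [|/negbT Qi]; first by rewrite !mulr0.
  have [ne hk] := ratio_bound Qi; have li := lh_gt0 i.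
  have -> : lh i * (lh i * x k i / (lh i - la) * (lh i * x k i / (lh i - la))) =
     (lh i / (lh i - la)) ^+ 2 * (lh i * x k i ^+ 2) by ring.
  rewrite ler_wpM2r ?(mulr_ge0 (ltW li) (sqr_ge0 _))//.
  rewrite -[leLHS]real_normK ?num_real// lerXn2r ?nnegrE//.
  exact: le_trans (normr_ge0 _) hk.
move=> h; have {h} : S ^+ 2 <= (eta * kap) ^+ 2 * S.
  by apply: le_trans h _; rewrite exprMn -[leRHS]mulrA ler_wpM2l ?sqr_ge0.
have [->|Sn0] := eqVneq S 0; first by rewrite sqr_ge0.
by rewrite expr2 ler_pM2r// lt_neqAle eq_sym Sn0.
Qed.

Let off := (eta * kap) ^+ 2.
Let eps' := eps + off / mu.

(** Parseval splits the Gram matrix of the trial vectors; coercivity turns the energy of the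
    off-cluster part into a bound in the form [B], whence the division by [mu] in [eps']. *)
Lemma cluster_gram k k' : P k -> P k' ->
  `|\sum_(i | Q i) x k i * x k' i - (k == k')%:R| <= eps'.
Proof.
move=> Pk Pk'; have -> : \sum_(i | Q i) x k i * x k' i =
    B (r k) (r k') - \sum_(i | ~~ Q i) x k i * x k' i.
  by rewrite parsevalB [X in _ = X - _](bigID Q) /= addrK.
rewrite addrAC; apply: le_trans (ler_normB _ _) _; apply: lerD (gram k k') _.
apply: le_trans (ler_norm_sum _ _ _) _.
rewrite ler_pdivlMr// mulr_suml.
have h1 := off_cluster Pk; have h2 := off_cluster Pk'.
have : \sum_(i | ~~ Q i) `|x k i * x k' i| * mu <=
   2^-1 * (\sum_(i | ~~ Q i) lh i * x k i ^+ 2) + 2^-1 * (\sum_(i | ~~ Q i) lh i * x k' i ^+ 2).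
  rewrite !mulr_sumr -big_split /=; apply: ler_sum => i _; rewrite normrM.
  have hm := lh_ge i; have := sqr_ge0 (`|x k i| - `|x k' i|); rewrite sqrrB !real_normK ?num_real//.
  have := mulr_ge0 (normr_ge0 (x k i)) (normr_ge0 (x k' i)); set p := _ * _; rewrite mulr2n.
  move=> p0 hp; have : p * mu <= p * lh i by rewrite ler_wpM2l.
  have : 0 <= lh i * (x k i ^+ 2 - (p + p) + x k' i ^+ 2) by rewrite mulr_ge0// ltW// lh_gt0.
  lra.
rewrite /off; lra.
Qed.

(** The cluster is cut short when the discrete space has fewer than [J] dimensions, so this is an
    inequality; it is the one that [gram_flip] asks for. *)
Lemma card_cluster : (#|Q| <= #|P|)%N.
Proof.
have [hJ|hJ] := leqP J #|I|; last first.
  have f (i : 'I_#|I|) : (i < J)%N by apply: ltn_trans hJ.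
  have injf : injective (fun i => Ordinal (f i)) by move=> i i' [] /val_inj.
  rewrite -(fintype.card_image injf).
  apply: subset_leq_card; apply/fintype.subsetP => k /fintype.imageP[i /andP[h _] ->].
  exact: h.
pose f (k : 'I_J) := widen_ord hJ k.
have injf : injective f by move=> i i' /(congr1 val) /= /val_inj.
rewrite -(fintype.card_image injf).
apply: subset_leq_card; apply/fintype.subsetP => i /andP[h hi].
by apply/fintype.imageP; exists (Ordinal hi) => //; exact: val_inj.
Qed.

Let sumP (F : 'I_J -> R) (M : R) : 0 <= M -> (forall k, P k -> F k <= M) -> \sum_(k | P k) F k <= J%:R * M.
Proof.
move=> M0 h; apply: (@le_trans _ _ (\sum_(k | P k) M)); first exact: ler_sum.
rewrite sumr_const -[M *+ _]mulr_natl ler_wpM2r// ler_nat.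
by apply: leq_trans (max_card _) _; rewrite card_ord.
Qed.

(* The trial vectors of the cluster nearly are an orthonormal system of the span of the discrete
   eigenvectors of the cluster, so their coordinate matrix is nearly orthogonal ([gram_flip]). *)
Lemma cluster_approx (j : 'I_#|I|) : (J0 <= j < J)%N ->
  exists beta : 'I_J -> R,
    [/\ forall k : 'I_J, (k < J0)%N -> beta k = 0,
        `|\sum_k beta k ^+ 2 - 1| <= J%:R * eps' &
        A (fun a => c j a - \sum_k beta k * r k a) (fun a => c j a - \sum_k beta k * r k a) <=
          (la + g) * J%:R ^+ 3 * eps' ^+ 2 + (1 + J%:R * eps') * J%:R * off].
Proof.
(* The coefficients are the components of the trial vectors along [c j]: the inverse of a nearly
   orthogonal matrix is nearly its transpose. *)
move=> Qj; pose beta k := if P k then x k j else 0.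
have cardP : (#|P|%:R <= J%:R :> R) by rewrite ler_nat; apply: leq_trans (max_card _) _; rewrite card_ord.
have Jpos : (0 < J)%N by case/andP: Qj => _; case: (J) => //.
have eps0 : 0 <= eps.
  by apply: le_trans (gram (Ordinal Jpos) (Ordinal Jpos)).
have off0 : 0 <= off by rewrite sqr_ge0.
have eps'0 : 0 <= eps' by rewrite addr_ge0// divr_ge0// ltW.
have flip i i' : Q i -> Q i' -> `|\sum_(k | P k) x k i * x k i' - (i == i')%:R| <= J%:R * eps'.
  move=> Qi Qi'; apply: le_trans (gram_flip card_cluster cluster_gram Qi Qi') _.
  by rewrite ler_wpM2r.
have sb : \sum_k beta k ^+ 2 = \sum_(k | P k) x k j ^+ 2.
  by rewrite [RHS]big_mkcond; apply: eq_bigr => k _; rewrite /beta; case: ifP => //; rewrite expr0n.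
have hb : `|\sum_k beta k ^+ 2 - 1| <= J%:R * eps'.
  have := flip j j Qj Qj; rewrite eqxx sb; under eq_bigr => k _ do rewrite -expr2.
  by [].
exists beta; split=> //.
  by move=> k kJ; rewrite /beta /P leqNgt kJ.
set y := fun a => _.
have xy i : B y (c i) = (j == i)%:R - \sum_(k | P k) x k j * x k i.
  have -> : B y (c i) = B (c j) (c i) - B (fun a => \sum_k beta k * r k a) (c i).
    rewrite -mulN1r -mformZl -mformDl; apply: eq_mform => // a; rewrite /y mulN1r//.
  rewrite orth mform_suml; congr (_ - _); rewrite [RHS]big_mkcond; apply: eq_bigr => k _.
  by rewrite /beta; case: ifP => //; rewrite mul0r.
have -> : A y y = \sum_i lh i * B y (c i) ^+ 2 by rewrite parsevalA.
(* Inside the cluster the components of [y] are entries of [1 - X^T X]; outside, [c j] has no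
   component and only the off-cluster parts of the trial vectors remain. *)
rewrite (bigID Q) /=; apply: lerD.
  apply: (@le_trans _ _ (\sum_(i | Q i) (la + g) * (J%:R * eps') ^+ 2)).
    apply: ler_sum => i Qi; have li := lh_gt0 i.
    apply: ler_pM; rewrite ?sqr_ge0 ?(ltW li)//; first by apply: mid; case/andP: Qi.
    rewrite xy -[leLHS]real_normK ?num_real// lerXn2r ?nnegrE ?mulr_ge0// distrC.
    exact: flip.
  rewrite sumr_const -[X in X <= _]mulr_natl.
  have -> : (la + g) * J%:R ^+ 3 * eps' ^+ 2 = J%:R * ((la + g) * (J%:R * eps') ^+ 2) by ring.
  rewrite ler_wpM2r ?(mulr_ge0 (addr_ge0 (ltW la0) (ltW g0)) (sqr_ge0 _))//.
  by apply: le_trans cardP; rewrite ler_nat card_cluster.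
apply: (@le_trans _ _ ((\sum_(k | P k) x k j ^+ 2) * \sum_(k | P k) \sum_(i | ~~ Q i) lh i * x k i ^+ 2)).
  rewrite exchange_big /= mulr_sumr; apply: ler_sum => i Qi.
  rewrite xy -mulr_sumr [leRHS]mulrCA ler_wpM2l ?(ltW (lh_gt0 i))//.
  have -> : (j == i)%:R = 0 :> R by have -> : (j == i) = false by apply/negbTE; apply: contraNneq Qi => <-.
  rewrite sub0r sqrrN.
  exact: sum_CS.
rewrite -mulrA; apply: ler_pM.
- by apply: sumr_ge0 => k _; rewrite sqr_ge0.
- by apply: sumr_ge0 => k _; apply: sumr_ge0 => i _; rewrite mulr_ge0 ?sqr_ge0 ?(ltW (lh_gt0 i)).
- by have := hb; rewrite sb ler_norml => /andP[_]; lra.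
- by apply: sumP => // k Pk; exact: off_cluster.
Qed.

End cluster.
End core.

Section tensor_sums.
Context {R : realFieldType}.
Variables (d : nat) (m : 'I_d -> nat).
Local Notation ix := {dffun forall k : 'I_d, 'I_(m k)}.

(** Distributivity for index ranges that depend on the factor, obtained from the tagged version by
    way of [fprod]. *)
Lemma dffun_distr (F : forall k, 'I_(m k) -> R) :
  \prod_(k < d) \sum_(j < m k) F k j = \sum_(i : ix) \prod_(k < d) F k (i k).
Proof.
pose T_ (k : 'I_d) : finType := 'I_(m k).
transitivity (\prod_(k < d) \sum_(j in tagged_with T_ k) untag 0 (F k) j).
  by apply: eq_bigr => k _; rewrite (big_tag (fun k (j : T_ k) => F k j)).
rewrite (bigA_distr_big_dep _ (fun k (j : {k & T_ k}) => untag 0 (F k) j)).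
pose P_ (k : 'I_d) : {ffun T_ k -> R} := [ffun j => F k j].
have h := @big_fprod R 0 1 *%R +%R 'I_d T_ P_.
transitivity (\sum_(t : fprod T_) \prod_(k in 'I_d) P_ k (t k)).
  rewrite h; apply: eq_bigr => g _; apply: eq_bigr => k _.
  rewrite /untag; case: eqP => // e; by rewrite ffunE.
rewrite (reindex (@dffun_of_fprod _ T_)) /=; last first.
  by apply: onW_bij; exact: dffun_of_fprod_bij.
by apply: eq_bigr => t _; apply: eq_bigr => k _; rewrite !ffunE.
Qed.

Lemma mform_tvec (G : forall k, 'I_(m k) -> 'I_(m k) -> R) (r s : forall k, 'I_(m k) -> R) :
  mform (tform G) (tvec r) (tvec s) = \prod_k mform (G k) (r k) (s k).
Proof.
rewrite /mform dffun_distr; apply: eq_bigr => i _; rewrite dffun_distr.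
by apply: eq_bigr => j _; rewrite /tform /tvec -!big_split.
Qed.

Lemma mform_tvecl (G : forall k, 'I_(m k) -> 'I_(m k) -> R) (r : forall k, 'I_(m k) -> R) v :
  mform (tform G) (tvec r) v = \sum_j v j * tvec (fun k j => \sum_i G k i j * r k i) j.
Proof.
rewrite /mform exchange_big; apply: eq_bigr => j _.
rewrite /tvec dffun_distr mulr_sumr; apply: eq_bigr => i _.
by rewrite /tform /= big_split mulrA mulrC.
Qed.

Lemma mform_rank1_sum K (w : forall k : 'I_d, 'I_K -> R) (v : forall k : 'I_d, 'I_K -> 'I_(m k) -> R) x :
  mform (tform (fun k i j => \sum_(a < K) w k a * (v k a i * v k a j))) x x =
  \sum_(f : {ffun 'I_d -> 'I_K}) (\prod_k w k (f k)) * (\sum_i x i * tvec (fun k => v k (f k)) i) ^+ 2.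
Proof.
transitivity (mform (fun i j : ix => \sum_(f : {ffun 'I_d -> 'I_K}) (\prod_k w k (f k)) *
    (tvec (fun k => v k (f k)) i * tvec (fun k => v k (f k)) j)) x x).
  apply: eq_mformG => i j; rewrite /tform bigA_distr_bigA /=; apply: eq_bigr => f _.
  by rewrite /tvec -!big_split.
by rewrite mform_sumG; apply: eq_bigr => f _; rewrite mform_scaleG mform_rank1 expr2.
Qed.

Lemma tform_scale_all (c : 'I_d -> R) (G : forall k, 'I_(m k) -> 'I_(m k) -> R) x y :
  mform (tform (fun k i j => c k * G k i j)) x y = (\prod_k c k) * mform (tform G) x y.
Proof. by rewrite -mform_scaleG; apply: eq_mformG => i j; rewrite /tform big_split. Qed.

End tensor_sums.

(** * Integration on the unit cube *)

Section rV_measure.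
Context {R : realType}.
Local Notation mu := (@lebesgue_measure R).
Local Notation O01 := (`]0%R, 1%R[%classic : set R).
Local Notation Om := (@Omega R _).

Lemma rV_cons0 n (t : R) (x : 'rV[R]_n) : rV_cons (t, x) ord0 ord0 = t.
Proof. by have := congr1 fst (rV_consK (t, x)). Qed.

Lemma rV_consS n (t : R) (x : 'rV[R]_n) i :
  rV_cons (t, x) ord0 (lift ord0 i) = x ord0 i.
Proof. by have := congr1 snd (rV_consK (t, x)) => /= /rowP/(_ i); rewrite mxE. Qed.

Lemma rV_cons_Omega n (t : R) (x : 'rV[R]_n) :
  Omega (rV_cons (t, x)) <-> O01 t /\ Omega x.
Proof.
split=> [h|[h1 h2] i].
  split; first by have := h ord0; rewrite rV_cons0 /= in_itv.
  by move=> i; have := h (lift ord0 i); rewrite rV_consS.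
case: (unliftP ord0 i) => [j ->|->]; first by rewrite rV_consS; exact: h2.
by rewrite rV_cons0; move: h1; rewrite /= in_itv.
Qed.

Lemma preimage_rV_cons_Omega n :
  @rV_cons R n @^-1` Om = O01 `*` (Om : set 'rV[R]_n).
Proof. by apply/seteqP; split=> -[t x] /= /rV_cons_Omega. Qed.

Lemma measurable_Omega n : measurable (Om : set 'rV[R]_n).
Proof.
rewrite (_ : Om = \big[setI/setT]_(i < n) ((fun x : 'rV[R]_n => x ord0 i) @^-1` O01)).
  apply: bigsetI_measurable => i _; rewrite -[X in measurable X]setTI.
  by apply: (measurable_coord i) => //; exact: measurable_itv.
rewrite -bigcap_seq; apply/seteqP; split=> x /= h.
  by move=> i _ /=; rewrite in_itv; exact: h.
by move=> i; have := h i (mem_index_enum i); rewrite /= in_itv.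
Qed.
#[local] Hint Extern 0 (measurable _) => solve [exact: measurable_Omega] : core.

Lemma lebesgue_rV_Omega n : (lebesgue_rV n (Om : set 'rV[R]_n) = 1)%E.
Proof.
elim: n => [|n IH] /=.
  by rewrite diracE mem_set// => -[].
rewrite /rV_step /pushforward preimage_rV_cons_Omega.
rewrite product_measure1E//= ?lebesgue_measure_itv/= ?lte_fin ?ltr01 ?IH//.
by rewrite oppr0 adde0 mule1.
Qed.

Definition cube_integrable n (f : 'rV[R]_n -> R) :=
  (lebesgue_rV n).-integrable Om (EFin \o f).
Definition cube_integral n (f : 'rV[R]_n -> R) :=
  \int[lebesgue_rV n]_(x in Om) f x.
Definition I01 (f : R -> R) := \int[mu]_(t in O01) f t.

Lemma bounded_cube_integrable n (f : 'rV[R]_n -> R) (M : R) :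
  measurable_fun Om f -> (forall x, Om x -> `|f x| <= M) ->
  cube_integrable f.
Proof.
move=> mf fM; apply: (@le_integrable _ _ _ _ _ _ _ (cst M%:E)) => //.
- exact/measurable_EFinP.
- move=> x Ox /=; rewrite lee_fin; apply: le_trans (ler_norm _); exact: fM.
- apply/integrableP; split => //; rewrite integral_cst//=.
  by have -> := lebesgue_rV_Omega n; rewrite mule1 ltry.
Qed.

Lemma bounded_I01_integrable (f : R -> R) (M : R) :
  measurable_fun O01 f -> (forall x, O01 x -> `|f x| <= M) ->
  mu.-integrable O01 (EFin \o f).
Proof.
move=> mf fM; apply: (@le_integrable _ _ _ _ _ _ _ (cst M%:E)) => //.
- exact/measurable_EFinP.
- move=> x Ox /=; rewrite lee_fin; apply: le_trans (ler_norm _); exact: fM.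
- apply/integrableP; split => //; rewrite integral_cst//= lebesgue_measure_itv/= lte_fin ltr01.
  by rewrite oppr0 adde0 mule1 ltry.
Qed.

(** A partial integral is extended-real valued; being integrable, it is finite almost everywhere, so
    taking the finite part changes it on a null set only. *)
Lemma integrable_fine d (T : measurableType d) (m : {measure set T -> \bar R})
    (F : T -> \bar R) : m.-integrable setT F ->
  m.-integrable setT ((EFin \o fine) \o F) /\
  (\int[m]_x ((EFin \o fine) \o F) x = \int[m]_x F x)%E.
Proof.
move=> iF; have mF : measurable_fun setT F := measurable_int _ iF.
have mfF : measurable_fun setT ((EFin \o fine) \o F).
  by apply/measurable_EFinP; exact: measurableT_comp.
split.
  apply: (le_integrable _ mfF _ iF) => // x _ /=.
  by case: (F x) => //=; rewrite normr0 leey.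
apply: ae_eq_integral => //.
have := integrable_ae measurableT iF; apply: filterS => x /= h _.
by rewrite fineK// h.
Qed.

Lemma integrable_fubini_G d1 d2 (T1 : measurableType d1) (T2 : measurableType d2)
    (m1 : {sigma_finite_measure set T1 -> \bar R})
    (m2 : {sigma_finite_measure set T2 -> \bar R}) (F : T1 * T2 -> \bar R) :
  (m1 \x m2)%E.-integrable setT F -> m2.-integrable setT (fubini_G m1 F).
Proof.
move=> iF; have mF : measurable_fun setT F := measurable_int _ iF.
apply/integrableP; split; first exact: (measurable_fubini_G iF).
have h := (integrable21ltyP m1 m2 mF).1 iF; apply: le_lt_trans h.
apply: ge0_le_integral => //.
- by apply: measurableT_comp => //; exact: (measurable_fubini_G iF).
- apply: (measurable_fun_fubini_tonelli_G (abse \o F)) => //=.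
  exact: measurableT_comp.
- move=> y _; apply: le_abse_integral => //.
  exact: measurableT_comp.
Qed.

Section fubini.
Context n (f : 'rV[R]_n.+1 -> R).
Hypothesis intf : cube_integrable f.
(** Extension by zero outside the cube, pulled back along [rV_cons]: the measure on row vectors is
    by definition the image of the product measure. *)
Let g : measurableTypeR R * 'rV[R]_n -> \bar R :=
  (EFin \o (f \_ Om)) \o @rV_cons R n.
Let mfO : measurable_fun [set: 'rV[R]_n.+1] (EFin \o (f \_ Om)).
Proof.
apply/measurable_EFinP; apply/(measurable_restrictT _ _).1 => //.
by apply/measurable_EFinP; exact: measurable_int intf.
Qed.

Lemma integrable_product :
  (mu \x lebesgue_rV n)%E.-integrable setT g.
Proof.
have mg : measurable_fun setT g.
  by apply: (measurableT_comp mfO); exact: measurable_rV_cons.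
apply/integrableP; split=> //.
move/integrableP : intf => [_]; rewrite integral_mkcond /=.
rewrite ge0_integral_pushforward//=.
- apply: le_lt_trans; rewrite le_eqVlt; apply/orP; left; apply/eqP.
  apply: eq_integral => x _ /=; rewrite /g /= !patchE; case: ifP => //= _.
  by rewrite normr0.
- exact: measurable_rV_cons.
- apply/(measurable_restrictT _ _).1 => //; apply/measurable_EFinP.
  by apply: measurableT_comp => //; apply/measurable_EFinP; exact: measurable_int intf.
- by move=> y _; rewrite erestrict_ge0// => x _; exact: abse_ge0.
Qed.

Lemma cube_integral_product :
  (cube_integral f)%:E = (\int[mu \x lebesgue_rV n]_z g z)%E.
Proof.
rewrite /cube_integral /Rintegral fineK; last by have := integrable_fin_num (@measurable_Omega _) intf.
rewrite integral_mkcond /= integral_pushforward//=.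
- by apply: eq_integral => x _; rewrite /g restrict_EFin.
- exact: measurable_rV_cons.
- by rewrite restrict_EFin.
- have := integrable_product; rewrite /g -restrict_EFin; exact.
Qed.

Let gE t x : g (t, x) = ((fun t => (f (rV_cons (t, x)))) \_ O01 t * \1_Om x)%:E.
Proof.
rewrite /g /= !patchE indicE; congr (_ %:E).
case: ifPn => [/set_mem/rV_cons_Omega[h1 h2]|/negP h].
  by rewrite !mem_set// mulr1.
case: ifPn => [/set_mem h1|_]; rewrite ?mul0r//.
rewrite memNset ?mulr0// => h2; apply: h; apply/mem_set/rV_cons_Omega; split => //.
Qed.

Lemma ae_slice_integrable :
  {ae lebesgue_rV n, forall x, Om x ->
    mu.-integrable O01 (EFin \o (fun t => f (rV_cons (t, x))))}.
Proof.
have := ae_integrable2 integrable_product; apply: filterS => x /= h Ox.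
apply/(integrable_mkcond (EFin \o (fun t => f (rV_cons (t, x)))) _).2 => //.
rewrite restrict_EFin; apply: eq_integrable h => //= t _.
by rewrite gE indicE mem_set// mulr1.
Qed.

(** The first coordinate is the outer variable here and the inner one in [fubini_slice]. *)
Lemma fubini_tail :
  mu.-integrable O01 (EFin \o (fun t => cube_integral (fun x => f (rV_cons (t, x))))) /\
  cube_integral f = I01 (fun t => cube_integral (fun x => f (rV_cons (t, x)))).
Proof.
have [h1 h2] := integrable_fine (integrable_fubini_F integrable_product).
have e : (EFin \o fine) \o fubini_F (lebesgue_rV n) g =
    (EFin \o (fun t => cube_integral (fun x => f (rV_cons (t, x))))) \_ O01.
  apply/funext => t; rewrite patchE /= /fubini_F; case: ifPn => [|/negP] Ot.
    congr (fine _)%:E; rewrite [RHS]integral_mkcond; apply: eq_integral => x _.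
    by rewrite gE /patch indicE Ot; case: (x \in _); rewrite /= ?mulr1 ?mulr0.
  rewrite integral0_eq// => x _; rewrite gE patchE ifF ?mul0r//.
  by apply/negP => h'; apply: Ot.
split; first by apply/(integrable_mkcond _ _).2 => //; rewrite -e.
apply: EFin_inj; rewrite cube_integral_product -integral12_prod_meas1; last exact: integrable_product.
rewrite -h2 e -integral_mkcond /I01 /Rintegral fineK//.
apply: integrable_fin_num => //.
by apply/(integrable_mkcond _ _).2 => //; rewrite -e.
Qed.

Lemma fubini_slice :
  cube_integrable (fun x => I01 (fun t => f (rV_cons (t, x)))) /\
  cube_integral f = cube_integral (fun x => I01 (fun t => f (rV_cons (t, x)))).
Proof.
have [h1 h2] := integrable_fine (integrable_fubini_G integrable_product).
have e : (EFin \o fine) \o fubini_G mu g =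
    (EFin \o (fun x => I01 (fun t => f (rV_cons (t, x))))) \_ Om.
  apply/funext => x; rewrite patchE /= /fubini_G; case: ifPn => [|/negP] Ot.
    congr (fine _)%:E; rewrite [RHS]integral_mkcond; apply: eq_integral => t _.
    by rewrite gE /patch indicE Ot mulr1; case: (t \in _).
  rewrite integral0_eq// => t _; rewrite gE indicE.
  by move/negP/negbTE: Ot => ->; rewrite mulr0.
split; first by apply/(integrable_mkcond _ _).2 => //; rewrite -e.
apply: EFin_inj; rewrite cube_integral_product -integral21_prod_meas1; last exact: integrable_product.
rewrite -h2 e -integral_mkcond /cube_integral /Rintegral fineK//.
apply: integrable_fin_num => //.
by apply/(integrable_mkcond _ _).2 => //; rewrite -e.
Qed.

End fubini.
End rV_measure.

(** * Bounded measurable functions and the fundamental theorem of calculus *)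

Section bounded_measurable.
Context {R : realType}.
Local Notation mu := (@lebesgue_measure R).
Local Notation O01 := (`]0%R, 1%R[%classic : set R).
Local Notation Om := (@Omega R _).
#[local] Hint Extern 0 (measurable _) => solve [exact: measurable_Omega] : core.

(** On the cube, which has measure one, such functions are integrable, and the class is stable under
    sums and products; integrability conditions thus reduce to closure lemmas. *)
Definition bmeas d (T : measurableType d) (D : set T) (f : T -> R) :=
  measurable_fun D f /\ exists M, forall x, D x -> `|f x| <= M.

Section closure.
Context d (T : measurableType d) (D : set T).
Implicit Types f g : T -> R.

Lemma bmeas_cst c : bmeas D (fun=> c).
Proof. by split; [exact: measurable_cst|exists `|c|]. Qed.

Lemma eq_bmeas f g : {in D, f =1 g} -> bmeas D f -> bmeas D g.
Proof.
move=> fg [mf [M fM]]; split; first exact: eq_measurable_fun mf.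
by exists M => x Dx; rewrite -fg ?inE//; exact: fM.
Qed.

Lemma bmeasD f g : bmeas D f -> bmeas D g -> bmeas D (fun x => f x + g x).
Proof.
move=> [mf [M fM]] [mg [M' gM]]; split; first exact: measurable_funD.
by exists (M + M') => x Dx; rewrite (le_trans (ler_normD _ _))// lerD ?fM ?gM.
Qed.

Lemma bmeasM f g : bmeas D f -> bmeas D g -> bmeas D (fun x => f x * g x).
Proof.
move=> [mf [M fM]] [mg [M' gM]]; split; first exact: measurable_funM.
by exists (M * M') => x Dx; rewrite normrM ler_pM ?fM ?gM.
Qed.

Lemma bmeasZ c f : bmeas D f -> bmeas D (fun x => c * f x).
Proof. by apply: bmeasM; exact: bmeas_cst. Qed.

Lemma bmeasB f g : bmeas D f -> bmeas D g -> bmeas D (fun x => f x - g x).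
Proof.
move=> hf hg; apply: (@eq_bmeas (fun x => f x + (-1) * g x)).
  by move=> x _; rewrite mulN1r.
by apply: bmeasD => //; exact: bmeasZ.
Qed.

Lemma bmeas_sum I (r : seq I) (P : pred I) (F : I -> T -> R) :
  (forall i, P i -> bmeas D (F i)) -> bmeas D (fun x => \sum_(i <- r | P i) F i x).
Proof.
move=> h; elim: r => [|i r IH].
  by under eq_fun do rewrite big_nil; exact: bmeas_cst.
under eq_fun do rewrite big_cons.
case: (boolP (P i)) => // Pi.
by apply: bmeasD => //; exact: h.
Qed.

Lemma bmeas_prod I (r : seq I) (P : pred I) (F : I -> T -> R) :
  (forall i, P i -> bmeas D (F i)) -> bmeas D (fun x => \prod_(i <- r | P i) F i x).
Proof.
move=> h; elim: r => [|i r IH].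
  by under eq_fun do rewrite big_nil; exact: bmeas_cst.
under eq_fun do rewrite big_cons.
case: (boolP (P i)) => // Pi.
by apply: bmeasM => //; exact: h.
Qed.

End closure.

Lemma bmeas_cube_integrable n (f : 'rV[R]_n -> R) : bmeas Om f -> cube_integrable f.
Proof. by move=> [mf [M fM]]; exact: bounded_cube_integrable fM. Qed.

Lemma bmeas_I01_integrable f : bmeas O01 f -> mu.-integrable O01 (EFin \o f).
Proof. by move=> [mf [M fM]]; exact: bounded_I01_integrable fM. Qed.

Lemma bmeas_coord n (k : 'I_n) f : bmeas O01 f -> bmeas Om (fun x => f (x ord0 k)).
Proof.
move=> [mf [M fM]]; split.
  apply: (measurable_comp _ _ mf) => //.
    by move=> _ [x Ox <-]; rewrite /= in_itv; exact: Ox.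
  by apply: measurable_funTS; exact: measurable_coord.
by exists M => x Ox; apply: fM; rewrite /= in_itv; exact: Ox.
Qed.

Lemma bmeas_tail n (f : 'rV[R]_n.+1 -> R) t :
  O01 t -> bmeas Om f -> bmeas Om (fun x => f (rV_cons (t, x))).
Proof.
move=> Ot [mf [M fM]]; split.
  apply: (measurable_comp _ _ mf) => //.
    by move=> _ [x Ox <-]; apply/rV_cons_Omega.
  apply: measurable_funTS; apply: (measurableT_comp (@measurable_rV_cons R n)).
  exact: pair1_measurable.
by exists M => x Ox; apply: fM; apply/rV_cons_Omega.
Qed.

Section I01_algebra.
Implicit Types f g : R -> R.

Lemma eq_I01 f g : (forall t, O01 t -> f t = g t) -> I01 f = I01 g.
Proof. by move=> h; apply: eq_Rintegral => t /set_mem; exact: h. Qed.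

Lemma I01D f g : bmeas O01 f -> bmeas O01 g -> I01 (fun t => f t + g t) = I01 f + I01 g.
Proof. by move=> hf hg; apply: RintegralD => //; exact: bmeas_I01_integrable. Qed.

Lemma I01B f g : bmeas O01 f -> bmeas O01 g -> I01 (fun t => f t - g t) = I01 f - I01 g.
Proof. by move=> hf hg; apply: RintegralB => //; exact: bmeas_I01_integrable. Qed.

Lemma I01Z c f : bmeas O01 f -> I01 (fun t => c * f t) = c * I01 f.
Proof. by move=> hf; apply: RintegralZl => //; exact: bmeas_I01_integrable. Qed.

Lemma I01_sum I (r : seq I) (P : pred I) (F : I -> R -> R) :
  (forall i, P i -> bmeas O01 (F i)) ->
  I01 (fun t => \sum_(i <- r | P i) F i t) = \sum_(i <- r | P i) I01 (F i).
Proof.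
move=> h; elim: r => [|i r IH].
  rewrite big_nil (@eq_I01 _ (cst 0)); first by rewrite /I01 Rintegral_cst ?mul0r.
  by move=> t _; rewrite big_nil.
rewrite big_cons; under eq_I01 do rewrite big_cons.
by case: (boolP (P i)) => // Pi; rewrite I01D ?IH//; [exact: h|exact: bmeas_sum].
Qed.

Lemma le_I01 f g : bmeas O01 f -> bmeas O01 g -> (forall t, O01 t -> f t <= g t) -> I01 f <= I01 g.
Proof. by move=> hf hg fg; apply: le_Rintegral => //; exact: bmeas_I01_integrable. Qed.

Lemma I01_ge0 f : (forall t, O01 t -> 0 <= f t) -> 0 <= I01 f.
Proof. by move=> h; apply: Rintegral_ge0 => t Ot; exact: h. Qed.

Lemma I01_cst (c : R) : I01 (fun=> c) = c.
Proof.
rewrite /I01 Rintegral_cst//= lebesgue_measure_itv/= lte_fin ltr01/= oppr0.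
by rewrite addr0 mulr1.
Qed.

Lemma I01_bounded f M : bmeas O01 f -> (forall t, O01 t -> f t <= M) -> I01 f <= M.
Proof. by move=> hf fM; rewrite -[M]I01_cst; apply: le_I01 => //; exact: bmeas_cst. Qed.

End I01_algebra.

Definition tens n (f : 'I_n -> R -> R) (x : 'rV[R]_n) : R :=
  \prod_(k < n) f k (x ord0 k).

Lemma bmeas_tens n (f : 'I_n -> R -> R) :
  (forall k, bmeas O01 (f k)) -> bmeas Om (tens f).
Proof. by move=> h; apply: bmeas_prod => k _; exact: bmeas_coord. Qed.

Lemma cube_integral_tens n (f : 'I_n -> R -> R) :
  (forall k, bmeas O01 (f k)) -> cube_integral (tens f) = \prod_(k < n) I01 (f k).
Proof.
elim: n f => [|n IH] f h.
  rewrite big_ord0 /cube_integral.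
  rewrite (@eq_Rintegral _ _ _ _ _ (cst 1)); last by move=> x _; rewrite /tens big_ord0.
  transitivity (1 * fine (lebesgue_rV 0 (Om : set 'rV[R]_0))).
    by apply: Rintegral_cst.
  by rewrite lebesgue_rV_Omega mul1r.
have [_ ->] := fubini_slice (bmeas_cube_integrable (bmeas_tens h)).
rewrite big_ord_recl -IH// /cube_integral -RintegralZl//; last first.
  by apply: bmeas_cube_integrable; exact: bmeas_tens.
apply: eq_Rintegral => x _; rewrite -RintegralZr//; last first.
  exact: bmeas_I01_integrable.
apply: eq_Rintegral => t _; rewrite /tens big_ord_recl rV_cons0; congr (_ * _).
by apply: eq_bigr => i _; rewrite rV_consS.
Qed.

Lemma bmeas_continuous f : continuous f -> bmeas O01 f.
Proof.
move=> cf; split; first by apply: measurable_funTS; exact: continuous_measurable_fun.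
have /compact_bounded : compact (f @` `[0, 1]).
  by apply: continuous_compact; [exact: continuous_subspaceT|exact: segment_compact].
move=> [M [_ hM]]; exists (M + 1) => x Ox; apply: (hM (M + 1)); first by rewrite ltrDl.
by exists x => //; exact: subset_itv_oo_cc.
Qed.

Lemma is_derive_continuous (F : R -> R) (x df : R) :
  is_derive x 1 F df -> {for x, continuous F}.
Proof.
by move=> h; apply: differentiable_continuous; apply/derivable1_diffP; have := h => -[].
Qed.

Lemma FTC_within (F f : R -> R) a b : a <= b ->
  (forall x : R, a <= x <= b -> is_derive x 1 F (f x)) ->
  {within `[a, b], continuous f} ->
  \int[mu]_(t in `[a, b]) f t = F b - F a.
Proof.
move=> + dF cf; rewrite le_eqVlt => /predU1P[<-|ab].
  by rewrite set_itv1 Rintegral_set1 subrr.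
have cF x : a <= x <= b -> {for x, continuous F}.
  by move=> xab; exact: is_derive_continuous (dF x xab).
rewrite /Rintegral (@continuous_FTC2 _ f F)//.
- split.
  + by move=> x /subset_itv_oo_cc; rewrite /= in_itv => xab; have := dF x xab => -[].
  + by apply: cvg_at_right_filter; apply: cF; rewrite lexx ltW.
  + by apply: cvg_at_left_filter; apply: cF; rewrite lexx ltW.
- move=> x /subset_itv_oo_cc; rewrite /= in_itv => xab.
  by rewrite derive1E; have := dF x xab => -[].
Qed.

Lemma FTC_segment (F f : R -> R) a b : a <= b ->
  (forall x : R, is_derive x 1 F (f x)) -> continuous f ->
  \int[mu]_(t in `[a, b]) f t = F b - F a.
Proof. by move=> ab dF cf; apply: FTC_within => //; exact: continuous_subspaceT. Qed.

Lemma I01_segment f : continuous f -> I01 f = \int[mu]_(t in `[0, 1]) f t.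
Proof.
move=> cf; have h : mu.-integrable `[0, 1] (EFin \o f).
  apply: continuous_compact_integrable; first exact: segment_compact.
  exact: continuous_subspaceT.
rewrite /I01 Rintegral_itv_bndo_bndc; last first.
  by apply: integrableS h => //; exact: subset_itv_oo_cc.
rewrite Rintegral_itv_obnd_cbnd//.
by apply: integrableS h => //; exact: subset_itv_oc_cc.
Qed.

Lemma I01_FTC (F f : R -> R) :
  (forall x : R, is_derive x 1 F (f x)) -> continuous f -> I01 f = F 1 - F 0.
Proof.
move=> dF cf; by rewrite I01_segment//; exact: FTC_segment.
Qed.

Definition upd n (x : 'rV[R]_n) (k : 'I_n) (t : R) : 'rV[R]_n :=
  \row_i (if i == k then t else x ord0 i).

Lemma upd_cons0 n (x : 'rV[R]_n) s t : upd (rV_cons (s, x)) ord0 t = rV_cons (t, x).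
Proof.
apply/rowP => i; rewrite mxE; case: (unliftP ord0 i) => [j ->|->].
  by rewrite eq_sym (negbTE (neq_lift _ _)) !rV_consS.
by rewrite eqxx rV_cons0.
Qed.

Lemma upd_consS n (x : 'rV[R]_n) k s t :
  upd (rV_cons (s, x)) (lift ord0 k) t = rV_cons (s, upd x k t).
Proof.
apply/rowP => i; rewrite mxE; case: (unliftP ord0 i) => [j ->|->].
  by rewrite (inj_eq lift_inj) !rV_consS mxE.
by rewrite (negbTE (neq_lift _ _)) !rV_cons0.
Qed.

(** By induction on the dimension, Fubini freezes the coordinates that precede [k] until [k] is the
    first one; then the one-dimensional fundamental theorem applies on each line. *)
Lemma cube_integral_derive n (k : 'I_n) (psi G : 'rV[R]_n -> R) :
  bmeas Om G ->
  (forall x (t : R), is_derive t 1 (fun s => psi (upd x k s)) (G (upd x k t))) ->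
  (forall x, continuous (fun s => G (upd x k s))) ->
  (forall x, psi (upd x k 0) = 0 /\ psi (upd x k 1) = 0) ->
  cube_integral G = 0.
Proof.
elim: n k psi G => [[]//|n IH] k psi G bG dG cG bd.
case: (unliftP ord0 k) => [j kj|k0].
  have [_ ->] := fubini_tail (bmeas_cube_integrable bG).
  rewrite /I01 (@eq_Rintegral _ _ _ _ _ (cst 0)) ?Rintegral_cst ?mul0r// => t /set_mem Ot.
  apply: (IH j (fun x => psi (rV_cons (t, x)))).
  - exact: bmeas_tail.
  - move=> x s; have := dG (rV_cons (t, x)) s; rewrite kj upd_consS.
    by under eq_fun do rewrite upd_consS.
  - by move=> x; have := cG (rV_cons (t, x)); rewrite kj; under eq_fun do rewrite upd_consS.
  - by move=> x; have := bd (rV_cons (t, x)); rewrite kj !upd_consS.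
have [_ ->] := fubini_slice (bmeas_cube_integrable bG).
rewrite /cube_integral (@eq_Rintegral _ _ _ _ _ (cst 0)) ?Rintegral_cst ?mul0r// => x /set_mem Ox.
transitivity (psi (rV_cons (1, x)) - psi (rV_cons (0, x))); last first.
  by have := bd (rV_cons (0, x)); rewrite k0 !upd_cons0 => -[-> ->]; rewrite subrr.
apply: (@I01_FTC (fun t => psi (rV_cons (t, x)))).
- move=> s; have := dG (rV_cons (0, x)) s; rewrite k0 upd_cons0.
  by under eq_fun do rewrite upd_cons0.
- by have := cG (rV_cons (0, x)); rewrite k0; under eq_fun do rewrite upd_cons0.
Qed.

Lemma measurable_cell n (m : nat) (z : 'rV[int]_n) :
  measurable [set x : 'rV[R]_n | forall k, Num.floor (x ord0 k * m.+1%:R) = z ord0 k].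
Proof.
rewrite (_ : [set _ | _] = \big[setI/setT]_(i < n) ((fun x : 'rV[R]_n => x ord0 i) @^-1`
    (`[(z ord0 i)%:~R / m.+1%:R, (z ord0 i + 1)%:~R / m.+1%:R[%classic : set R))).
  apply: bigsetI_measurable => i _; rewrite -[X in measurable X]setTI.
  by apply: (measurable_coord i) => //; exact: measurable_itv.
have m0 : 0 < m.+1%:R :> R by rewrite ltr0n.
have e (t : R) (a : int) : (Num.floor (t * m.+1%:R) = a) <->
    t \in `[a%:~R / m.+1%:R, (a + 1)%:~R / m.+1%:R[.
  rewrite in_itv /= ler_pdivrMr// ltr_pdivlMr//; split; last exact: floor_def.
  by move=> <-; rewrite floor_le floorD1_gt.
rewrite -bigcap_seq; apply/seteqP; split=> x /= h.
  by move=> i _ /=; apply/e; exact: h.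
by move=> i; have := h i (mem_index_enum i) => /= /e.
Qed.

(** The sigma-algebra is generated by the coordinates, so continuity does not yield measurability at
    once. [F] is the pointwise limit of its values at points rounded down to a grid, and these take
    countably many values, on measurable cells. *)
Lemma continuous_rV_measurable n (F : 'rV[R]_n -> R) :
  continuous F -> measurable_fun setT F.
Proof.
move=> cF.
pose r (m : nat) (x : 'rV[R]_n) : 'rV[R]_n :=
  \row_k ((Num.floor (x ord0 k * m.+1%:R))%:~R / m.+1%:R).
apply: (@measurable_fun_cvg _ _ _ _ (fun m => F \o r m)) => //.
  move=> m _ Y mY; rewrite setTI.
  rewrite (_ : _ @^-1` _ = \bigcup_(z in [set z : 'rV[int]_n | Y (F (\row_k ((z ord0 k)%:~R / m.+1%:R)))])
     [set x : 'rV[R]_n | forall k, Num.floor (x ord0 k * m.+1%:R) = z ord0 k]).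
    rewrite bigcup_mkcond; apply: countable_bigcupT_measurable => // z.
    by case: ifPn => // _; exact: measurable_cell.
  apply/seteqP; split => x /=.
    move=> Yx; exists (\row_k Num.floor (x ord0 k * m.+1%:R)); last by move=> k; rewrite mxE.
    by move: Yx => /=; congr (Y (F _)); apply/rowP => k; rewrite !mxE.
  by move=> [z /= Yz hz]; move: Yz; congr (Y (F _)); apply/rowP => k; rewrite !mxE hz.
move=> x _; apply: (cvg_comp (r ^~ x) F _ (cF x)).
move=> A [P /= hP PA]; rewrite /nbhs /=.
have h : forall i : 'I_1 * 'I_n, \forall m \near \oo, P i.1 i.2 (r m x i.1 i.2).
  move=> [i k] /=; suff : (r m x i k) @[m --> \oo] --> x i k by apply; exact: hP.
  rewrite (ord1 i); under eq_fun do rewrite mxE.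
  apply/cvgrPdist_le => /= e e0; near=> m.
  have m0 : 0 < m.+1%:R :> R by rewrite ltr0n.
  rewrite ler_norml.
  have := floor_le (x ord0 k * m.+1%:R); rewrite -ler_pdivrMr// => h1.
  have := floorD1_gt (x ord0 k * m.+1%:R); rewrite -ltr_pdivlMr// intrD mulrDl => h2.
  have h3 : 1 / m.+1%:R <= e.
    by rewrite mul1r ltW//; near: m; exact: (near_infty_natSinv_lt (PosNum e0)).
    rewrite (_ : 0 = ord0 :> 'I_1); last exact: val_inj.
  move: h1 h2 h3; rewrite mulr1z; set a := (Num.floor _)%:~R / _; set b := 1 / _; set y := x _ _ => h1 h2 h3.
  apply/andP; split; lra.
have : \forall m \near \oo, forall i : 'I_1 * 'I_n, P i.1 i.2 (r m x i.1 i.2).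
  exact: filter_forall.
by apply: filterS => m hm; apply: PA => i j; exact: (hm (i, j)).
Unshelve. all: by end_near. Qed.

End bounded_measurable.

(** * Piecewise smooth functions on uniform meshes *)

Section piecewise.
Context {R : realType}.
Local Notation mu := (@lebesgue_measure R).
Local Notation O01 := (`]0%R, 1%R[%classic : set R).
Implicit Types (f g : R -> R) (n e : nat) (F G H : nat -> R -> R).

Fixpoint nderivable n f : Prop :=
  if n is n'.+1 then (forall x, derivable f x 1) /\ nderivable n' (derive1 f) else True.

Definition smooth1 f := forall n, nderivable n f.

Lemma derive1_is f g : (forall x : R, is_derive x 1 f (g x)) -> (derive1 f) = g.
Proof. by move=> h; apply/funext => x; rewrite derive1E; have := h x => -[]. Qed.

Lemma smooth1_is_derive f : smooth1 f -> forall x : R, is_derive x 1 f ((derive1 f) x).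
Proof. by move=> /(_ 1%N)[h _] x; rewrite derive1E; exact: DeriveDef. Qed.

Lemma smooth1_derive f : smooth1 f -> smooth1 (derive1 f).
Proof. by move=> h n; have [] := h n.+1. Qed.

Lemma smooth1_continuous f : smooth1 f -> continuous f.
Proof. by move=> /smooth1_is_derive h x; exact: is_derive_continuous (h x). Qed.

Lemma nderivable_le n f : nderivable n.+1 f -> nderivable n f.
Proof. by elim: n f => // n IH f [h1 h2]; split => //; exact: IH. Qed.

Lemma nderivable_cst n c : nderivable n (fun=> c).
Proof.
elim: n c => // n IH c; split; first by move=> x; exact: derivable_cst.
have -> : derive1 (fun=> c : R) = fun=> 0.
  by apply: derive1_is => x; exact: is_derive_cst.
exact: IH.
Qed.

Lemma nderivableD n f g :
  nderivable n f -> nderivable n g -> nderivable n (fun x => f x + g x).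
Proof.
elim: n f g => // n IH f g [f1 f2] [g1 g2].
split; first by move=> x; exact: derivableD.
have -> : derive1 (fun x => f x + g x) = (fun x => (derive1 f) x + (derive1 g) x).
  by apply: derive1_is => x; rewrite !derive1E; apply: is_deriveD; exact: DeriveDef.
exact: IH.
Qed.

Lemma nderivableM n f g :
  nderivable n f -> nderivable n g -> nderivable n (fun x => f x * g x).
Proof.
elim: n f g => // n IH f g hf hg.
have [f1 f2] := hf; have [g1 g2] := hg.
split; first by move=> x; exact: derivableM.
have -> : derive1 (fun x => f x * g x) = (fun x => f x * (derive1 g) x + g x * (derive1 f) x).
  by apply: derive1_is => x; rewrite !derive1E; apply: is_deriveM; exact: DeriveDef.
by apply: nderivableD; apply: IH => //; exact: nderivable_le.
Qed.

Lemma smooth1_cst c : smooth1 (fun=> c). Proof. by move=> n; exact: nderivable_cst. Qed.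

Lemma smooth1D f g : smooth1 f -> smooth1 g -> smooth1 (fun x => f x + g x).
Proof. by move=> hf hg n; exact: nderivableD. Qed.

Lemma smooth1M f g : smooth1 f -> smooth1 g -> smooth1 (fun x => f x * g x).
Proof. by move=> hf hg n; exact: nderivableM. Qed.

Lemma smooth1_sum I (r : seq I) (P : pred I) (A : I -> R -> R) :
  (forall i, P i -> smooth1 (A i)) -> smooth1 (fun x => \sum_(i <- r | P i) A i x).
Proof.
move=> h; elim: r => [|i r IH].
  by under eq_fun do rewrite big_nil; exact: smooth1_cst.
under eq_fun do rewrite big_cons.
by case: (boolP (P i)) => // Pi; apply: smooth1D => //; exact: h.
Qed.

Lemma is_derive_horner (q : {poly R}) (x : R) :
  is_derive x 1 (fun t => q.[t]) (q^`()).[x].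
Proof.
elim/poly_ind: q => [|q c IH].
  rewrite deriv0 horner0; under eq_fun do rewrite horner0.
  exact: is_derive_cst.
under eq_fun do rewrite hornerMXaddC.
rewrite derivMXaddC hornerD hornerMX.
have h := is_deriveD (is_deriveM IH (is_derive_id x 1)) (is_derive_cst c x 1).
by apply: is_derive_eq h _; rewrite /= addr0 /GRing.scale /= mulr1 [x * _]mulrC.
Qed.

Lemma smooth1_horner (q : {poly R}) : smooth1 (fun x => q.[x]).
Proof.
move=> n; elim: n q => // n IH q; split.
  by move=> x; have [] := is_derive_horner q x.
by rewrite (derive1_is (is_derive_horner q)).
Qed.

Lemma is_derive_scale (w x : R) : is_derive x 1 (fun x : R => w * x) w.
Proof.
have h := is_deriveM (is_derive_cst w x 1) (is_derive_id x 1).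
by apply: is_derive_eq h _; rewrite /= scaler0 addr0 [_ *: _]mulr1.
Qed.

Lemma is_derive_sinM (w x : R) :
  is_derive x 1 (fun x : R => sin (w * x)) (w * cos (w * x)).
Proof.
have h := @is_derive1_comp _ sin (fun x : R => w * x) x _ _ (is_derive_sin _) (is_derive_scale w x).
by apply: is_derive_eq h _; rewrite mulrC.
Qed.

Lemma is_derive_cosM (w x : R) :
  is_derive x 1 (fun x : R => cos (w * x)) (- w * sin (w * x)).
Proof.
have h := @is_derive1_comp _ cos (fun x : R => w * x) x _ _ (is_derive_cos _) (is_derive_scale w x).
by apply: is_derive_eq h _; rewrite mulrC mulrN mulNr.
Qed.

Lemma is_derive_trig (a b w x : R) :
  is_derive x 1 (fun x : R => a * sin (w * x) + b * cos (w * x))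
    (- (b * w) * sin (w * x) + a * w * cos (w * x)).
Proof.
have h := is_deriveD
  (is_deriveM (is_derive_cst a x 1) (is_derive_sinM w x))
  (is_deriveM (is_derive_cst b x 1) (is_derive_cosM w x)).
apply: is_derive_eq h _; rewrite /= !scaler0 !addr0 /GRing.scale /=; ring.
Qed.

Lemma smooth1_trig (a b w : R) : smooth1 (fun x : R => a * sin (w * x) + b * cos (w * x)).
Proof.
move=> n; elim: n a b => // n IH a b; split.
  by move=> x; have [] := is_derive_trig a b w x.
by rewrite (derive1_is (is_derive_trig a b w)).
Qed.

Definition node n e : R := e%:R / n%:R.

Lemma element_of_node n x : (0 < n)%N -> O01 x ->
  [/\ (element_of n x < n)%N, node n (element_of n x) <= x & x < node n (element_of n x).+1].
Proof.
move=> n0; rewrite /= in_itv /= => /andP[x0 x1].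
have nr : 0 < n%:R :> R by rewrite ltr0n.
have xn : 0 <= x * n%:R by rewrite mulr_ge0// ltW.
have /andP[h1 h2] := truncn_itv xn.
have h3 : (Num.truncn (x * n%:R) < n)%N.
  by rewrite -(ltr_nat R) (le_lt_trans h1)// -[ltRHS]mul1r ltr_pM2r.
have -> : element_of n x = Num.truncn (x * n%:R).
  by apply/minn_idPl; rewrite -ltnS prednK.
by split=> //; rewrite /node ?ler_pdivrMr ?ltr_pdivlMr.
Qed.

Lemma node_le n e e' : (e <= e')%N -> node n e <= node n e'.
Proof. by move=> h; rewrite /node ler_wpM2r ?invr_ge0// ler_nat. Qed.

Lemma node_lt n e e' : (0 < n)%N -> (e < e')%N -> node n e < node n e'.
Proof. by move=> n0 h; rewrite /node ltr_pM2r ?invr_gt0 ?ltr0n// ltr_nat. Qed.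

Lemma node0 n : node n 0 = 0. Proof. by rewrite /node mul0r. Qed.

Lemma node1 n : (0 < n)%N -> node n n = 1.
Proof. by move=> n0; rewrite /node divff// pnatr_eq0 -lt0n. Qed.

Lemma element_of_eq n e x : (0 < n)%N -> O01 x ->
  node n e <= x -> x < node n e.+1 -> element_of n x = e.
Proof.
move=> n0 Ox h1 h2; have [h3 h4 h5] := element_of_node n0 Ox.
apply/eqP; rewrite eqn_leq; apply/andP; split; rewrite leqNgt; apply/negP => h.
  by have := lt_le_trans h2 (le_trans (node_le n h) h4); rewrite ltxx.
by have := lt_le_trans h5 (le_trans (node_le n h) h1); rewrite ltxx.
Qed.

Lemma element_of_refine n m x : (0 < n)%N -> (0 < m)%N -> O01 x ->
  element_of n x = (element_of (n * m) x %/ m)%N.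
Proof.
move=> n0 m0 Ox; have nm0 : (0 < n * m)%N by rewrite muln_gt0 n0.
have [h3 h4 h5] := element_of_node nm0 Ox; set e := element_of _ _ in h3 h4 h5 *.
have E k : node n k = node (n * m) (k * m).
  by rewrite /node !natrM -mulf_div divff ?mulr1// pnatr_eq0 -lt0n.
apply: element_of_eq => //; rewrite E.
  by apply: le_trans h4; apply: node_le; exact: leq_divM.
by apply: (lt_le_trans h5); apply: node_le; exact: ltn_ceil.
Qed.

Definition pw n H x := H (element_of n x) x.

(** Continuity is asked on the closed cell only: the integrands of the spectral gap inequality
    involve cotangents with poles outside their cell. *)
Definition ccont n H := forall e, (e < n)%N ->
  {within `[node n e, node n e.+1], continuous (H e)}.

Lemma ccont_continuous n H : (forall e, continuous (H e)) -> ccont n H.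
Proof. by move=> h e _; exact: continuous_subspaceT. Qed.

Let cellset n e : set R := O01 `&` `[node n e, node n e.+1[.

Lemma bmeas_pw n H : (0 < n)%N -> ccont n H -> bmeas O01 (pw n H).
Proof.
move=> n0 cH.
have b e : exists M, (e < n)%N -> forall x, x \in `[node n e, node n e.+1] -> `|H e x| <= M.
  have [en|en] := ltnP e n; last by exists 0.
  have /compact_bounded : compact (H e @` `[node n e, node n e.+1]).
    by apply: continuous_compact; [exact: cH|exact: segment_compact].
  move=> [M [_ hM]]; exists (M + 1) => _ x Ox; apply: (hM (M + 1)); first by rewrite ltrDl.
  by exists x.
have /choice[M hM] := b.
split.
  have U : O01 = \bigcup_e cellset n e.
    apply/seteqP; split=> x.
      move=> Ox; have [h1 h2 h3] := element_of_node n0 Ox.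
      by exists (element_of n x) => //; split => //=; rewrite in_itv /= h2 h3.
    by move=> [e _ []].
  rewrite U; apply/measurable_fun_bigcup.
    by move=> e; apply: measurableI => //; exact: measurable_itv.
  move=> e; have [en|en] := ltnP e n; last first.
    rewrite (_ : cellset n e = set0); first exact: measurable_fun_set0.
    rewrite -subset0 => x [+ /=]; rewrite /= !in_itv /= => /andP[_ x1] /andP[x2 _].
    have := le_lt_trans (node_le n en) (le_lt_trans x2 x1).
    by rewrite node1// ltxx.
  apply: (@eq_measurable_fun _ _ _ _ _ (H e)).
    move=> x /set_mem[Ox /=]; rewrite in_itv /= => /andP[h1 h2].
    by rewrite /pw (element_of_eq n0 Ox h1 h2).
  apply: (@measurable_funS _ _ _ _ `[node n e, node n e.+1]) => //.
    by move=> x [_]; exact: subset_itv_co_cc.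
  by apply: subspace_continuous_measurable_fun => //; exact: cH.
exists (\sum_(e < n) `|M e|) => x Ox; have [h1 h2 h3] := element_of_node n0 Ox.
apply: (@le_trans _ _ `|M (element_of n x)|).
  apply: le_trans (ler_norm _); apply: hM => //=.
  by rewrite in_itv /= h2 ltW.
by rewrite (bigD1 (Ordinal h1)) //= lerDl sumr_ge0.
Qed.

Lemma I01_cells n f : (0 < n)%N -> bmeas O01 f ->
  I01 f = \sum_(e < n) \int[mu]_(t in `]node n e, node n e.+1[) f t.
Proof.
move=> n0 hf; have If := bmeas_I01_integrable hf.
suff h k : (k <= n)%N -> \int[mu]_(t in `]0, node n k[) f t =
    \sum_(e < k) \int[mu]_(t in `]node n e, node n e.+1[) f t.
  by rewrite -h// node1.
elim: k => [_|k IH kn]; first by rewrite node0 set_itvoo0 Rintegral_set0 big_ord0.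
have k1 : node n k.+1 <= 1 by rewrite -(node1 n0) node_le.
have k0 : 0 <= node n k by rewrite -(node0 n) node_le.
have kk := node_lt n0 (ltnSn k).
have I1 : mu.-integrable `]0, node n k.+1[ (EFin \o f).
  apply: integrableS If => //; apply: subset_itvl; by rewrite bnd_simp.
have I2 : mu.-integrable `]0, node n k[ (EFin \o f).
  apply: integrableS I1 => //; apply: subset_itvl; by rewrite bnd_simp ltW.
rewrite big_ord_recr/= -IH ?(ltnW kn)// (Rintegral_itv_bndo_bndc I2).
by have <- := @Rintegral_itvB _ f _ _ (node n k) I1; rewrite ?bnd_simp// addrC subrK.
Qed.

Lemma cell_itv n e x : (0 < n)%N -> (e < n)%N -> node n e <= x -> x < node n e.+1 ->
  0 < x -> O01 x.
Proof.
move=> n0 en h1 h2 x0; rewrite /= in_itv /= x0 (lt_le_trans h2)//.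
by rewrite -(node1 n0) node_le.
Qed.

Lemma I01_pw_FTC n (P p : nat -> R -> R) : (0 < n)%N -> ccont n p ->
  (forall e, (e < n)%N -> forall x : R, node n e <= x <= node n e.+1 -> is_derive x 1 (P e) (p e x)) ->
  I01 (pw n p) = \sum_(e < n) (P e (node n e.+1) - P e (node n e)).
Proof.
move=> n0 cp dP; rewrite (I01_cells n0 (bmeas_pw n0 cp)); apply: eq_bigr => e _.
have ee := node_lt n0 (ltnSn e).
have en := ltn_ord e.
rewrite -(FTC_within (ltW ee) (dP e en))//; last exact: cp.
have Ip : mu.-integrable `[node n e, node n e.+1] (EFin \o p e).
  by apply: continuous_compact_integrable; [exact: segment_compact|exact: cp].
rewrite -Rintegral_itv_obnd_cbnd; last first.
  by apply: integrableS Ip => //; exact: subset_itv_oc_cc.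
rewrite -Rintegral_itv_bndo_bndc; last first.
  by apply: integrableS Ip => //; exact: subset_itv_oo_cc.
apply: eq_Rintegral => x /set_mem /=; rewrite in_itv /= => /andP[h1 h2].
have x0 : 0 < x by apply: le_lt_trans h1; rewrite -(node0 n) node_le.
by rewrite /pw (element_of_eq n0 (cell_itv n0 en (ltW h1) h2 x0) (ltW h1) h2).
Qed.

Lemma telescope_nodes n (P : nat -> R -> R) : (0 < n)%N ->
  (forall e, (e.+1 < n)%N -> P e (node n e.+1) = P e.+1 (node n e.+1)) ->
  \sum_(e < n) (P e (node n e.+1) - P e (node n e)) = P n.-1 1 - P 0%N 0.
Proof.
move=> n0 h.
suff H k : (0 < k <= n)%N -> \sum_(e < k) (P e (node n e.+1) - P e (node n e)) =
    P k.-1 (node n k) - P 0%N 0.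
  by rewrite H ?n0 ?leqnn// node1.
elim: k => // -[_ _|k IH /andP[_ kn]]; first by rewrite big_ord_recr big_ord0 /= add0r node0.
by rewrite big_ord_recr [LHS]/= IH ?(ltnW kn)// (h k)//=; ring.
Qed.

Lemma pw_refine n m H x : (0 < n)%N -> (0 < m)%N -> O01 x ->
  pw (n * m) (fun e => H (e %/ m)%N) x = pw n H x.
Proof. by move=> n0 m0 Ox; rewrite /pw -element_of_refine. Qed.

(* A function on [0, 1] is encoded by one smooth function per cell of the uniform mesh with [n]
   cells; [pws0] says that these functions match at the nodes and vanish at both ends. *)
Record pws0 n F : Prop := Pws0 {
  pws0_n : (0 < n)%N;
  pws0_smooth : forall e, smooth1 (F e);
  pws0_match : forall e, (e.+1 < n)%N -> F e (node n e.+1) = F e.+1 (node n e.+1);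
  pws0_0 : F 0%N 0 = 0;
  pws0_1 : F n.-1 1 = 0 }.

Definition cderiv F : nat -> R -> R := fun e => derive1 (F e).
Definition cmul F G : nat -> R -> R := fun e x => F e x * G e x.
Definition bpw n F G := I01 (pw n (cmul F G)).
Definition apw n F G := bpw n (cderiv F) (cderiv G).

End piecewise.

(** * Spectral gap in one dimension *)

Section spectral1.
Context {R : realType}.
Local Notation O01 := (`]0%R, 1%R[%classic : set R).
Implicit Types (f g : R -> R) (n e : nat) (F G H : nat -> R -> R).

Lemma is_derive_affine (c b x : R) : is_derive x 1 (fun x : R => c * x + b) c.
Proof.
have h := is_deriveD (is_derive_scale c x) (is_derive_cst b x 1).
by apply: is_derive_eq h _; rewrite addr0.
Qed.

Lemma is_derive_cot (c b x : R) : sin (c * x + b) != 0 ->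
  is_derive x 1 (fun x : R => cos (c * x + b) / sin (c * x + b))
   (- c * (1 + (cos (c * x + b) / sin (c * x + b)) ^+ 2)).
Proof.
move=> s0.
have hc := @is_derive1_comp _ cos _ x _ _ (is_derive_cos _) (is_derive_affine c b x).
have hs := @is_derive1_comp _ sin _ x _ _ (is_derive_sin _) (is_derive_affine c b x).
have hv : is_derive x 1 (fun y => (sin (c * y + b))^-1)
    (- (sin (c * x + b)) ^- 2 *: (cos (c * x + b) * c)).
  exact: (is_deriveV (f := sin \o (fun x : R => c * x + b))).
have h := is_deriveM hc hv.
apply: is_derive_eq h _; rewrite /= /GRing.scale /=.
by field.
Qed.

Lemma smooth1_cderiv_continuous F : (forall e, smooth1 (F e)) -> forall e, continuous (cderiv F e).
Proof. by move=> h e; apply: smooth1_continuous; exact: smooth1_derive. Qed.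

Lemma bmeas_pwM n F G : (0 < n)%N -> (forall e, continuous (F e)) -> (forall e, continuous (G e)) ->
  bmeas O01 (pw n (cmul F G)).
Proof.
move=> n0 hF hG; apply: bmeas_pw => //; apply: ccont_continuous => e x.
by apply: cvgM; [exact: hF|exact: hG].
Qed.

(* Jacobi's trick: [f'^2 - c^2 f^2 = (f' - q f)^2 + (q f^2)'] for [q = c cot(c x + b)], which has
   no pole on an interval of length [1/m], as [c < pi m]. *)
Lemma jacobi m q F (c : R) : (0 < m)%N -> (0 < q)%N -> (forall e, smooth1 (F e)) ->
  (forall e, (e.+1 < m * q)%N -> F e (node (m * q) e.+1) = F e.+1 (node (m * q) e.+1)) ->
  (forall k, (k < m)%N -> F (k * q)%N (node (m * q) (k * q)) = 0) ->
  F (m * q).-1 1 = 0 -> 0 < c -> c < pi * m%:R ->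
  c ^+ 2 * bpw (m * q) F F <= apw (m * q) F F.
Proof.
move=> m0 q0 sF mF zF F1 c0 cpi.
set N := (m * q)%N in mF zF F1 *.
have N0 : (0 < N)%N by rewrite muln_gt0 m0.
have mr : 0 < m%:R :> R by rewrite ltr0n.
(* Centres the argument of the cotangent: over an interval of length [1 / m] it runs from [th] to
   [pi - th]. *)
pose th := (pi - c / m%:R) / 2.
have th0 : 0 < th by rewrite divr_gt0// subr_gt0 ltr_pdivrMr.
(* The phase is constant on each group of [q] consecutive cells, that is, between consecutive
   multiples of [1 / m]. *)
pose b e := th - c * ((e %/ q)%N%:R / m%:R).
pose ct e x := cos (c * x + b e) / sin (c * x + b e).
pose P e x := c * ct e x * (F e x * F e x).
pose p e x := - c ^+ 2 * (1 + ct e x ^+ 2) * F e x ^+ 2 + 2 * c * ct e x * F e x * cderiv F e x.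
have cF e : continuous (F e) by exact: smooth1_continuous.
have cdF := smooth1_cderiv_continuous sF.
have qr : 0 < q%:R :> R by rewrite ltr0n.
have nodeN k : node N (k * q) = k%:R / m%:R :> R.
  by rewrite /node /N !natrM; field; rewrite !gt_eqF.
have s0 e x : (e < N)%N -> node N e <= x <= node N e.+1 -> sin (c * x + b e) != 0.
  move=> eN /andP[x1 x2]; rewrite gt_eqF//; apply: sin_gt0_pi.
  have h1 : (e %/ q)%N%:R / m%:R <= x.
    by rewrite -nodeN; apply: le_trans x1; apply: node_le; exact: leq_divM.
  have h2 : x <= ((e %/ q)%N%:R + 1) / m%:R.
    rewrite natr1 -nodeN; apply: (le_trans x2); apply: node_le.
    exact: ltn_ceil.
  have -> : c * x + b e = th + c * (x - (e %/ q)%N%:R / m%:R) by rewrite /b; ring.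
  have h3 : 0 <= c * (x - (e %/ q)%N%:R / m%:R) by rewrite mulr_ge0 ?subr_ge0// ltW.
  have h4 : c * (x - (e %/ q)%N%:R / m%:R) <= c / m%:R.
    by rewrite ler_pM2l// lerBlDl (le_trans h2)// mulrDl mul1r.
  have h5 : pi = th + th + c / m%:R by rewrite /th; field; rewrite gt_eqF.
  apply/andP; split; lra.
have dct e x : (e < N)%N -> node N e <= x <= node N e.+1 ->
    is_derive x 1 (ct e) (- c * (1 + ct e x ^+ 2)).
  by move=> eN /(s0 _ _ eN) h; exact: is_derive_cot.
have dP e : (e < N)%N -> forall x : R, node N e <= x <= node N e.+1 -> is_derive x 1 (P e) (p e x).
  move=> eN x xe.
  have h := is_deriveM (is_deriveM (is_derive_cst c x 1) (dct e x eN xe))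
     (is_deriveM (smooth1_is_derive (sF e) x) (smooth1_is_derive (sF e) x)).
  apply: is_derive_eq h _; rewrite /= !fctE /GRing.scale /= /p /cderiv; set u := ct e x; set v := derive1 _ _; set w := F e x; ring.
have cp : ccont N p.
  move=> e eN; apply: continuous_in_subspaceT => x /set_mem /=; rewrite in_itv => xe.
  have cct : {for x, continuous (ct e)} by exact: (is_derive_continuous (dct e x eN xe)).
  apply: cvgD; apply: cvgM.
  - apply: cvgM; first exact: cvg_cst.
    by apply: cvgD; [exact: cvg_cst|rewrite expr2; apply: cvgM].
  - by rewrite expr2; apply: cvgM; exact: cF.
  - by apply: cvgM; [apply: cvgM; [exact: cvg_cst|]|exact: cF].
  - exact: cdF.
have I0 : I01 (pw N p) = 0.
  rewrite (I01_pw_FTC N0 cp dP) telescope_nodes//.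
    rewrite /P F1 -[X in F 0%N X](node0 N) -(mul0n q) zF//.
    by rewrite !mulr0 subrr.
  move=> e eN; rewrite /P mF//.
  (* At a multiple of [1 / m] the cotangent jumps but [F] vanishes; at the other nodes the phase
     does not change. *)
  have [qe|qe] := boolP (q %| e.+1)%N.
    have := zF (e.+1 %/ q)%N; rewrite divnK// => ->.
      by rewrite !mulr0.
    by rewrite ltn_divLR//.
  by rewrite /ct /b divnS// (negbTE qe) add0n.
rewrite -subr_ge0 -(I01Z _ (bmeas_pwM N0 cF cF)) -I01B; last 2 first.
- exact: bmeas_pwM.
- by apply: bmeasZ; exact: bmeas_pwM.
rewrite -I0; apply: le_I01.
- exact: bmeas_pw.
- by apply: bmeasB; [|apply: bmeasZ]; exact: bmeas_pwM.
move=> t _; rewrite /pw /cmul /p -subr_ge0.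
set e := element_of N t.
have -> : cderiv F e t * cderiv F e t - c ^+ 2 * (F e t * F e t) -
    (- c ^+ 2 * (1 + ct e t ^+ 2) * F e t ^+ 2 + 2 * c * ct e t * F e t * cderiv F e t) =
  (cderiv F e t - c * ct e t * F e t) ^+ 2 by ring.
exact: sqr_ge0.
Qed.

Definition freq (k : nat) : R := k.+1%:R * pi.
(** The null cosine term puts [phi] in the family of [is_derive_trig], which is closed under
    derivation; the factor [Num.sqrt 2] is the normalization in L^2. *)
Definition phi (k : nat) (x : R) : R := Num.sqrt 2 * sin (freq k * x) + 0 * cos (freq k * x).
Definition dphi (k : nat) (x : R) : R :=
  - (0 * freq k) * sin (freq k * x) + Num.sqrt 2 * freq k * cos (freq k * x).
Definition cphi (k : nat) : nat -> R -> R := fun=> phi k.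

Lemma smooth1_phi k : smooth1 (phi k). Proof. exact: smooth1_trig. Qed.

Lemma smooth1_dphi k : smooth1 (dphi k). Proof. exact: smooth1_trig. Qed.

Lemma is_derive_phi k (x : R) : is_derive x 1 (phi k) (dphi k x).
Proof. exact: is_derive_trig. Qed.

Lemma is_derive_dphi k (x : R) : is_derive x 1 (dphi k) (- freq k ^+ 2 * phi k x).
Proof.
have h := is_derive_trig (- (0 * freq k)) (Num.sqrt 2 * freq k) (freq k) x.
by apply: is_derive_eq h _; rewrite /phi; ring.
Qed.

Lemma derive1_phi k : derive1 (phi k) = dphi k.
Proof. by apply: derive1_is => x; exact: is_derive_phi. Qed.

Lemma sin_natpi k : sin (k%:R * pi) = 0 :> R.
Proof.
elim: k => [|k IH]; first by rewrite mul0r sin0.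
by rewrite -natr1 mulrDl mul1r sinDpi IH oppr0.
Qed.

Lemma phi0 k : phi k 0 = 0. Proof. by rewrite /phi mulr0 sin0 mulr0 mul0r addr0. Qed.

Lemma phi1 k : phi k 1 = 0.
Proof. by rewrite /phi mulr1 /freq sin_natpi mulr0 mul0r addr0. Qed.

Lemma freq_gt0 k : 0 < freq k. Proof. by rewrite mulr_gt0 ?ltr0n// pi_gt0. Qed.

Lemma freq_inj : injective freq.
Proof.
move=> i j /eqP; rewrite /freq -subr_eq0 -mulrBl mulf_eq0 [pi == 0]gt_eqF ?pi_gt0// orbF.
by rewrite subr_eq0 eqr_nat => /eqP[].
Qed.

Lemma pws0_phi n k : (0 < n)%N -> pws0 n (cphi k).
Proof.
by move=> n0; split=> // [e||]; [exact: smooth1_phi|exact: phi0|exact: phi1].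
Qed.

Lemma eq_bpw n n' F G F' G' : (forall x, O01 x -> pw n F x = pw n' F' x) ->
  (forall x, O01 x -> pw n G x = pw n' G' x) -> bpw n F G = bpw n' F' G'.
Proof. by move=> hF hG; apply: eq_I01 => t Ot; rewrite /pw /cmul; congr (_ * _); [exact: hF|exact: hG]. Qed.

(** The product of [F] and [dphi k] matches at the nodes and vanishes at both ends, so the integral
    of its derivative telescopes to zero. *)
Lemma apw_phi n F k : pws0 n F -> apw n F (cphi k) = freq k ^+ 2 * bpw n F (cphi k).
Proof.
move=> [n0 sF mF F0 F1].
have cF e : continuous (F e) by exact: smooth1_continuous.
have cdF := smooth1_cderiv_continuous sF.
have cph : continuous (phi k) := smooth1_continuous (smooth1_phi k).
have cdph : continuous (dphi k) := smooth1_continuous (smooth1_dphi k).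
pose P e x := F e x * dphi k x.
pose p e x := F e x * (- freq k ^+ 2 * phi k x) + dphi k x * cderiv F e x.
have dP e : (e < n)%N -> forall x : R, node n e <= x <= node n e.+1 -> is_derive x 1 (P e) (p e x).
  by move=> _ x _; apply: (is_deriveM (smooth1_is_derive (sF e) x) (is_derive_dphi k x)).
have cp : ccont n p.
  apply: ccont_continuous => e x; apply: cvgD; apply: cvgM.
  - exact: cF.
  - by apply: cvgM; [exact: cvg_cst|exact: cph].
  - exact: cdph.
  - exact: cdF.
have h : I01 (pw n p) = 0.
  rewrite (I01_pw_FTC n0 cp dP) telescope_nodes//; first by rewrite /P F0 F1 !mul0r subrr.
  by move=> e en; rewrite /P mF.
apply/eqP; rewrite -subr_eq0; apply/eqP; rewrite -h /apw /bpw.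
rewrite -I01Z; last exact: bmeas_pwM.
rewrite -I01B; last 2 first.
- by apply: bmeas_pwM => // e; rewrite /cderiv /cphi derive1_phi.
- by apply: bmeasZ; exact: bmeas_pwM.
apply: eq_I01 => t _; rewrite /pw /cmul /p {2}/cderiv /cphi derive1_phi; ring.
Qed.

Lemma bpwC n F G : bpw n F G = bpw n G F.
Proof. by apply: eq_I01 => t _; rewrite /pw /cmul mulrC. Qed.

Lemma bpw_cphi n k l : (0 < n)%N -> bpw n (cphi k) (cphi l) = I01 (fun t => phi k t * phi l t).
Proof. by []. Qed.

Lemma phi_orthonormal k l : I01 (fun t => phi k t * phi l t) = (k == l)%:R :> R.
Proof.
have [<-|kl] := eqVneq k l.
  pose w := freq k; have w0 : w != 0 by rewrite gt_eqF ?freq_gt0.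
  rewrite (@eq_I01 _ _ (fun t => 1 - cos (2 * w * t))); last first.
    move=> t _; rewrite /phi mul0r addr0 -/w mulrACA -!expr2 sqr_sqrtr ?ler0n// sin2cos2.
    have -> : 2 * w * t = (w * t) *+ 2 by rewrite mulr2n; ring.
    by rewrite cos_mulr2n mulr2n; ring.
  transitivity (1 + - (2 * w)^-1 * sin (2 * w * 1) - (0 + - (2 * w)^-1 * sin (2 * w * 0))); last first.
    by rewrite mulr1 mulr0 sin0 /w /freq mulrA -natrM sin_natpi !mulr0 !addr0 subr0.
  apply: (@I01_FTC _ (fun t => t + (- (2 * w)^-1 * sin (2 * w * t)))).
  - move=> x; have h := is_deriveD (is_derive_id x 1)
      (is_deriveM (is_derive_cst (- (2 * w)^-1) x 1) (is_derive_sinM (2 * w) x)).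
    by apply: is_derive_eq h _; rewrite /= /GRing.scale /= ; field.
  - move=> x; apply: cvgB; first exact: cvg_cst.
    exact: (is_derive_continuous (is_derive_cosM (2 * w) x)).
(* For different frequencies: the energy product is symmetric, so both eigenvalue relations apply to
   it. *)
have alg (a b A I : R) : 0 < a -> 0 < b -> a != b -> A = a ^+ 2 * I -> A = b ^+ 2 * I -> I = 0.
  move=> a0 b0 ab -> /eqP; rewrite -subr_eq0 -mulrBl mulf_eq0 subr_eq0 eqrXn2 ?ltW//.
  by rewrite (negbTE ab) => /eqP.
apply: (alg (freq l) (freq k) (apw 1 (cphi k) (cphi l))).
- exact: freq_gt0.
- exact: freq_gt0.
- by apply: contra kl => /eqP/freq_inj ->.
- exact: apw_phi (pws0_phi k (ltn0Sn 0)).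
- by rewrite -/(bpw 1 (cphi k) (cphi l)) (bpwC 1 (cphi k)) /apw bpwC; exact: apw_phi (pws0_phi l (ltn0Sn 0)).
Qed.

Definition lincell m (B : 'I_m -> nat -> R -> R) (a : 'I_m -> R) : nat -> R -> R :=
  fun e t => \sum_(i < m) a i * B i e t.

Lemma smooth1_lincell m (B : 'I_m -> nat -> R -> R) a e :
  (forall i, smooth1 (B i e)) -> smooth1 (lincell B a e).
Proof. by move=> h; apply: smooth1_sum => i _; apply: smooth1M => //; exact: smooth1_cst. Qed.

Lemma is_derive_sum m (f g : 'I_m -> R -> R) (x : R) :
  (forall i, is_derive x 1 (f i) (g i x)) ->
  is_derive x 1 (fun t => \sum_(i < m) f i t) (\sum_(i < m) g i x).
Proof.
elim: m f g => [|m IH] f g h.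
  by rewrite big_ord0; under eq_fun do rewrite big_ord0; exact: is_derive_cst.
rewrite big_ord_recr; under eq_fun do rewrite big_ord_recr.
by apply: is_deriveD => //; apply: (IH (fun i => f (widen_ord (leqnSn m) i)) (fun i => g (widen_ord (leqnSn m) i))).
Qed.

Lemma cderiv_lincell m (B : 'I_m -> nat -> R -> R) a : (forall i e, smooth1 (B i e)) ->
  cderiv (lincell B a) = lincell (fun i => cderiv (B i)) a.
Proof.
move=> h; apply/funext => e; apply: derive1_is => x.
apply: (@is_derive_sum _ _ (fun i t => a i * cderiv (B i) e t)) => i.
have h1 := is_deriveM (is_derive_cst (a i) x 1) (smooth1_is_derive (h i e) x).
by apply: is_derive_eq h1 _; rewrite /= scaler0 addr0.
Qed.

Lemma bpw_lincell n m (B : 'I_m -> nat -> R -> R) a b : (0 < n)%N ->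
  (forall i e, continuous (B i e)) ->
  bpw n (lincell B a) (lincell B b) =
  \sum_(i < m) \sum_(j < m) a i * b j * bpw n (B i) (B j).
Proof.
move=> n0 cB; rewrite /bpw.
transitivity (I01 (fun t => \sum_(i < m) \sum_(j < m)
    a i * b j * pw n (cmul (B i) (B j)) t)).
  apply: eq_I01 => t _; rewrite /pw /cmul /lincell big_distrl/=; apply: eq_bigr => i _.
  by rewrite big_distrr/=; apply: eq_bigr => j _; ring.
have bB i j : bmeas O01 (pw n (cmul (B i) (B j))) by exact: bmeas_pwM.
rewrite I01_sum; last by move=> i _; apply: bmeas_sum => j _; exact: bmeasZ.
apply: eq_bigr => i _; rewrite I01_sum; last by move=> j _; exact: bmeasZ.
by apply: eq_bigr => j _; rewrite I01Z.
Qed.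

Lemma apw_lincell n m (B : 'I_m -> nat -> R -> R) a b : (0 < n)%N ->
  (forall i e, smooth1 (B i e)) ->
  apw n (lincell B a) (lincell B b) =
  \sum_(i < m) \sum_(j < m) a i * b j * apw n (B i) (B j).
Proof.
move=> n0 sB; rewrite /apw !cderiv_lincell// bpw_lincell// => i.
exact: smooth1_cderiv_continuous.
Qed.

Lemma pws0_lincell n m (B : 'I_m -> nat -> R -> R) a : (0 < n)%N ->
  (forall i, pws0 n (B i)) -> pws0 n (lincell B a).
Proof.
move=> n0 h; split => //.
- by move=> e; apply: smooth1_lincell => i; exact: pws0_smooth (h i) e.
- by move=> e en; apply: eq_bigr => i _; rewrite (pws0_match (h i)).
- by rewrite /lincell big1// => i _; rewrite (pws0_0 (h i)) mulr0.
- by rewrite /lincell big1// => i _; rewrite (pws0_1 (h i)) mulr0.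
Qed.

(** The same function on a mesh with [m] times as many cells: [jacobi] needs a common refinement of
    the given mesh and of the grid of step [1 / (K + 1)]. *)
Definition crefine m F : nat -> R -> R := fun e => F (e %/ m)%N.

Lemma node_refine n m k : (0 < m)%N -> node (n * m) (k * m) = node n k :> R.
Proof. by move=> m0; rewrite /node !natrM -mulf_div divff ?mulr1// pnatr_eq0 -lt0n. Qed.

Lemma pws0_refine n m F : (0 < m)%N -> pws0 n F -> pws0 (n * m) (crefine m F).
Proof.
move=> m0 [n0 sF mF F0 F1]; have nm0 : (0 < n * m)%N by rewrite muln_gt0 n0.
split=> //.
- by move=> e; exact: sF.
- move=> e en; rewrite /crefine divnS//; have [qe|qe] := boolP (m %| e.+1)%N; last by rewrite add0n.
  have E : e.+1 = ((e %/ m).+1 * m)%N by rewrite -[LHS](divnK qe) divnS// qe add1n.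
  rewrite add1n [in node _ _]E node_refine// mF//.
  by move: en; rewrite E ltn_pmul2r.
- by rewrite /crefine div0n.
- rewrite /crefine; suff -> : ((n * m).-1 %/ m)%N = n.-1 by [].
  by rewrite -subn1 -[in LHS](prednK n0) mulSn addnC -addnBA// divnMDl// divn_small ?addn0// subn1 ltn_predL.
Qed.

Lemma bpw_refine n m F G : (0 < n)%N -> (0 < m)%N ->
  bpw (n * m) (crefine m F) (crefine m G) = bpw n F G.
Proof. by move=> n0 m0; apply: eq_bpw => x Ox; exact: pw_refine. Qed.

Lemma apw_refine n m F G : (0 < n)%N -> (0 < m)%N ->
  apw (n * m) (crefine m F) (crefine m G) = apw n F G.
Proof. by move=> n0 m0; exact: bpw_refine. Qed.

(** Quadratic form of [s F] minus a combination of sines when the block of the sines is diagonal; it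
    serves the mass and the energy alike. *)
Lemma gram_expand K (a : 'I_K.+1 -> R) (g : 'I_K.+1 -> 'I_K.+1 -> R)
    (s A : R) (x u v : 'I_K -> R) :
  a ord0 = s -> (forall j, a (lift ord0 j) = - x j) ->
  g ord0 ord0 = A -> (forall j, g ord0 (lift ord0 j) = u j) ->
  (forall j, g (lift ord0 j) ord0 = u j) ->
  (forall j k, g (lift ord0 j) (lift ord0 k) = (j == k)%:R * v j) ->
  \sum_(i < K.+1) \sum_(j < K.+1) a i * a j * g i j =
  s ^+ 2 * A - 2 * s * \sum_(j < K) x j * u j + \sum_(j < K) v j * x j ^+ 2.
Proof.
move=> a0 aS g00 g0S gS0 gSS; rewrite big_ord_recl big_ord_recl a0 g00.
rewrite (eq_bigr (fun j => - s * (x j * u j))); last first.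
  by move=> j _; rewrite aS g0S; ring.
rewrite [X in _ + X](eq_bigr (fun j => - s * (x j * u j) + v j * x j ^+ 2)); last first.
  move=> j _; rewrite big_ord_recl aS a0 gS0; congr (_ + _); first by ring.
  rewrite (bigD1 j)//= aS gSS eqxx big1 ?addr0; first by rewrite /=; ring.
  by move=> k kj; rewrite gSS eq_sym (negbTE kj) mul0r mulr0.
by rewrite big_split/= -!mulr_sumr; ring.
Qed.

Lemma apwC n F G : apw n F G = apw n G F.
Proof. exact: bpwC. Qed.

Opaque bpw apw phi freq.

Section projection.
Variables (K : nat).
Local Notation m := K.+1.
(** The midpoint between [K * pi] and [(K + 1) * pi]: it exceeds the first [K] frequencies, which
    makes the interpolation solvable, and stays strictly below the limit of [jacobi]. *)
Let c := (K%:R + 1/2) * pi : R.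

Let c0 : 0 < c. Proof. by rewrite mulr_gt0 ?pi_gt0// ltr_wpDl. Qed.

(** With [s = 1] this is a remainder of [F]; with [s = 0] it is a pure combination of sines, used to
    prove that interpolation by sines is solvable. *)
Definition phi_comb F (x : 'rV[R]_K) (s : R) : nat -> R -> R :=
  fun e t => s * F e t - \sum_(j < K) x ord0 j * phi j t.

Local Notation comb := phi_comb.

Let combE F (x : 'rV[R]_K) (s : R) : exists (B : 'I_K.+1 -> nat -> R -> R) (a : 'I_K.+1 -> R), [/\ B ord0 = F, forall j : 'I_K, B (lift ord0 j) = cphi j,
  a ord0 = s, forall j : 'I_K, a (lift ord0 j) = - x ord0 j & comb F x s = @lincell K.+1 B a].
Proof.
exists (fun i => if unlift ord0 i is Some j then cphi j else F).
exists (fun i => if unlift ord0 i is Some j then - x ord0 j else s).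
split=> [|j||j|]; rewrite ?unlift_none ?liftK//.
apply/funext => e; apply/funext => t; rewrite /phi_comb /lincell big_ord_recl unlift_none.
by congr (_ + _); rewrite -sumrN; apply: eq_bigr => j _; rewrite liftK mulNr.
Qed.

Let pB n F (B : 'I_K.+1 -> nat -> R -> R) : pws0 n F -> B ord0 = F ->
  (forall j : 'I_K, B (lift ord0 j) = cphi j) -> forall i, pws0 n (B i).
Proof.
move=> h B0 BS i; case: (unliftP ord0 i) => [j ->|->]; last by rewrite B0.
by rewrite BS; apply: pws0_phi; case: h.
Qed.

Lemma b_comb n F x s : pws0 n F ->
  bpw n (comb F x s) (comb F x s) =
  s ^+ 2 * bpw n F F - 2 * s * \sum_(j < K) x ord0 j * bpw n F (cphi j) +
  \sum_(j < K) 1 * x ord0 j ^+ 2.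
Proof.
move=> pF; have n0 := pws0_n pF; have [B [a [B0 BS a0 aS ->]]] := combE F x s.
rewrite bpw_lincell//; last first.
  by move=> i e; apply: smooth1_continuous; exact: pws0_smooth (pB pF B0 BS i) e.
apply: (gram_expand (a := a) (g := fun i j => bpw n (B i) (B j)) (s := s)
  (A := bpw n F F) (x := fun j => x ord0 j) (u := fun j => bpw n F (cphi j)) (v := fun=> 1)).
- exact: a0.
- exact: aS.
- by rewrite B0.
- by move=> j; rewrite B0 BS.
- by move=> j; rewrite B0 BS bpwC.
- by move=> j k; rewrite !BS bpw_cphi// phi_orthonormal mulr1.
Qed.

Lemma a_comb n F x s : pws0 n F ->
  apw n (comb F x s) (comb F x s) =
  s ^+ 2 * apw n F F - 2 * s * \sum_(j < K) x ord0 j * (freq j ^+ 2 * bpw n F (cphi j)) +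
   \sum_(j < K) freq j ^+ 2 * x ord0 j ^+ 2.
Proof.
move=> pF; have n0 := pws0_n pF; have [B [a [B0 BS a0 aS ->]]] := combE F x s.
rewrite apw_lincell//; last by move=> i e; exact: pws0_smooth (pB pF B0 BS i) e.
apply: (gram_expand (a := a) (g := fun i j => apw n (B i) (B j)) (s := s)
  (A := apw n F F) (x := fun j => x ord0 j) (u := fun j => freq j ^+ 2 * bpw n F (cphi j))
  (v := fun j => freq j ^+ 2)).
- exact: a0.
- exact: aS.
- by rewrite B0.
- by move=> j; rewrite B0 BS apw_phi.
- by move=> j; rewrite B0 BS apwC apw_phi.
- move=> j k; rewrite !BS apw_phi ?bpw_cphi ?phi_orthonormal//; last exact: pws0_phi.
  by rewrite mulrC -[LHS]/((j == k)%:R * _); have [->|_] := eqVneq j k; rewrite ?mul0r.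
Qed.

Lemma pcomb n F x s : pws0 n F -> pws0 n (comb F x s).
Proof.
move=> pF; have [B [a [B0 BS a0 aS ->]]] := combE F x s.
by apply: pws0_lincell; [exact: pws0_n pF|exact: pB pF B0 BS].
Qed.

(** The index [k.+1 * n %/ m] is the cell of the original mesh that contains the refined cell
    starting at [k.+1 / m]. *)
Let nodal n F (x : 'rV[R]_K) (s : R) : pws0 n F ->
  (forall k : 'I_K, s * F (k.+1 * n %/ m)%N (node m k.+1) = \sum_(j < K) x ord0 j * phi j (node m k.+1)) ->
  c ^+ 2 * bpw n (comb F x s) (comb F x s) <= apw n (comb F x s) (comb F x s).
Proof.
move=> pF h; have n0 := pws0_n pF; set v := comb F x s.
have pv := pws0_refine (ltn0Sn K) (pcomb x s pF).
rewrite -(bpw_refine _ _ n0 (ltn0Sn K)) -(apw_refine _ _ n0 (ltn0Sn K)).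
rewrite [(n * _)%N]mulnC in pv *.
apply: jacobi => //.
- by move=> e; exact: pws0_smooth pv e.
- exact: pws0_match pv.
- move=> [|k] km; first by rewrite mul0n node0; exact: pws0_0 pv.
  rewrite node_refine// /crefine /v /phi_comb.
  by have := h (Ordinal (km : (k < K)%N)) => /= ->; rewrite subrr.
- exact: pws0_1 pv.
- rewrite /c mulrC ltr_pM2l ?pi_gt0// -[m%:R]natr1 ltrD2l; lra.
Qed.

(* [jacobi] applies to [F] minus the combination of the first [K] sines that interpolates it at
   the nodes [k/(K+1)]; it also shows that this interpolation problem is solvable. *)
Lemma spectral_gap1 n F : pws0 n F ->
  bpw n F F - \sum_(j < K) bpw n F (cphi j) ^+ 2 <= apw n F F / c ^+ 2.
Proof.
move=> pF; have n0 := pws0_n pF.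
pose S : 'M[R]_K := \matrix_(j, k) phi j (node m k.+1).
have freqc j : (j < K)%N -> freq j ^+ 2 < c ^+ 2.
  move=> jK; rewrite ltrXn2r ?ltW ?freq_gt0// ltr_pM2r ?pi_gt0//.
  by apply: (@le_lt_trans _ _ K%:R); [rewrite ler_nat|lra].
(* A combination of sines vanishing at all the nodes would have energy at least [c ^+ 2] times its
   mass, while every [freq j] is less than [c]. *)
have Su : S \in unitmx.
  rewrite -row_free_unit -kermx_eq0; apply/eqP/row_matrixP => i; rewrite row0.
  set y := row i _.
  have yS : y *m S = 0 by apply/sub_kermxP; rewrite row_sub.
  have h := @nodal n F y 0 pF _.
  have {}h : c ^+ 2 * \sum_(j < K) 1 * y ord0 j ^+ 2 <= \sum_(j < K) freq j ^+ 2 * y ord0 j ^+ 2.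
    have := h _; rewrite b_comb// a_comb// expr0n !mulr0 !mul0r subrr !add0r; apply => k.
    have /rowP/(_ k) := yS; rewrite mxE [RHS]mxE => e; rewrite mul0r -[LHS]e.
    by apply: eq_bigr => j _; rewrite !mxE.
  apply/rowP => j; rewrite [RHS]mxE; apply/eqP; rewrite -sqrf_eq0; apply/eqP.
  have h2 : \sum_(j < K) (c ^+ 2 - freq j ^+ 2) * y ord0 j ^+ 2 <= 0.
    rewrite (eq_bigr (fun j => c ^+ 2 * (1 * y ord0 j ^+ 2) - freq j ^+ 2 * y ord0 j ^+ 2)).
      by rewrite sumrB -mulr_sumr subr_le0.
    by move=> k _; ring.
  have h3 (k : 'I_K) : true -> 0 <= (c ^+ 2 - freq k ^+ 2) * y ord0 k ^+ 2.
    by move=> _; rewrite mulr_ge0 ?sqr_ge0// subr_ge0 ltW// freqc.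
  have /eqP h4 : \sum_(j < K) (c ^+ 2 - freq j ^+ 2) * y ord0 j ^+ 2 == 0.
    by rewrite eq_le h2 sumr_ge0.
  have /(_ j isT)/eqP := psumr_eq0P h3 h4.
  by rewrite mulf_eq0 gt_eqF ?subr_gt0 ?freqc//= => /eqP.
pose g : 'rV[R]_K := \row_k F (k.+1 * n %/ m)%N (node m k.+1).
pose x := g *m invmx S.
have xS : x *m S = g by rewrite mulmxKV.
have := @nodal n F x 1 pF _; rewrite b_comb// a_comb// expr1n !mul1r !mulr1.
set b := bpw n F F; set a := apw n F F; pose u j := bpw n F (cphi j).
move=> h; have {}h : c ^+ 2 * (b - 2 * \sum_(j < K) x ord0 j * u j + \sum_(j < K) 1 * x ord0 j ^+ 2) <=
    a - 2 * \sum_(j < K) x ord0 j * (freq j ^+ 2 * u j) + \sum_(j < K) freq j ^+ 2 * x ord0 j ^+ 2.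
  apply: h => k; have /rowP/(_ k) := xS; rewrite mxE [RHS]mxE => <-; rewrite ?mul1r.
  by apply: eq_bigr => j _; rewrite !mxE.
rewrite ler_pdivlMr ?exprn_gt0// mulrC.
(* Passing from the interpolation coefficients [x] to the Fourier coefficients [u] leaves a term in
   [x - u], with weight [c ^+ 2] on the left and the smaller [freq j ^+ 2] on the right. *)
have e1 : b - 2 * \sum_(j < K) x ord0 j * u j + \sum_(j < K) 1 * x ord0 j ^+ 2 =
    (b - \sum_(j < K) u j ^+ 2) + \sum_(j < K) (x ord0 j - u j) ^+ 2.
  rewrite mulr_sumr -!sumrN -!addrA; congr (_ + _); rewrite -!big_split/=.
  by apply: eq_bigr => j _; ring.
have e2 : a - 2 * \sum_(j < K) x ord0 j * (freq j ^+ 2 * u j) + \sum_(j < K) freq j ^+ 2 * x ord0 j ^+ 2 =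
    a - \sum_(j < K) (freq j * u j) ^+ 2 + \sum_(j < K) freq j ^+ 2 * (x ord0 j - u j) ^+ 2.
  rewrite mulr_sumr -!sumrN -!addrA; congr (_ + _); rewrite -!big_split/=.
  by apply: eq_bigr => j _; ring.
have e3 : 0 <= \sum_(j < K) (freq j * u j) ^+ 2 by apply: sumr_ge0 => j _; exact: sqr_ge0.
have e4 : \sum_(j < K) freq j ^+ 2 * (x ord0 j - u j) ^+ 2 <= c ^+ 2 * \sum_(j < K) (x ord0 j - u j) ^+ 2.
  by rewrite mulr_sumr; apply: ler_sum => j _; rewrite ler_wpM2r ?sqr_ge0// ltW// freqc.
rewrite e1 e2 mulrDr in h; lra.
Qed.

End projection.

Lemma bessel_energy K n F : pws0 n F ->
  \sum_(j < K) freq j ^+ 2 * bpw n F (cphi j) ^+ 2 <= apw n F F.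
Proof.
move=> pF; have h : 0 <= apw n (phi_comb F (\row_(j < K) bpw n F (cphi j)) 1)
    (phi_comb F (\row_(j < K) bpw n F (cphi j)) 1).
  by apply: I01_ge0 => t _; rewrite /pw /cmul -expr2 sqr_ge0.
move: h; rewrite a_comb// expr1n mul1r mulr1 => h; rewrite -subr_ge0; apply: le_trans h _.
rewrite le_eqVlt; apply/orP; left; apply/eqP; rewrite mulr_sumr -addrA -sumrN -sumrN -big_split/=; congr (_ + _).
by apply: eq_bigr => j _; rewrite mxE; ring.
Qed.

Lemma bessel_l2 K n F : pws0 n F ->
  \sum_(j < K) bpw n F (cphi j) ^+ 2 <= bpw n F F.
Proof.
move=> pF; have h : 0 <= bpw n (phi_comb F (\row_(j < K) bpw n F (cphi j)) 1)
    (phi_comb F (\row_(j < K) bpw n F (cphi j)) 1).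
  by apply: I01_ge0 => t _; rewrite /pw /cmul -expr2 sqr_ge0.
move: h; rewrite b_comb// expr1n mul1r mulr1 => h; rewrite -subr_ge0; apply: le_trans h _.
rewrite le_eqVlt; apply/orP; left; apply/eqP; rewrite mulr_sumr -addrA -sumrN -sumrN -big_split/=; congr (_ + _).
by apply: eq_bigr => j _; rewrite mxE; ring.
Qed.

Lemma residual_l2 K n F : pws0 n F ->
  let v := phi_comb F (\row_(j < K) bpw n F (cphi j)) 1 in
  [/\ pws0 n v, bpw n v v <= apw n F F / ((K%:R + 1/2) * pi) ^+ 2 & apw n v v <= apw n F F].
Proof.
move=> pF v; split; first exact: pcomb.
- apply: le_trans (spectral_gap1 K pF); rewrite b_comb// expr1n mul1r mulr1.
  rewrite le_eqVlt; apply/orP; left; apply/eqP.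
  rewrite mulr_sumr -addrA -sumrN -sumrN -big_split/=; congr (_ + _).
  by apply: eq_bigr => j _; rewrite mxE; ring.
- rewrite a_comb// expr1n mul1r mulr1 -addrA gerDl.
  rewrite addrC subr_le0 mulr_sumr; apply: ler_sum => j _; rewrite mxE.
  have : 0 <= freq j ^+ 2 * bpw n F (cphi j) ^+ 2 by rewrite mulr_ge0 ?sqr_ge0.
  set a := freq j; set b := bpw _ _ _; have -> : 2 * (b * (a ^+ 2 * b)) = a ^+ 2 * b ^+ 2 + a ^+ 2 * b ^+ 2 by ring.
  by rewrite lerDl.
Qed.

End spectral1.

(** * Completeness of the sines *)

Section completeness1.
Context {R : realType}.
Local Notation mu := (@lebesgue_measure R).
Local Notation O01 := (`]0%R, 1%R[%classic : set R).
Implicit Types (f g : R -> R) (n e : nat) (F G H : nat -> R -> R).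

Lemma integrable_bmeasM d (T : measurableType d) (m : {measure set T -> \bar R})
    (D : set T) (f g : T -> R) : measurable D ->
  m.-integrable D (EFin \o f) -> bmeas D g ->
  m.-integrable D (EFin \o (fun x => f x * g x)).
Proof.
move=> mD If [mg [M hM]].
have mf : measurable_fun D f by apply/measurable_EFinP; exact: measurable_int If.
apply: (le_integrable mD _ _ (integrableZl mD M If)).
  by apply/measurable_EFinP; exact: measurable_funM.
move=> x Dx /=; rewrite lee_fin !normrM mulrC ler_wpM2r//.
exact: le_trans (hM x Dx) (ler_norm _).
Qed.

Lemma I01_integrableM (f g : R -> R) :
  mu.-integrable O01 (EFin \o f) -> bmeas O01 g ->
  mu.-integrable O01 (EFin \o (fun x => f x * g x)).
Proof.
move=> If [mg [M hM]].
have mf : measurable_fun O01 f by apply/measurable_EFinP; exact: measurable_int If.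
apply: (le_integrable _ _ _ (integrableZl _ M If)) => //.
  by apply/measurable_EFinP; exact: measurable_funM.
move=> x Dx /=; rewrite lee_fin !normrM mulrC ler_wpM2r//.
exact: le_trans (hM x Dx) (ler_norm _).
Qed.

Lemma I01_integrableZ (c : R) (f : R -> R) :
  mu.-integrable O01 (EFin \o f) -> mu.-integrable O01 (EFin \o (fun x => c * f x)).
Proof.
move=> If; have := I01_integrableM If (@bmeas_cst _ _ _ O01 c).
by apply: eq_integrable => // x _; rewrite /= mulrC.
Qed.

(** The derivative of [F ^+ 2] is [2 F F'], at most [t F' ^+ 2 + F ^+ 2 / t]; it is integrated from
    0 cell by cell because [F'] may jump. *)
Lemma sup_bound n F (t x : R) : pws0 n F -> 0 < t -> O01 x ->
  pw n F x ^+ 2 <= t * apw n F F + t^-1 * bpw n F F.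
Proof.
move=> [n0 sF mF F0 F1] t0 Ox.
have cF e : continuous (F e) by exact: smooth1_continuous.
have cdF := smooth1_cderiv_continuous sF.
pose q e y := 2 * (F e y * cderiv F e y).
pose g e y := t * (cderiv F e y * cderiv F e y) + t^-1 * (F e y * F e y).
have cq e : continuous (q e).
  by move=> y; apply: cvgM; [exact: cvg_cst|apply: cvgM; [exact: cF|exact: cdF]].
have cg e : continuous (g e).
  by move=> y; apply: cvgD; apply: cvgM; (try exact: cvg_cst); apply: cvgM; try exact: cdF; exact: cF.
have dq e (y : R) : is_derive y 1 (fun y => F e y * F e y) (q e y).
  have h := is_deriveM (smooth1_is_derive (sF e) y) (smooth1_is_derive (sF e) y).
  by apply: is_derive_eq h _; rewrite /q /cderiv /GRing.scale /=; ring.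
have qg e y : q e y <= g e y.
  rewrite -subr_ge0 /q /g; set a := F e y; set b := cderiv F e y.
  have -> : t * (b * b) + t^-1 * (a * a) - 2 * (a * b) = t^-1 * (t * b - a) ^+ 2.
    by field; rewrite gt_eqF.
  by rewrite mulr_ge0 ?sqr_ge0// invr_ge0 ltW.
have g0 e y : 0 <= g e y.
  by rewrite /g addr_ge0// mulr_ge0 ?invr_ge0 ?(ltW t0)// -expr2 sqr_ge0.
have -> : t * apw n F F + t^-1 * bpw n F F = I01 (pw n g).
  have h1 : bmeas O01 (pw n (cmul (cderiv F) (cderiv F))) by exact: bmeas_pwM.
  have h2 : bmeas O01 (pw n (cmul F F)) by exact: bmeas_pwM.
  by rewrite -[apw n F F]/(I01 _) -[bpw n F F]/(I01 _) -!I01Z// -I01D//; exact: bmeasZ.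
rewrite (I01_cells n0); last by apply: bmeas_pw => //; exact: ccont_continuous.
have cell e : (e < n)%N ->
    \int[mu]_(y in `]node n e, node n e.+1[) pw n g y = \int[mu]_(y in `[node n e, node n e.+1]) g e y.
  move=> en; have Ip : mu.-integrable `[node n e, node n e.+1] (EFin \o g e).
    by apply: continuous_compact_integrable; [exact: segment_compact|exact: continuous_subspaceT].
  rewrite -Rintegral_itv_obnd_cbnd; last first.
    by apply: integrableS Ip => //; exact: subset_itv_oc_cc.
  rewrite -Rintegral_itv_bndo_bndc; last first.
    by apply: integrableS Ip => //; exact: subset_itv_oo_cc.
  apply: eq_Rintegral => y /set_mem /=; rewrite in_itv /= => /andP[h1 h2].
  have y0 : 0 < y by apply: le_lt_trans h1; rewrite -(node0 n) node_le.
  by rewrite /pw (element_of_eq n0 (cell_itv n0 en (ltW h1) h2 y0) (ltW h1) h2).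
have sub e a b : a <= b -> F e b * F e b - F e a * F e a <= \int[mu]_(y in `[a, b]) g e y.
  move=> ab; rewrite -(@FTC_segment _ (fun y => F e y * F e y) (q e))//.
  apply: le_Rintegral => //; apply: continuous_compact_integrable;
    by [exact: segment_compact|exact: continuous_subspaceT].
have [h1 h2 h3] := element_of_node n0 Ox; set e := element_of n x in h1 h2 h3 *.
have step k : (k < n)%N -> F k (node n k) * F k (node n k) <=
    \sum_(i < k) \int[mu]_(y in `]node n i, node n i.+1[) pw n g y.
  elim: k => [_|k IH kn]; first by rewrite node0 F0 mul0r big_ord0.
  rewrite big_ord_recr/= cell ?(ltnW kn)// -mF//.
  have := IH (ltnW kn); have := sub k (node n k) (node n k.+1) (node_le n (leqnSn k)).
  lra.
apply: (@le_trans _ _ (\sum_(i < e.+1) \int[mu]_(y in `]node n i, node n i.+1[) pw n g y)).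
  rewrite big_ord_recr/= cell//; have := step e h1.
  have h4 : F e x * F e x - F e (node n e) * F e (node n e) <=
      \int[mu]_(y in `[node n e, node n e.+1]) g e y.
    apply: (le_trans (sub e _ _ h2)).
    have Ic a b : mu.-integrable `[a, b] (EFin \o g e).
      by apply: continuous_compact_integrable; [exact: segment_compact|exact: continuous_subspaceT].
    rewrite -subr_ge0 Rintegral_itvB ?bnd_simp//; last exact: ltW.
    exact: Rintegral_ge0.
  rewrite /pw -/e expr2; lra.
rewrite -(big_mkord xpredT (fun i => \int[mu]_(y in `]node n i, node n i.+1[) pw n g y)).
rewrite -[leRHS](big_mkord xpredT (fun i => \int[mu]_(y in `]node n i, node n i.+1[) pw n g y)).
rewrite (@big_cat_nat _ _ _ e.+1 0 n)//= lerDl; apply: sumr_ge0 => i _.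
by apply: Rintegral_ge0 => y _; exact: g0.
Qed.

Lemma half_freq_ge K : K.+1%:R <= (K%:R + 1/2) * pi :> R.
Proof.
have K0 : 0 <= K%:R :> R by [].
rewrite -natr1; apply: (@le_trans _ _ ((K%:R + 1/2) * 2)); first by lra.
by rewrite ler_wpM2l ?pi_ge2// addr_ge0.
Qed.

Lemma half_in01 : O01 (1/2).
Proof. rewrite /= in_itv /=; apply/andP; split; lra. Qed.

Section L1.
Variable f : R -> R.
Hypothesis If : mu.-integrable O01 (EFin \o f).
Hypothesis fphi : forall k, I01 (fun t => f t * phi k t) = 0.

Let Iabs : mu.-integrable O01 (EFin \o (fun t => `|f t|)).
Proof. by have := integrable_abse If; apply: eq_integrable. Qed.

(* The sine expansion of a continuous piecewise smooth function converges uniformly. *)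
Lemma L1_phi_pws0 n F : pws0 n F -> I01 (fun t => f t * pw n F t) = 0.
Proof.
move=> pF; have n0 := pws0_n pF.
have cF e : continuous (F e) by apply: smooth1_continuous; exact: pws0_smooth pF e.
have bF : bmeas O01 (pw n F) by apply: bmeas_pw => //; exact: ccont_continuous.
have bphi k : bmeas O01 (phi k).
  by apply: bmeas_continuous; exact: smooth1_continuous (smooth1_phi k).
pose A := I01 (fun t => `|f t|).
have A0 : 0 <= A by exact: I01_ge0.
set I := I01 _.
(* A bound of order [1 / (K + 1)] for every [K] forces [I = 0], by the Archimedean property. *)
suff h K : I ^+ 2 <= (A ^+ 2 * (2 * apw n F F)) * K.+1%:R^-1.
  have h0 : 0 <= A ^+ 2 * (2 * apw n F F).
    have := h 0; rewrite invr1 mulr1; apply: le_trans; exact: sqr_ge0.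
  apply/eqP; rewrite -sqrf_eq0 eq_le sqr_ge0 andbT leNgt; apply/negP => I0.
  set B := A ^+ 2 * _ in h h0.
  have B0 : 0 < B by have := h 0; rewrite invr1 mulr1; apply: lt_le_trans.
  have := h (Num.truncn (B / I ^+ 2)); rewrite leNgt ltr_pdivrMr ?ltr0n// => /negP; apply.
  rewrite mulrC -ltr_pdivrMr//; exact: truncnS_gt.
pose c := (K%:R + 1/2) * pi : R.
have [pv bv av] := residual_l2 K pF; set v := phi_comb _ _ _ in pv bv av.
have cv e : continuous (v e) by apply: smooth1_continuous; exact: pws0_smooth pv e.
have bmv : bmeas O01 (pw n v) by apply: bmeas_pw => //; exact: ccont_continuous.
have IE : I = I01 (fun t => f t * pw n v t).
  pose S t := \sum_(j < K) bpw n F (cphi j) * phi j t.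
  have bS k : bmeas O01 (fun t => \sum_(j < k) bpw n F (cphi j) * phi j t).
    by apply: bmeas_sum => j _; exact: bmeasZ.
  have IS : I01 (fun t => f t * S t) = 0.
    rewrite /S; elim: {+}K => [|k IHk].
      rewrite (@eq_I01 _ _ (cst 0)) ?I01_cst// => t _; first by rewrite big_ord0 mulr0.
    rewrite (@eq_I01 _ _ (fun t => f t * (\sum_(j < k) bpw n F (cphi j) * phi j t) +
        bpw n F (cphi k) * (f t * phi k t))); last first.
      by move=> t _; rewrite big_ord_recr/=; ring.
    have I1 := I01_integrableM If (bphi k).
    rewrite /I01 RintegralD//; last 2 first.
    - by apply: I01_integrableM => //; exact: bS.
    - exact: I01_integrableZ.
    by rewrite RintegralZl// -/(I01 _) IHk -/(I01 _) fphi mulr0 addr0.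
  have -> : I01 (fun t => f t * pw n v t) = I01 (fun t => f t * pw n F t - f t * S t).
    apply: eq_I01 => t _; rewrite /v /phi_comb /pw mul1r mulrBr; congr (_ - _ * _).
    by apply: eq_bigr => j _; rewrite mxE.
  rewrite /I01 RintegralB//=; last 2 first.
  - exact: I01_integrableM.
  - by apply: I01_integrableM => //; exact: bS.
  by rewrite -/(I01 (fun t => f t * S t)) IS subr0.
have c0 : 0 < c by rewrite mulr_gt0 ?pi_gt0// ltr_wpDl.
have cK : K.+1%:R <= c.
  exact: half_freq_ge.
have vsup t : O01 t -> `|pw n v t| ^+ 2 <= 2 * apw n F F / K.+1%:R.
  move=> Ot; rewrite real_normK ?num_real//.
  (* The choice [t = 1 / c] balances the two terms of [sup_bound]: the bound of the mass of the
     remainder is smaller than that of its energy by the factor [c ^+ 2]. *)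
  have ci : 0 < c^-1 by rewrite invr_gt0.
  apply: (le_trans (sup_bound pv ci Ot)); rewrite invrK.
  have h1 : c^-1 * apw n v v <= c^-1 * apw n F F by rewrite ler_pM2l.
  have h2 : c * bpw n v v <= c^-1 * apw n F F.
    have : c * bpw n v v <= c * (apw n F F / c ^+ 2) by rewrite ler_pM2l.
    by have -> : c * (apw n F F / c ^+ 2) = c^-1 * apw n F F by field; rewrite gt_eqF.
  have h3 : c^-1 * apw n F F <= K.+1%:R^-1 * apw n F F.
    apply: ler_wpM2r; last by rewrite lef_pV2 ?posrE.
    by apply: I01_ge0 => s _; rewrite /pw /cmul -expr2 sqr_ge0.
  apply: (le_trans (lerD (le_trans h1 h3) (le_trans h2 h3))); rewrite le_eqVlt; apply/orP; left; apply/eqP; ring.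
have a0 : 0 <= 2 * apw n F F / K.+1%:R.
  by apply: le_trans (vsup (1/2) _); [exact: sqr_ge0|exact: half_in01].
have IA : `|I| <= A * Num.sqrt (2 * apw n F F / K.+1%:R).
  have Ifv := I01_integrableM If bmv.
  rewrite IE; apply: (le_trans (le_normr_Rintegral _ Ifv)) => //.
  rewrite /A /I01 -RintegralZr//; apply: le_Rintegral => //.
  - by have := integrable_abse Ifv; apply: eq_integrable.
  - have := I01_integrableZ (Num.sqrt (2 * apw n F F / K.+1%:R)) Iabs.
    by apply: eq_integrable => // t _; rewrite /= mulrC.
  move=> t Ot; rewrite normrM ler_wpM2l//.
  by rewrite -[leLHS]sqrtr_sqr ler_wsqrtr// -[X in X <= _]real_normK ?num_real// vsup.
have : `|I| ^+ 2 <= (A * Num.sqrt (2 * apw n F F / K.+1%:R)) ^+ 2.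
  by rewrite lerXn2r ?nnegrE// mulr_ge0 ?sqrtr_ge0.
by rewrite real_normK ?num_real// exprMn sqr_sqrtr// [A ^+ 2 * (_ / _)]mulrA.
Qed.

(** Slope, and below it constant term, on each cell, of the piecewise linear hat function of node
    [i]; hats are the localized test functions of [L1_complete1]. *)
Definition hat_slope n i e : R := if e.+1 == i then n%:R else if e == i then - n%:R else 0.
Definition hat_cst i e : R := if e.+1 == i then - e%:R else if e == i then e.+1%:R else 0.
Definition hat n i : nat -> R -> R := fun e x => hat_slope n i e * x + hat_cst i e.

Lemma pws0_hat n i : (0 < i < n)%N -> pws0 n (hat n i).
Proof.
move=> /andP[i0 i_n]; have n0 : (0 < n)%N := leq_trans i0 (ltnW i_n).
have nr : n%:R != 0 :> R by rewrite pnatr_eq0 -lt0n.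
have nodeM e : n%:R * node n e = e%:R :> R by rewrite /node mulrC divfK.
split => //.
- move=> e k; apply: nderivableD; last exact: smooth1_cst.
  apply: nderivableM; first exact: smooth1_cst.
  move: k; have := smooth1_horner ('X : {poly R}); under eq_fun do rewrite hornerX; exact.
- move=> e en; rewrite /hat /hat_slope /hat_cst.
  have [ei|ei] := eqVneq e.+1 i.
    rewrite (_ : e.+2 == i = false); last by rewrite -ei; apply/negbTE/eqP; lia.
    by rewrite mulNr !nodeM -[e.+2%:R]natr1 -natr1; ring.
  have [ei'|ei'] := eqVneq e i.
    rewrite (_ : e.+2 == i = false); last by rewrite -ei'; apply/negbTE/eqP; lia.
    by rewrite mulNr nodeM mul0r addr0 addNr.
  case: eqP => // _; first by rewrite nodeM mul0r addr0 subrr.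
- by rewrite /hat /hat_slope /hat_cst mulr0 add0r; case: eqP => _; [rewrite oppr0|case: eqP => // e; rewrite -e in i0].
- rewrite /hat /hat_slope /hat_cst prednK// (_ : n == i = false); last by apply/negbTE; rewrite neq_ltn i_n orbT.
  by rewrite mulr1 ; case: eqP => _; rewrite ?addr0 ?addNr.
Qed.

Lemma hat_itv n i x : (0 < n)%N -> O01 x -> 0 <= pw n (hat n i) x <= 1.
Proof.
move=> n0 Ox; have [_ h1 h2] := element_of_node n0 Ox; rewrite /pw; set e := element_of _ _ in h1 h2 *.
have nr : 0 < n%:R :> R by rewrite ltr0n.
move: h1 h2; rewrite /node ler_pdivrMr// ltr_pdivlMr// -natr1 mulrC => h1 h2.
rewrite /hat /hat_slope /hat_cst -natr1; case: ifP => _; last case: ifP => _; apply/andP; split; lra.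
Qed.

Lemma hat_support n i x : (0 < n)%N -> O01 x -> pw n (hat n i) x != 0 ->
  (element_of n x == i) || ((element_of n x).+1 == i).
Proof.
move=> n0 Ox; rewrite /pw /hat /hat_slope /hat_cst.
by case: (_.+1 == i) => //=; case: (_ == i) => //=; rewrite ?orbT// mul0r addr0 eqxx.
Qed.

Lemma hat_integral n i : (0 < i < n)%N -> I01 (pw n (hat n i)) = n%:R^-1.
Proof.
move=> /andP[i0 i_n]; have n0 : (0 < n)%N := leq_trans i0 (ltnW i_n).
have ph : pws0 n (hat n i) by apply: pws0_hat; rewrite i0.
have nr : n%:R != 0 :> R by rewrite pnatr_eq0 -lt0n.
pose P e x := hat_slope n i e / 2 * (x * x) + hat_cst i e * x.
have -> : I01 (pw n (hat n i)) = \sum_(e < n) (P e (node n e.+1) - P e (node n e)).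
  apply: I01_pw_FTC => //.
    by apply: ccont_continuous => e; apply: smooth1_continuous; exact: pws0_smooth ph e.
  move=> e en x _; have h := is_deriveD
    (is_deriveM (is_derive_cst (hat_slope n i e / 2) x 1)
       (is_deriveM (is_derive_id x 1) (is_derive_id x 1)))
    (is_deriveM (is_derive_cst (hat_cst i e) x 1) (is_derive_id x 1)).
  apply: is_derive_eq h _; rewrite /= !fctE /GRing.scale /= /hat; by field.
have i1 : (i.-1 < n)%N by apply: leq_ltn_trans i_n; exact: leq_pred.
rewrite (bigD1 (Ordinal i1))//= (bigD1 (Ordinal i_n))/=; last first.
  by apply/eqP => -[]; move: i0; case: (i) => // k _ /=; lia.
rewrite big1 ?addr0; last first.
  move=> [e en] /= /andP[/eqP/eqP h1 h2].
  have e1 : e.+1 == i = false.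
    by apply/eqP => h; move/eqP: h1; apply; apply: val_inj => /=; rewrite -h.
  have e2 : e == i = false.
    by apply/eqP => h; move/eqP: h2; apply; apply: val_inj => /=.
  by rewrite /P /hat_slope /hat_cst e1 e2 !mul0r !addr0 subrr.
rewrite /P /hat_slope /hat_cst prednK// eqxx (_ : i.+1 == i = false) ?eqxx; last first.
  by apply/negbTE; rewrite neq_ltn ltnSn orbT.
rewrite /node; case: (i) i0 => // k _ /=.
by rewrite -!natr1; field.
Qed.

(** As [f] is orthogonal to the hats, [|f x| / n] equals in modulus the integral of [f - f x]
    against a hat near [x]. This is at most the integral of [|f - f x|] over a ball of radius
    [2 / n], which is of smaller order than [1 / n] at a Lebesgue point. *)
Lemma L1_complete1 : {ae mu, forall x, O01 x -> f x = 0}.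
Proof.
pose F := f \_ O01.
have IF : mu.-integrable setT (EFin \o F).
  by rewrite /F -restrict_EFin; apply/(integrable_mkcond _ _).1.
have locF : locally_integrable setT F.
  by apply: open_integrable_locally => //; exact: openT.
have := lebesgue_differentiation locF; apply: filterS; first exact: (ae_filter_ringOfSetsType mu).
move=> x xF Ox.
have FO y : O01 y -> F y = f y by move=> Oy; rewrite /F patchE mem_set.
apply/eqP; rewrite -normr_eq0 eq_le normr_ge0 andbT; apply/ler_addgt0Pr => eps eps0.
rewrite add0r.
(* The ball of radius [2 / n] has measure [4 / n], whence the division by 4. *)
have e4 : 0 < eps / 4 by rewrite divr_gt0.
have [/= Ff Fc] := (fine_cvgP _ _).1 xF.
have hc : \forall r \near 0^'+, `|0 - fine (davg F x r)| < eps / 4.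
  by move/cvgrPdist_lt : Fc; apply.
have [d /= d0 hd0] := filterI Ff hc.
have hdav r : 0 < r -> r < d -> (davg F x r < (eps / 4)%:E)%E.
  move=> r0 rd; have [] := hd0 r _ r0; first by rewrite /= sub0r normrN gtr0_norm.
  move=> h1; rewrite sub0r normrN ger0_norm ?fine_ge0 ?davg_ge0// => h2.
  by rewrite -(fineK h1) lte_fin.
have [x0 x1] : 0 < x /\ x < 1 by move: Ox; rewrite /= in_itv => /andP[].
(* Large enough for the average over the ball of radius [2 / n] to be small, and for [x] to lie
   beyond the first cell, so that the node [i] is interior. *)
pose n0 := (maxn (Num.truncn (2 / d)) (Num.truncn x^-1).+1)%N; set n := n0.+1.
have hd : (davg F x (2 / n%:R) < (eps / 4)%:E)%E.
  apply: hdav; first by rewrite divr_gt0// ltr0n.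
  rewrite ltr_pdivrMr ?ltr0n// mulrC -ltr_pdivrMr//.
  apply: (lt_le_trans (truncnS_gt _)); rewrite ler_nat ltnS; exact: leq_maxl.
have n_gt0 : (0 < n)%N by [].
have nr : 0 < n%:R :> R by rewrite ltr0n.
pose i := element_of n x.
have [i_n hi1 hi2] := element_of_node n_gt0 Ox.
have i0 : (0 < i)%N.
  rewrite lt0n; apply/eqP => e0; rewrite -/i e0 /node in hi2.
  move: hi2; rewrite ltNge => /negP; apply.
  rewrite mul1r invf_ple ?posrE//; apply: (le_trans (ltW (truncnS_gt _))).
  by rewrite ler_nat /n /n0 leqW// leq_maxr.
have hin : (0 < i < n)%N by rewrite i0.
have ph := pws0_hat hin.
have ch e : continuous (hat n i e) by apply: smooth1_continuous; exact: pws0_smooth ph e.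
have bh : bmeas O01 (pw n (hat n i)) by apply: bmeas_pw => //; exact: ccont_continuous.
have Ic : mu.-integrable O01 (EFin \o cst (f x)) by apply: bmeas_I01_integrable; exact: bmeas_cst.
have Id : mu.-integrable O01 (EFin \o (fun y => f y - f x)).
  by have := @integrableB _ _ _ mu O01 (measurable_itv _) _ _ If Ic; apply: eq_integrable.
have Ig := I01_integrableM Id bh.
have key : `|f x| / n%:R = `|I01 (fun y => (f y - f x) * pw n (hat n i) y)|.
  rewrite (@eq_I01 _ _ (fun y => f y * pw n (hat n i) y - f x * pw n (hat n i) y)); last first.
    by move=> y _; rewrite mulrBl.
  rewrite /I01 RintegralB//; last 2 first.
  - exact: I01_integrableM.
  - by apply: bmeas_I01_integrable; exact: bmeasZ.
  rewrite -/(I01 _) -/(I01 _) L1_phi_pws0// I01Z// hat_integral// sub0r normrN normrM.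
  by rewrite (@ger0_norm _ n%:R^-1)// invr_ge0.
have key2 : ((`|f x| / n%:R)%:E <= \int[mu]_(y in ball x (2 / n%:R)) `|(F y - F x)%:E|)%E.
  rewrite key /I01 EFin_normr_Rintegral//.
  apply: (le_trans (le_abse_integral _ _ _)) => //; first by apply: measurable_int Ig.
  have mB : measurable (ball x (2 / n%:R) : set R) by exact: measurable_ball.
  rewrite integral_mkcond [leRHS]integral_mkcond; apply: ge0_le_integral => //.
  - by move=> y _; apply: erestrict_ge0 => z _; exact: abse_ge0.
  - apply/(measurable_restrictT _ _).1 => //.
    by apply: measurableT_comp => //; apply: measurable_int Ig.
  - apply/(measurable_restrictT _ _).1 => //.
    apply: measurable_funTS; apply: measurableT_comp => //; apply/measurable_EFinP.
    apply: measurable_funB => //; apply/measurable_EFinP; exact: measurable_int IF.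
  move=> y _; rewrite !patchE; case: ifPn => [/set_mem Oy|_]; last first.
    by case: ifPn => //= _; rewrite lee_fin.
  have /andP[h0 h1] := hat_itv i n_gt0 Oy.
  have [->|h2] := eqVneq (pw n (hat n i) y) 0.
    by rewrite mulr0 abse0; case: ifPn => //= _; rewrite lee_fin.
  rewrite mem_set; last first.
    have [_ hy1 hy2] := element_of_node n_gt0 Oy.
    have hn e : node n e.+1 = node n e + n%:R^-1 :> R by rewrite /node -natr1 mulrDl mul1r.
    have ni : 0 < n%:R^-1 :> R by rewrite invr_gt0.
    rewrite /ball /= ltr_norml; move: hi1 hi2; rewrite -/i => hi1 hi2.
    case/orP: (hat_support n_gt0 Oy h2) => /eqP hs.
      by rewrite hs in hy1 hy2; rewrite hn in hy2 hi2; apply/andP; split; lra.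
    by rewrite -hs !hn in hi1 hi2; rewrite hn in hy2; apply/andP; split; lra.
  rewrite /= lee_fin !FO// normrM ler_piMr// ger0_norm//.
have r0 : 0 <= 2 / n%:R :> R by rewrite divr_ge0.
rewrite /davg /iavg lebesgue_measure_ball// in hd.
move: hd; have -> : (2 / n%:R) *+ 2 = 4 / n%:R :> R by rewrite mulr2n; field; rewrite gt_eqF.
rewrite inver gt_eqF ?divr_gt0//.
rewrite lte_pdivrMl ?divr_gt0// => hd.
have := le_lt_trans key2 hd; rewrite -EFinM lte_fin ltr_pdivrMr//.
by have -> : 4 / n%:R * (eps / 4) * n%:R = eps by [field; rewrite gt_eqF|]; exact: ltW.
Qed.

End L1.
End completeness1.

(** * Completeness of the sine products on the cube *)

Section cube.
Context {R : realType}.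
Local Notation mu := (@lebesgue_measure R).
Local Notation O01 := (`]0%R, 1%R[%classic : set R).
Local Notation Om := (@Omega R _).
#[local] Hint Extern 0 (measurable _) => solve [exact: measurable_Omega] : core.

Lemma cube_integrable_abs n (f : 'rV[R]_n -> R) :
  cube_integrable f -> cube_integrable (fun x => `|f x|).
Proof. by move=> If; have := integrable_abse If; apply: eq_integrable. Qed.

Lemma cube_integrable_measurable n (f : 'rV[R]_n -> R) :
  cube_integrable f -> measurable_fun Om f.
Proof. by move=> If; apply/measurable_EFinP => //; exact: measurable_int If. Qed.

Lemma cube_abs0 n (f : 'rV[R]_n -> R) : cube_integrable f ->
  cube_integral (fun x => `|f x|) = 0 <-> {ae lebesgue_rV n, forall x, Om x -> f x = 0}.
Proof.
move=> If; have mf := measurable_int _ If.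
have h := ae_eq_integral_abs (lebesgue_rV n) (@measurable_Omega R n) mf.
have IA := integrable_fin_num (@measurable_Omega R n) (cube_integrable_abs If).
split=> [h0|h0].
  have /h.1 : (\int[lebesgue_rV n]_(x in Om) `|(EFin \o f) x| = 0)%E.
    by rewrite -[0%E]/(0%:E) -h0 /cube_integral /Rintegral fineK.
  by apply: filterS => x /= h1 Ox; have := h1 Ox => -[].
rewrite /cube_integral /Rintegral.
have -> : (\int[lebesgue_rV n]_(x in Om) (`|f x|)%:E = 0)%E by
  apply/h; apply: filterS h0 => x /= h1 Ox; rewrite h1.
by [].
Qed.

Lemma ae_cube_integral n (f g : 'rV[R]_n -> R) :
  measurable_fun Om f -> measurable_fun Om g ->
  {ae lebesgue_rV n, forall x, Om x -> f x = g x} -> cube_integral f = cube_integral g.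
Proof.
move=> mf mg fg; congr fine; apply: ae_eq_integral => //; try exact/measurable_EFinP.
by apply: filterS fg => x /= h Ox; rewrite h.
Qed.

Lemma bmeas_phi k : bmeas O01 (@phi R k).
Proof. by apply: bmeas_continuous; exact: smooth1_continuous (smooth1_phi k). Qed.

Definition tphi n (al : 'I_n -> nat) : 'rV[R]_n -> R := tens (fun k => phi (al k)).

Lemma bmeas_tphi n (al : 'I_n -> nat) : bmeas Om (tphi al).
Proof. by apply: bmeas_tens => k; exact: bmeas_phi. Qed.

(** Induction on the dimension: each sine coefficient in the first variable is orthogonal to all
    sine products in the other ones, hence vanishes almost everywhere; as there are countably many,
    the one-dimensional result applies on almost every line. *)
Lemma cube_complete n (f : 'rV[R]_n -> R) : cube_integrable f ->
  (forall al, cube_integral (fun x => f x * tphi al x) = 0) ->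
  cube_integral (fun x => `|f x|) = 0.
Proof.
elim: n f => [|n IH] f If fphi.
  have e (x : 'rV[R]_0) : x = 0 by apply/rowP => -[].
  have := fphi (fun=> 0%N); rewrite /cube_integral.
  rewrite (@eq_Rintegral _ _ _ _ _ (cst (f 0))); last first.
    by move=> x _; rewrite /tphi /tens big_ord0 mulr1 (e x).
  rewrite Rintegral_cst// => h.
  rewrite (@eq_Rintegral _ _ _ _ _ (cst `|f 0|)); last by move=> x _; rewrite (e x).
  rewrite Rintegral_cst//; move/eqP: h; rewrite mulf_eq0 => /orP[/eqP->|/eqP->].
    by rewrite normr0 mul0r.
  by rewrite mulr0.
pose F k (x : 'rV[R]_n) := I01 (fun t => f (rV_cons (t, x)) * phi k t).
have bphi0 k : bmeas Om (fun x : 'rV[R]_n.+1 => phi k (x ord0 ord0)).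
  exact: bmeas_coord (bmeas_phi k).
have Ifk k : cube_integrable (fun x => f x * phi k (x ord0 ord0)).
  exact: integrable_bmeasM.
have FE k : F k = fun x => I01 (fun t => f (rV_cons (t, x)) * phi k (rV_cons (t, x) ord0 ord0)).
  by apply/funext => x; apply: eq_I01 => t _; rewrite rV_cons0.
have IF k : cube_integrable (F k) by rewrite FE; exact: (fubini_slice (Ifk k)).1.
have F0 k : {ae lebesgue_rV n, forall x, Om x -> F k x = 0}.
  apply/(cube_abs0 (IF k)); apply: IH => // al.
  pose be (i : 'I_n.+1) := if unlift ord0 i is Some j then al j else k.
  have Ib : cube_integrable (fun x => f x * tphi be x).
    by apply: integrable_bmeasM => //; exact: bmeas_tphi.
  suff <- : cube_integral (fun x => f x * tphi be x) = cube_integral (fun x => F k x * tphi al x).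
    exact: fphi.
  have [h1 ->] := fubini_slice Ib.
  apply: ae_cube_integral; first exact: cube_integrable_measurable.
    exact: (cube_integrable_measurable (integrable_bmeasM (@measurable_Omega R n) (IF k) (bmeas_tphi al))).
  have := ae_slice_integrable (Ifk k); apply: filterS => x /= h Ox.
  rewrite FE -[RHS]RintegralZr//; last exact: h.
  apply: eq_Rintegral => t _; rewrite -mulrA; congr (_ * _).
  rewrite /tphi /tens big_ord_recl /be unlift_none rV_cons0; congr (_ * _).
  by apply: eq_bigr => j _; rewrite liftK rV_consS.
have IA := cube_integrable_abs If.
have [I1 ->] := fubini_slice IA.
rewrite (@ae_cube_integral _ _ (cst 0)).
- by rewrite /cube_integral Rintegral_cst// mul0r.
- exact: cube_integrable_measurable.
- exact: measurable_cst.
have h1 := ae_slice_integrable If.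
have h2 : {ae lebesgue_rV n, forall x, forall k, Om x -> F k x = 0}.
  exact: ae_foralln.
move: h1 h2; apply: filterS2 => x h1 h2 Ox.
have hx := L1_complete1 (h1 Ox) (fun k => h2 k Ox).
have mf := measurable_int _ (h1 Ox).
rewrite /I01 /Rintegral.
have h := @ae_eq_integral_abs _ _ _ mu O01 (measurable_itv _) _ mf.
have [_ h'] := h; rewrite -[RHS]/(fine 0%E); congr fine; apply: h'.
case: hx => A [mA A0 hA]; exists A; split => // t ht; apply: hA.
by move: ht; apply: contra_not => /= hh Ot; rewrite hh.
Qed.

Lemma cvg_rV n (T : Type) (FF : set_system T) (FF_ : Filter FF) (f : T -> 'rV[R]_n) (x : 'rV[R]_n) :
  (forall k, (fun t => f t ord0 k) @ FF --> x ord0 k) -> f @ FF --> x.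
Proof.
move=> h A [P /= hP PA]; rewrite /nbhs /=.
have h1 : forall i : 'I_1 * 'I_n, \forall t \near FF, P i.1 i.2 (f t i.1 i.2).
  move=> [i k] /=; have -> : i = ord0 by apply: val_inj; case: (i) => -[].
  by apply: (h k); exact: hP.
have : \forall t \near FF, forall i : 'I_1 * 'I_n, P i.1 i.2 (f t i.1 i.2).
  exact: filter_forall.
by apply: filterS => t ht; apply: PA => i j; exact: (ht (i, j)).
Qed.

Lemma continuous_upd n (x : 'rV[R]_n) k : continuous (upd x k).
Proof.
move=> t; apply: cvg_rV => i; rewrite mxE; under eq_fun do rewrite mxE.
by case: (i == k); [exact: cvg_id|exact: cvg_cst].
Qed.

Lemma continuous_coord n (k : 'I_n) : continuous (fun x : 'rV[R]_n => x ord0 k).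
Proof. exact: coord_continuous. Qed.

Lemma bmeas_continuous_rV n (F : 'rV[R]_n -> R) : continuous F -> bmeas Om F.
Proof.
move=> cF; split; first by apply: measurable_funTS; exact: continuous_rV_measurable.
pose K := [set v : 'rV[R]_n | forall i, (`[0, 1]%classic : set R) (v ord0 i)].
have /compact_bounded : compact (F @` K).
  apply: continuous_compact; first exact: continuous_subspaceT.
  by apply: (@rV_compact R n (fun=> (`[0, 1]%classic : set R))) => i; exact: segment_compact.
move=> [M [_ hM]]; exists (M + 1) => x Ox; apply: (hM (M + 1)); first by rewrite ltrDl.
exists x => // i; rewrite /= in_itv /=; have := Ox i.
by move=> /andP[/ltW -> /ltW ->].
Qed.

Lemma is_derive_upd n (F : 'rV[R]_n -> R) (k : 'I_n) x (t : R) :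
  (forall y, derivable F y (delta_mx ord0 k)) ->
  is_derive t 1 (fun s => F (upd x k s)) (partial k F (upd x k t)).
Proof.
move=> dF.
have e : (fun h : R => h^-1 *: (((fun s => F (upd x k s)) \o shift t) (h *: 1) - F (upd x k t))) =
   (fun h : R => h^-1 *: ((F \o shift (upd x k t)) (h *: delta_mx ord0 k) - F (upd x k t))).
  apply/funext => h /=; congr (_ *: (F _ - _)); apply/rowP => i; rewrite !mxE eqxx /=.
  by case: (i == k); rewrite ?mulr1 ?mulr0 ?add0r //= /GRing.scale /= mulr1.
split.
  by rewrite /derivable e; exact: dF.
by rewrite /derive e.
Qed.

End cube.

(** * Weak gradients *)

Section H1.
Context {R : realType} (n : nat).
Local Notation Om := (@Omega R _).
#[local] Hint Extern 0 (measurable _) => solve [exact: measurable_Omega] : core.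
Implicit Types (u v w : 'rV[R]_n -> R).

Lemma bformE u v : bform u v = cube_integral (fun x => u x * v x). Proof. by []. Qed.

Lemma L2_integrableM u v : L2 u -> L2 v -> cube_integrable (fun x => u x * v x).
Proof.
move=> [mu_ Iu] [mv Iv].
have := integrableD (@measurable_Omega R n) Iu Iv; apply: le_integrable => //.
  by apply/measurable_EFinP => //; exact: measurable_funM.
move=> x Ox /=; rewrite lee_fin; apply: le_trans (ler_norm _).
have := sqr_ge0 (`|u x| - `|v x|); rewrite sqrrB !real_normK ?num_real// normrM.
have := mulr_ge0 (normr_ge0 (u x)) (normr_ge0 (v x)).
set a := `|u x| * `|v x|; set b := u x ^+ 2; set c := v x ^+ 2; rewrite mulr2n; lra.
Qed.

Lemma L2D u v : L2 u -> L2 v -> L2 (fun x => u x + v x).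
Proof.
move=> Lu Lv; split; first by apply: measurable_funD; [case: Lu|case: Lv].
have I1 := Lu.2; have I2 := Lv.2; have I3 := integrableZl (@measurable_Omega R n) 2 (L2_integrableM Lu Lv).
have := integrableD (@measurable_Omega R n) (integrableD (@measurable_Omega R n) I1 I2) I3.
apply: eq_integrable => // x _; rewrite /= -?EFinM -?EFinD; congr (_%:E); ring.
Qed.

Lemma L2Z c u : L2 u -> L2 (fun x => c * u x).
Proof.
move=> Lu; split; first by apply: measurable_funM; [exact: measurable_cst|case: Lu].
have := integrableZl (@measurable_Omega R n) (c ^+ 2) Lu.2.
by apply: eq_integrable => // x _; rewrite /= -EFinM exprMn.
Qed.

Lemma bmeas_L2 u : bmeas Om u -> L2 u.
Proof.
move=> bu; split; first by case: bu.
by apply: bmeas_cube_integrable; under eq_fun do rewrite expr2; exact: bmeasM.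
Qed.

Lemma L2B u v : L2 u -> L2 v -> L2 (fun x => u x - v x).
Proof.
move=> Lu Lv; have := L2D Lu (L2Z (-1) Lv).
by under eq_fun do rewrite mulN1r.
Qed.

Lemma L2_sum I (r : seq I) (F : I -> 'rV[R]_n -> R) :
  (forall i, L2 (F i)) -> L2 (fun x => \sum_(i <- r) F i x).
Proof.
move=> h; elim: r => [|i r IH].
  by under eq_fun do rewrite big_nil; apply: bmeas_L2; exact: bmeas_cst.
by under eq_fun do rewrite big_cons; exact: L2D.
Qed.

Lemma L2_integrable u : L2 u -> cube_integrable u.
Proof.
move=> Lu; have := L2_integrableM Lu (bmeas_L2 (@bmeas_cst R _ _ Om 1)).
by apply: eq_integrable => // x _; rewrite /= mulr1.
Qed.

Lemma bformC u v : bform u v = bform v u.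
Proof. by apply: eq_Rintegral => x _; rewrite mulrC. Qed.

Lemma bformDl u v w : L2 u -> L2 v -> L2 w ->
  bform (fun x => u x + v x) w = bform u w + bform v w.
Proof.
move=> Lu Lv Lw; rewrite /bform -RintegralD//; try exact: L2_integrableM.
by apply: eq_Rintegral => x _; rewrite mulrDl.
Qed.

Lemma bformZl c u w : L2 u -> L2 w -> bform (fun x => c * u x) w = c * bform u w.
Proof.
move=> Lu Lw; rewrite /bform -RintegralZl//; last exact: L2_integrableM.
by apply: eq_Rintegral => x _; rewrite mulrA.
Qed.

Lemma bformBl u v w : L2 u -> L2 v -> L2 w ->
  bform (fun x => u x - v x) w = bform u w - bform v w.
Proof.
move=> Lu Lv Lw; rewrite -mulN1r -bformZl// -bformDl//; last exact: L2Z.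
by apply: eq_Rintegral => x _; rewrite mulN1r.
Qed.

Lemma bform_suml I (r : seq I) (F : I -> 'rV[R]_n -> R) w : (forall i, L2 (F i)) -> L2 w ->
  bform (fun x => \sum_(i <- r) F i x) w = \sum_(i <- r) bform (F i) w.
Proof.
move=> h Lw; elim: r => [|i r IH].
  rewrite big_nil /bform (@eq_Rintegral _ _ _ _ _ (cst 0)) ?Rintegral_cst ?mul0r//.
  by move=> x _; rewrite big_nil mul0r.
rewrite big_cons -IH -bformDl//; last exact: L2_sum.
by apply: eq_Rintegral => x _; rewrite big_cons.
Qed.

Lemma bform_ge0 u : 0 <= bform u u.
Proof. by apply: Rintegral_ge0 => x _; rewrite -expr2 sqr_ge0. Qed.

Lemma bform_quad u v t : L2 u -> L2 v ->
  bform (fun x => u x + t * v x) (fun x => u x + t * v x) =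
  bform u u + 2 * t * bform u v + t ^+ 2 * bform v v.
Proof.
move=> Lu Lv; have Ltv := L2Z t Lv; have Lw := L2D Lu Ltv.
rewrite bformDl// ![bform _ (fun x => u x + t * v x)]bformC !bformDl// !bformZl//.
rewrite ![bform _ (fun x => t * v x)]bformC !bformZl// (bformC v u); ring.
Qed.

Lemma bform_CS u v : L2 u -> L2 v -> bform u v ^+ 2 <= bform u u * bform v v.
Proof.
by move=> Lu Lv; apply: discriminant => [|t]; rewrite -?bform_quad//; exact: bform_ge0.
Qed.

Lemma bform_cvg (p : nat -> 'rV[R]_n -> R) u th :
  (forall m, L2 (p m)) -> L2 u -> L2 th ->
  bform (p m \- u) (p m \- u) @[m --> \oo] --> (0 : R) ->
  bform (p m) th @[m --> \oo] --> bform u th.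
Proof.
move=> Lp Lu Lth h; apply/cvgrPdist_le => e e0.
have h1 : bform (p m \- u) (p m \- u) * bform th th @[m --> \oo] --> (0 * bform th th : R).
  by apply: cvgM h _; exact: cvg_cst.
rewrite mul0r in h1; move/cvgrPdist_le : h1 => /(_ (e ^+ 2)).
rewrite exprn_gt0// => /(_ isT); apply: filterS => m; rewrite sub0r normrN => hm.
rewrite -(@ler_pXn2r _ 2)// ?nnegrE ?(ltW e0)// real_normK ?num_real//.
rewrite -sqrrN opprB -bformBl//.
apply: le_trans (bform_CS (L2B (Lp m) Lu) Lth) _.
exact: le_trans (ler_norm _) hm.
Qed.

Lemma test_continuous (phi : 'rV[R]_n -> R) : test_function phi -> continuous phi.
Proof. by move=> [/(_ [::])[]]. Qed.

Lemma test_L2 (phi : 'rV[R]_n -> R) : test_function phi -> L2 phi.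
Proof. by move=> /test_continuous h; apply: bmeas_L2; exact: bmeas_continuous_rV. Qed.

Lemma test_partial_continuous (phi : 'rV[R]_n -> R) k :
  test_function phi -> continuous (partial k phi).
Proof. by move=> [/(_ [:: k])[]]. Qed.

Lemma test_partial_L2 (phi : 'rV[R]_n -> R) k : test_function phi -> L2 (partial k phi).
Proof. by move=> /(@test_partial_continuous _ k) h; apply: bmeas_L2; exact: bmeas_continuous_rV. Qed.

Definition repl (k : 'I_n) (f df : 'I_n -> R -> R) : 'I_n -> R -> R :=
  fun i => if i == k then df i else f i.

Lemma tens_upd (f : 'I_n -> R -> R) x k s :
  tens f (upd x k s) = f k s * \prod_(i < n | i != k) f i (x ord0 i).
Proof.
rewrite /tens (bigD1 k)//= mxE eqxx; congr (_ * _).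
by apply: eq_bigr => i /negbTE ik; rewrite mxE ik.
Qed.

Lemma tens_repl_upd (f df : 'I_n -> R -> R) x k s :
  tens (repl k f df) (upd x k s) = df k s * \prod_(i < n | i != k) f i (x ord0 i).
Proof.
rewrite tens_upd /repl eqxx; congr (_ * _).
by apply: eq_bigr => i /negbTE ik; rewrite ik.
Qed.

(** The boundary terms vanish through the test function, so the factors [f i] are free at the
    boundary; this admits cosines. *)
Lemma test_ibp (phi : 'rV[R]_n -> R) (f df : 'I_n -> R -> R) k : test_function phi ->
  (forall i (x : R), is_derive x 1 (f i) (df i x)) -> (forall i, continuous (df i)) ->
  bform (partial k phi) (tens f) = - bform phi (tens (repl k f df)).
Proof.
move=> tphi dfi cdf.
have cf i : continuous (f i) by move=> x; exact: is_derive_continuous (dfi i x).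
have b1 : bmeas Om (tens f) by apply: bmeas_tens => i; exact: bmeas_continuous.
have b2 : bmeas Om (tens (repl k f df)).
  by apply: bmeas_tens => i; rewrite /repl; case: ifP => _; exact: bmeas_continuous.
have b3 := bmeas_continuous_rV (test_continuous tphi).
have b4 := bmeas_continuous_rV (@test_partial_continuous _ k tphi).
apply/eqP; rewrite -subr_eq0 opprK; apply/eqP.
rewrite !bformE /cube_integral -RintegralD//; try by apply: bmeas_cube_integrable; exact: bmeasM.
apply: (@cube_integral_derive _ _ k (fun x => phi x * tens f x)).
- by apply: bmeasD; exact: bmeasM.
- move=> x t.
  under eq_fun do rewrite tens_upd.
  rewrite tens_upd tens_repl_upd; set C := \prod_(_ < _ | _) _.
  have d1 : is_derive t 1 (fun s => phi (upd x k s)) (partial k phi (upd x k t)).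
    by apply: is_derive_upd => y; have [/(_ [::])[_ ]] := tphi.
  have h := is_deriveM d1 (is_deriveM (dfi k t) (is_derive_cst C t 1)).
  apply: is_derive_eq h _; rewrite /= !fctE /GRing.scale /=; ring.
- move=> x t.
  under eq_fun do rewrite tens_upd tens_repl_upd.
  have c1 : continuous (partial k phi \o upd x k).
    by move=> s; apply: continuous_comp; [exact: continuous_upd|exact: test_partial_continuous].
  have c2 : continuous (phi \o upd x k).
    by move=> s; apply: continuous_comp; [exact: continuous_upd|exact: test_continuous].
  rewrite ?tens_upd ?tens_repl_upd; set C := \prod_(_ < _ | _) _.
  apply: cvgD; apply: cvgM.
  + exact: c1.
  + by apply: cvgM; [exact: cf|exact: cvg_cst].
  + exact: c2.
  + by apply: cvgM; [exact: cdf|exact: cvg_cst].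
- move=> x; have [_ [K [_ KO K0]]] := tphi.
  by split; rewrite K0 ?mul0r// => /KO /(_ k); rewrite mxE eqxx ltxx ?andbF.
Qed.

Lemma gradient_ibp u g (f df : 'I_n -> R -> R) k : H01_gradient u g ->
  (forall i (x : R), is_derive x 1 (f i) (df i x)) -> (forall i, continuous (df i)) ->
  bform (g k) (tens f) = - bform u (tens (repl k f df)).
Proof.
move=> [Lu Lg [p [tp hp hg]]] dfi cdf.
have cf i : continuous (f i) by move=> x; exact: is_derive_continuous (dfi i x).
have L1 : L2 (tens f) by apply: bmeas_L2; apply: bmeas_tens => i; exact: bmeas_continuous.
have L3 : L2 (tens (repl k f df)).
  by apply: bmeas_L2; apply: bmeas_tens => i; rewrite /repl; case: ifP => _; exact: bmeas_continuous.
have c1 := bform_cvg (fun m => @test_partial_L2 _ k (tp m)) (Lg k) L1 (hg k).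
have c2 := bform_cvg (fun m => test_L2 (tp m)) Lu L3 hp.
have c3 : bform (partial k (p m)) (tens f) @[m --> \oo] --> - bform u (tens (repl k f df)).
  under eq_fun do rewrite (test_ibp k (tp _) dfi cdf).
  exact: cvgN c2.
exact: (cvg_unique _ c1 c3).
Qed.

(** Integration by parts expresses the coefficients of either gradient on the sine products by [u]
    alone, and the sine products are complete. *)
Lemma gradient_unique u g g' : H01_gradient u g -> H01_gradient u g' ->
  forall k, {ae lebesgue_rV n, forall x, Om x -> g k x = g' k x}.
Proof.
move=> hg hg' k; have Lg : L2 (g k) by case: hg. have Lg' : L2 (g' k) by case: hg'.
have I := L2_integrable (L2B Lg Lg').
suff /(cube_abs0 I).1 : cube_integral (fun x => `|g k x - g' k x|) = 0.
  by apply: filterS => x h Ox; apply/eqP; rewrite -subr_eq0; apply/eqP; exact: h.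
apply: cube_complete => // al.
have L1 : L2 (@tphi R n al) by apply: bmeas_L2; exact: bmeas_tphi.
have dphi_ i (x : R) := is_derive_phi (al i) x.
have cdphi i : continuous (@dphi R (al i)) := smooth1_continuous (smooth1_dphi (al i)).
transitivity (bform (fun x => g k x - g' k x) (tphi al)); first by [].
rewrite bformBl//; apply/eqP; rewrite subr_eq0; apply/eqP.
by rewrite (gradient_ibp k hg dphi_ cdphi) (gradient_ibp k hg' dphi_ cdphi).
Qed.

Lemma ae_bform u v w : L2 u -> L2 v -> L2 w ->
  {ae lebesgue_rV n, forall x, Om x -> u x = v x} -> bform u w = bform v w.
Proof.
move=> Lu Lv Lw h; apply: ae_cube_integral.
- by apply: measurable_funM; [case: Lu|case: Lw].
- by apply: measurable_funM; [case: Lv|case: Lw].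
- by apply: filterS h => x h Ox; rewrite h.
Qed.

Lemma grad_gradient u : H01 u -> H01_gradient u (grad u).
Proof. move=> [g hg]; rewrite /grad; exact: (@xgetPex _ _ (H01_gradient u) (ex_intro _ g hg)). Qed.

(** [grad] is a choice among almost everywhere equal gradients; this frees the form from that
    choice. *)
Lemma aformE u v g h : H01_gradient u g -> H01_gradient v h ->
  aform u v = \sum_(k < n) bform (g k) (h k).
Proof.
move=> hu hv; have gu := grad_gradient (ex_intro _ _ hu); have gv := grad_gradient (ex_intro _ _ hv).
apply: eq_bigr => k _.
have L1 : L2 (g k) by case: hu. have L2' : L2 (h k) by case: hv.
have L3 : L2 (grad u k) by case: gu. have L4 : L2 (grad v k) by case: gv.
rewrite (ae_bform L3 L1 L4 (gradient_unique gu hu k)) bformC.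
by rewrite (ae_bform L4 L2' L1 (gradient_unique gv hv k)) bformC.
Qed.

End H1.

(** * B-splines *)

Section bsplines.
Context {R : realType}.
Variables (p n : nat).
Hypothesis n0 : (0 < n)%N.
Local Notation T := (@knot R p n).
Local Notation piece := (@bspline_piece R p n).

Let nR : (0 : R) < n%:R. Proof. by rewrite ltr0n. Qed.

Lemma knot_mono i j : (i <= j)%N -> T i <= T j.
Proof. by move=> ij; rewrite /knot ler_pM2r ?invr_gt0// ler_nat; lia. Qed.

Lemma knot_elt e : (e <= n)%N -> T (e + p) = e%:R / n%:R.
Proof. by move=> h; rewrite /knot; congr (_%:R / _); lia. Qed.

Lemma knot_low i : (i <= p)%N -> T i = 0.
Proof. by move=> h; rewrite /knot (_ : minn _ _ = 0%N) ?mul0r//; lia. Qed.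

Lemma knot_high i : (n + p <= i)%N -> T i = 1.
Proof. by move=> h; rewrite /knot (_ : minn _ _ = n) ?divff ?gt_eqF//; lia. Qed.

Lemma knot_step i j : (i <= j)%N -> T j != T i -> n%:R^-1 <= T j - T i.
Proof.
rewrite /knot => ij; set a := minn _ _; set b := minn _ _ => h.
have ab : (b.+1 <= a)%N.
  have : a != b by apply: contra_neq h => ->.
  by rewrite /a /b; lia.
rewrite -mulrBl -[leLHS]mul1r ler_wpM2r ?invr_ge0 ?(ltW nR)//.
by rewrite lerBrDl natr1 ler_nat.
Qed.

Lemma knot_inv_le i j : (i <= j)%N -> 0 <= (T j - T i)^-1 <= n%:R.
Proof.
move=> ij; rewrite invr_ge0 subr_ge0 knot_mono//=.
have [->|h] := eqVneq (T j) (T i); first by rewrite subrr invr0 ltW.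
have h1 := knot_step ij h.
by rewrite -[leRHS]invrK lef_pV2// posrE ?invr_gt0//; apply: lt_le_trans h1; rewrite invr_gt0.
Qed.

Lemma pieceS e q i :
  piece e q.+1 i = (T (i + q.+1) - T i)^-1 *: (('X - (T i)%:P) * piece e q i) +
   (T (i + q.+2) - T i.+1)^-1 *: (((T (i + q.+2))%:P - 'X) * piece e q i.+1).
Proof. by rewrite [in RHS](addnS i q.+1). Qed.

Lemma horner_pieceS e q i x :
  (piece e q.+1 i).[x] = (T (i + q.+1) - T i)^-1 * ((x - T i) * (piece e q i).[x]) +
   (T (i + q.+2) - T i.+1)^-1 * ((T (i + q.+2) - x) * (piece e q i.+1).[x]).
Proof. by rewrite pieceS hornerD !hornerZ !hornerM !hornerD !hornerN !hornerX !hornerC. Qed.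

Lemma horner_piece0 e i x : (piece e 0 i).[x] = (i == e + p)%N%:R.
Proof. by rewrite -[(piece e 0 i)]/((i == e + p)%N%:R) -polyC_natr hornerC. Qed.

Lemma piece_support e q i : ~~ ((i <= e + p)%N && (e + p <= i + q)%N) -> piece e q i = 0.
Proof.
elim: q i => [|q IH] i /= h.
  by rewrite (_ : (i == e + p)%N = false)//; apply/negbTE; apply: contra h => /eqP ->; lia.
rewrite IH ?(IH i.+1) ?mulr0 ?scaler0 ?addr0//; apply: contra h; lia.
Qed.

Lemma knot_support e q i : (e < n)%N -> (i <= e + p)%N -> (e + p <= i + q)%N ->
  T i <= e%:R / n%:R /\ e.+1%:R / n%:R <= T (i + q.+1).
Proof.
move=> en h1 h2; rewrite -knot_elt 1?ltnW// -knot_elt//; split; apply: knot_mono => //; lia.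
Qed.

Lemma knot_support_lt e q i : (e < n)%N -> (i <= e + p)%N -> (e + p <= i + q)%N ->
  T i < T (i + q.+1).
Proof.
move=> en h1 h2; have [a b] := knot_support en h1 h2.
by apply: le_lt_trans a _; apply: lt_le_trans b; rewrite ltr_pM2r ?invr_gt0// ltr_nat.
Qed.

Lemma piece_ge0 e q i x : (e < n)%N -> e%:R / n%:R <= x -> x <= e.+1%:R / n%:R ->
  0 <= (piece e q i).[x].
Proof.
move=> en ex xe; elim: q i => [|q IH] i.
  by rewrite /= -polyC_natr hornerC ler0n.
rewrite horner_pieceS; apply: addr_ge0.
  have [/andP[a b]|h1] := boolP ((i <= e + p)%N && (e + p <= i + q)%N); last first.
    by rewrite (piece_support h1) horner0 !mulr0.
  have [c d] := knot_support en a b.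
  rewrite mulr_ge0 ?(andP (knot_inv_le (leq_addr _ _))).1// mulr_ge0// subr_ge0.
  exact: le_trans ex.
have [/andP[a b]|h1] := boolP ((i.+1 <= e + p)%N && (e + p <= i.+1 + q)%N); last first.
  by rewrite (piece_support h1) horner0 !mulr0.
have [c d] := knot_support en a b; rewrite addSnnS in d.
have h : (i.+1 <= i + q.+2)%N by lia.
rewrite mulr_ge0 ?(andP (knot_inv_le h)).1// mulr_ge0// subr_ge0.
exact: le_trans xe d.
Qed.

Lemma piece_unity e q : (e < n)%N -> (q <= p)%N -> \sum_(i < n + p) piece e q i = 1.
Proof.
move=> en; elim: q => [|q IH] qp.
  have h : (e + p < n + p)%N by lia.
  rewrite (bigD1 (Ordinal h)) //= eqxx big1 ?addr0// => i; rewrite -val_eqE /= => /negbTE ->//.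
rewrite -(IH (ltnW qp)).
(* The two halves of the Cox-de Boor recursion: [w i + v i] is the spline of lower degree, and the
   shift between [v i.+1] and [v i] only involves terms that vanish on the cell. *)
pose w i : {poly R} := (T (i + q.+1) - T i)^-1 *: (('X - (T i)%:P) * piece e q i).
pose v i : {poly R} := (T (i + q.+1) - T i)^-1 *: (((T (i + q.+1))%:P - 'X) * piece e q i).
have wv i : w i + v i = piece e q i.
  have [/andP[a b]|h] := boolP ((i <= e + p)%N && (e + p <= i + q)%N); last first.
    by rewrite /w /v (piece_support h) !mulr0 !scaler0 addr0.
  rewrite /w /v -scalerDr -mulrDl.
  have -> : 'X - (T i)%:P + ((T (i + q.+1))%:P - 'X) = (T (i + q.+1) - T i)%:P.
    by rewrite polyCB addrC addrA subrK.
  by rewrite mul_polyC scalerA mulVf ?scale1r// gt_eqF// subr_gt0 (knot_support_lt en a b).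
have pE i : piece e q.+1 i = w i + v i.+1 by rewrite /w /v pieceS addSnnS.
under eq_bigr => i _ do rewrite pE.
under [RHS]eq_bigr => i _ do rewrite -wv.
rewrite !big_split /=; congr (_ + _).
have v0 i : ~~ ((i <= e + p)%N && (e + p <= i + q)%N) -> v i = 0.
  by move=> /piece_support; rewrite /v => ->; rewrite mulr0 scaler0.
transitivity (\sum_(i < (n + p).+1) v i).
  by rewrite big_ord_recl v0 ?add0r//=; lia.
by rewrite big_ord_recr /= v0 ?addr0//=; lia.
Qed.

Lemma size_piece e q i : (size (piece e q i) <= q.+1)%N.
Proof.
elim: q i => [|q IH] i; first by rewrite /=; case: eqP => _; rewrite ?size_poly1 ?size_poly0.
rewrite pieceS.
have aux (a b : {poly R}) : (size a <= 2)%N -> (size b <= q.+1)%N -> (size (a * b)%R <= q.+2)%N.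
  by move=> ha hb; apply: leq_trans (size_polyMleq _ _) _; lia.
apply: leq_trans (size_polyD _ _) _; rewrite geq_max; apply/andP; split.
  by apply: leq_trans (size_scale_leq _ _) _; apply: aux; rewrite ?size_XsubC.
apply: leq_trans (size_scale_leq _ _) _; apply: aux => //.
by rewrite -opprB size_polyN size_XsubC.
Qed.

Lemma piece_derivative e q i :
  (piece e q.+1 i)^`()%R = q.+1%:R *: ((T (i + q.+1) - T i)^-1 *: piece e q i -
    (T (i + q.+2) - T i.+1)^-1 *: piece e q i.+1).
Proof.
elim: q i => [|q IH] i.
  rewrite /= !addn1 !addn2 scale1r derivD !derivZ !derivM !derivB !derivX !derivC.
  by rewrite -!polyC_natr !derivC !mulr0 !addr0 subr0 sub0r mul1r mulN1r scalerN.
rewrite pieceS.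
rewrite derivD !derivZ !derivM !derivB !derivX !derivC subr0 sub0r mul1r mulN1r !IH !pieceS.
rewrite !(addSnnS i) -!mul_polyC.
set A := piece e q i; set B := piece e q i.+1; set C := piece e q i.+2.
set t0 := T i; set t1 := T i.+1; set t2 := T i.+2.
set s1 := T (i + q.+1); set s2 := T (i + q.+2); set s3 := T (i + q.+3).
have l01 : t0 <= t1 by apply: knot_mono.
have l12 : t1 <= s2 by apply: knot_mono; lia.
have l23 : s2 <= s3 by apply: knot_mono; lia.
(* The part of the identity that is not a formal cancellation; at a repeated knot it holds through
   the convention [0^-1 = 0]. *)
have key : (s2 - t1)^-1%:P * ((s2 - t0)^-1%:P * (s2%:P - t0%:P) - (s3 - t1)^-1%:P * (s3%:P - t1%:P)) = 0 :> {poly R}.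
  have [->|h] := eqVneq s2 t1; first by rewrite subrr invr0 polyC0 mul0r.
  have h' : t1 < s2 by rewrite lt_neqAle eq_sym h.
  by rewrite -!polyCB -!polyCM !mulVf ?subrr ?mulr0// gt_eqF// subr_gt0;
    [exact: lt_le_trans h' l23|exact: le_lt_trans l01 h'].
have -> : q.+2%:R%:P = q.+1%:R%:P + 1 :> {poly R} by rewrite -natr1 polyCD.
apply/eqP; rewrite -subr_eq0.
set K := _ * (_ * (s2%:P - t0%:P) - _) in key.
match goal with |- is_true (?l == 0) => have -> : l = - (q.+1%:R%:P) * B * K by rewrite /K; ring end.
by rewrite key mulr0.
Qed.

(** The coefficients of the recursion are common to both cells, so continuity passes from degree 1,
    checked by hand, to the higher degrees. *)
Lemma piece_continuous e q i : (e.+1 < n)%N -> (0 < q)%N ->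
  (piece e q i).[e.+1%:R / n%:R] = (piece e.+1 q i).[e.+1%:R / n%:R].
Proof.
move=> en; case: q => // q _; elim: q i => [|q IH] i; last by rewrite !(horner_pieceS _ q.+1) !IH.
rewrite !horner_pieceS /= -!polyC_natr !hornerC !addn1 !addn2.
rewrite -(@knot_elt e.+1)// 1?ltnW// addSn.
have hne k : (k <= e.+1)%N -> T (k + p).+1 - T (k + p) != 0.
  move=> ke; rewrite subr_eq0 gt_eqF//.
  by have := @knot_support_lt k 0 (k + p); rewrite addn1 addn0; apply => //; lia.
have h1 := hne _ (leqnSn e); have h2 := hne _ (leqnn e.+1); rewrite addSn in h2.
have [<-|ni] := eqVneq (e + p)%N i.
  rewrite (_ : ((e + p).+1 == e + p)%N = false); last by lia.
  rewrite (_ : (e + p == (e + p).+1)%N = false); last by lia.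
  by rewrite /= !mulr0 !mulr1 !mulVf// addr0 add0r.
have [<-|ni2] := eqVneq (e + p).+1 i.
  rewrite (_ : ((e + p).+2 == e + p)%N = false); last by lia.
  by rewrite subrr !(mul0r, mulr0).
have [ei|ni3] := eqVneq i.+1 (e + p)%N.
  by rewrite -ei subrr !(mul0r, mulr0).
by [].
Qed.

Lemma piece_at0 q i : (q <= p)%N -> (piece 0 q i).[0] = (i + q == p)%N%:R.
Proof.
elim: q i => [|q IH] i qp; first by rewrite horner_piece0 addn0.
rewrite horner_pieceS !IH; try exact: ltnW.
have -> : (0 - T i) * (i + q == p)%N%:R = 0.
  by case: eqP => [h|_]; rewrite ?mulr0// knot_low ?subrr ?mul0r//; lia.
rewrite mulr0 add0r addSnnS; case: eqP => [h|_]; last by rewrite !mulr0.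
rewrite (@knot_low i.+1); last by lia.
rewrite !subr0 mulr1 mulVf// gt_eqF//.
have := @knot_support_lt 0 0 p n0; rewrite add0n addn0 addn1 => /(_ (leqnn _) (leqnn _)).
by rewrite knot_low// addnS h.
Qed.

Lemma piece_at1 q i : (piece n.-1 q i).[1] = (i.+1 == n + p)%N%:R.
Proof.
have n1 : (n.-1 + p).+1 = (n + p)%N by lia.
elim: q i => [|q IH] i; first by rewrite horner_piece0 -n1 eqSS.
rewrite horner_pieceS !IH.
have -> : (T (i + q.+2) - 1) * (i.+2 == n + p)%N%:R = 0.
  by case: eqP => [h|_]; rewrite ?mulr0// knot_high ?subrr ?mul0r//; lia.
rewrite mulr0 addr0; case: eqP => [h|_]; last by rewrite !mulr0.
rewrite mulr1 (@knot_high (i + q.+1)); last by lia.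
rewrite mulVf// subr_eq0 gt_eqF//.
have := @knot_support_lt n.-1 0 i; rewrite addn0 addn1 (@knot_high i.+1); last by lia.
by apply; lia.
Qed.

End bsplines.

(** * Approximation of smooth functions by splines *)

Section approximation.
Context {R : realType}.

Lemma derive_lipschitz (f df : R -> R) (a b M x y : R) :
  (forall t : R, is_derive t 1 f (df t)) -> (forall t, a <= t <= b -> `|df t| <= M) ->
  a <= x <= b -> a <= y <= b -> `|f x - f y| <= M * `|x - y|.
Proof.
move=> dF hM; wlog xy : x y / x <= y => [h hx hy|/andP[ax xb] /andP[ay yb]].
  have [xy|yx] := leP x y; first exact: h.
  by rewrite distrC [in leRHS]distrC; apply: h => //; exact: ltW.
have [c cxy e] := @MVT_segment R f df x y xy (fun t _ => dF t)
  (continuous_subspaceT (fun t => is_derive_continuous (dF t))).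
move: cxy; rewrite in_itv /= => /andP[xc cy].
rewrite distrC e normrM distrC ler_wpM2r// hM// (le_trans ax xc) /= (le_trans cy yb)//.
Qed.

Variable p : nat.

Section fixed_n.
Variable n : nat.
Hypothesis n0 : (0 < n)%N.
Local Notation T := (@knot R p n).
Local Notation piece := (@bspline_piece R p n).
Let nR : (0 : R) < n%:R. Proof. by rewrite ltr0n. Qed.

(** All degrees [q <= p] share the knot vector and the index range of degree [p], so that
    differentiation lowers [q] and keeps everything else. *)
Definition spl (q : nat) (a : nat -> R) (e : nat) : {poly R} := \sum_(i < n + p) a i *: piece e q i.

Lemma horner_spl q a e x : (spl q a e).[x] = \sum_(i < n + p) a i * (piece e q i).[x].
Proof. by rewrite horner_sum; apply: eq_bigr => i _; rewrite hornerZ. Qed.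

Lemma splD q a b e : spl q (fun i => a i + b i) e = spl q a e + spl q b e.
Proof. by rewrite /spl -big_split; apply: eq_bigr => i _; rewrite scalerDl. Qed.

(** At [i = 0] the difference is zero because [0.-1 = 0]; this is harmless since the B-spline of
    index 0 and degree [q < p] vanishes on every cell. *)
Definition dcoef q (a : nat -> R) i : R :=
  q.+1%:R * (a i - a i.-1) * (T (i + q.+1) - T i)^-1.

Lemma spl_derivative q a e : (e < n)%N -> (q < p)%N ->
  (spl q.+1 a e)^`()%R = spl q (dcoef q a) e.
Proof.
move=> en qp; rewrite /spl raddf_sum /=.
pose w i := (T (i + q.+1) - T i)^-1.
transitivity (\sum_(i < n + p) q.+1%:R *: (a i *: (w i *: piece e q i)) -
   \sum_(i < n + p) q.+1%:R *: (a i *: (w i.+1 *: piece e q i.+1))).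
  rewrite -sumrB; apply: eq_bigr => i _; rewrite derivZ piece_derivative// -scalerBr -scalerBr.
  by rewrite scalerA mulrC -scalerA /w addSnnS.
have -> : \sum_(i < n + p) q.+1%:R *: (a i *: (w i.+1 *: piece e q i.+1)) =
   \sum_(i < n + p) q.+1%:R *: (a i.-1 *: (w i *: piece e q i)).
  transitivity (\sum_(i < (n + p).+1) q.+1%:R *: (a i.-1 *: (w i *: piece e q i))).
    rewrite [RHS]big_ord_recl /= (piece_support n0 (i := 0)) ?scaler0 ?add0r//=; lia.
  rewrite big_ord_recr /= (piece_support n0 (i := (n + p)%N)) ?scaler0 ?addr0//=; lia.
rewrite -sumrB; apply: eq_bigr => i _.
by rewrite !scalerA -scalerBl /dcoef /w; congr (_ *: _); ring.
Qed.

(** B-splines are nonnegative with sum one, so the value is a convex combination of the coefficients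
    that act on the cell. *)
Lemma spl_near q a e c M x : (e < n)%N -> (q <= p)%N ->
  e%:R / n%:R <= x -> x <= e.+1%:R / n%:R ->
  (forall i, (i <= e + p)%N -> (e + p <= i + q)%N -> `|a i - c| <= M) ->
  `|(spl q a e).[x] - c| <= M.
Proof.
move=> en qp ex xe h.
have PU : \sum_(i < n + p) (piece e q i).[x] = 1.
  by rewrite -horner_sum piece_unity// hornerC.
have -> : (spl q a e).[x] - c = \sum_(i < n + p) (a i - c) * (piece e q i).[x].
  rewrite horner_spl -{1}[c]mulr1 -PU mulr_sumr -sumrB; apply: eq_bigr => i _; ring.
apply: le_trans (ler_norm_sum _ _ _) _; rewrite -[leRHS]mulr1 -PU mulr_sumr.
apply: ler_sum => i _; have g := @piece_ge0 R p n n0 e q i x en ex xe.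
rewrite normrM (ger0_norm g).
have [/andP[a1 a2]|h1] := boolP ((i <= e + p)%N && (e + p <= i + q)%N).
  by rewrite ler_wpM2r// h.
by rewrite (piece_support n0 h1) horner0 !mulr0.
Qed.

Lemma spl_le q a e M x : (e < n)%N -> (q <= p)%N ->
  e%:R / n%:R <= x -> x <= e.+1%:R / n%:R -> (forall i, `|a i| <= M) ->
  `|(spl q a e).[x]| <= M.
Proof.
move=> en qp ex xe h; rewrite -[_.[_]]subr0; apply: spl_near => // i _ _; rewrite subr0//.
Qed.

Lemma spl0 a e : (e < n)%N -> spl 0 a e = (a (e + p)%N)%:P.
Proof.
move=> en; have h : (e + p < n + p)%N by lia.
rewrite /spl (bigD1 (Ordinal h)) //= eqxx big1 ?addr0 ?alg_polyC//.
by move=> i; rewrite -val_eqE /= => /negbTE ->; rewrite scaler0.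
Qed.

(** Each derivative multiplies the coefficients by at most [2 n], a difference divided by a knot
    distance; the factor [q.+1] is the one that derivation puts on the top coefficient. *)
Lemma spl_top q a e M : (e < n)%N -> (q <= p)%N -> (forall i, `|a i| <= M) ->
  `|(spl q a e)`_q| <= M * (2 * n%:R) ^+ q.
Proof.
move=> en; elim: q a M => [|q IH] a M qp h.
  by rewrite spl0// coefC eqxx expr0 mulr1.
have M0 : 0 <= M := le_trans (normr_ge0 _) (h 0%N).
have hd i : `|dcoef q a i| <= q.+1%:R * (M * (2 * n%:R)).
  have /andP[w0 wn] := @knot_inv_le R p n n0 i (i + q.+1) (leq_addr _ _).
  rewrite /dcoef -mulrA normrM normr_nat ler_wpM2l// normrM (ger0_norm w0).
  have : `|a i - a i.-1| <= M * 2.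
    apply: le_trans (ler_normB _ _) _; have := h i; have := h i.-1; lra.
  by move=> h2; rewrite mulrA; apply: ler_pM.
have := IH _ _ (ltnW qp) hd; rewrite -spl_derivative// coef_deriv.
rewrite -[_ *+ _]mulr_natr normrM normr_nat.
rewrite mulrC -mulrA ler_pM2l ?ltr0n//.
by rewrite -mulrA -exprS.
Qed.

Definition nk (i : nat) : nat := minn (i - p) n.

Lemma knotE i : T i = (nk i)%:R / n%:R. Proof. by []. Qed.

Lemma spl_end0 q a : (q <= p)%N -> (spl q a 0).[0] = a (p - q)%N.
Proof.
move=> qp; have h : (p - q < n + p)%N by lia.
rewrite horner_spl (bigD1 (Ordinal h)) //= piece_at0// subnK// eqxx mulr1 big1 ?addr0//.
move=> i; rewrite -val_eqE /= => ne; rewrite piece_at0//.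
by rewrite (_ : (i + q == p)%N = false) ?mulr0//; lia.
Qed.

Lemma spl_end1 q a : (spl q a n.-1).[1] = a (n + p).-1.
Proof.
have h : ((n + p).-1 < n + p)%N by lia.
rewrite horner_spl (bigD1 (Ordinal h)) //= piece_at1// prednK ?eqxx ?mulr1; last by lia.
rewrite big1 ?addr0// => i; rewrite -val_eqE /= => ne; rewrite piece_at1//.
by rewrite (_ : (i.+1 == n + p)%N = false) ?mulr0//; lia.
Qed.

Lemma spl_continuous q a e : (e.+1 < n)%N -> (0 < q)%N ->
  (spl q a e).[e.+1%:R / n%:R] = (spl q a e.+1).[e.+1%:R / n%:R].
Proof. by move=> en q0; rewrite !horner_spl; apply: eq_bigr => i _; rewrite piece_continuous. Qed.

(** Inverts [dcoef]: partial sums of the coefficients weighted by knot distances, with initial value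
    [v0]. *)
Definition antider q (b : nat -> R) (v0 : R) i : R :=
  v0 + \sum_(l < i.+1) b l * (T (l + q.+1) - T l) / q.+1%:R.

Lemma antider_derivative q b v0 e : (e < n)%N -> (q < p)%N ->
  (spl q.+1 (antider q b v0) e)^`()%R = spl q b e.
Proof.
move=> en qp; rewrite spl_derivative//; apply: eq_bigr => i _.
have [/andP[a1 a2]|h1] := boolP ((i <= e + p)%N && (e + p <= i + q)%N); last first.
  by rewrite (piece_support n0 h1) !scaler0.
have hT := @knot_support_lt R p n n0 e q i en a1 a2.
congr (_ *: _); rewrite /dcoef /antider.
have [i' ei] : exists i', nat_of_ord i = i'.+1 by exists i.-1; lia.
rewrite ei /= in hT *; rewrite big_ord_recr /=.
by field; rewrite subr_eq0 gt_eqF//= pnatr_eq0.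
Qed.

Lemma antider_start q b v0 : (q < p)%N -> antider q b v0 (p - q.+1) = v0.
Proof.
move=> qp; rewrite /antider big1 ?addr0// => l _; have := ltn_ord l => hl.
by rewrite !knot_low ?subrr ?mulr0 ?mul0r//; lia.
Qed.

End fixed_n.

(** [f j] stands for the [j]-th derivative. The bound of the top coefficient, uniform in [n], is
    what makes the mass defect small; the exact end values put the approximation of a sine in the
    discrete space. *)
Definition good_spline (q : nat) (f : nat -> R -> R) (C : R) (n : nat) (a : nat -> R) : Prop :=
  (forall e, (e < n)%N ->
    [/\ forall x, e%:R / n%:R <= x -> x <= e.+1%:R / n%:R ->
          `|f 0 x - (spl n q a e).[x]| <= C * n%:R ^- q.+1,
        (0 < q)%N -> forall x, e%:R / n%:R <= x -> x <= e.+1%:R / n%:R ->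
          `|f 1 x - (spl n q a e)^`()%R.[x]| <= C * n%:R ^- q &
        `|(spl n q a e)`_q| <= C]) /\
  ((0 < q)%N -> a (p - q)%N = f 0 0 /\ a (n + p).-1 = f 0 1).

Lemma cell_in01 n e (x : R) : (0 < n)%N -> (e < n)%N ->
  e%:R / n%:R <= x -> x <= e.+1%:R / n%:R -> 0 <= x <= 1.
Proof.
move=> n0 en h1 h2; apply/andP; split; first by apply: le_trans h1; rewrite divr_ge0.
by apply: le_trans h2 _; rewrite ler_pdivrMr ?ltr0n// mul1r ler_nat.
Qed.

(* Integrating an approximation [S'] of [f'] loses one order for [f - S]; the Schoenberg
   operator applied to [f - S], whose slope is already small, recovers it. *)
Lemma spline_approximation q : (q <= p)%N -> forall f : nat -> R -> R,
  (forall j (x : R), is_derive x 1 (f j) (f j.+1 x)) ->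
  (forall j, exists M, forall x, 0 <= x <= 1 -> `|f j x| <= M) ->
  exists2 C : R, 0 <= C & forall n, (0 < n)%N -> exists a, good_spline q f C n a.
Proof.
elim: q => [|q IH] qp f df bf.
  have [M0 h0] := bf 0%N; have [M1 h1] := bf 1%N.
  have M00 : 0 <= M0 by apply: le_trans (normr_ge0 _) (h0 0 _); rewrite lexx ler01.
  have M10 : 0 <= M1 by apply: le_trans (normr_ge0 _) (h1 0 _); rewrite lexx ler01.
  exists (M0 + M1); first exact: addr_ge0.
  move=> n n0; have nR : (0 : R) < n%:R by rewrite ltr0n.
  exists (fun i => f 0%N (knot p n i)); split=> // e en.
  have hc : 0 <= (e%:R / n%:R : R) <= 1.
    by apply: (@cell_in01 n e) => //; rewrite ler_pM2r ?invr_gt0// ler_nat.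
  split=> // [x ex xe|]; rewrite spl0// knot_elt ?(ltnW en)//.
    rewrite hornerC; apply: le_trans (derive_lipschitz (df 0%N) h1 (cell_in01 n0 en ex xe) hc) _.
    have xd : `|x - e%:R / n%:R| <= n%:R ^- 1.
      rewrite ger0_norm ?subr_ge0// lerBlDl expr1 -[X in _ + X]mul1r -mulrDl natr1//.
    apply: ler_pM => //; by rewrite lerDr.
  by rewrite coefC eqxx; apply: le_trans (h0 _ hc) _; rewrite lerDl.
have [C1 C10 hC1] := IH (ltnW qp) (fun j => f j.+1) (fun j => df j.+1) (fun j => bf j.+1).
exists (q.+2%:R * C1 + C1 + C1 * 2 ^+ q.+1).
  by rewrite !addr_ge0// mulr_ge0// exprn_ge0.
move=> n n0; have nR : (0 : R) < n%:R by rewrite ltr0n.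
have [b [hb _]] := hC1 n n0.
set A := antider n q b (f 0%N 0).
pose S e := spl n q.+1 A e.
have dS e : (e < n)%N -> (S e)^`()%R = spl n q b e by move=> en; exact: antider_derivative.
pose del := C1 * n%:R ^- q.+1.
have del0 : 0 <= del by rewrite mulr_ge0// invr_ge0 exprn_ge0// ltW.
(* Error of the antiderivative spline at node [k]; the last node is evaluated in the last cell. *)
pose ek k : R := if (k < n)%N then f 0%N (k%:R / n%:R) - (S k).[k%:R / n%:R] else f 0%N 1 - (S n.-1).[1].
have node_in e : (e < n)%N -> e%:R / n%:R <= e.+1%:R / n%:R :> R.
  by move=> _; rewrite ler_pM2r ?invr_gt0// ler_nat.
have Elip e x y : (e < n)%N -> e%:R / n%:R <= x <= e.+1%:R / n%:R -> e%:R / n%:R <= y <= e.+1%:R / n%:R ->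
    `|(f 0%N x - (S e).[x]) - (f 0%N y - (S e).[y])| <= del / n%:R.
  move=> en hx hy.
  have dE (t : R) : is_derive t 1 (fun t => f 0%N t - (S e).[t]) (f 1%N t - (S e)^`()%R.[t]).
    by apply: is_deriveB; exact: is_derive_horner.
  have hE t : e%:R / n%:R <= t <= e.+1%:R / n%:R -> `|f 1%N t - (S e)^`()%R.[t]| <= del.
    move=> /andP[t1 t2]; rewrite dS//; have [h _ _] := hb e en; exact: h.
  apply: le_trans (derive_lipschitz dE hE hx hy) _; rewrite ler_wpM2l//.
  have -> : n%:R^-1 = e.+1%:R / n%:R - e%:R / n%:R :> R by rewrite -mulrBl -natr1 addrAC subrr add0r mul1r.
  by move: hx hy => /andP[? ?] /andP[? ?]; rewrite ler_norml; apply/andP; split; lra.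
have ekS e : (e < n)%N -> ek e.+1 = f 0%N (e.+1%:R / n%:R) - (S e).[e.+1%:R / n%:R].
  move=> en; rewrite /ek; case: ltnP => h; first by rewrite /S spl_continuous.
  have en' : e.+1 = n by lia.
  by rewrite en' divff ?gt_eqF// -en'.
have ekE e : (e < n)%N -> ek e = f 0%N (e%:R / n%:R) - (S e).[e%:R / n%:R] by move=> en; rewrite /ek en.
have ek_step e : (e < n)%N -> `|ek e.+1 - ek e| <= del / n%:R.
  by move=> en; rewrite ekS// ekE//; apply: Elip; rewrite // ?lexx ?node_in.
have ek_lip k m : (k + m <= n)%N -> `|ek (k + m)%N - ek k| <= m%:R * (del / n%:R).
  elim: m => [|m IHm] h; first by rewrite addn0 subrr normr0 mul0r.
  rewrite addnS -natr1 mulrDl mul1r -[X in `|X|](subrKA (ek (k + m)%N)) addrC.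
  apply: le_trans (ler_normD _ _) _; rewrite lerD ?IHm ?ek_step//; lia.
have ek_lip2 k m M : (k <= n)%N -> (m <= n)%N -> (k <= m + M)%N -> (m <= k + M)%N ->
   `|ek k - ek m| <= M%:R * (del / n%:R).
  have dn0 : 0 <= del / n%:R by rewrite divr_ge0// ltW.
  wlog km : k m / (m <= k)%N => [h kn mn h1 h2|kn mn h1 h2].
    by have [mk|km] := leqP m k; [exact: h|rewrite distrC; apply: h => //; exact: ltnW].
  rewrite -{1}(subnKC km); apply: le_trans (ek_lip m (k - m)%N _) _; first by rewrite subnKC.
  by rewrite ler_wpM2r// ler_nat leq_subLR.
have ek0 : ek 0%N = 0.
  by rewrite ekE// mul0r /S spl_end0// /A antider_start// subrr.
have ek_le k : (k <= n)%N -> `|ek k| <= del.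
  move=> kn; have := ek_lip 0%N k; rewrite add0n ek0 subr0 => /(_ kn) h.
  apply: le_trans h _; rewrite mulrCA ler_piMr// ler_pdivrMr// mul1r ler_nat//.
(* The error is sampled at the knot [i.+1], in the support of the B-spline [i]. At the left end this
   samples the error at 0, which vanishes; the last sample corrects the value at 1. *)
pose tau i := ek (nk n i.+1).
have nk_le i : (nk n i <= n)%N by exact: geq_minr.
have tau_near e x i : (e < n)%N -> e%:R / n%:R <= x -> x <= e.+1%:R / n%:R ->
   (i <= e + p)%N -> (e + p <= i + q.+1)%N -> `|tau i - (f 0%N x - (S e).[x])| <= q.+2%:R * (del / n%:R).
  move=> en ex xe h1 h2.
  rewrite -[X in `|X|](subrKA (ek e)) -natr1 mulrDl mul1r.
  apply: le_trans (ler_normD _ _) _; apply: lerD.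
    apply: ek_lip2; rewrite ?nk_le ?(ltnW en)// /nk; lia.
  by rewrite ekE// distrC Elip ?lexx ?node_in ?ex.
(* The differences of [tau] are bounded by knot distances, which cancel the denominators; a zero
   distance makes the coefficient zero. *)
have dtau i : `|dcoef n q tau i| <= q.+1%:R * del.
  have /andP[w0 wn] := @knot_inv_le R p n n0 i (i + q.+1) (leq_addr _ _).
  rewrite /dcoef -mulrA normrM normr_nat ler_wpM2l// normrM (ger0_norm w0).
  have h : `|tau i - tau i.-1| <= del * (knot p n (i + q.+1) - knot p n i).
    case: i {w0 wn} => [|i].
      by rewrite subrr normr0 mulr_ge0// subr_ge0 knot_mono// leq_addr.
    rewrite /tau /=; apply: (@le_trans _ _ (del * (knot p n i.+2 - knot p n i.+1))).
      rewrite !knotE -mulrBl.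
      have hm : (nk n i.+1 <= nk n i.+2)%N by rewrite /nk; lia.
      rewrite -natrB// mulrCA; apply: ek_lip2; rewrite ?nk_le//; lia.
    by rewrite ler_wpM2l// lerB// knot_mono//; lia.
  have [e|ne] := eqVneq (knot p n (i + q.+1)) (knot p n i : R).
    by rewrite e subrr invr0 mulr0.
  rewrite ler_pdivrMr// subr_gt0 lt_neqAle eq_sym ne knot_mono// leq_addr.
by [].
exists (fun i => A i + tau i); split=> [e en|_]; last first.
  rewrite /A antider_start//; split.
    rewrite /tau (_ : nk n (p - q.+1).+1 = 0%N) ?ek0 ?addr0// /nk; lia.
  have := spl_end1 n0 q.+1 A => h; rewrite -/A.
  rewrite /tau (_ : nk n (n + p).-1.+1 = n); last by rewrite /nk; lia.
  rewrite /ek ltnn -[S n.-1]/(spl n q.+1 A n.-1) h; ring.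
have dn : del / n%:R = C1 * n%:R ^- q.+2.
  by rewrite /del [in RHS]exprSr invfM mulrA.
have e1 : `|(spl n q.+1 tau e)`_q.+1| <= C1 * 2 ^+ q.+1.
  apply: le_trans (@spl_top n n0 q.+1 tau e del en qp (fun i => ek_le _ (nk_le _))) _.
  rewrite /del exprMn -mulrA [_ * (2 ^+ _ * _)]mulrCA mulVf ?mulr1// expf_neq0// gt_eqF//.
have powpos k : 0 <= n%:R ^- k :> R by rewrite invr_ge0 exprn_ge0// ltW.
have C2 : 0 <= C1 * 2 ^+ q.+1 by rewrite mulr_ge0// exprn_ge0.
rewrite splD; split=> [x ex xe|_ x ex xe|].
- rewrite hornerD opprD addrA distrC.
  apply: le_trans (@spl_near n n0 q.+1 tau e _ (q.+2%:R * (del / n%:R)) x en qp ex xe _) _.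
    by move=> i h1 h2; exact: tau_near.
  rewrite dn mulrA ler_wpM2r// -addrA lerDl addr_ge0//.
- rewrite derivD hornerD opprD addrA; apply: le_trans (ler_normB _ _) _.
  have h1 : `|f 1%N x - (S e)^`()%R.[x]| <= del.
    by rewrite dS//; have [h _ _] := hb e en; exact: h.
  have h2 : `|(spl n q.+1 tau e)^`()%R.[x]| <= q.+1%:R * del.
    by rewrite spl_derivative//; apply: spl_le => //; exact: ltnW.
  apply: le_trans (lerD h1 h2) _.
  have -> : del + q.+1%:R * del = q.+2%:R * C1 * n%:R ^- q.+1.
    by rewrite /del -(natr1 q.+1); ring.
  by rewrite ler_wpM2r// -addrA lerDl addr_ge0.
- rewrite coefD; apply: le_trans (ler_normD _ _) _; apply: lerD => //.
  have [_ _ h] := hb e en; rewrite -dS// coef_deriv -[_ *+ _]mulr_natr normrM normr_nat in h.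
  have : `|(S e)`_q.+1| <= C1.
    apply: le_trans h; rewrite ler_peMr// ler1n//.
  by move=> h3; apply: le_trans h3 _; rewrite lerDr mulr_ge0.
Qed.

End approximation.

(** * Gauss-Legendre and Gauss-Lobatto rules *)

Section polynomial_integral.
Context {R : realType}.
Local Notation mu := (@lebesgue_measure R).
Implicit Types (f g q F : {poly R}).

Definition pprim q : {poly R} :=
  \poly_(i < (size q).+1) (if i is j.+1 then q`_j / j.+1%:R else 0).

Lemma pprimK q : (pprim q)^`()%R = q.
Proof.
apply/polyP => i; rewrite coef_deriv coef_poly ltnS.
case: ltnP => h; last by rewrite mul0rn nth_default.
by rewrite -[_ / _ *+ _]mulr_natr divfK// pnatr_eq0.
Qed.

(** The integral through the formal primitive, so that linearity and integration by parts are
    polynomial algebra; [pintE] identifies it with the Lebesgue integral. *)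
Definition pint (a b : R) q : R := (pprim q).[b] - (pprim q).[a].

Lemma pint_deriv a b F : pint a b F^`()%R = F.[b] - F.[a].
Proof.
rewrite /pint; set G := pprim _.
have h : (G - F)^`()%R = 0 by rewrite derivB pprimK subrr.
have hs : (size (G - F)%R <= 1)%N.
  by have := size_deriv (G - F); rewrite h size_poly0; case: (size _) => // -[].
have [c hc] : exists c, G = F + c%:P.
  by exists (G - F)`_0; rewrite -(size1_polyC hs) addrC subrK.
by rewrite hc !hornerD !hornerC; ring.
Qed.

Lemma pintE a b q : a <= b -> pint a b q = \int[mu]_(t in `[a, b]) q.[t].
Proof.
move=> ab.
have h (x : R) : is_derive x 1 (fun x => (pprim q).[x]) (q.[x]).
  by rewrite -[in X in is_derive _ _ _ X](pprimK q); exact: is_derive_horner.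
have c : continuous (fun x => q.[x]) by apply: smooth1_continuous; exact: smooth1_horner.
exact: esym (FTC_segment ab h c).
Qed.

Lemma pintD a b f g : pint a b (f + g) = pint a b f + pint a b g.
Proof. by rewrite -[f in LHS]pprimK -[g in LHS]pprimK -derivD pint_deriv /pint !hornerD; ring. Qed.

Lemma pintZ a b c f : pint a b (c *: f) = c * pint a b f.
Proof. by rewrite -[f in LHS]pprimK -derivZ pint_deriv /pint !hornerZ; ring. Qed.

Lemma pint0 a b : pint a b 0 = 0.
Proof. by rewrite -[X in pint _ _ X](scale0r (0 : {poly R})) pintZ mul0r. Qed.

Lemma pint_sum a b (I : Type) (r : seq I) (P : pred I) (G : I -> {poly R}) :
  pint a b (\sum_(i <- r | P i) G i) = \sum_(i <- r | P i) pint a b (G i).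
Proof.
elim: r => [|i r IH]; first by rewrite !big_nil pint0.
by rewrite !big_cons; case: ifP => _; rewrite ?pintD IH.
Qed.

Lemma pint_ibp a b f g :
  pint a b (f^`()%R * g) = f.[b] * g.[b] - f.[a] * g.[a] - pint a b (f * g^`()%R).
Proof. by rewrite -!hornerM -pint_deriv derivM pintD addrK. Qed.

Lemma pint_ge0 a b q : a <= b -> (forall x, a <= x <= b -> 0 <= q.[x]) -> 0 <= pint a b q.
Proof.
move=> ab h; rewrite pintE//; apply: Rintegral_ge0 => x; rewrite /= in_itv /=; exact: h.
Qed.

(** If the integral vanished, the monotone primitive would be constant on the interval, hence a
    constant polynomial by its number of roots. *)
Lemma pint_gt0 a b q : a < b -> q != 0 -> (forall x, a <= x <= b -> 0 <= q.[x]) -> 0 < pint a b q.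
Proof.
move=> ab q0 h; rewrite lt_neqAle eq_sym pint_ge0 ?ltW// andbT; apply: contra_neq q0 => h0.
set F := pprim q.
have hF x : a <= x <= b -> F.[x] = F.[a].
  move=> /andP[ax xb]; apply/eqP; rewrite eq_le; apply/andP; split.
    have : 0 <= pint x b q by apply: pint_ge0 => // y /andP[xy yb]; apply: h; rewrite yb (le_trans ax).
    by move: h0; rewrite /pint -/F => /eqP; rewrite subr_eq0 => /eqP <-; rewrite subr_ge0.
  have : 0 <= pint a x q by apply: pint_ge0 => // y /andP[ay yx]; apply: h; rewrite ay (le_trans yx).
  by rewrite /pint -/F subr_ge0.
pose s := [seq a + (b - a) / i.+1%:R | i <- iota 0 (size F).+1].
have sub : F - F.[a]%:P = 0.
  apply: (@roots_geq_poly_eq0 _ _ s).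
  - apply/allP => _ /mapP[i _ ->]; rewrite rootE !hornerE hF ?subrr//.
    rewrite lerDl divr_ge0 ?subr_ge0 ?(ltW ab)//= -lerBrDl ler_pdivrMr ?ltr0n//.
    by rewrite ler_peMr ?subr_ge0 ?(ltW ab)// ler1n.
  - have c0 : b - a != 0 by rewrite subr_eq0 gt_eqF.
    rewrite map_inj_uniq ?iota_uniq// => i i' /addrI /(mulfI c0) /invr_inj /eqP.
    by rewrite eqr_nat eqSS => /eqP.
  - rewrite size_map size_iota; apply: leq_trans (size_polyD _ _) _.
    by rewrite geq_max leqnSn /= size_polyN (leq_trans (size_polyC_leq1 _)).
by rewrite -(pprimK q) -/F -[F](subrK F.[a]%:P) sub add0r derivC.
Qed.

End polynomial_integral.

Section rules.
Context {R : realType}.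
Implicit Types (f g q F : {poly R}).

Let N11 : (-1 : R) < 1. Proof. by rewrite (lt_trans (ltrN10 _) ltr01). Qed.

Definition rule_sum (r : rule) f : R := \sum_(xw <- r) xw.2 * f.[xw.1].

Lemma rule_sum_blend tau (a b : rule) f :
  rule_sum (blend tau a b) f = tau * rule_sum a f + (1 - tau) * rule_sum b f.
Proof.
rewrite /rule_sum /blend big_cat !big_map /= !mulr_sumr.
by congr (_ + _); apply: eq_bigr => i _; rewrite mulrA.
Qed.

Lemma rule_sumD (r : rule) f g : rule_sum r (f + g) = rule_sum r f + rule_sum r g.
Proof. by rewrite /rule_sum -big_split; apply: eq_bigr => i _; rewrite hornerD mulrDr. Qed.

Lemma rule_sumZ (r : rule) c f : rule_sum r (c *: f) = c * rule_sum r f.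
Proof. by rewrite /rule_sum mulr_sumr; apply: eq_bigr => i _; rewrite hornerZ mulrCA. Qed.

Lemma interpolatory_sum xs f :
  rule_sum (interpolatory xs) f = \sum_(x <- xs) (\int[lebesgue_measure]_(t in `[(-1 : R), 1])
             \prod_(y <- xs | y != x) ((t - y) / (x - y))) * f.[x].
Proof. by rewrite /rule_sum /interpolatory big_map. Qed.

Definition nodal (xs : seq R) : {poly R} := \prod_(x <- xs) ('X - x%:P).

Lemma interpolatory_nodal0 xs q : rule_sum (interpolatory xs) (q * nodal xs) = 0.
Proof.
rewrite interpolatory_sum big_seq big1// => x xs_x; rewrite hornerM.
have /rootP -> : root (nodal xs) x by rewrite root_prod_XsubC.
by rewrite !mulr0.
Qed.

Lemma interpolatory_exact xs f : uniq xs -> (size f <= size xs)%N ->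
  rule_sum (interpolatory xs) f = pint (-1) 1 f.
Proof.
move=> Uxs sf.
pose ell x : {poly R} := \prod_(y <- xs | y != x) ((x - y)^-1 *: ('X - y%:P)).
have ellE x t : (ell x).[t] = \prod_(y <- xs | y != x) ((t - y) / (x - y)).
  by rewrite horner_prod; apply: eq_bigr => y _; rewrite hornerZ !hornerE mulrC.
have sell x : x \in xs -> (size (ell x) <= size xs)%N.
  move=> xx; have := size_poly_prod_leq.
  rewrite /ell => h.
  apply: (@leq_trans (size (\prod_(y <- rem x xs) ((x - y)^-1 *: ('X - y%:P)))%R)).
    rewrite (rem_filter x Uxs) big_filter; by [].
  have : (forall s : seq R, size (\prod_(y <- s) ((x - y)^-1 *: ('X - y%:P)))%R <= (size s).+1)%N.
    elim=> [|y s IH]; first by rewrite big_nil size_poly1.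
    rewrite big_cons; apply: leq_trans (size_polyMleq _ _) _ => /=.
    have h1 := leq_trans (size_scale_leq (x - y)^-1 ('X - y%:P)) (eq_leq (size_XsubC y)).
    by move: h1 IH; set u := size _; set v := size _; lia.
  move=> /(_ (rem x xs)); rewrite size_rem//; move: xx; case: (xs) => //.
have e : f = \sum_(x <- xs) f.[x] *: ell x.
  apply/eqP; rewrite -subr_eq0; apply/eqP; apply: (@roots_geq_poly_eq0 _ _ xs) => //.
    apply/allP => z zxs; rewrite rootE hornerD hornerN horner_sum (big_rem z)//=.
    rewrite hornerZ ellE big1 ?mulr1; last by move=> y yz; rewrite divff// subr_eq0 eq_sym.
    rewrite big_seq big1 ?addr0 ?subrr// => y; rewrite rem_filter// mem_filter => /andP[/= yz yxs].
    by rewrite hornerZ ellE (big_rem z)//= eq_sym yz subrr mul0r mul0r mulr0.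
  apply: leq_trans (size_polyD _ _) _; rewrite geq_max sf size_polyN /=.
  rewrite big_seq; apply: (big_ind (fun p : {poly R} => (size p <= size xs)%N)).
  - by rewrite size_poly0.
  - by move=> p1 p2 h1 h2; apply: leq_trans (size_polyD _ _) _; rewrite geq_max h1.
  - by move=> x xx; apply: leq_trans (size_scale_leq _ _) _; exact: sell.
rewrite interpolatory_sum [in RHS]e pint_sum; apply: eq_bigr => x _.
rewrite pintZ mulrC; congr (_ * _); rewrite pintE; last lra.
by apply: eq_Rintegral => t _; rewrite ellE.
Qed.

Lemma rolle_seq F (x : R) (s : seq R) : path <%R x s -> root F x -> all (root F) s ->
  exists t : seq R, [/\ size t = size s, path <%R x t, all (root F^`()%R) t &
    all (fun y => y < last x s) t].
Proof.
elim/last_ind: s => [|s z IH]; first by move=> _ _ _; exists [::].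
rewrite rcons_path all_rcons last_rcons => /andP[ps lz] rx /andP[rz rs].
have [t [st pt rt lt]] := IH ps rx rs.
have hl : root F (last x s).
  by case: (lastP s) rs => [|s' w] //; rewrite all_rcons last_rcons => /andP[].
have [|c] := @poly_rolle _ (last x s) z F lz.
  by rewrite (rootP hl) (rootP rz).
rewrite in_itv /= => /andP[c1 c2] dc.
exists (rcons t c); split.
- by rewrite !size_rcons st.
- rewrite rcons_path pt /=; case: (lastP t) lt => [|t' w] /=.
    move=> _; apply: le_lt_trans c1.
    have /allP := order_path_min lt_trans ps; case: (lastP s) => [|s' w] //= h.
    by rewrite last_rcons ltW// h// mem_rcons inE eqxx.
  by rewrite last_rcons all_rcons => /andP[h _]; exact: lt_trans c1.
- by rewrite all_rcons rt rootE dc eqxx.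
- rewrite all_rcons c2 /=; apply/allP => y /(allP lt) h.
  exact: lt_trans h lz.
Qed.

Lemma rolle_interior F (a b : R) (s : seq R) : a < b -> sorted <%R s -> all (fun y => a < y < b) s ->
  root F a -> root F b -> all (root F) s ->
  exists t : seq R, [/\ size t = (size s).+1, sorted <%R t, all (fun y => a < y < b) t &
    all (root F^`()%R) t].
Proof.
move=> ab ss sab ra rb rs.
have pth : path <%R a (rcons s b).
  rewrite rcons_path; apply/andP; split.
    by rewrite path_min_sorted//; apply/allP => y /(allP sab) /andP[].
  by case: (lastP s) sab => [|s' w] //=; rewrite all_rcons last_rcons => /andP[/andP[]].
have [t [st pt rt lt]] := rolle_seq pth ra (etrans (all_rcons _ _ _) (introT andP (conj rb rs))).
exists t; split=> //.
- by rewrite st size_rcons.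
- exact: path_sorted pt.
- rewrite last_rcons in lt; apply/allP => y yt; rewrite (allP lt _ yt) andbT.
  by have /allP := order_path_min lt_trans pt; apply.
Qed.

Lemma rolle_sorted F (s : seq R) (a b : R) : sorted <%R s -> all (fun y => a < y < b) s ->
  all (root F) s ->
  exists t : seq R, [/\ size t = (size s).-1, sorted <%R t, all (fun y => a < y < b) t &
    all (root F^`()%R) t].
Proof.
case: s => [|x s] /=; first by exists [::].
move=> ps /andP[/andP[ax xb] sab] /andP[rx rs].
have [t [st pt rt lt]] := rolle_seq ps rx rs; exists t; split=> //; first exact: path_sorted pt.
apply/allP => y yt; have /allP h := order_path_min lt_trans pt.
rewrite (lt_trans ax (h _ yt)) /=; apply: lt_le_trans (allP lt _ yt) _.
by case: (lastP s) sab => [|s' w] /=; [rewrite ltW|rewrite all_rcons last_rcons => /andP[/andP[_ /ltW]]].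
Qed.

(** As many distinct roots as the degree leave no room for others; applied to the Legendre
    polynomials and to their derivatives. *)
Lemma rootsR_full F (t : seq R) : F != 0 -> size F = (size t).+1 -> sorted <%R t -> all (root F) t ->
  perm_eq (rootsR F) t /\ F = lead_coef F *: nodal (rootsR F).
Proof.
move=> F0 sF st rt.
have ut : uniq t := sorted_uniq lt_trans ltxx st.
have rR x : (x \in rootsR F) = root F x by rewrite -(roots_on_rootsR F0) in_itv.
have uR : uniq (rootsR F) by exact: uniq_roots.
have sub : {subset t <= rootsR F} by move=> x /(allP rt); rewrite rR.
have sz : (size (rootsR F) <= size t)%N.
  by rewrite -ltnS -sF; apply: max_poly_roots => //; apply/allP => x; rewrite rR.
have [eqm] := uniq_min_size ut sub sz => seq_.
have pe : perm_eq (rootsR F) t by apply: uniq_perm => // x; rewrite eqm.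
split=> //; apply: all_roots_prod_XsubC; first by rewrite (perm_size pe).
- by apply/allP => x; rewrite rR.
- by rewrite uniq_rootsE.
Qed.

Lemma nodal_monic xs : nodal xs \is monic. Proof. exact: monic_prod_XsubC. Qed.

Section legendre.
Variable m : nat.
Let W : {poly R} := ('X^2 - 1) ^+ m.

Let Wend k (a : R) : a ^+ 2 = 1 -> (k < m)%N -> root W^`(k)%R a.
Proof.
move=> a1 km.
suff [g ->] : exists g, W^`(k)%R = ('X - a%:P) ^+ (m - k) * g.
  by rewrite rootM rootE horner_exp hornerXsubC subrr expr0n subn_eq0 leqNgt km eqxx.
elim: k km => [|k IH] km.
  exists (('X + a%:P) ^+ m); rewrite derivn0 subn0 /W -exprMn; congr (_ ^+ m).
  have -> : 1 = (a%:P) ^+ 2 :> {poly R} by rewrite -polyC_exp a1.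
  by rewrite subr_sqr.
have [g hg] := IH (ltnW km).
exists (g *+ (m - k) + ('X - a%:P) * g^`()%R).
rewrite derivnS hg derivM deriv_exp derivXsubC mul1r.
have -> : (m - k)%N = (m - k.+1).+1 by lia.
by rewrite /= exprS mulrnAl mulrDr mulrnAr; congr (_ + _); ring.
Qed.

(** Up to order [m - 1] the derivatives of [('X^2 - 1) ^+ m] still vanish at both ends, so each use
    of Rolle's theorem gains one interior root. *)
Let W_roots k : (k <= m)%N -> exists t : seq R,
  [/\ size t = k, sorted <%R t, all (fun y => -1 < y < 1) t & all (root W^`(k)%R) t].
Proof.
elim: k => [|k IH] km; first by exists [::].
have [t [st ss tt rt]] := IH (ltnW km).
have [|||t' [st' ss' tt' rt']] := @rolle_interior W^`(k)%R (-1) 1 t _ ss tt _ _ rt.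
- lra.
- by apply: Wend; rewrite ?sqrrN ?expr1n.
- by apply: Wend; rewrite ?expr1n.
by exists t'; split=> //; rewrite ?st' ?st// derivnS.
Qed.

Let cst : R := ((2 ^ m * m`!)%:R)^-1.
Let cst0 : cst != 0.
Proof. by rewrite invr_eq0 pnatr_eq0 -lt0n muln_gt0 expn_gt0 fact_gt0. Qed.

Lemma legendreE : legendre m = cst *: W^`(m)%R. Proof. by []. Qed.

Lemma size_legendre : size (legendre m : {poly R}) = m.+1.
Proof.
have s3 : size ('X^2 - 1 : {poly R}) = 3%N by rewrite size_XnsubC.
have W0 : W != 0 by rewrite expf_neq0// -size_poly_eq0 s3.
rewrite legendreE size_scale// size_derivn polySpred// size_exp s3 /=; lia.
Qed.

Lemma legendre_neq0 : legendre m != 0 :> {poly R}.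
Proof. by rewrite -size_poly_eq0 size_legendre. Qed.

Lemma legendre_roots : exists t : seq R,
  [/\ size t = m, sorted <%R t, all (fun y => -1 < y < 1) t & all (root (legendre m)) t].
Proof.
have [t [st ss tt rt]] := W_roots (leqnn m).
exists t; split=> //; apply/allP => x /(allP rt); rewrite legendreE rootZ//.
Qed.

(** By Rodrigues' formula: each integration by parts has vanishing boundary terms and lowers the
    degree of [q]. *)
Lemma legendre_orthogonal q : (size q <= m)%N -> pint (-1) 1 (legendre m * q) = 0.
Proof.
move=> sq; rewrite legendreE -scalerAl pintZ.
suff h k : (k <= m)%N -> forall q, (size q <= k)%N -> pint (-1) 1 (W^`(k)%R * q) = 0.
  by rewrite (h m)// mulr0.
elim: k => [|k IH] km {sq}q sq.
  by move: sq; rewrite leqn0 size_poly_eq0 => /eqP ->; rewrite mulr0 pint0.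
rewrite derivnS pint_ibp IH ?(ltnW km)//; last first.
  by rewrite size_deriv; case: (size q) sq.
rewrite (rootP (Wend _ km)) ?expr1n// (rootP (Wend _ km)) ?sqrrN ?expr1n//.
by rewrite !mul0r !subr0.
Qed.

End legendre.

Lemma legendre_nodal m : uniq (rootsR (legendre m : {poly R})) /\
  size (rootsR (legendre m : {poly R})) = m /\
  legendre m = lead_coef (legendre m) *: nodal (rootsR (legendre m)).
Proof.
have [t [st ss tt rt]] := legendre_roots m.
have [pe e] := rootsR_full (legendre_neq0 m) (etrans (size_legendre m) (congr1 S (esym st))) ss rt.
by split; [exact: uniq_roots|split; [rewrite (perm_size pe)|]].
Qed.

(** After division by the nodal polynomial, the remainder is integrated exactly by interpolation and
    the quotient, of degree less than [m], is orthogonal to the Legendre polynomial. *)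
Lemma gauss_exact m f : (size f <= m.*2)%N -> rule_sum (gauss_legendre m) f = pint (-1) 1 f.
Proof.
have [U [sz e]] := legendre_nodal m; set xs := rootsR _ in U sz e *.
move=> sf; rewrite /gauss_legendre -/xs.
have sN : size (nodal xs) = m.+1 by rewrite size_prod_XsubC sz.
have N0 : nodal xs != 0 by rewrite -size_poly_eq0 sN.
rewrite [in LHS](divp_eq f (nodal xs)) rule_sumD interpolatory_nodal0 add0r.
rewrite interpolatory_exact//; last by rewrite sz -ltnS -sN ltn_modp.
rewrite [in RHS](divp_eq f (nodal xs)) pintD.
set q := f %/ nodal xs; have sq : (size q <= m)%N by rewrite size_divp// sN /= leq_subLR addnn.
have lc0 : lead_coef (legendre m : {poly R}) != 0 by rewrite lead_coef_eq0 legendre_neq0.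
have -> : nodal xs = (lead_coef (legendre m))^-1 *: legendre m by rewrite [X in _ *: X]e scalerA mulVf// scale1r.
rewrite -scalerAr pintZ mulrC mulrC [_ * legendre m]mulrC.
by rewrite legendre_orthogonal ?mulr0 ?add0r.
Qed.

(** The polynomial [H] vanishes at all the nodes, is nonnegative on [-1, 1] and has leading
    coefficient -1. Adding a multiple of [H] brings the degree of [f] below 2p, where the rule is
    exact; so [gam] is the integral of [H]. *)
Lemma lobatto_defect p : (0 < p)%N -> exists2 gam : R, 0 < gam &
  forall f, (size f <= p.*2.+1)%N ->
  rule_sum (gauss_lobatto p.+1) f = pint (-1) 1 f + gam * f`_p.*2.
Proof.
move=> p0; have p2 : (p.+1 + p.-1 = p.*2)%N by lia.
have p3 : ((3 + (p + p).-1).-1 = p.*2.+1)%N by lia.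
rewrite /gauss_lobatto /=.
set D := (legendre p)^`()%R; set rs := rootsR D.
have sD : size D = p by rewrite size_deriv size_legendre.
have D0 : D != 0 by rewrite -size_poly_eq0 sD -lt0n.
have [t0 [st0 ss0 tt0 rt0]] := legendre_roots p.
have [t [st ss tt rt]] := rolle_sorted ss0 tt0 rt0; rewrite st0 in st.
have [pe e] : perm_eq rs t /\ D = lead_coef D *: nodal rs.
  by apply: rootsR_full => //; rewrite sD st prednK.
have Urs : uniq rs by exact: uniq_roots.
have rs01 x : x \in rs -> -1 < x < 1 by rewrite (perm_mem pe) => /(allP tt).
set xs := _ :: _.
have szrs : size rs = p.-1 by rewrite (perm_size pe).
have szxs : size xs = p.+1 by rewrite /= size_rcons szrs; lia.
have Uxs : uniq xs.
  rewrite /= rcons_uniq mem_rcons inE negb_or Urs andbT -!andbA; apply/and3P; split.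
  - by rewrite eq_sym -subr_eq0 opprK -(natrD _ 1 1) pnatr_eq0.
  - by apply/negP => /rs01; rewrite ltxx.
  - by apply/negP => /rs01; rewrite ltxx andbF.
have nodE : nodal xs = ('X^2 - 1) * nodal rs.
  rewrite /nodal big_cons -cats1 big_cat /= big_seq1 polyCN opprK polyC1; ring.
have lc0 : lead_coef D != 0 by rewrite lead_coef_eq0.
have nodD : nodal xs = (lead_coef D)^-1 *: (('X^2 - 1) * D).
  by rewrite nodE scalerAr [X in _ *: X]e scalerA mulVf// scale1r.
have sN : size (nodal xs) = p.+2 by rewrite size_prod_XsubC szxs.
have N0 : nodal xs != 0 by rewrite -size_poly_eq0 sN.
have exact f : (size f <= p.*2)%N -> rule_sum (interpolatory xs) f = pint (-1) 1 f.
  move=> sf; rewrite [in LHS](divp_eq f (nodal xs)) rule_sumD interpolatory_nodal0 add0r.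
  rewrite interpolatory_exact//; last by rewrite szxs -ltnS -sN ltn_modp.
  rewrite [in RHS](divp_eq f (nodal xs)) pintD.
  set q := f %/ nodal xs; have sq : (size q <= p.-1)%N by rewrite size_divp// sN /= leq_subLR p2.
  (* The factor ['X^2 - 1] kills the boundary terms when the derivative of the Legendre polynomial
     is integrated by parts. *)
  have -> : q * nodal xs = (lead_coef D)^-1 *: (D * (('X^2 - 1) * q)).
    by rewrite nodD -!mul_polyC; ring.
  rewrite pintZ pint_ibp.
  have -> : (('X^2 - 1) * q).[1] = 0 :> R by rewrite hornerM !hornerE expr1n subrr mul0r.
  have -> : (('X^2 - 1) * q).[-1] = 0 :> R by rewrite hornerM !hornerE sqrrN expr1n subrr mul0r.
  rewrite legendre_orthogonal ?mulr0 ?subrr ?mul0r ?add0r//; last first.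
    have h := size_polyMleq ('X^2 - 1) q.
    have s3 : size ('X^2 - 1 : {poly R}) = 3%N by rewrite size_XnsubC.
    rewrite size_deriv; rewrite s3 in h; move: h sq p0; set u := size _; set v := size q.
    by clear; lia.
  by rewrite mulr0 add0r.
pose H : {poly R} := (1 - 'X^2) * nodal rs ^+ 2.
have X1 : (1 - 'X^2 : {poly R}) = - ('X^2 - 1) by rewrite opprB.
have sX : size ('X^2 - 1 : {poly R}) = 3%N by rewrite size_XnsubC.
have lX : lead_coef ('X^2 - 1 : {poly R}) = 1.
  by apply/eqP; rewrite -[_ == _]/(_ \is monic) monicXnsubC.
have snod : size (nodal rs) = p by rewrite size_prod_XsubC szrs prednK.
have nod0 : nodal rs != 0 by rewrite -size_poly_eq0 snod -lt0n.
have H0 : H != 0.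
  by rewrite mulf_neq0 ?expf_neq0// X1 oppr_eq0 -size_poly_eq0 sX.
have sH : size H = p.*2.+1.
  rewrite size_mul ?expf_neq0//; last by rewrite X1 oppr_eq0 -size_poly_eq0 sX.
  by rewrite X1 size_polyN sX expr2 size_mul// snod.
have lH : H`_p.*2 = -1.
  have -> : p.*2 = (size H).-1 by rewrite sH.
  rewrite -/(lead_coef H) lead_coefM lead_coef_exp (eqP (nodal_monic rs)) expr1n mulr1.
  by rewrite X1 lead_coefN lX.
have H1 : rule_sum (interpolatory xs) H = 0.
  have -> : H = - nodal rs * nodal xs by rewrite nodE /H; ring.
  exact: interpolatory_nodal0.
exists (pint (-1) 1 H).
  apply: pint_gt0 => //.
  move=> x /andP[x1 x2]; rewrite /H hornerM horner_exp mulr_ge0 ?sqr_ge0//.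
  have -> : (1 - 'X^2).[x] = (1 - x) * (1 + x) by rewrite !hornerE; ring.
  by rewrite mulr_ge0 ?subr_ge0// -lerBlDl sub0r.
move=> f sf; pose g := f + f`_p.*2 *: H.
have sg : (size g <= p.*2)%N.
  apply/leq_sizeP => i hi; rewrite coefD coefZ.
  have [->|ne] := eqVneq i p.*2; first by rewrite lH mulrN1 subrr.
  have h : (p.*2 < i)%N by rewrite ltn_neqAle eq_sym ne.
  have hH : (size H <= i)%N by rewrite sH.
  by rewrite (nth_default 0 hH) (nth_default 0 (leq_trans sf h)) mulr0 addr0.
have := exact g sg; rewrite rule_sumD rule_sumZ H1 mulr0 addr0 pintD pintZ => ->.
by rewrite mulrC.
Qed.

Lemma optimal_tau_lt1 p : (0 < p <= 7)%N -> 0 < 1 - optimal_tau p :> R.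
Proof.
case: p => [|[|[|[|[|[|[|[|]]]]]]]] // _; rewrite /optimal_tau ?opprK; try lra.
Qed.

(** The Gauss part is exact up to degree 2p + 1, so the defect is that of the Lobatto part, with the
    weight [1 - optimal_tau p], which is positive. *)
Lemma optimal_rule_defect p : (0 < p <= 7)%N -> exists2 kap : R, 0 < kap &
  forall f, (size f <= p.*2.+1)%N ->
  rule_sum (optimal_rule p) f = pint (-1) 1 f + kap * f`_p.*2.
Proof.
move=> hp; have /andP[p0 _] := hp; have [gam g0 hg] := lobatto_defect p0.
exists ((1 - optimal_tau p) * gam); first by rewrite mulr_gt0// optimal_tau_lt1.
move=> f sf; rewrite rule_sum_blend gauss_exact ?hg//; last by lia.
ring.
Qed.

(* The Legendre component of top degree alone accounts for the leading coefficient. *)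
Lemma pint_sqr_lead m : exists2 c : R, 0 < c &
  forall q, (size q <= m.+1)%N -> c * q`_m ^+ 2 <= pint (-1) 1 (q * q).
Proof.
pose L : {poly R} := legendre m.
have lc0 : lead_coef L != 0 by rewrite lead_coef_eq0 legendre_neq0.
pose M := (lead_coef L)^-1 *: L.
have sM : size M = m.+1 by rewrite size_scale ?invr_eq0// size_legendre.
have lM : M`_m = 1.
  have lE : L`_m = lead_coef L by rewrite lead_coefE size_legendre.
  by rewrite coefZ lE mulVf.
have M0 : M != 0 by rewrite -size_poly_eq0 sM.
exists (pint (-1) 1 (M * M)).
  apply: pint_gt0; [exact: N11|exact: mulf_neq0|].
  by move=> x _; rewrite hornerM -expr2 sqr_ge0.
move=> q sq; pose r := q - q`_m *: M.
have sr : (size r <= m)%N.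
  apply/leq_sizeP => i hi; rewrite coefB coefZ.
  have [->|ne] := eqVneq i m; first by rewrite lM mulr1 subrr.
  have h : (m < i)%N by rewrite ltn_neqAle eq_sym ne.
  have hM : (size M <= i)%N by rewrite sM.
  by rewrite (nth_default 0 hM) (nth_default 0 (leq_trans sq h)) mulr0 subr0.
have -> : q * q = q`_m ^+ 2 *: (M * M) + ((2 * q`_m) *: (M * r) + r * r).
  have -> : q = q`_m *: M + r by rewrite addrC subrK.
  have -> : (q`_m *: M + r)`_m = q`_m by rewrite addrC subrK.
  by rewrite -!mul_polyC polyCM polyC_exp; ring.
rewrite pintD pintZ mulrC lerDl pintD pintZ.
have -> : pint (-1) 1 (M * r) = 0 by rewrite -scalerAl pintZ legendre_orthogonal ?mulr0.
rewrite mulr0 add0r; apply: pint_ge0; first exact: ltW N11.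
by move=> x _; rewrite hornerM -expr2 sqr_ge0.
Qed.

End rules.

(** * One-dimensional discrete forms *)

Section cell_functions.
Context {R : realType}.
Implicit Types (F G H : nat -> R -> R).

Definition csub F G : nat -> R -> R := fun e x => F e x - G e x.

Lemma pws0_csub n F G : pws0 n F -> pws0 n G -> pws0 n (csub F G).
Proof.
move=> [n0 sF mF F0 F1] [_ sG mG G0 G1]; split=> //.
- move=> e; have := smooth1D (sF e) (smooth1M (smooth1_cst (-1)) (sG e)).
  by under eq_fun do rewrite mulN1r.
- by move=> e en; rewrite /csub mF// mG.
- by rewrite /csub F0 G0 subrr.
- by rewrite /csub F1 G1 subrr.
Qed.

Lemma cderiv_csub F G : (forall e, smooth1 (F e)) -> (forall e, smooth1 (G e)) ->
  cderiv (csub F G) = csub (cderiv F) (cderiv G).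
Proof.
move=> sF sG; apply/funext => e; apply: derive1_is => x.
exact: is_deriveB (smooth1_is_derive (sF e) x) (smooth1_is_derive (sG e) x).
Qed.

Lemma bpw_ge0 n F : 0 <= bpw n F F.
Proof. by apply: I01_ge0 => t _; rewrite /pw /cmul -expr2 sqr_ge0. Qed.

Lemma bpwBl n F G H : (0 < n)%N -> (forall e, continuous (F e)) -> (forall e, continuous (G e)) ->
  (forall e, continuous (H e)) -> bpw n (csub F G) H = bpw n F H - bpw n G H.
Proof.
move=> n0 cF cG cH; rewrite /bpw -I01B; try exact: bmeas_pwM.
by apply: eq_I01 => t _; rewrite /pw /cmul /csub mulrBl.
Qed.

Lemma bpwBr n F G H : (0 < n)%N -> (forall e, continuous (F e)) -> (forall e, continuous (G e)) ->
  (forall e, continuous (H e)) -> bpw n H (csub F G) = bpw n H F - bpw n H G.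
Proof. by move=> *; rewrite bpwC bpwBl// !(bpwC _ H). Qed.

Lemma bpw_quad n F G t : (0 < n)%N -> (forall e, continuous (F e)) -> (forall e, continuous (G e)) ->
  0 <= bpw n F F + 2 * t * bpw n F G + t ^+ 2 * bpw n G G.
Proof.
move=> n0 cF cG.
have h1 := bmeas_pwM n0 cF cF; have h2 := bmeas_pwM n0 cF cG; have h3 := bmeas_pwM n0 cG cG.
rewrite /bpw -I01Z// -[t ^+ 2 * _]I01Z// -I01D//; last exact: bmeasZ.
rewrite -I01D; [|by apply: bmeasD => //; exact: bmeasZ|exact: bmeasZ].
apply: I01_ge0 => x _; rewrite /pw /cmul; set u := F _ _; set v := G _ _.
by have := sqr_ge0 (u + t * v); congr (0 <= _); ring.
Qed.

Lemma bpw_CS n F G : (0 < n)%N -> (forall e, continuous (F e)) -> (forall e, continuous (G e)) ->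
  bpw n F G ^+ 2 <= bpw n F F * bpw n G G.
Proof.
move=> n0 cF cG; apply: discriminant => [|t]; first exact: bpw_ge0.
exact: bpw_quad.
Qed.

Lemma young (b u v t : R) : 0 < t -> b ^+ 2 <= u * v -> 0 <= u -> 0 <= v -> `|b| <= t * u + t^-1 * v.
Proof.
move=> t0 h u0 v0; rewrite -(@ler_pXn2r _ 2)// ?nnegrE//; last first.
  by rewrite addr_ge0// mulr_ge0// ?invr_ge0 ltW.
rewrite real_normK ?num_real//; apply: le_trans h _.
have -> : (t * u + t^-1 * v) ^+ 2 = u * v + (u * v + (t * u) ^+ 2 + (t^-1 * v) ^+ 2).
  by field; rewrite gt_eqF.
by rewrite lerDl !addr_ge0 ?sqr_ge0// mulr_ge0.
Qed.

Lemma bpw_poly n (f g : nat -> {poly R}) : (0 < n)%N ->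
  bpw n (fun e x => (f e).[x]) (fun e x => (g e).[x]) =
  \sum_(e < n) pint (node n e) (node n e.+1) (f e * g e).
Proof.
move=> n0.
have cc : ccont n (cmul (fun e x => (f e).[x]) (fun e x => (g e).[x])).
  apply: ccont_continuous => e x; apply: cvgM; exact: (smooth1_continuous (smooth1_horner _)).
apply: (I01_pw_FTC (P := fun e x => (pprim (f e * g e)).[x]) n0 cc) => e en x _.
rewrite /cmul -hornerM -[in X in is_derive _ _ _ X](pprimK (f e * g e)).
exact: is_derive_horner.
Qed.

Lemma cderiv_poly (f : nat -> {poly R}) :
  cderiv (fun e x => (f e).[x]) = fun e x => ((f e)^`()%R).[x].
Proof. by apply/funext => e; apply: derive1_is => x; exact: is_derive_horner. Qed.

End cell_functions.

(** * Transport of polynomials to the reference cell *)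

Section affine_change.
Context {R : realType}.
Implicit Types (f A : {poly R}).

Definition cell_map (n e : nat) : {poly R} := (2 * n%:R)^-1 *: 'X + ((e%:R + 2^-1) / n%:R)%:P.

Lemma horner_cell_map n e x : (cell_map n e).[x] = (e%:R + (1 + x) / 2) / n%:R.
Proof.
have [->|n0] := eqVneq n 0%N; first by rewrite !hornerE /= !(mulr0, invr0, mul0r) addr0.
by rewrite !hornerE; field; rewrite pnatr_eq0.
Qed.

Lemma size_cell_map n e : (size (cell_map n e) <= 2)%N.
Proof.
apply: leq_trans (size_polyD _ _) _; rewrite geq_max; apply/andP; split.
  by apply: leq_trans (size_scale_leq _ _) _; rewrite size_polyX.
by rewrite (leq_trans (size_polyC_leq1 _)).
Qed.

Lemma coef_comp_cell f n e N : (size f <= N.+1)%N ->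
  (f \Po cell_map n e)`_N = f`_N * (2 * n%:R) ^- N.
Proof.
move=> sf.
have sA := size_cell_map n e; set A := cell_map n e in sA *.
have A1 : A`_1 = (2 * n%:R)^-1 by rewrite coefD coefZ coefX coefC /= mulr1 addr0.
have sX i : (size (A ^+ i)%R <= i.+1)%N.
  elim: i => [|i IH]; first by rewrite expr0 size_poly1.
  rewrite exprS; apply: leq_trans (size_polyMleq _ _) _.
  by move: sA IH; set u := size _; set v := size _; clear; lia.
have top i : (A ^+ i)`_i = A`_1 ^+ i.
  elim: i => [|i IH]; first by rewrite !expr0 coef1.
  rewrite exprS coefM !big_ord_recl big1 /= => [|j _]; last first.
    by rewrite [A`_ _]nth_default ?mul0r// (leq_trans sA).
  by rewrite subn0 [(A ^+ i)`_i.+1]nth_default// mulr0 add0r addr0 /bump /= subSS subn0 IH exprS.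
have -> : f \Po A = \sum_(i < N.+1) f`_i *: A ^+ i.
  rewrite comp_polyE (big_ord_widen _ (fun i => f`_i *: A ^+ i) sf) big_mkcond /=.
  by apply: eq_bigr => i _; case: ltnP => // h; rewrite nth_default ?scale0r.
rewrite coef_sum big_ord_recr /= coefZ top A1 exprVn big1 ?add0r// => i _.
by rewrite coefZ [X in _ * X]nth_default ?mulr0// (leq_trans (sX i)).
Qed.

Lemma pint_comp_cell f n e : (0 < n)%N ->
  pint (node n e) (node n e.+1) f = (2 * n%:R)^-1 * pint (-1) 1 (f \Po cell_map n e).
Proof.
move=> n0; have nR : n%:R != 0 :> R by rewrite pnatr_eq0 -lt0n.
have -> : f \Po cell_map n e = (2 * n%:R) *: (pprim f \Po cell_map n e)^`()%R.
  rewrite deriv_comp pprimK /cell_map derivD derivC derivZ derivX addr0 -scalerAr mulr1 scalerA.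
  by rewrite mulfV ?scale1r// mulf_neq0// pnatr_eq0.
rewrite pintZ mulKf; last by rewrite mulf_neq0// pnatr_eq0.
rewrite pint_deriv !horner_comp !horner_cell_map /pint /node.
by congr (_.[_] - _.[_]); rewrite -?natr1; field.
Qed.

End affine_change.

Section one_dimension.
Context {R : realType}.
Variable p : nat.
Hypothesis hp : (0 < p <= 7)%N.
Let p0 : (0 < p)%N. Proof. by case/andP: hp. Qed.
(** [kap] is the defect of the rule on the monomial of degree 2p, [clead] the constant of an inverse
    inequality on the reference cell; the values given to them in the end depend on [p] alone. *)
Variables kap clead : R.
Hypothesis kap0 : 0 < kap.
Hypothesis clead0 : 0 < clead.
Hypothesis hkap : forall f : {poly R}, (size f <= p.*2.+1)%N ->
  rule_sum (optimal_rule p) f = pint (-1) 1 f + kap * f`_p.*2.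
Hypothesis hlead : forall q : {poly R}, (size q <= p)%N -> clead * q`_p.-1 ^+ 2 <= pint (-1) 1 (q * q).

Section fixed_n.
Variable n : nat.
Hypothesis n0 : (0 < n)%N.
Local Notation m := (n + p - 2)%N.
Local Notation piece := (@bspline_piece R p n).
Let nR : n%:R != 0 :> R. Proof. by rewrite pnatr_eq0 -lt0n. Qed.
Let nR0 : 0 < n%:R :> R. Proof. by rewrite ltr0n. Qed.

(** The shift drops the first B-spline, and the range of [i] drops the last one: these are the two
    that do not vanish at the ends. *)
Definition cB (i : 'I_m) : nat -> R -> R := fun e x => (piece e p i.+1).[x].
Definition vpol (c : 'I_m -> R) (e : nat) : {poly R} := \sum_i c i *: piece e p i.+1.
Definition cS (c : 'I_m -> R) : nat -> R -> R := fun e x => (vpol c e).[x].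

Lemma cSE c : cS c = lincell cB c.
Proof.
apply/funext => e; apply/funext => x; rewrite /cS /lincell horner_sum.
by apply: eq_bigr => i _; rewrite hornerZ.
Qed.

Lemma pws0_cB i : pws0 n (cB i).
Proof.
split=> //.
- by move=> e; exact: smooth1_horner.
- by move=> e en; exact: piece_continuous.
- rewrite /cB piece_at0//; case: eqP => //; lia.
- rewrite /cB piece_at1//; have := ltn_ord i; case: eqP => //; lia.
Qed.

Lemma pws0_cS c : pws0 n (cS c).
Proof. by rewrite cSE; apply: pws0_lincell => // i; exact: pws0_cB. Qed.

Lemma size_vpol c e : (size (vpol c e) <= p.+1)%N.
Proof.
apply: (big_ind (fun r : {poly R} => (size r <= p.+1)%N)).
- by rewrite size_poly0.
- by move=> r1 r2 h1 h2; apply: leq_trans (size_polyD _ _) _; rewrite geq_max h1.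
- by move=> i _; apply: leq_trans (size_scale_leq _ _) _; exact: size_piece.
Qed.

(** [GM] and [GK] are the exact mass and stiffness matrices; their counterparts with quadrature are
    [GH] and [GKh]. *)
Definition GM (i j : 'I_m) : R := bpw n (cB i) (cB j).
Definition GK (i j : 'I_m) : R := apw n (cB i) (cB j).

Lemma sym_GM : sym GM. Proof. by move=> i j; exact: bpwC. Qed.

Lemma sym_GK : sym GK. Proof. by move=> i j; exact: apwC. Qed.

Lemma mform_GM c c' : mform GM c c' = bpw n (cS c) (cS c').
Proof.
rewrite !cSE bpw_lincell//; last by move=> i e; apply: smooth1_continuous; exact: pws0_smooth (pws0_cB i) e.
by apply: eq_bigr => i _; apply: eq_bigr => j _; rewrite mulrC.
Qed.

Lemma mform_GK c c' : mform GK c c' = apw n (cS c) (cS c').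
Proof.
rewrite !cSE apw_lincell//; last by move=> i e; exact: pws0_smooth (pws0_cB i) e.
by apply: eq_bigr => i _; apply: eq_bigr => j _; rewrite mulrC.
Qed.

Local Notation Or := (@optimal_rule R p).

Definition cell_rule (f : nat -> {poly R}) : R :=
  \sum_(e < n) \sum_(q < size Or) ((nth (0, 0) Or q).2 / (2 * n%:R)) *
    (f e).[(e%:R + (1 + (nth (0, 0) Or q).1) / 2) / n%:R].

Definition GH (i j : 'I_m) : R := cell_rule (fun e => piece e p i.+1 * piece e p j.+1).
Definition GKh (i j : 'I_m) : R := cell_rule (fun e => (piece e p i.+1)^`()%R * (piece e p j.+1)^`()%R).

Lemma cell_ruleE (f : nat -> {poly R}) : (forall e, (size (f e) <= p.*2.+1)%N) ->
  cell_rule f = \sum_(e < n) (pint (node n e) (node n e.+1) (f e) + kap * (2 * n%:R) ^- p.*2.+1 * (f e)`_p.*2).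
Proof.
move=> sf; apply: eq_bigr => e _.
rewrite pint_comp_cell//.
have sc : (size (f e \Po cell_map n e) <= p.*2.+1)%N.
  apply: leq_trans (size_comp_poly_leq _ _) _.
  have := size_cell_map (R := R) n e; have := sf e.
  set u := size _; set v := size _ => h1 h2; have : (u.-1 * v.-1 <= p.*2 * 1)%N by apply: leq_mul; lia.
  lia.
have := hkap sc; rewrite (coef_comp_cell _ _ (sf e)) => h.
transitivity ((2 * n%:R)^-1 * rule_sum Or (f e \Po cell_map n e)).
  rewrite /rule_sum (big_nth (0, 0)) big_mkord mulr_sumr; apply: eq_bigr => q _.
  by rewrite horner_comp horner_cell_map; ring.
have y0 : 2 * n%:R != 0 :> R by rewrite mulf_neq0// pnatr_eq0.
move: h; set y := 2 * n%:R in y0 *; move=> ->; rewrite mulrDr; congr (_ + _); rewrite [y ^+ p.*2.+1]exprS.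
by field; rewrite ?expf_neq0// y0.
Qed.

Definition top (c : 'I_m -> R) (e : nat) : R := (vpol c e)`_p.

Lemma coefM_top (f g : {poly R}) : (size f <= p.+1)%N -> (size g <= p.+1)%N -> (f * g)`_p.*2 = f`_p * g`_p.
Proof.
move=> sf sg; have h : (p < p.*2.+1)%N by lia.
rewrite coefM (bigD1 (Ordinal h))//= big1 ?addr0; first by rewrite -addnn addKn.
move=> j; rewrite -val_eqE /= => jp; have [pj|pj] := ltnP p j.
  by rewrite [f`_j]nth_default ?mul0r// (leq_trans sf).
by rewrite [g`_ _]nth_default ?mulr0// (leq_trans sg)//; lia.
Qed.

Lemma size_mul_top (f g : {poly R}) : (size f <= p.+1)%N -> (size g <= p.+1)%N -> (size (f * g)%R <= p.*2.+1)%N.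
Proof.
move=> sf sg; apply: leq_trans (size_polyMleq _ _) _.
by move: sf sg; set u := size _; set v := size _; clear; lia.
Qed.

Lemma sym_GH : sym GH.
Proof. by move=> i j; rewrite /GH; congr cell_rule; apply/funext => e; rewrite mulrC. Qed.

Lemma mform_cell_rule (f : 'I_m -> nat -> {poly R}) (c c' : 'I_m -> R) :
  mform (fun i j => cell_rule (fun e => f i e * f j e)) c c' =
  cell_rule (fun e => (\sum_i c i *: f i e) * (\sum_i c' i *: f i e)).
Proof.
rewrite /mform /cell_rule.
under eq_bigr => i _ do under eq_bigr => j _ do rewrite mulr_suml.
under eq_bigr => i _ do rewrite exchange_big /=.
rewrite exchange_big /=; apply: eq_bigr => e _.
under eq_bigr => i _ do under eq_bigr => j _ do rewrite mulr_suml.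
under eq_bigr => i _ do rewrite exchange_big /=.
rewrite exchange_big /=; apply: eq_bigr => q _.
rewrite hornerM !horner_sum mulr_suml mulr_sumr; apply: eq_bigr => i _.
rewrite !mulr_sumr; apply: eq_bigr => j _; rewrite !hornerM !hornerZ; ring.
Qed.

(* Excess of the discrete mass form over the exact one: only top coefficients enter, because the
   rule is exact in degree less than 2p. *)
Definition defect (c c' : 'I_m -> R) : R :=
  kap * (2 * n%:R) ^- p.*2.+1 * \sum_(e < n) top c e * top c' e.

Lemma mform_GH c c' : mform GH c c' = bpw n (cS c) (cS c') + defect c c'.
Proof.
rewrite mform_cell_rule (cell_ruleE (f := fun e => vpol c e * vpol c' e)); last first.
  by move=> e; apply: size_mul_top; exact: size_vpol.
rewrite big_split /= -bpw_poly// -mulr_sumr; congr (_ + _ * _); apply: eq_bigr => e _.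
by rewrite coefM_top//; exact: size_vpol.
Qed.

Lemma apw_cS c c' : apw n (cS c) (cS c') =
  \sum_(e < n) pint (node n e) (node n e.+1) ((vpol c e)^`()%R * (vpol c' e)^`()%R).
Proof. by rewrite /apw !cderiv_poly bpw_poly. Qed.

Lemma size_dvpol c e : (size (vpol c e)^`()%R <= p)%N.
Proof. by rewrite size_deriv; have := size_vpol c e; case: (size _). Qed.

(** Products of first derivatives have degree at most 2p - 2, where the rule is exact. *)
Lemma mform_GKh c c' : mform GKh c c' = apw n (cS c) (cS c').
Proof.
rewrite mform_cell_rule apw_cS cell_ruleE => [|e].
  apply: eq_bigr => e _.
  have e1 b : \sum_(i < m) b i *: (piece e p i.+1)^`()%R = (vpol b e)^`()%R.
    by rewrite /vpol raddf_sum /=; apply: eq_bigr => i _; rewrite derivZ.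
  have hs : (size ((vpol c e)^`() * (vpol c' e)^`())%R <= p.*2)%N; last first.
    by rewrite !e1 (nth_default 0 hs) mulr0 addr0.
  apply: leq_trans (size_polyMleq _ _) _; have := size_dvpol c e; have := size_dvpol c' e.
  by set u := size _; set v := size _; clear; lia.
have e1 b : \sum_(i < m) b i *: (piece e p i.+1)^`()%R = (vpol b e)^`()%R.
  by rewrite /vpol raddf_sum /=; apply: eq_bigr => i _; rewrite derivZ.
by rewrite !e1; apply: size_mul_top; apply: leq_trans (size_dvpol _ _) _.
Qed.

Lemma defect_ge0 c : 0 <= defect c c.
Proof.
rewrite mulr_ge0 ?mulr_ge0 ?(ltW kap0) ?invr_ge0 ?exprn_ge0 ?mulr_ge0 ?(ltW nR0)//.
by apply: sumr_ge0 => e _; rewrite -expr2 sqr_ge0.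
Qed.

Lemma defect_CS c c' : defect c c' ^+ 2 <= defect c c * defect c' c'.
Proof.
rewrite /defect; set K := kap / _; rewrite exprMn.
have -> : K * (\sum_(e < n) top c e * top c e) * (K * (\sum_(e < n) top c' e * top c' e)) =
  K ^+ 2 * ((\sum_(e < n) top c e ^+ 2) * (\sum_(e < n) top c' e ^+ 2)).
  under eq_bigr => e _ do rewrite -expr2.
  by under [X in _ * (_ * X)]eq_bigr => e _ do rewrite -expr2; ring.
by rewrite ler_wpM2l ?sqr_ge0//; exact: sum_CS.
Qed.

(** An inverse inequality: the top coefficient of a spline is, up to the factor [p], that of its
    derivative, which [hlead] bounds by the energy on the reference cell. Scaling to cells of length
    [1 / n] leaves the factor [n^-2]. *)
Lemma defect_le c : defect c c <= kap / clead * n%:R ^- 2 * apw n (cS c) (cS c).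
Proof.
rewrite apw_cS /defect mulr_sumr mulr_sumr; apply: ler_sum => e _.
rewrite pint_comp_cell// comp_polyM.
set q := _ \Po _.
have sq : (size q <= p)%N.
  apply: leq_trans (size_comp_poly_leq _ _) _.
  have := size_cell_map (R := R) n e; have := size_dvpol c e.
  set u := size _; set v := size _ => h1 h2; have : (u.-1 * v.-1 <= p.-1 * 1)%N by apply: leq_mul; lia.
  by move: p0; clear; lia.
have := hlead sq; have -> : q`_p.-1 = top c e * p%:R * (2 * n%:R) ^- p.-1.
  have s1 : (size (vpol c e)^`()%R <= p.-1.+1)%N by rewrite prednK// size_dvpol.
  by rewrite /q (coef_comp_cell _ _ s1) coef_deriv prednK// -[_ *+ p]mulr_natr.
set P := pint _ _ _; set t := top c e; set y := 2 * n%:R => h.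
have y0 : 0 < y by rewrite mulr_gt0.
have p1 : 1 <= p%:R :> R by rewrite ler1n.
have key : clead * (t ^+ 2 * y ^- p.-1 ^+ 2) <= P.
  apply: le_trans h; rewrite ler_pM2l// !exprMn -mulrA ler_wpM2l ?sqr_ge0//.
  by rewrite ler_peMl ?sqr_ge0// exprn_ege1.
have -> : kap * y ^- p.*2.+1 * (t * t) = kap / clead * y ^- 2 * (y^-1 * (clead * (t ^+ 2 * y ^- p.-1 ^+ 2))).
  have -> : p.*2.+1 = (2 + 1 + p.-1 * 2)%N by move: p0; clear; lia.
  rewrite !exprD exprM expr1; field; do ?[apply/andP; split]; rewrite ?expf_neq0// gt_eqF//.
apply: (@le_trans _ _ (kap / clead * y ^- 2 * (y^-1 * P))).
  rewrite ler_wpM2l ?mulr_ge0 ?divr_ge0 ?invr_ge0 ?exprn_ge0 ?(ltW y0) ?(ltW kap0) ?(ltW clead0)//.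
  by rewrite ler_pM2l ?invr_gt0.
have P0 : 0 <= P by apply: le_trans key; rewrite mulr_ge0 ?(ltW clead0)// mulr_ge0 ?sqr_ge0.
rewrite ler_wpM2r ?mulr_ge0 ?invr_ge0 ?(ltW y0)//.
rewrite ler_wpM2l ?divr_ge0 ?(ltW kap0) ?(ltW clead0)// lef_pV2 ?posrE ?exprn_gt0//.
by rewrite lerXn2r ?nnegrE ?(ltW y0) ?(ltW nR0)// ler_peMl ?ler1n ?(ltW nR0).
Qed.

Lemma psd_GM : psd GM. Proof. by move=> c; rewrite mform_GM bpw_ge0. Qed.

Lemma psd_GK : psd GK. Proof. by move=> c; rewrite mform_GK bpw_ge0. Qed.

Lemma GM_le_GH c : mform GM c c <= mform GH c c.
Proof. by rewrite mform_GM mform_GH lerDl defect_ge0. Qed.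

Lemma psd_GH : psd GH. Proof. by move=> c; apply: le_trans (GM_le_GH c); exact: psd_GM. Qed.

Definition bt (k : nat) (i : 'I_m) : R := bpw n (cB i) (cphi k).

Lemma bpw_bt c k : bpw n (cS c) (cphi k) = \sum_i c i * bt k i.
Proof.
pose B' (o : 'I_m.+1) : nat -> R -> R := if unlift ord0 o is Some i then cB i else cphi k.
have := @bpw_lincell R n m.+1 B' (fun o => if unlift ord0 o is Some i then c i else 0)
   (fun o => if unlift ord0 o is Some i then 0 else 1) n0.
have -> : lincell B' (fun o => if unlift ord0 o is Some i then c i else 0) = cS c.
  rewrite cSE; apply/funext => e; apply/funext => x; rewrite /lincell big_ord_recl unlift_none mul0r add0r.
  by apply: eq_bigr => i _; rewrite /B' liftK.
have -> : lincell B' (fun o => if unlift ord0 o is Some i then 0 else 1) = cphi k.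
  apply/funext => e; apply/funext => x; rewrite /lincell big_ord_recl /B' unlift_none mul1r big1 ?addr0//.
  by move=> i _; rewrite liftK mul0r.
move=> -> => [|o e].
  rewrite big_ord_recl big1 ?add0r => [|o _]; last by rewrite unlift_none !mul0r.
  apply: eq_bigr => i _; rewrite big_ord_recl liftK /B' liftK unlift_none mulr1 big1 ?addr0//.
  by move=> i' _; rewrite liftK mulr0 mul0r.
rewrite /B'; case: unliftP => [i _|_]; apply: smooth1_continuous; last exact: smooth1_phi.
exact: pws0_smooth (pws0_cB i) e.
Qed.

Lemma bessel_GH K c : \sum_(k < K) (\sum_i c i * bt k i) ^+ 2 <= mform GH c c.
Proof.
apply: le_trans (GM_le_GH c); rewrite mform_GM.
by under eq_bigr => k _ do rewrite -bpw_bt; apply: bessel_l2; exact: pws0_cS.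
Qed.

Lemma bessel_GK K c : \sum_(k < K) freq k ^+ 2 * (\sum_i c i * bt k i) ^+ 2 <= mform GK c c.
Proof.
rewrite mform_GK; under eq_bigr => k _ do rewrite -bpw_bt.
by apply: bessel_energy; exact: pws0_cS.
Qed.

Lemma gap_GH K c : mform GH c c - \sum_(k < K) (\sum_i c i * bt k i) ^+ 2 <=
  (((K%:R + 1/2) * pi) ^- 2 + kap / clead * n%:R ^- 2) * mform GK c c.
Proof.
rewrite mform_GH mform_GK mulrDl addrAC; apply: lerD; last exact: defect_le.
under eq_bigr => k _ do rewrite -bpw_bt.
by rewrite mulrC; apply: spectral_gap1; exact: pws0_cS.
Qed.

(** The constant of [gap_GH] for [K = 0], with [n^-2] replaced by 1 to make it uniform in [n]. *)
Definition poincare : R := (pi / 2) ^- 2 + kap / clead.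

Lemma poincare_GH c : mform GH c c <= poincare * mform GK c c.
Proof.
have := gap_GH 0 c; rewrite big_ord0 subr0 add0r => h; apply: le_trans h _.
rewrite ler_wpM2r ?psd_GK// /poincare mul1r [2^-1 * pi]mulrC lerD2l ler_piMr ?divr_ge0 ?(ltW kap0) ?(ltW clead0)//.
by rewrite invf_le1 ?exprn_gt0// exprn_ege1// ler1n.
Qed.

Record trial (C : R) (k : nat) (r : 'I_m -> R) : Prop := Trial {
  trial_l2 : bpw n (csub (cS r) (cphi k)) (csub (cS r) (cphi k)) <= C * n%:R ^- p.*2;
  trial_h1 : apw n (csub (cS r) (cphi k)) (csub (cS r) (cphi k)) <= C * n%:R ^- p.*2;
  trial_top : forall e, (e < n)%N -> `|top r e| <= C }.

(** There are [n] cells, each with a bounded top coefficient and a weight of order [n^-(2p+1)]. *)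
Lemma trial_defect C k r : 0 <= C -> trial C k r -> defect r r <= kap * C ^+ 2 * n%:R ^- p.*2.
Proof.
move=> C0 [_ _ ht]; rewrite /defect.
have y0 : 0 < 2 * n%:R :> R by rewrite mulr_gt0.
apply: (@le_trans _ _ (kap * (2 * n%:R) ^- p.*2.+1 * (n%:R * C ^+ 2))).
  rewrite ler_wpM2l ?mulr_ge0 ?(ltW kap0) ?invr_ge0 ?exprn_ge0 ?(ltW y0)//.
  rewrite mulr_natl -[n in leRHS]card_ord -sumr_const; apply: ler_sum => e _.
  by rewrite -expr2 -[leLHS]real_normK ?num_real// lerXn2r ?nnegrE// ht.
have -> : kap / (2 * n%:R) ^+ p.*2.+1 * (n%:R * C ^+ 2) = kap * C ^+ 2 * (2^-1 * (2 * n%:R) ^- p.*2).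
  rewrite exprS invfM; set v := (_ ^+ p.*2)^-1; by field.
rewrite ler_wpM2l ?mulr_ge0 ?sqr_ge0 ?(ltW kap0)//.
apply: (@le_trans _ _ ((2 * n%:R) ^- p.*2)).
  by rewrite ler_piMl ?invr_ge0 ?exprn_ge0 ?(ltW y0)// invf_le1// ler1n.
rewrite lef_pV2 ?posrE ?exprn_gt0// lerXn2r ?nnegrE ?(ltW y0) ?(ltW nR0)//.
by rewrite ler_peMl ?ler1n ?(ltW nR0).
Qed.

End fixed_n.

Fixpoint phi_derivs (k j : nat) : R -> R := if j is j'.+1 then derive1 (phi_derivs k j') else phi k.

Lemma smooth1_phi_derivs k j : smooth1 (phi_derivs k j).
Proof. by elim: j => [|j IH]; [exact: smooth1_phi|exact: smooth1_derive]. Qed.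

Lemma bounded_segment (f : R -> R) : continuous f ->
  exists M, forall x, 0 <= x <= 1 -> `|f x| <= M.
Proof.
move=> cf; have /compact_bounded : compact (f @` `[0, 1]).
  by apply: continuous_compact; [exact: continuous_subspaceT|exact: segment_compact].
move=> [M [_ hM]]; exists (M + 1) => x hx; apply: (hM (M + 1)); first by rewrite ltrDl.
by exists x.
Qed.

(** A sine vanishes at both ends, so exact end values make the first and the last coefficient of its
    approximation zero, and the approximation lies in the discrete space. *)
Lemma trial_exists k : exists2 C : R, 0 <= C & forall n, (0 < n)%N -> exists r, @trial n C k r.
Proof.
have [C C0 hC] := @spline_approximation R p p (leqnn p) (phi_derivs k)
  (fun j => smooth1_is_derive (smooth1_phi_derivs k j))
  (fun j => bounded_segment (smooth1_continuous (smooth1_phi_derivs k j))).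
(* [C ^+ 2] bounds the integrals of the squared errors and [C] the top coefficients. *)
exists (C ^+ 2 + C); first by rewrite addr_ge0 ?sqr_ge0.
move=> n n0; have nR0 : 0 < n%:R :> R by rewrite ltr0n.
have [a [ha /(_ p0) [a0 a1]]] := hC n n0.
rewrite subnn /= phi0 in a0; rewrite /= phi1 in a1.
exists (fun i => a i.+1).
have vE e : vpol (fun i : 'I_(n + p - 2) => a i.+1) e = spl p n p a e.
  rewrite /spl /vpol; have hnp : (n + p)%N = (n + p - 2).+2 by lia.
  transitivity (\sum_(i < (n + p - 2).+2) a i *: bspline_piece p n e p i); last by rewrite -hnp.
  rewrite big_ord_recl big_ord_recr /= a0 scale0r add0r.
  have -> : a (bump 0 (n + p - 2)) = 0 by rewrite -a1 /bump; congr a; lia.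
  by rewrite scale0r addr0.
have np1 : 0 <= n%:R ^- p :> R by rewrite invr_ge0 exprn_ge0// ltW.
have npp : n%:R ^- p ^+ 2 = n%:R ^- p.*2 :> R by rewrite -exprVn -exprM muln2 exprVn.
have n1 : n%:R ^- p.+1 <= n%:R ^- p :> R.
  rewrite lef_pV2 ?posrE ?exprn_gt0// exprS ler_peMl ?exprn_ge0 ?(ltW nR0)// ler1n//.
have bnd (F : nat -> R -> R) : (forall e, continuous (F e)) ->
   (forall e, (e < n)%N -> forall x, node n e <= x -> x <= node n e.+1 -> `|F e x| <= C * n%:R ^- p) ->
   bpw n F F <= (C ^+ 2 + C) * n%:R ^- p.*2.
  move=> cF hF; apply: I01_bounded; first exact: bmeas_pwM.
  move=> t Ot; have [h1 h2 h3] := element_of_node n0 Ot.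
  rewrite /pw /cmul -expr2 -[leLHS]real_normK ?num_real//.
  apply: (@le_trans _ _ ((C * n%:R ^- p) ^+ 2)).
    by rewrite lerXn2r ?nnegrE ?mulr_ge0// hF// ltW.
  by rewrite exprMn npp ler_wpM2r ?lerDl ?invr_ge0 ?exprn_ge0// ltW.
have sS e : smooth1 (cS (fun i : 'I_(n + p - 2) => a i.+1) e) by exact: smooth1_horner.
have sP e : smooth1 (@cphi R k e) by exact: smooth1_phi.
split.
- apply: bnd => [e|e en x h1 h2].
    by move=> x; apply: cvgB; [exact: (smooth1_continuous (sS e))|exact: (smooth1_continuous (sP e))].
  have [h _ _] := ha e en; rewrite /csub /cS vE distrC; apply: le_trans (h x h1 h2) _.
  by rewrite ler_wpM2l.
- rewrite /apw cderiv_csub//; apply: bnd => [e|e en x h1 h2].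
    by move=> x; apply: cvgB; [exact: (smooth1_cderiv_continuous sS)|exact: (smooth1_cderiv_continuous sP)].
  have [_ /(_ p0) h _] := ha e en; rewrite /csub /cS cderiv_poly /= vE distrC.
  exact: h.
- move=> e en; have [_ _ h] := ha e en; rewrite /top vE; apply: le_trans h _.
  by rewrite lerDr sqr_ge0.
Qed.

End one_dimension.

Section one_dimension.
Context {R : realType}.

Lemma apwE n (F G : nat -> R -> R) : apw n F G = bpw n (cderiv F) (cderiv G). Proof. by []. Qed.

Opaque bpw apw phi freq.
Variable p : nat.
Hypothesis hp : (0 < p <= 7)%N.
Variables kap clead : R.
Hypothesis kap0 : 0 < kap.
Hypothesis clead0 : 0 < clead.
Hypothesis hkap : forall f : {poly R}, (size f <= p.*2.+1)%N ->
  rule_sum (optimal_rule p) f = pint (-1) 1 f + kap * f`_p.*2.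
Hypothesis hlead : forall q : {poly R}, (size q <= p)%N -> clead * q`_p.-1 ^+ 2 <= pint (-1) 1 (q * q).

Lemma bpw_le2 n (F G : nat -> R -> R) : (0 < n)%N -> (forall e, continuous (F e)) -> (forall e, continuous (G e)) ->
  bpw n F F <= 2 * bpw n (csub F G) (csub F G) + 2 * bpw n G G.
Proof.
move=> n0 cF cG; have cD e : continuous (csub F G e) by move=> x; apply: cvgB; [exact: cF|exact: cG].
have := bpw_quad (- 2) n0 cF cG.
rewrite bpwBl// !bpwBr// (bpwC n G F).
set a := bpw n F F; set b := bpw n F G; set c := bpw n G G; lra.
Qed.

Lemma norm_add_young (a b c t u v x y : R) : `|a| <= t * u + t^-1 * v -> `|b| <= x -> `|c| <= y ->
  `|a + b + c| <= t * u + t^-1 * v + x + y.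
Proof.
move=> h1 h2 h3; apply: le_trans (ler_normD _ _) _; apply: lerD h3.
by apply: le_trans (ler_normD _ _) _; apply: lerD.
Qed.

Lemma gram_constant_le (a b c d d' C u k : R) : a <= C * u -> b <= C * u -> c <= (2 * C + 2) * u ->
  d <= k * C ^+ 2 * u -> d' <= k * C ^+ 2 * u ->
  a + c + (u + b) + (d + d') <= (4 * C + 3 + 2 * k * C ^+ 2) * u.
Proof.
set kc := k * C ^+ 2; set Cu := C * u; set ku := kc * u.
have -> : (4 * C + 3 + 2 * k * C ^+ 2) * u = 4 * Cu + 3 * u + 2 * ku by rewrite /Cu /ku /kc; ring.
have -> : (2 * C + 2) * u = 2 * Cu + 2 * u by rewrite /Cu; ring.
by move=> *; lra.
Qed.

Lemma summand_le5 (a b c d e : R) : 0 <= a -> 0 <= b -> 0 <= c -> 0 <= d -> 0 <= e ->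
  [/\ 0 <= a + b + c + d + e, a <= a + b + c + d + e, b <= a + b + c + d + e,
    c <= a + b + c + d + e & d <= a + b + c + d + e /\ e <= a + b + c + d + e].
Proof. by move=> *; split; [lra|lra|lra|lra|split; lra]. Qed.

Lemma sqr_sub_sub_le (a b c A B D : R) : a ^+ 2 <= A -> b ^+ 2 <= B -> c ^+ 2 <= D ->
  (a - b - c) ^+ 2 <= 3 * (A + B + D).
Proof.
move=> h1 h2 h3; have := sqr_ge0 (a + b); have := sqr_ge0 (a + c); have := sqr_ge0 (b - c).
have -> : (b - c) ^+ 2 = b ^+ 2 + c ^+ 2 - 2 * (b * c) by ring.
have -> : (a + c) ^+ 2 = a ^+ 2 + c ^+ 2 + 2 * (a * c) by ring.
have -> : (a + b) ^+ 2 = a ^+ 2 + b ^+ 2 + 2 * (a * b) by ring.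
have -> : (a - b - c) ^+ 2 = a ^+ 2 + b ^+ 2 + c ^+ 2 - 2 * (a * b) - 2 * (a * c) + 2 * (b * c) by ring.
set x := a * b; set y := a * c; set z := b * c.
set a2 := a ^+ 2 in h1 *; set b2 := b ^+ 2 in h2 *; set c2 := c ^+ 2 in h3 *; lra.
Qed.

Section fixed_n.
Variable n : nat.
Hypothesis n0 : (0 < n)%N.
Local Notation m := (n + p - 2)%N.
Let nR0 : 0 < n%:R :> R. Proof. by rewrite ltr0n. Qed.
Local Notation eta := (n%:R ^- p : R).
Let eta0 : 0 < eta. Proof. by rewrite invr_gt0 exprn_gt0. Qed.
Let eta1 : eta <= 1. Proof. by rewrite invf_le1 ?exprn_gt0// exprn_ege1// ler1n. Qed.
Let eta2 : n%:R ^- p.*2 = eta ^+ 2. Proof. by rewrite -exprVn -[in RHS]exprVn -exprM muln2. Qed.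
Let cS_cont (r : 'I_m -> R) : forall e, continuous (cS r e).
Proof. by move=> e; apply: smooth1_continuous; exact: smooth1_horner. Qed.
Let phi_cont k : forall e, continuous (@cphi R k e).
Proof. by move=> e; apply: smooth1_continuous; exact: smooth1_phi. Qed.
Let dS_cont (r : 'I_m -> R) : forall e, continuous (cderiv (cS r) e).
Proof. by move=> e; apply: smooth1_cderiv_continuous => e'; exact: smooth1_horner. Qed.
Let dphi_cont k : forall e, continuous (cderiv (@cphi R k) e).
Proof. by move=> e; apply: smooth1_cderiv_continuous => e'; exact: smooth1_phi. Qed.
Let sub_cont (F G : nat -> R -> R) : (forall e, continuous (F e)) -> (forall e, continuous (G e)) ->
  forall e, continuous (csub F G e).
Proof. by move=> cF cG e x; apply: cvgB; [exact: cF|exact: cG]. Qed.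

Let dsubE (r : 'I_m -> R) k : cderiv (csub (cS r) (cphi k)) = csub (cderiv (cS r)) (cderiv (cphi k)).
Proof. by apply: cderiv_csub => e; [exact: smooth1_horner|exact: smooth1_phi]. Qed.

Lemma bpw_phi_phi k l : bpw n (cphi k) (cphi l) = (k == l)%:R :> R.
Proof. by rewrite bpw_cphi// phi_orthonormal. Qed.

Lemma apw_phi_phi k : apw n (cphi k) (cphi k) = freq k ^+ 2 :> R.
Proof. by rewrite apw_phi; [rewrite bpw_phi_phi eqxx mulr1|exact: pws0_phi]. Qed.

Lemma trial_norm C k (r : 'I_m -> R) : trial C k r -> bpw n (cS r) (cS r) <= 2 * C * eta ^+ 2 + 2.
Proof.
move=> [h _ _]; apply: le_trans (bpw_le2 n0 (@cS_cont r) (@phi_cont k)) _.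
by rewrite bpw_phi_phi eqxx mulr1 lerD2r -mulrA ler_pM2l// -eta2.
Qed.

Lemma trial_energy C k (r : 'I_m -> R) : trial C k r -> apw n (cS r) (cS r) <= 2 * C * eta ^+ 2 + 2 * freq k ^+ 2.
Proof.
move=> [_ h _]; have := bpw_le2 n0 (@dS_cont r) (@dphi_cont k).
rewrite -!apwE apw_phi_phi => h2; apply: le_trans h2 _.
rewrite lerD2r -mulrA ler_pM2l// -eta2; by move: h; rewrite apwE dsubE.
Qed.

Lemma eta_sq_le : eta ^+ 2 <= eta.
Proof. by rewrite expr2 ler_piMl// ltW. Qed.

(** Replacing a spline by its sine costs a product of a function of squared norm [O(eta ^+ 2)] with
    a bounded one; Young's inequality, weighted by [eta] or its inverse, makes it [O(eta)]. The
    defect is bounded by the same order. *)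
Lemma trial_gram (C : R) k l (r r' : 'I_m -> R) : 0 <= C -> trial C k r -> trial C l r' ->
  `|mform (@GH R p n) r r' - (k == l)%:R| <= (4 * C + 3 + 2 * kap * C ^+ 2) * eta.
Proof.
move=> C0 tr tr'; rewrite (mform_GH hp kap0 clead0 hkap n0).
set D := csub (cS r) (cphi k); set D' := csub (cS r') (cphi l).
have e1 : bpw n D (cS r') = bpw n (cS r) (cS r') - bpw n (cphi k) (cS r') by rewrite bpwBl.
have e2 : bpw n (cphi k) D' = bpw n (cphi k) (cS r') - (k == l)%:R by rewrite bpwBr// bpw_phi_phi.
have -> : bpw n (cS r) (cS r') + defect kap r r' - (k == l)%:R =
  bpw n D (cS r') + bpw n (cphi k) D' + defect kap r r' by rewrite e1 e2; ring.
have cD := sub_cont (@cS_cont r) (@phi_cont k); have cD' := sub_cont (@cS_cont r') (@phi_cont l).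
have t0 : 0 < eta^-1 by rewrite invr_gt0.
have h1 := young t0 (bpw_CS n0 cD (@cS_cont r')) (bpw_ge0 n D) (bpw_ge0 n (cS r')).
have h2 := young eta0 (bpw_CS n0 (@phi_cont k) cD') (bpw_ge0 n (cphi k)) (bpw_ge0 n D').
have h3 := young ltr01 (defect_CS kap r r') (defect_ge0 kap0 n0 r) (defect_ge0 kap0 n0 r').
apply: le_trans (norm_add_young h1 h2 h3) _.
rewrite !invrK invr1 !mul1r bpw_phi_phi eqxx mulr1.
have k1 : eta^-1 * bpw n D D <= C * eta.
  rewrite ler_pdivrMl//; apply: le_trans (trial_l2 tr) _; rewrite eta2 le_eqVlt; apply/orP; left; apply/eqP; ring.
have k2 : eta^-1 * bpw n D' D' <= C * eta.
  rewrite ler_pdivrMl//; apply: le_trans (trial_l2 tr') _; rewrite eta2 le_eqVlt; apply/orP; left; apply/eqP; ring.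
have k3 : eta * bpw n (cS r') (cS r') <= (2 * C + 2) * eta.
  rewrite mulrC ler_pM2r//; apply: le_trans (trial_norm tr') _; rewrite lerD2r ler_piMr ?mulr_ge0//.
  by rewrite exprn_ile1// ltW.
have k4 (r1 : 'I_m -> R) k1' : trial C k1' r1 -> defect kap r1 r1 <= kap * C ^+ 2 * eta.
  move=> t1; apply: le_trans (trial_defect kap0 n0 C0 t1) _.
  by rewrite eta2 ler_wpM2l ?mulr_ge0 ?sqr_ge0 ?(ltW kap0)// eta_sq_le.
have k5 := k4 _ _ tr; have k6 := k4 _ _ tr'.
rewrite !invrK in k1 k2; exact: gram_constant_le k1 k2 k3 k5 k6.
Qed.

(** The sine satisfies its eigenvalue equation exactly against every spline, so only the residual of
    [r - phi k] and the defect remain; Cauchy-Schwarz in each form, together with [poincare], bounds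
    them by the energy of [v]. *)
Lemma trial_residual (C : R) k (r v : 'I_m -> R) : 0 <= C -> trial C k r ->
  (mform (@GK R p n) r v - freq k ^+ 2 * mform (@GH R p n) r v) ^+ 2 <=
  3 * (C + freq k ^+ 4 * C * poincare kap clead + freq k ^+ 4 * (kap * C ^+ 2 * (kap / clead))) * eta ^+ 2 *
  mform (@GK R p n) v v.
Proof.
move=> C0 tr; rewrite (mform_GH hp kap0 clead0 hkap n0) !(mform_GK hp kap0 clead0 n0).
set D := csub (cS r) (cphi k).
have e1 : bpw n D (cS v) = bpw n (cS r) (cS v) - bpw n (cphi k) (cS v) by rewrite bpwBl.
have e2 : bpw n (csub (cderiv (cS r)) (cderiv (cphi k))) (cderiv (cS v)) = apw n (cS r) (cS v) - apw n (cphi k) (cS v).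
  by rewrite bpwBl.
have e3 : apw n (cphi k) (cS v) = freq k ^+ 2 * bpw n (cphi k) (cS v).
  by rewrite apwC bpwC apw_phi//; exact: (pws0_cS hp kap0 clead0 n0).
set DD := csub (cderiv (cS r)) (cderiv (cphi k)) in e2 *.
have cD := sub_cont (@cS_cont r) (@phi_cont k).
have cDD := sub_cont (@dS_cont r) (@dphi_cont k).
have hDD : bpw n DD DD <= C * eta ^+ 2.
  by have := trial_h1 tr; rewrite apwE dsubE eta2.
have hD : bpw n D D <= C * eta ^+ 2 by have := trial_l2 tr; rewrite eta2.
set A := apw n (cS v) (cS v).
have A0 : 0 <= A by exact: bpw_ge0.
have hv : bpw n (cS v) (cS v) <= poincare kap clead * A.
  rewrite /A -(mform_GM hp kap0 clead0 n0) -(mform_GK hp kap0 clead0 n0).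
  apply: le_trans (GM_le_GH hp kap0 clead0 hkap n0 v) _; exact: (poincare_GH hp kap0 clead0 hkap hlead n0).
have hE : defect kap v v <= kap / clead * A.
  apply: le_trans (defect_le hp kap0 clead0 hlead n0 v) _; rewrite ler_wpM2r//.
  by rewrite ler_piMr ?divr_ge0 ?(ltW kap0) ?(ltW clead0)// invf_le1 ?exprn_gt0// exprn_ege1// ler1n.
have hEr : defect kap r r <= kap * C ^+ 2 * eta ^+ 2.
  by have := trial_defect kap0 n0 C0 tr; rewrite eta2.
have P0 : 0 <= poincare kap clead.
  by rewrite addr_ge0 ?divr_ge0 ?(ltW kap0) ?(ltW clead0)// invr_ge0 exprn_ge0// divr_ge0// pi_ge0.
have -> : apw n (cS r) (cS v) - freq k ^+ 2 * (bpw n (cS r) (cS v) + defect kap r v) =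
  bpw n DD (cderiv (cS v)) - freq k ^+ 2 * bpw n D (cS v) - freq k ^+ 2 * defect kap r v.
  by rewrite e1 e2 e3; ring.
have s1 : bpw n DD (cderiv (cS v)) ^+ 2 <= C * eta ^+ 2 * A.
  apply: le_trans (bpw_CS n0 cDD (@dS_cont v)) _; rewrite -/A ler_wpM2r//.
have s2 : (freq k ^+ 2 * bpw n D (cS v)) ^+ 2 <= freq k ^+ 4 * C * poincare kap clead * eta ^+ 2 * A.
  rewrite exprMn -exprM.
  have -> : freq k ^+ 4 * C * poincare kap clead * eta ^+ 2 * A = freq k ^+ 4 * ((C * eta ^+ 2) * (poincare kap clead * A)) by ring.
  rewrite ler_wpM2l ?exprn_even_ge0//; apply: le_trans (bpw_CS n0 cD (@cS_cont v)) _.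
  by apply: ler_pM => //; exact: bpw_ge0.
have s3 : (freq k ^+ 2 * defect kap r v) ^+ 2 <= freq k ^+ 4 * (kap * C ^+ 2 * (kap / clead)) * eta ^+ 2 * A.
  rewrite exprMn -exprM.
  have -> : freq k ^+ 4 * (kap * C ^+ 2 * (kap / clead)) * eta ^+ 2 * A =
     freq k ^+ 4 * ((kap * C ^+ 2 * eta ^+ 2) * (kap / clead * A)) by ring.
  rewrite ler_wpM2l ?exprn_even_ge0//; apply: le_trans (defect_CS kap r v) _.
  by apply: ler_pM => //; exact: defect_ge0.
apply: le_trans (sqr_sub_sub_le s1 s2 s3) _.
rewrite le_eqVlt; apply/orP; left; apply/eqP; ring.
Qed.

End fixed_n.

(** Interface between the one-dimensional and the tensor-product estimates, with a single constant
    for the first [K] modes. *)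
Record trial_family (C : R) (n : nat) (K : nat) (r : nat -> 'I_(n + p - 2) -> R) : Prop := TrialFamily {
  tf_l2 : forall k, (k < K)%N ->
    bpw n (csub (cS (r k)) (cphi k)) (csub (cS (r k)) (cphi k)) <= C * (n%:R ^- p) ^+ 2;
  tf_h1 : forall k, (k < K)%N ->
    apw n (csub (cS (r k)) (cphi k)) (csub (cS (r k)) (cphi k)) <= C * (n%:R ^- p) ^+ 2;
  tf_norm : forall k, (k < K)%N -> bpw n (cS (r k)) (cS (r k)) <= C;
  tf_energy : forall k, (k < K)%N -> apw n (cS (r k)) (cS (r k)) <= C;
  tf_gram : forall k l, (k < K)%N -> (l < K)%N ->
    `|mform (@GH R p n) (r k) (r l) - (k == l)%:R| <= C * n%:R ^- p;
  tf_residual : forall k v, (k < K)%N ->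
    (mform (@GK R p n) (r k) v - freq k ^+ 2 * mform (@GH R p n) (r k) v) ^+ 2 <=
      C * (n%:R ^- p) ^+ 2 * mform (@GK R p n) v v }.

Lemma trial_family_exists K : exists2 C : R, 0 <= C & forall n, (0 < n)%N -> exists r, @trial_family C n K r.
Proof.
have /choice[c hc] : forall k, exists c : R, 0 <= c /\ forall n, (0 < n)%N -> exists r, @trial R p n c k r.
  by move=> k; have [c c0 h] := trial_exists hp kap0 clead0 k; exists c.
pose S := \sum_(k < K) c k.
have S0 : 0 <= S by apply: sumr_ge0 => k _; exact: (hc k).1.
have cS k : (k < K)%N -> c k <= S.
  move=> kK; rewrite /S (bigD1 (Ordinal kK))//= lerDl; apply: sumr_ge0 => i _; exact: (hc i).1.
pose W := freq K ^+ 2 : R.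
have W0 : 0 <= W by exact: sqr_ge0.
have hW k : (k < K)%N -> freq k ^+ 2 <= W.
  move=> kK; rewrite lerXn2r ?nnegrE ?(ltW (freq_gt0 _))//.
  Transparent freq.
  by rewrite ler_pM2r ?pi_gt0// ler_nat ltnS ltnW.
have P0 : 0 <= poincare kap clead.
  by rewrite addr_ge0 ?divr_ge0 ?(ltW kap0) ?(ltW clead0)// invr_ge0 exprn_ge0// divr_ge0// pi_ge0.
have kc0 : 0 <= kap * S ^+ 2 * (kap / clead) by rewrite mulr_ge0 ?divr_ge0 ?mulr_ge0 ?sqr_ge0 ?(ltW kap0) ?(ltW clead0).
pose Q := 3 * (S + W ^+ 2 * S * poincare kap clead + W ^+ 2 * (kap * S ^+ 2 * (kap / clead))).
have Q0 : 0 <= Q.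
  have q1 : 0 <= W ^+ 2 * S * poincare kap clead by apply: mulr_ge0 P0; apply: mulr_ge0 S0; exact: sqr_ge0.
  have q2 : 0 <= W ^+ 2 * (kap * S ^+ 2 * (kap / clead)) by apply: mulr_ge0 kc0; exact: sqr_ge0.
  by rewrite mulr_ge0// !addr_ge0.
pose G := 4 * S + 3 + 2 * kap * S ^+ 2.
have G0 : 0 <= G by rewrite !addr_ge0 ?mulr_ge0 ?sqr_ge0 ?(ltW kap0).
have a1 : 0 <= 2 * S + 2 by rewrite addr_ge0 ?mulr_ge0.
have a2 : 0 <= 2 * S + 2 * W by apply: addr_ge0; apply: mulr_ge0.
have [C0 CS C2 C3 [C4 C5]] := summand_le5 S0 a1 a2 G0 Q0.
exists (S + (2 * S + 2) + (2 * S + 2 * W) + G + Q); first exact: C0.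
move=> n n0; have nR0 : 0 < n%:R :> R by rewrite ltr0n.
have eta0 : 0 <= n%:R ^- p :> R by rewrite invr_ge0 exprn_ge0// ltW.
have eta1 : n%:R ^- p <= 1 :> R by rewrite invf_le1 ?exprn_gt0// exprn_ege1// ler1n.
have eta21 : n%:R ^- p ^+ 2 <= 1 :> R by rewrite exprn_ile1.
have eta20 : 0 <= n%:R ^- p ^+ 2 :> R by rewrite sqr_ge0.
have eta2 : n%:R ^- p.*2 = n%:R ^- p ^+ 2 :> R by rewrite -exprVn -[in RHS]exprVn -exprM muln2.
have /choice[r hr] : forall k, exists r, @trial R p n (c k) k r by move=> k; exact: (hc k).2.
have tr k : (k < K)%N -> trial S k (r k).
  move=> kK; have [h1 h2 h3] := hr k; have h := cS k kK.
  have np : 0 <= n%:R ^- p.*2 :> R by rewrite eta2.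
  split.
  - by apply: le_trans h1 _; rewrite ler_wpM2r.
  - by apply: le_trans h2 _; rewrite ler_wpM2r.
  - by move=> e en; apply: le_trans (h3 e en) h.
set C := _ + Q in C0 CS C2 C3 C4 C5 *.
exists r; split.
- move=> k kK; have := trial_l2 (tr k kK); rewrite eta2 => h; apply: le_trans h _.
  by rewrite ler_wpM2r.
- move=> k kK; have := trial_h1 (tr k kK); rewrite eta2 => h; apply: le_trans h _.
  by rewrite ler_wpM2r.
- move=> k kK; apply: le_trans (trial_norm n0 (tr k kK)) _; apply: le_trans C2.
  by rewrite lerD2r ler_piMr// mulr_ge0.
- move=> k kK; apply: le_trans (trial_energy n0 (tr k kK)) _; apply: le_trans C3.
  apply: lerD; first by rewrite ler_piMr// mulr_ge0.
  by rewrite ler_pM2l// hW.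
- move=> k l kK lK; apply: le_trans (trial_gram n0 S0 (tr k kK) (tr l lK)) _.
  by rewrite ler_wpM2r.
- move=> k v kK; apply: le_trans (trial_residual n0 v S0 (tr k kK)) _.
  rewrite ler_wpM2r ?(psd_GK hp kap0 clead0 n0)// ler_wpM2r//; apply: le_trans C5.
  have f4 : freq k ^+ 4 <= W ^+ 2.
    by rewrite -[4%N]/(2 * 2)%N exprM lerXn2r ?nnegrE ?sqr_ge0// hW.
  rewrite ler_pM2l//; apply: lerD; last by rewrite ler_wpM2r.
  by rewrite lerD2l ler_wpM2r// ler_wpM2r.
Qed.

End one_dimension.

(** * Density of smooth functions *)

Section bumps.
Context {R : realType}.
Local Notation mu := (@lebesgue_measure R).
Local Notation O01 := (`]0%R, 1%R[%classic : set R).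
Implicit Types (f g : R -> R).

Lemma is_derive_flat f (x C : R) : (forall h : R, `|h| <= 1 -> `|f (h + x) - f x| <= C * h ^+ 2) ->
  is_derive x 1 f 0.
Proof.
move=> hf.
have C0 : 0 <= C by have := hf 1; rewrite normr1 expr1n mulr1 => /(_ (lexx _)); exact: le_trans.
have key : h^-1 *: ((f \o shift x) (h *: 1) - f x) @[h --> 0^'] --> (0 : R).
  apply/cvgrPdist_le => e e0.
  have eC : 0 < Num.min 1 (e / (C + 1)) by rewrite lt_min ltr01 divr_gt0// ltr_wpDl.
  near=> h.
  have h0 : h != 0 by near: h; exact: nbhs_dnbhs_neq.
  have hd : `|h| <= Num.min 1 (e / (C + 1)) by near: h; exact: dnbhs0_le.
  rewrite sub0r normrN /= [h *: 1]mulr1 normrZ normfV.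
  rewrite ler_pdivrMl ?normr_gt0//; apply: le_trans (hf h _) _.
    by apply: le_trans hd _; rewrite ge_min lexx.
  rewrite -real_normK ?num_real// expr2 mulrCA ler_wpM2l//.
  have : `|h| <= e / (C + 1) by apply: le_trans hd _; rewrite ge_min lexx orbT.
  rewrite ler_pdivlMr ?ltr_wpDl// => h1; apply: le_trans h1.
  by rewrite mulrC ler_wpM2l// lerDl.
split; first by apply/cvg_ex; exists 0.
exact: cvg_lim key.
Unshelve. all: by end_near. Qed.

(* The polynomial factor makes the family stable under derivation. *)
Definition gexp (P : {poly R}) (x : R) : R := if 0 < x then P.[x^-1] * expR (- x^-1) else 0.

(** From [expR (y / k) >= y / k] with [y = 1 / h]: the power [k = size P + 2] absorbs the polynomial
    and leaves [h ^+ 2]. *)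
Lemma gexp_small (P : {poly R}) : exists C : R, forall h : R, `|h| <= 1 -> `|gexp P h| <= C * h ^+ 2.
Proof.
pose m := size P; pose S := \sum_(i < m) `|P`_i|.
have S0 : 0 <= S by apply: sumr_ge0.
pose k : R := m.+2%:R.
have k0 : 0 < k by rewrite ltr0n.
exists (S * k ^+ m.+2) => h h1; rewrite /gexp; case: ltP => [h0|_]; last first.
  by rewrite normr0 mulr_ge0 ?sqr_ge0// mulr_ge0// exprn_ge0// ltW.
set y := h^-1; have y1 : 1 <= y by rewrite /y invf_ge1// -[h]ger0_norm// ltW.
have y0 : 0 < y by exact: lt_le_trans y1.
rewrite normrM [`|expR _|]ger0_norm ?expR_ge0//.
have hP : `|P.[y]| <= S * y ^+ m.
  rewrite horner_coef; apply: le_trans (ler_norm_sum _ _ _) _; rewrite mulr_suml.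
  apply: ler_sum => i _; rewrite normrM ler_wpM2l// ger0_norm ?exprn_ge0 ?(ltW y0)//.
  by rewrite ler_weXn2l// ltnW.
have he : expR (- y) <= k ^+ m.+2 * y ^- m.+2.
  have e1 : expR y = expR (k^-1 * y) ^+ m.+2 by rewrite -expRM_natl mulrA mulfV ?mul1r// gt_eqF.
  have ky : 0 <= k^-1 * y.
    by apply: mulr_ge0; [rewrite invr_ge0; exact: ltW|exact: ltW].
  have hy : (k^-1 * y) ^+ m.+2 <= expR y.
    by rewrite e1 lerXn2r ?nnegrE ?expR_ge0//; apply: le_trans (expR_ge1Dx _); rewrite lerDr.
  have gen (u v : R) N : u ^+ N * v ^- N = ((u^-1 * v) ^+ N)^-1.
    by rewrite -[v ^- N]exprVn -exprMn -[RHS]exprVn invfM invrK.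
  rewrite gen.
  by rewrite expRN lef_pV2 ?posrE ?expR_gt0 ?exprn_gt0 ?mulr_gt0 ?invr_gt0.
apply: le_trans (ler_pM (normr_ge0 _) (expR_ge0 _) hP he) _.
have -> : S * y ^+ m * (k ^+ m.+2 * y ^- m.+2) = S * k ^+ m.+2 * h ^+ 2.
  rewrite -[m.+2]addn2 [y ^+ (m + 2)]exprD /y; field; rewrite ?expf_neq0 ?gt_eqF//.
by [].
Qed.

Lemma gexp0 (P : {poly R}) x : x <= 0 -> gexp P x = 0.
Proof. by rewrite /gexp leNgt => /negbTE ->. Qed.

Lemma is_derive_gexp (P : {poly R}) (x : R) :
  is_derive x 1 (gexp P) (gexp ('X^2 * (P - P^`()%R)) x).
Proof.
have [x0|x0|->] := ltgtP x 0.
- rewrite gexp0 ?ltW//; have h0 : is_derive x 1 (fun=> 0 : R) (0 : R) := is_derive_cst (0 : R) x 1.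
  apply: (near_eq_is_derive _ h0); near=> y.
  have y0 : y < 0 by near: y; exact: lt_nbhsl.
  by rewrite gexp0// ltW.
- suff h0 : is_derive x 1 (fun y : R => P.[y^-1] * expR (- y^-1)) (gexp ('X^2 * (P - P^`()%R)) x).
    apply: (near_eq_is_derive _ h0); near=> y.
    by rewrite /gexp; have -> : 0 < y by near: y; exact: lt_nbhsr.
  have xn : x != 0 by rewrite gt_eqF.
  have hV : is_derive x 1 (fun y : R => y^-1) (- x ^- 2).
    have h := is_deriveV (f := fun y : R => y) xn (is_derive_id x 1).
    by apply: is_derive_eq h _; rewrite /GRing.scale /= mulr1.
  have h1 := @is_derive1_comp _ (fun y => P.[y]) (fun y : R => y^-1) x _ _ (is_derive_horner P _) hV.
  have hN := is_deriveN hV.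
  have h2 := @is_derive1_comp _ expR (fun y : R => - y^-1) x _ _ (is_derive_expR _) hN.
  have h := is_deriveM h1 h2.
  apply: is_derive_eq h _; rewrite /gexp x0 /GRing.scale /= !hornerE /=.
  rewrite exprVn; ring.
- rewrite gexp0//; have [C hC] := gexp_small P; apply: (@is_derive_flat _ _ C) => h h1.
  by rewrite addr0 [gexp P 0]gexp0// subr0; exact: hC.
Unshelve. all: by end_near. Qed.

Lemma smooth1_gexp P : smooth1 (gexp P).
Proof.
move=> n; elim: n P => // n IH P; split; first by move=> x; have := is_derive_gexp P x => -[].
by rewrite (derive1_is (is_derive_gexp P)); exact: IH.
Qed.

Lemma is_derive_comp_affine f df (c d x : R) : (forall x : R, is_derive x 1 f (df x)) ->
  is_derive x 1 (fun t => f (c * t + d)) (c * df (c * x + d)).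
Proof.
move=> h; have h1 := @is_derive1_comp _ f (fun t : R => c * t + d) x _ _ (h _) (is_derive_affine c d x).
by apply: is_derive_eq h1 _; rewrite mulrC.
Qed.

Lemma smooth1_affine f (c d : R) : smooth1 f -> smooth1 (fun t => f (c * t + d)).
Proof.
move=> sf n; elim: n f sf => // n IH f sf.
have h x := is_derive_comp_affine c d x (smooth1_is_derive sf).
split; first by move=> x; have := h x => -[].
rewrite (derive1_is h); apply: nderivableM; first exact: nderivable_cst.
exact: IH (smooth1_derive sf).
Qed.

Lemma smooth1_antiderivative f F : (forall x : R, is_derive x 1 F (f x)) -> smooth1 f -> smooth1 F.
Proof.
move=> dF sf [|n] //; split; first by move=> x; have := dF x => -[].
by rewrite (derive1_is dF).
Qed.

Lemma antiderivative f : continuous f -> (forall x, x <= 0 -> f x = 0) ->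
  exists F, (forall x : R, is_derive x 1 F (f x)) /\ forall x, x <= 0 -> F x = 0.
Proof.
(* The lower limit lies to the left of the support of [f], so that 0 is interior to the interval of
   the fundamental theorem. *)
move=> cf f0; pose F x := \int[mu]_(t in `[-1, x]) f t.
have F0 x : x <= 0 -> F x = 0.
  move=> x0; rewrite /F (@eq_Rintegral _ _ _ _ _ (cst 0)) ?Rintegral_cst ?mul0r//.
  by move=> t /set_mem /=; rewrite in_itv /= => /andP[_ tx]; rewrite f0// (le_trans tx).
exists F; split=> // x; have [x0|x0] := ltP x 0.
  rewrite f0 ?ltW//; have h0 : is_derive x 1 (fun=> 0 : R) (0 : R) := is_derive_cst (0 : R) x 1.
  apply: (near_eq_is_derive _ h0); near=> y.
  have y0 : y < 0 by near: y; exact: lt_nbhsl.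
  by rewrite F0// ltW.
have x1 : -1 < x by apply: lt_le_trans x0; rewrite oppr_lt0.
have xx : x < x + 1 by rewrite ltrDl.
have I : mu.-integrable `[-1, x + 1] (EFin \o f).
  by apply: continuous_compact_integrable; [exact: segment_compact|exact: continuous_subspaceT].
have [d1 d2] := continuous_FTC1_closed xx I x1 (cf x).
by split; [exact: d1|rewrite -derive1E; exact: d2].
Unshelve. all: by end_near. Qed.

Lemma derive0_eq f (a b : R) df : (forall x : R, is_derive x 1 f (df x)) -> a <= b ->
  (forall t, a <= t <= b -> df t = 0) -> f a = f b.
Proof.
move=> h ab h0; apply/eqP; rewrite -subr_eq0 -normr_le0 -[leRHS](mul0r `|a - b|).
apply: (derive_lipschitz (a := a) (b := b) h); rewrite ?lexx ?ab//.
by move=> t ht; rewrite h0// normr0.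
Qed.

Lemma derive_ge0_le f (a b : R) df : (forall x : R, is_derive x 1 f (df x)) -> a <= b ->
  (forall t, 0 <= df t) -> f a <= f b.
Proof.
move=> h ab h0.
have [c _ e] := @MVT_segment R f df a b ab (fun t _ => h t)
  (continuous_subspaceT (fun t => is_derive_continuous (h t))).
by rewrite -subr_ge0 e mulr_ge0// subr_ge0.
Qed.

(** Normalized primitive of a bump supported in [0, 1]. *)
Lemma smooth_step : exists s : R -> R, [/\ smooth1 s, forall x, x <= 0 -> s x = 0,
  forall x, 1 <= x -> s x = 1 & forall x, 0 <= s x <= 1].
Proof.
pose be x := gexp 1 x * gexp 1 (-1 * x + 1).
have sbe : smooth1 be by apply: smooth1M; [exact: smooth1_gexp|apply: smooth1_affine; exact: smooth1_gexp].
have g_ge0 x : 0 <= gexp 1 x.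
  by rewrite /gexp; case: ifP => // _; rewrite hornerC mul1r expR_ge0.
have be0 x : 0 <= be x by exact: mulr_ge0.
have bl x : x <= 0 -> be x = 0 by move=> x0; rewrite /be gexp0// mul0r.
have br x : 1 <= x -> be x = 0 by move=> x1; rewrite /be [gexp 1 (-1 * x + 1)]gexp0 ?mulr0//; lra.
have [B [dB B0]] := antiderivative (smooth1_continuous sbe) bl.
have B1 x : 1 <= x -> B x = B 1.
  move=> x1; apply/esym; apply: (derive0_eq dB) => // t /andP[t1 _]; exact: br.
have Bpos : 0 < B 1.
  (* The total mass is positive by the mean value theorem on [1/4, 3/4], where the bump does not
     vanish. *)
  have h14 : (1/4 : R) <= 3/4 by lra.
  have [c] := @MVT_segment R B be (1/4) (3/4) h14 (fun t _ => dB t)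
    (continuous_subspaceT (fun t => is_derive_continuous (dB t))).
  rewrite in_itv /= => /andP[c1 c2] e.
  have bc : 0 < be c.
    by rewrite /be /gexp !ifT; [rewrite !hornerC !mul1r mulr_gt0// expR_gt0|lra|lra].
  have h1 : 0 <= B (1/4) by rewrite -[leLHS](B0 0)//; apply: (derive_ge0_le dB) => //; lra.
  have h2 : B (3/4) <= B 1 by apply: (derive_ge0_le dB) => //; lra.
  have h3 : 0 < be c * (3/4 - 1/4) by rewrite mulr_gt0//; lra.
  lra.
exists (fun x => (B 1)^-1 * B x); split.
- by apply: smooth1M; [exact: smooth1_cst|exact: smooth1_antiderivative dB sbe].
- by move=> x x0; rewrite (B0 x x0) mulr0.
- by move=> x x1; rewrite (B1 x x1) mulVf// gt_eqF.
- move=> x; apply/andP; split.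
    rewrite mulr_ge0 ?invr_ge0 ?(ltW Bpos)//.
    have [x0|x0] := leP x 0; first by rewrite (B0 x x0).
    by rewrite -[leLHS](B0 0)//; apply: (derive_ge0_le dB) => //; exact: ltW.
  rewrite mulrC ler_pdivrMr// mul1r.
  have [x1|x1] := leP 1 x; first by rewrite (B1 x x1).
  by apply: (derive_ge0_le dB) => //; exact: ltW.
Qed.

Lemma plateau (a b d : R) : 0 < d -> exists chi : R -> R, [/\ smooth1 chi,
  forall x, x <= a -> chi x = 0, forall x, b <= x -> chi x = 0,
  forall x, a + d <= x -> x <= b - d -> chi x = 1 & forall x, 0 <= chi x <= 1].
Proof.
move=> d0; have [s [ss s0 s1 s01]] := smooth_step.
pose u x := d^-1 * x + - (d^-1 * a); pose v x := - d^-1 * x + d^-1 * b.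
exists (fun x => s (u x) * s (v x)); split.
- by apply: smooth1M; apply: smooth1_affine.
- move=> x xa; rewrite s0 ?mul0r// /u -mulrBr pmulr_rle0 ?invr_gt0// subr_le0//.
- move=> x xb; rewrite [s (v x)]s0 ?mulr0// /v mulNr addrC -mulrBr pmulr_rle0 ?invr_gt0// subr_le0//.
- move=> x h1 h2; rewrite s1 ?[s (v x)]s1 ?mulr1//.
    by rewrite /v mulNr addrC -mulrBr ler_pdivlMl// mulr1; lra.
  by rewrite /u -mulrBr ler_pdivlMl// mulr1; lra.
- move=> x; have /andP[h1 h2] := s01 (u x); have /andP[h3 h4] := s01 (v x).
  by rewrite mulr_ge0//= mulr_ile1.
Qed.

Lemma bmeas_indic (a b : R) : bmeas O01 (\1_(`[a, b]%classic : set R) : R -> R).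
Proof.
split; first exact: measurable_indic.
by exists (1 : R) => x _; rewrite indicE normr_nat lern1; case: (_ \in _).
Qed.

Lemma I01_indic_le (a b : R) : a <= b -> I01 (\1_(`[a, b]%classic : set R) : R -> R) <= b - a.
Proof.
move=> ab; rewrite /I01 /Rintegral integral_indic//.
have h : (mu (`[a, b] `&` O01) <= (b - a)%:E)%E.
  apply: (@le_trans _ _ (mu `[a, b])); last first.
    by rewrite lebesgue_measure_itv /=; case: ifP => // _; rewrite lee_fin subr_ge0.
  by apply: le_measure; rewrite ?inE//; exact: measurableI.
have fin : mu (`[a, b] `&` O01) \is a fin_num.
  by rewrite ge0_fin_numE//; apply: le_lt_trans h _; rewrite ltry.
by rewrite -lee_fin fineK.
Qed.

Lemma sqr_I01_le f : bmeas O01 f -> I01 f ^+ 2 <= I01 (fun x => f x ^+ 2).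
Proof.
move=> bf; have bf2 : bmeas O01 (fun x => f x ^+ 2).
  rewrite (_ : (fun x => f x ^+ 2) = fun x => f x * f x); first exact: bmeasM.
  by apply/funext => x; rewrite expr2.
have := @I01_ge0 R (fun x => f x ^+ 2 - 2 * I01 f * f x + I01 f ^+ 2).
rewrite I01D ?I01B ?I01Z ?I01_cst//; try by [exact: bmeasZ|exact: bmeas_cst].
  have -> : I01 (fun t => f t ^+ 2) - 2 * I01 f * I01 f + I01 f ^+ 2 = I01 (fun t => f t ^+ 2) - I01 f ^+ 2 by ring.
  rewrite subr_ge0; apply => t _.
  by have := sqr_ge0 (f t - I01 f); congr (0 <= _); ring.
by apply: bmeasB => //; exact: bmeasZ.
Qed.

End bumps.

Section density.
Context {R : realType}.
Local Notation O01 := (`]0%R, 1%R[%classic : set R).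
Implicit Types (F G H : nat -> R -> R).

Lemma O01_le (x : R) : O01 x -> 0 <= x <= 1.
Proof. by rewrite /= in_itv /= => /andP[h1 h2]; rewrite !ltW. Qed.

Lemma cells_bounded n G : (forall e, continuous (G e)) ->
  exists2 M : R, 0 <= M & forall e (x : R), (e < n)%N -> 0 <= x <= 1 -> `|G e x| <= M.
Proof.
move=> cG; elim: n => [|n [M M0 hM]]; first by exists 0.
have [M' hM'] := bounded_segment (cG n).
exists (M + `|M'|); first by rewrite addr_ge0.
move=> e x; rewrite ltnS leq_eqVlt => /orP[/eqP -> hx|en hx].
  by apply: le_trans (hM' x hx) _; apply: le_trans (ler_norm _) _; rewrite lerDr.
by apply: le_trans (hM e x en hx) _; rewrite lerDl.
Qed.

(** Every cell has its own cutoff, which hides the jumps of [G] at the nodes. The error is confined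
    to two strips of width [2 * dl] per cell and is at most [M] there. *)
Lemma plateau_cells n G (M dl : R) : (0 < n)%N -> 0 < dl -> 0 <= M -> (forall e, smooth1 (G e)) ->
  (forall e (x : R), (e < n)%N -> 0 <= x <= 1 -> `|G e x| <= M) ->
  exists g, [/\ smooth1 g, forall x, x <= dl -> g x = 0, forall x, 1 - dl <= x -> g x = 0 &
    I01 (fun x => (g x - pw n G x) ^+ 2) <= M ^+ 2 * (n%:R * (4 * dl))].
Proof.
move=> n0 dl0 M0 sG hM.
have [chi hchi] := choice (fun e : nat => plateau (node n e + dl) (node n e.+1 - dl) dl0).
pose g x := \sum_(e < n) chi e x * G e x.
have sg : smooth1 g.
  by apply: smooth1_sum => e _; apply: smooth1M => //; have [] := hchi e.
have node_ge0 e : 0 <= node n e :> R by rewrite -(@node0 R n) node_le.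
have node_le1 e : (e < n)%N -> node n e.+1 <= 1 :> R by move=> en; rewrite -(@node1 R n)// node_le.
have gcell e x : (e < n)%N -> node n e <= x -> x <= node n e.+1 -> g x = chi e x * G e x.
  move=> en x1 x2; rewrite /g (bigD1 (Ordinal en))//= big1 ?addr0// => i ie.
  have [_ cl cr _ _] := hchi i; have : (i < e)%N || (e < i)%N by rewrite -neq_ltn.
  move=> /orP[ie'|ei].
    rewrite cr ?mul0r//; have : node n i.+1 <= node n e :> R by exact: node_le.
    lra.
  rewrite cl ?mul0r//; have : node n e.+1 <= node n i :> R by exact: node_le.
  lra.
exists g; split=> //.
- move=> x xd; rewrite /g big1// => e _; have [_ cl _ _ _] := hchi e.
  by rewrite cl ?mul0r//; have := node_ge0 e; lra.
- move=> x xd; rewrite /g big1// => e _; have [_ _ cr _ _] := hchi e.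
  by rewrite cr ?mul0r//; have := node_le1 e (ltn_ord e); lra.
pose ind e x : R := (\1_(`[node n e, node n e + 2 * dl]%classic : set R) x : R) +
  \1_(`[node n e.+1 - 2 * dl, node n e.+1]%classic : set R) x.
have bind e : bmeas O01 (ind e) by apply: bmeasD; exact: bmeas_indic.
have ind0 e x : 0 <= ind e x by rewrite addr_ge0// indicE ler0n.
have bG : bmeas O01 (pw n G).
  by apply: bmeas_pw => //; apply: ccont_continuous => e; exact: smooth1_continuous.
have bgG : bmeas O01 (fun x => (g x - pw n G x) ^+ 2).
  rewrite (_ : (fun x => _) = fun x => (g x - pw n G x) * (g x - pw n G x)).
    by apply: bmeasM; apply: bmeasB => //; apply: bmeas_continuous; exact: smooth1_continuous.
  by apply/funext => x; rewrite expr2.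
have bsum : bmeas O01 (fun x => M ^+ 2 * \sum_(e < n) ind e x).
  by apply: bmeasZ; apply: bmeas_sum.
apply: (@le_trans _ _ (I01 (fun x => M ^+ 2 * \sum_(e < n) ind e x))).
  apply: le_I01 => // x xO.
  have [en x1 x2] := element_of_node n0 xO; set e := element_of n x in en x1 x2.
  rewrite /pw -/e (gcell e)//; last exact: ltW.
  have [_ _ _ c1 c01] := hchi e; have /andP[c0 cle] := c01 x.
  have -> : chi e x * G e x - G e x = (chi e x - 1) * G e x by ring.
  have hG : G e x ^+ 2 <= M ^+ 2.
    by rewrite -real_normK ?num_real// lerXn2r ?nnegrE//; apply: hM => //; exact: O01_le.
  have hc : (chi e x - 1) ^+ 2 <= \sum_(e < n) ind e x.
    have hc1 : (chi e x - 1) ^+ 2 <= 1.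
      have -> : (chi e x - 1) ^+ 2 = (1 - chi e x) ^+ 2 by ring.
      by rewrite expr_le1// ?subr_ge0// gerBl.
    rewrite (bigD1 (Ordinal en))//=.
    have hs : 0 <= \sum_(i < n | i != Ordinal en) ind i x by exact: sumr_ge0.
    have [h1|h1] := leP x (node n e + 2 * dl).
      apply: le_trans hc1 _; rewrite /ind [X in X + _ + _]indicE mem_set/=; last by rewrite in_itv /= x1 h1.
      by rewrite -addrA lerDl addr_ge0// indicE ler0n.
    have [h2|h2] := leP (node n e.+1 - 2 * dl) x.
      apply: le_trans hc1 _; rewrite /ind [X in _ + X + _]indicE mem_set/=; last first.
        by rewrite in_itv /= h2 ltW.
      by rewrite addrAC lerDr addr_ge0// indicE ler0n.
    by rewrite c1 ?subrr ?expr0n/= ?addr_ge0//; lra.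
  by rewrite exprMn mulrC ler_pM// sqr_ge0.
rewrite I01Z; last exact: bmeas_sum.
rewrite ler_wpM2l ?sqr_ge0// I01_sum//.
apply: (@le_trans _ _ (\sum_(e < n) 4 * dl)).
  apply: ler_sum => e _; rewrite I01D; try exact: bmeas_indic.
  have h1 : node n e <= node n e + 2 * dl :> R by lra.
  have h2 : node n e.+1 - 2 * dl <= node n e.+1 :> R by lra.
  have := I01_indic_le h1; have := I01_indic_le h2; lra.
by rewrite sumr_const card_ord -[leLHS]mulr_natl.
Qed.

Lemma cutoff_constant_le (A S k a b : R) : a <= k -> b ^+ 2 <= k -> 0 <= S ->
  2 * a + 2 * ((3 * S) ^+ 2 * b ^+ 2) <= (2 + 18 * S ^+ 2) * k.
Proof.
move=> h1 h2 S0.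
have h3 : S ^+ 2 * b ^+ 2 <= S ^+ 2 * k by rewrite ler_wpM2l ?sqr_ge0.
have -> : (3 * S) ^+ 2 * b ^+ 2 = 9 * (S ^+ 2 * b ^+ 2) by ring.
have -> : (2 + 18 * S ^+ 2) * k = 2 * k + 18 * (S ^+ 2 * k) by ring.
lra.
Qed.

(* [th] integrates the derivative of [F] cut off near the nodes; the end value of the integral is
   removed with a smooth step. *)
Lemma pws0_density n F (e : R) : pws0 n F -> 0 < e -> exists (th : R -> R) (a b : R),
  [/\ smooth1 th, 0 < a, b < 1, (forall x : R, ~ (a <= x <= b) -> th x = 0) &
      apw n (csub (fun=> th) F) (csub (fun=> th) F) <= e /\
      bpw n (csub (fun=> th) F) (csub (fun=> th) F) <= e].
Proof.
move=> pF e0; have [n0 sF mF F0 F1] := pF.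
have sG i : smooth1 (cderiv F i) by exact: smooth1_derive.
have [M M0 hM] := cells_bounded n (fun i => smooth1_continuous (sG i)).
have [s [ss s0 s1 s01]]  := @smooth_step R.
have ss3 : smooth1 (fun x => s (3 * x + -1)) by exact: smooth1_affine.
have sds := smooth1_derive ss.
have [S' hS'] := bounded_segment (smooth1_continuous (smooth1_affine 3 (-1) sds)).
pose S : R := `|S'|.
have S0 : 0 <= S by exact: normr_ge0.
have hS (x : R) : 0 <= x <= 1 -> `|derive1 s (3 * x + -1)| <= S.
  by move=> hx; apply: le_trans (hS' x hx) _; exact: ler_norm.
(* [k * dl] bounds the squared cutoff error and [Q] collects the constants of the energy estimate,
   so that [dl = e / Q] brings it below [e]. *)
pose k : R := M ^+ 2 * (n%:R * 4); pose Q : R := (2 + 18 * S ^+ 2) * k + 1.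
have k0 : 0 <= k by rewrite mulr_ge0 ?sqr_ge0// mulr_ge0.
have Q0 : 0 < Q by rewrite ltr_wpDl// mulr_ge0// addr_ge0// mulr_ge0// sqr_ge0.
pose dl : R := e / Q.
have dl0 : 0 < dl by rewrite divr_gt0.
have [g [sg g0 g1 hg]] := plateau_cells n0 dl0 M0 sG hM.
have [P [dP P0]] := antiderivative (smooth1_continuous sg) (fun x x0 => g0 x (le_trans x0 (ltW dl0))).
have sP := smooth1_antiderivative dP sg.
have Pl (x : R) : x <= dl -> P x = 0.
  move=> xd; have [x0|x0] := leP x 0; first exact: P0.
  rewrite -(P0 0 (lexx _)); apply/esym; apply: (derive0_eq dP (ltW x0)) => t /andP[_ tx].
  by apply: g0; exact: le_trans xd.
have Pr (x : R) : 1 - dl <= x -> P x = P 1.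
  move=> xd; have [x1|x1] := leP x 1.
    by apply: (derive0_eq dP) => // t /andP[t1 _]; apply: g1; exact: le_trans t1.
  apply/esym; apply: (derive0_eq dP (ltW x1)) => t /andP[t1 _]; apply: g1.
  by apply: le_trans t1; rewrite gerBl ltW.
(* The step rises between 1/3 and 2/3, away from both ends, so that [th] keeps a compact support in
   the open interval. *)
pose c : R := P 1; pose th (x : R) : R := P x + (- c) * s (3 * x + -1).
have sth : smooth1 th by apply: smooth1D => //; apply: smooth1M => //; exact: smooth1_cst.
have dth (x : R) : is_derive x 1 th (g x + (- c) * (3 * derive1 s (3 * x + -1))).
  apply: is_deriveD; apply: (is_derive_eq (is_deriveZ (- c) (is_derive_comp_affine 3 (-1) x (smooth1_is_derive ss)))).
  by [].
pose a : R := Num.min dl (1/3); pose b : R := Num.max (1 - dl) (2/3).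
have a0 : 0 < a by rewrite lt_min dl0/=; lra.
have b1 : b < 1 by rewrite gt_max gtrBl dl0/=; lra.
have th0 (x : R) : ~ (a <= x <= b) -> th x = 0.
  move=> /negP; rewrite negb_and -!ltNge => /orP[].
    by rewrite lt_min => /andP[h1 h2]; rewrite /th Pl ?ltW// s0 ?mulr0 ?addr0//; lra.
  by rewrite gt_max => /andP[h1 h2]; rewrite /th Pr ?ltW// s1 ?mulr1 ?subrr//; lra.
have thend0 : th 0 = 0 by apply: th0; rewrite [a <= 0]leNgt a0.
have thend1 : th 1 = 0 by apply: th0; rewrite [1 <= b]leNgt b1 andbF.
exists th, a, b; split=> //.
have pth : pws0 n (fun=> th : R -> R) by split.
have pD := pws0_csub pth pF.
have bG : bmeas O01 (pw n (cderiv F)).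
  by apply: bmeas_pw => //; apply: ccont_continuous => i; exact: smooth1_continuous.
have bg : bmeas O01 g by apply: bmeas_continuous; exact: smooth1_continuous.
have bgG : bmeas O01 (fun x => g x - pw n (cderiv F) x) by exact: bmeasB.
have IG : I01 (pw n (cderiv F)) = 0.
  have hcc : ccont n (cderiv F) by apply: ccont_continuous => i; exact: smooth1_continuous.
  have hd i : (i < n)%N -> forall x : R, node n i <= x <= node n i.+1 -> is_derive x 1 (F i) (cderiv F i x).
    by move=> _ x _; exact: smooth1_is_derive.
  by rewrite (I01_pw_FTC n0 hcc hd) (telescope_nodes n0 mF) F0 F1 subrr.
have Ig : I01 g = c by rewrite (I01_FTC dP (smooth1_continuous sg)) (P0 0)// subr0.
(* The derivative of [F] has integral zero, so [c] is the integral of the cutoff error alone. *)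
have hc : c ^+ 2 <= k * dl.
  rewrite -[c]subr0 -Ig -IG -I01B//; apply: le_trans (sqr_I01_le bgG) _.
  by apply: le_trans hg _; rewrite /k; lra.
have dlQ : (2 + 18 * S ^+ 2) * (k * dl) <= e.
  have -> : e = Q * dl by rewrite /dl mulrC divfK// gt_eqF.
  by rewrite mulrA ler_wpM2r ?(ltW dl0)// /Q lerDl.
have ha : apw n (csub (fun=> th) F) (csub (fun=> th) F) <= e.
  apply: le_trans dlQ.
  rewrite /apw cderiv_csub//.
  have bsq : bmeas O01 (fun x => (g x - pw n (cderiv F) x) ^+ 2).
    by rewrite (_ : (fun x => _) = fun x => (g x - pw n (cderiv F) x) * (g x - pw n (cderiv F) x)); [exact: bmeasM|apply/funext => x; rewrite expr2].
  apply: (@le_trans _ _ (I01 (fun x => 2 * (g x - pw n (cderiv F) x) ^+ 2 + 2 * ((3 * S) ^+ 2 * c ^+ 2)))).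
    apply: le_I01; first by rewrite -cderiv_csub//; apply: bmeas_pwM => // i; exact: smooth1_cderiv_continuous (pws0_smooth pD) _.
      by apply: bmeasD; [exact: bmeasZ|exact: bmeas_cst].
    move=> x xO; rewrite /pw /cmul /csub (_ : cderiv (fun=> th) _ x = g x + (- c) * (3 * derive1 s (3 * x + -1))); last first.
      by rewrite /cderiv (derive1_is dth).
    set gx := g x; set Gx := cderiv F _ x; set y := derive1 s _.
    have hy : y ^+ 2 <= S ^+ 2.
      by rewrite -real_normK ?num_real// lerXn2r ?nnegrE//; apply: hS; exact: O01_le.
    have h1 : c ^+ 2 * y ^+ 2 <= c ^+ 2 * S ^+ 2 by rewrite ler_wpM2l ?sqr_ge0.
    have -> : (3 * S) ^+ 2 * c ^+ 2 = 9 * (c ^+ 2 * S ^+ 2) by ring.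
    have h2 := sqr_ge0 (gx - Gx + 3 * (c * y)).
    have -> : (gx + - c * (3 * y) - Gx) * (gx + - c * (3 * y) - Gx) =
      2 * (gx - Gx) ^+ 2 + 18 * (c ^+ 2 * y ^+ 2) - (gx - Gx + 3 * (c * y)) ^+ 2 by ring.
    lra.
  rewrite I01D ?I01_cst ?I01Z//; try by [exact: bmeasZ|exact: bmeas_cst].
  by apply: cutoff_constant_le => //; apply: le_trans hg _; rewrite /k; lra.
split=> //; apply: le_trans ha.
(* The mass of the difference is at most its energy: this is the gap inequality with no sine
   removed, whose constant [pi / 2] exceeds 1. *)
have := spectral_gap1 0 pD; rewrite big_ord0 subr0 => h; apply: le_trans h _.
have h1 := @half_freq_ge R 0.
by rewrite ler_pdivrMr ?exprn_gt0 ?(lt_le_trans _ h1)// ler_peMr ?bpw_ge0// exprn_ege1.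
Qed.

End density.

(** * Tensor products of piecewise smooth functions in H^1_0 *)

Section tensor_density.
Context {R : realType}.
Local Notation O01 := (`]0%R, 1%R[%classic : set R).
Local Notation Om := (@Omega R _).
Implicit Types (F G H : nat -> R -> R).

Lemma derive_tens d (f df : 'I_d -> R -> R) (k : 'I_d) x : (forall t : R, is_derive t 1 (f k) (df k t)) ->
  is_derive x (delta_mx ord0 k) (tens f) (tens (repl k f df) x).
Proof.
move=> hd; pose c := \prod_(i < d | i != k) f i (x ord0 i); pose t := x ord0 k.
have xE : upd x k t = x by apply/rowP => i; rewrite mxE; case: eqP => // ->.
have h1 : is_derive t 1 (fun s => f k s * c) (df k t * c).
  have hM := is_deriveM (hd t) (is_derive_cst c t 1).
  by apply: (is_derive_eq hM); rewrite scaler0 add0r; exact: mulrC.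
have e : (fun h : R => h^-1 *: ((tens f \o shift x) (h *: delta_mx ord0 k) - tens f x)) =
   (fun h : R => h^-1 *: (((fun s => f k s * c) \o shift t) (h *: 1) - f k t * c)).
  apply/funext => h /=; rewrite /shift /=.
  have -> : h *: delta_mx ord0 k + x = upd x k (h *: 1 + t).
    apply/rowP => i; rewrite !mxE eqxx /=; case: eqP => [->|_].
      by rewrite /GRing.scale /= mulr1.
    by rewrite mulr0 add0r.
  by rewrite -[in X in _ - X]xE !tens_upd.
case: h1 => h1 h2; split; first by rewrite /derivable e; exact: h1.
rewrite /derive e; apply: etrans h2 _.
by rewrite -[x in RHS]xE tens_repl_upd.
Qed.

Lemma foldr_partial_tens d (th : 'I_d -> R -> R) (s : seq 'I_d) : (forall k, smooth1 (th k)) ->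
  exists2 th' : 'I_d -> R -> R, (forall k, smooth1 (th' k)) & foldr (@partial R d) (tens th) s = tens th'.
Proof.
move=> sth; elim: s => [|k s [th' sth' e]]; first by exists th.
exists (repl k th' (fun k => derive1 (th' k))).
  by move=> i; rewrite /repl; case: eqP => _; [exact: smooth1_derive|exact: sth'].
rewrite /= e; apply/funext => x; rewrite /partial.
have h := derive_tens x (smooth1_is_derive (sth' k)) (df := fun k => derive1 (th' k)).
exact: (@derive_val _ _ _ _ _ _ _ h).
Qed.

Lemma continuous_tens d (f : 'I_d -> R -> R) : (forall k, continuous (f k)) -> continuous (tens f).
Proof.
move=> cf; rewrite /tens; elim: (index_enum _) => [|k s IH].
  by under eq_fun do rewrite big_nil; exact: cst_continuous.
rewrite (_ : (fun x => _) = fun x : 'rV[R]_d => f k (x ord0 k) * \prod_(i <- s) f i (x ord0 i)); last first.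
  by apply/funext => x; rewrite big_cons.
have ck : continuous (fun x : 'rV[R]_d => f k (x ord0 k)).
  by move=> y; apply: (@continuous_comp _ _ _ (fun x : 'rV[R]_d => x ord0 k) (f k)); [exact: continuous_coord|exact: cf].
by move=> x; exact: (continuousM (ck x) (IH x)).
Qed.

Lemma test_function_tens d (th : 'I_d -> R -> R) (a b : 'I_d -> R) :
  (forall k, smooth1 (th k)) -> (forall k, 0 < a k) -> (forall k, b k < 1) ->
  (forall k x, ~ (a k <= x <= b k) -> th k x = 0) -> test_function (tens th).
Proof.
move=> sth a0 b1 h0; split.
  move=> s; have [th' sth' ->] := foldr_partial_tens s sth; split.
    by apply: continuous_tens => k; exact: smooth1_continuous.
  by move=> k x; have [] := derive_tens x (smooth1_is_derive (sth' k)) (df := fun k => derive1 (th' k)).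
exists [set v : 'rV[R]_d | forall i, (`[a i, b i]%classic : set R) (v ord0 i)]; split.
- by apply: (@rV_compact R d (fun i => `[a i, b i]%classic)) => i; exact: segment_compact.
- move=> v hv k; have := hv k; rewrite /= in_itv /= => /andP[h1 h2].
  by rewrite (lt_le_trans (a0 k) h1) (le_lt_trans h2 (b1 k)).
- move=> x hx; have [k hk] : exists k, ~ (a k <= x ord0 k <= b k).
    apply: contrapT => hn; apply: hx => i /=; rewrite in_itv /=.
    by apply: contrapT => hi; apply: hn; exists i.
  by rewrite /tens (bigD1 k)//= h0// mul0r.
Qed.

Lemma sum_sqr_le (I : finType) (a : I -> R) : (\sum_i a i) ^+ 2 <= #|I|%:R * \sum_i a i ^+ 2.
Proof.
have := @sum_CS R I predT (fun=> 1) a.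
under eq_bigr do rewrite mul1r.
by under [X in _ <= X * _ -> _]eq_bigr do rewrite expr1n; rewrite sumr_const.
Qed.

Lemma bform_tens d (f g : 'I_d -> R -> R) : (forall k, bmeas O01 (f k)) -> (forall k, bmeas O01 (g k)) ->
  bform (tens f) (tens g) = \prod_k I01 (fun t => f k t * g k t).
Proof.
move=> bf bg; rewrite bformE -cube_integral_tens; last by move=> k; exact: bmeasM.
by congr cube_integral; apply/funext => x; rewrite /tens big_split.
Qed.

(** The factors are exchanged one at a time. One [d] counts the terms and the other comes from
    squaring their sum; in each term one factor is a difference and the others are bounded through
    [B]. *)
Lemma tens_close d (f g : 'I_d -> R -> R) (B e : R) : 1 <= B -> 0 <= e ->
  (forall k, bmeas O01 (f k)) -> (forall k, bmeas O01 (g k)) ->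
  (forall k, I01 (fun t => f k t ^+ 2) <= B) -> (forall k, I01 (fun t => g k t ^+ 2) <= B) ->
  (forall k, I01 (fun t => (f k t - g k t) ^+ 2) <= e) ->
  bform (tens f \- tens g) (tens f \- tens g) <= d%:R ^+ 2 * B ^+ d * e.
Proof.
move=> B1 e0 bf bg hf hg hfg; have B0 : 0 <= B := le_trans ler01 B1.
pose h (l k : 'I_d) : R -> R := if (k < l)%N then f k else if k == l then fun t => f k t - g k t else g k.
have bh l k : bmeas O01 (h l k) by rewrite /h; case: ifP => _ //; case: ifP => _ //; exact: bmeasB.
have bth l : bmeas Om (tens (h l)) by exact: bmeas_tens.
have E x : (tens f \- tens g) x = \sum_(l < d) tens (h l) x.
  rewrite /= /tens prod_telescope; apply: eq_bigr => l _; apply: eq_bigr => k _.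
  by rewrite /h; case: ifP => // _; case: ifP.
have sqM (u : R -> R) : (fun t => u t * u t) = (fun t => u t ^+ 2) by apply/funext => t; rewrite expr2.
have hI l : bform (tens (h l)) (tens (h l)) <= B ^+ d * e.
  rewrite bform_tens//; rewrite (bigD1 l)//=.
  have h1 : I01 (fun t => h l l t * h l l t) <= e.
    rewrite sqM (_ : h l l = fun t => f l t - g l t); first exact: hfg.
    by rewrite /h ltnn eqxx.
  have h2 : \prod_(k < d | k != l) I01 (fun t => h l k t * h l k t) <= B ^+ d.
    have : \prod_(k < d | k != l) I01 (fun t => h l k t * h l k t) <= \prod_(k < d | k != l) B.
      apply: ler_prod => k kl; apply/andP; split.
        by apply: I01_ge0 => t _; rewrite -expr2 sqr_ge0.
      by rewrite sqM /h (negbTE kl); case: ifP => _; [exact: hf|exact: hg].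
    move=> hh; apply: le_trans hh _; rewrite prodr_const ler_weXn2l//.
    by rewrite -[leqRHS]card_ord max_card.
  rewrite mulrC; apply: ler_pM => //.
    by apply: prodr_ge0 => k _; apply: I01_ge0 => t _; rewrite -expr2 sqr_ge0.
  by apply: I01_ge0 => t _; rewrite -expr2 sqr_ge0.
have L2h l : L2 (tens (h l)) by exact: bmeas_L2.
have bS : bmeas Om (fun x => \sum_(l < d) tens (h l) x) by exact: bmeas_sum.
have -> : bform (tens f \- tens g) (tens f \- tens g) = cube_integral (fun x => (\sum_(l < d) tens (h l) x) ^+ 2).
  by rewrite bformE; congr cube_integral; apply/funext => x; rewrite E expr2.
have bsq l : bmeas Om (fun x => tens (h l) x * tens (h l) x) by exact: bmeasM.
apply: (@le_trans _ _ (cube_integral (fun x => d%:R * \sum_(l < d) (tens (h l) x * tens (h l) x)))).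
  rewrite /cube_integral; apply: le_Rintegral.
  - exact: measurable_Omega.
  - have := bmeas_cube_integrable (bmeasM bS bS); rewrite /cube_integrable.
    by congr (_.-integrable _ _); apply/funext => x /=; rewrite expr2.
  - by apply: bmeas_cube_integrable; apply: bmeasZ; exact: bmeas_sum.
  - move=> x _; have := sum_sqr_le (fun l : 'I_d => tens (h l) x); rewrite card_ord.
    by under [X in _ <= _ * X -> _]eq_bigr do rewrite expr2.
have -> : cube_integral (fun x => d%:R * \sum_(l < d) (tens (h l) x * tens (h l) x)) = d%:R * \sum_(l < d) bform (tens (h l)) (tens (h l)).
  have -> : (fun x => d%:R * \sum_(l < d) (tens (h l) x * tens (h l) x)) =
     fun x => (d%:R * (\sum_(l < d) (tens (h l) x * tens (h l) x))) * 1 by apply/funext => x; rewrite mulr1.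
  rewrite -[LHS]bformE bformZl; first last.
  - by apply: bmeas_L2; exact: bmeas_cst.
  - by apply: bmeas_L2; exact: bmeas_sum.
  rewrite bform_suml; first last.
  - by apply: bmeas_L2; exact: bmeas_cst.
  - by move=> l; apply: bmeas_L2.
  congr (_ * _); apply: eq_bigr => l _; rewrite !bformE; congr cube_integral.
  by apply/funext => x; rewrite mulr1.
rewrite expr2 -!mulrA ler_wpM2l//.
apply: (@le_trans _ _ (\sum_(l < d) B ^+ d * e)); first exact: ler_sum.
by rewrite sumr_const card_ord -[leLHS]mulr_natl.
Qed.

Lemma bmeas_pws0 n F : pws0 n F -> bmeas O01 (pw n F).
Proof. by move=> pF; apply: bmeas_pw; [exact: pws0_n pF|apply: ccont_continuous => e; exact: smooth1_continuous (pws0_smooth pF e)]. Qed.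

Lemma bmeas_cderiv n F : pws0 n F -> bmeas O01 (pw n (cderiv F)).
Proof. by move=> pF; apply: bmeas_pw; [exact: pws0_n pF|apply: ccont_continuous => e; exact: smooth1_cderiv_continuous (pws0_smooth pF) _]. Qed.

Lemma I01_sqr_le (f g : R -> R) (e : R) : bmeas O01 f -> bmeas O01 g ->
  I01 (fun t => (f t - g t) ^+ 2) <= e -> I01 (fun t => f t ^+ 2) <= 2 * I01 (fun t => g t ^+ 2) + 2 * e.
Proof.
move=> bf bg h.
have sq (u : R -> R) : bmeas O01 u -> bmeas O01 (fun t => u t ^+ 2).
  by move=> bu; rewrite (_ : (fun t => _) = fun t => u t * u t); [exact: bmeasM|apply/funext => t; rewrite expr2].
have bfg := bmeasB bf bg.
apply: (@le_trans _ _ (I01 (fun t => 2 * g t ^+ 2 + 2 * (f t - g t) ^+ 2))).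
  apply: le_I01; [exact: sq|by apply: bmeasD; apply: bmeasZ; exact: sq|].
  move=> t _; have := sqr_ge0 (f t - 2 * g t); set x := f t; set y := g t.
  have -> : (x - 2 * y) ^+ 2 = 2 * y ^+ 2 + 2 * (x - y) ^+ 2 - x ^+ 2 by ring.
  by rewrite subr_ge0.
rewrite I01D ?I01Z; try exact: sq; try by apply: bmeasZ; exact: sq.
by rewrite lerD2l ler_wpM2l.
Qed.

(** Covers the B-splines and, with a single cell, the sines. Each factor is approximated together
    with its derivative by smooth functions of compact support, and [tens_close] applies to the
    product and to its partial derivatives. *)
Lemma H01_tens d (n : 'I_d -> nat) (F : 'I_d -> nat -> R -> R) : (forall k, pws0 (n k) (F k)) ->
  H01_gradient (tens (fun k => pw (n k) (F k)))
    (fun l => tens (repl l (fun k => pw (n k) (F k)) (fun k => pw (n k) (cderiv (F k))))).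
Proof.
move=> pF; set f := fun k => pw (n k) (F k); set df := fun k => pw (n k) (cderiv (F k)).
have bf k : bmeas O01 (f k) by exact: bmeas_pws0.
have bdf k : bmeas O01 (df k) by exact: bmeas_cderiv.
have brepl (u v : 'I_d -> R -> R) l : (forall k, bmeas O01 (u k)) -> (forall k, bmeas O01 (v k)) ->
  forall k, bmeas O01 (repl l u v k) by move=> bu bv k; rewrite /repl; case: ifP.
have key (m : nat) : exists th : 'I_d -> R -> R, [/\ forall k, smooth1 (th k), test_function (tens th),
   forall k, I01 (fun t => (th k t - f k t) ^+ 2) <= m.+1%:R^-1 &
   forall k, I01 (fun t => (derive1 (th k) t - df k t) ^+ 2) <= m.+1%:R^-1].
  have e0 : (0 : R) < m.+1%:R^-1 by rewrite invr_gt0 ltr0n.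
  have [th hth] := choice (fun k => pws0_density (pF k) e0).
  have [a ha] := choice hth; have [b hb] := choice ha.
  exists th; split.
  - by move=> k; have [] := hb k.
  - by apply: (@test_function_tens d th a b) => k; have [h1 h2 h3 h4 h5] := hb k.
  - move=> k; have [_ _ _ _ [_ h]] := hb k.
    suff <- : bpw (n k) (csub (fun=> th k) (F k)) (csub (fun=> th k) (F k)) = I01 (fun t => (th k t - f k t) ^+ 2) by [].
    by congr I01; apply/funext => t; rewrite /pw /cmul /csub expr2.
  - move=> k; have [s1 _ _ _ [h _]] := hb k.
    suff <- : apw (n k) (csub (fun=> th k) (F k)) (csub (fun=> th k) (F k)) = I01 (fun t => (derive1 (th k) t - df k t) ^+ 2) by [].
    have e : cderiv (csub (fun=> th k) (F k)) = csub (fun=> derive1 (th k)) (cderiv (F k)).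
      by rewrite cderiv_csub//; exact: pws0_smooth (pF k).
    rewrite /apw e; by congr I01; apply/funext => t; rewrite /pw /cmul /csub expr2.
have [th hth] := choice key.
have Bf : exists2 B : R, 1 <= B & forall k, 2 * I01 (fun t => f k t ^+ 2) + 2 <= B /\ 2 * I01 (fun t => df k t ^+ 2) + 2 <= B.
  pose c k := 2 * I01 (fun t => f k t ^+ 2) + 2 * I01 (fun t => df k t ^+ 2).
  have sq0 (u : R -> R) : 0 <= I01 (fun t => u t ^+ 2) by apply: I01_ge0 => t _; exact: sqr_ge0.
  have c0 k : 0 <= c k by rewrite addr_ge0// mulr_ge0.
  exists (2 + \sum_k c k); first by have : 0 <= \sum_k c k by [exact: sumr_ge0]; lra.
  move=> k; have : c k <= \sum_k c k by rewrite (bigD1 k)//= lerDl sumr_ge0.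
  by rewrite /c; have := sq0 (f k); have := sq0 (df k); lra.
have [B B1 hB] := Bf.
have inv1 m : m.+1%:R^-1 <= 1 :> R by rewrite invf_le1 ?ltr0n// ler1n.
have inv0 m : 0 <= m.+1%:R^-1 :> R by rewrite invr_ge0.
have cvg0 (z : nat -> R) : (forall m, 0 <= z m) -> (forall m, z m <= d%:R ^+ 2 * B ^+ d * m.+1%:R^-1) ->
  z @ \oo --> (0 : R).
  move=> z0 zle; apply: (@squeeze_cvgr _ _ _ _ (fun=> 0) (fun m => d%:R ^+ 2 * B ^+ d * m.+1%:R^-1)).
  - by apply: nearW => m; rewrite z0 zle.
  - exact: cvg_cst.
  - rewrite -[X in _ --> X](mulr0 (d%:R ^+ 2 * B ^+ d)); apply: cvgMr.
    exact: cvg_harmonic.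
have close (u v : 'I_d -> R -> R) m : (forall k, bmeas O01 (u k)) -> (forall k, bmeas O01 (v k)) ->
    (forall k, I01 (fun t => (u k t - v k t) ^+ 2) <= m.+1%:R^-1) ->
    (forall k, 2 * I01 (fun t => v k t ^+ 2) + 2 <= B) ->
    bform (tens u \- tens v) (tens u \- tens v) <= d%:R ^+ 2 * B ^+ d * m.+1%:R^-1.
  move=> bu bv huv hv; apply: tens_close => // k.
    apply: le_trans (I01_sqr_le (bu k) (bv k) (huv k)) _; apply: le_trans (hv k).
    by rewrite lerD2l -[leRHS]mulr1 ler_wpM2l.
  have h0 : 0 <= I01 (fun t => v k t ^+ 2) by apply: I01_ge0 => t _; exact: sqr_ge0.
  by have := hv k; lra.
have bth m k : bmeas O01 (th m k) by apply: bmeas_continuous; apply: smooth1_continuous; have [] := hth m.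
have bdth m k : bmeas O01 (derive1 (th m k)).
  by apply: bmeas_continuous; apply: smooth1_continuous; apply: smooth1_derive; have [] := hth m.
split.
- by apply: bmeas_L2; exact: bmeas_tens.
- by move=> l; apply: bmeas_L2; apply: bmeas_tens; exact: brepl.
- exists (fun m => tens (th m)); split.
  + by move=> m; have [] := hth m.
  + apply: cvg0 => m; first exact: bform_ge0.
    apply: close => //; first by have [] := hth m.
    by move=> k; have [] := hB k.
  + move=> l; apply: cvg0 => m; first exact: bform_ge0.
    have -> : partial l (tens (th m)) = tens (repl l (th m) (fun k => derive1 (th m k))).
      apply/funext => x; have [s1 _ _ _] := hth m.
      exact: (@derive_val _ _ _ _ _ _ _ (derive_tens x (smooth1_is_derive (s1 l)) (df := fun k => derive1 (th m k)))).
    have [_ _ h1 h2] := hth m.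
    apply: close; try exact: brepl.
      by move=> k; rewrite /repl; case: ifP.
    by move=> k; rewrite /repl; have [] := hB k; case: ifP.
Qed.

End tensor_density.

(** * Eigensystems of the Laplacian *)

Section eigenfunctions.
Context {R : realType} (n : nat).
Implicit Types (u v w : 'rV[R]_n -> R) (g h : 'I_n -> 'rV[R]_n -> R).

Lemma partial_lin (a b : R) u v k : (forall x, derivable u x (delta_mx ord0 k)) ->
  (forall x, derivable v x (delta_mx ord0 k)) ->
  partial k (fun x => a * u x + b * v x) = (fun x => a * partial k u x + b * partial k v x) /\
  forall x, derivable (fun x => a * u x + b * v x) x (delta_mx ord0 k).
Proof.
move=> du dv.
have h x : is_derive x (delta_mx ord0 k) (fun x => a * u x + b * v x) (a * partial k u x + b * partial k v x).
  have hu := DeriveDef (du x) (erefl _); have hv := DeriveDef (dv x) (erefl _).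
  exact: (is_deriveD (is_deriveZ a hu) (is_deriveZ b hv)).
split; last by move=> x; have [] := h x.
by apply/funext => x; rewrite {1}/partial (@derive_val _ _ _ _ _ _ _ (h x)).
Qed.

Lemma test_lin (a b : R) u v : test_function u -> test_function v ->
  test_function (fun x => a * u x + b * v x).
Proof.
move=> [su [K [cK KO uK]]] [sv [L [cL LO vL]]]; split.
  have E s : foldr (@partial R n) (fun x => a * u x + b * v x) s =
      fun x => a * foldr (@partial R n) u s x + b * foldr (@partial R n) v s x.
    by elim: s => //= k s ->; have [] := partial_lin a b ((su s).2 k) ((sv s).2 k).
  move=> s; rewrite E; split.
    move=> x; have c1 := (su s).1 x; have c2 := (sv s).1 x.
    exact: (continuousD (continuousM (@cst_continuous _ _ a x) c1) (continuousM (@cst_continuous _ _ b x) c2)).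
  by move=> k; have [] := partial_lin a b ((su s).2 k) ((sv s).2 k).
exists (K `|` L); split.
- exact: compactU.
- by move=> x [/KO|/LO].
- by move=> x /not_orP[h1 h2]; rewrite uK// vL// !mulr0 addr0.
Qed.

Lemma L2_lin (a b : R) u v : L2 u -> L2 v -> L2 (fun x => a * u x + b * v x).
Proof. by move=> Lu Lv; apply: L2D; exact: L2Z. Qed.

Lemma bform_linl (a b : R) u v w : L2 u -> L2 v -> L2 w ->
  bform (fun x => a * u x + b * v x) w = a * bform u w + b * bform v w.
Proof. by move=> Lu Lv Lw; rewrite bformDl ?bformZl//; exact: L2Z. Qed.

Lemma bform_linr (a b : R) u v w : L2 u -> L2 v -> L2 w ->
  bform w (fun x => a * u x + b * v x) = a * bform w u + b * bform w v.
Proof. by move=> Lu Lv Lw; rewrite bformC bform_linl// ![bform w _]bformC. Qed.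

Lemma bform_lin_le (a b : R) u v : L2 u -> L2 v ->
  bform (fun x => a * u x + b * v x) (fun x => a * u x + b * v x) <=
  2 * a ^+ 2 * bform u u + 2 * b ^+ 2 * bform v v.
Proof.
move=> Lu Lv; have := bform_ge0 (fun x => a * u x + (- b) * v x).
rewrite !bform_linl ?bform_linr//; try exact: L2_lin.
rewrite [bform v u]bformC; set x := bform u u; set y := bform u v; set z := bform v v.
have -> : a * (a * x + - b * y) + - b * (a * y + - b * z) = a ^+ 2 * x - 2 * a * b * y + b ^+ 2 * z by ring.
have -> : a * (a * x + b * y) + b * (a * y + b * z) = a ^+ 2 * x + 2 * a * b * y + b ^+ 2 * z by ring.
move=> ?; lra.
Qed.

Lemma H01_gradient_L2 u g : H01_gradient u g -> L2 u.
Proof. by case. Qed.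

Lemma H01_L2 u : H01 u -> L2 u.
Proof. by case=> g []. Qed.

Lemma H01_gradient_lin (a b : R) u v g h : H01_gradient u g -> H01_gradient v h ->
  H01_gradient (fun x => a * u x + b * v x) (fun k x => a * g k x + b * h k x).
Proof.
move=> [Lu Lg [p [tp pu pg]]] [Lv Lh [q [tq qv qh]]].
have lim (P Q : nat -> 'rV[R]_n -> R) (U V : 'rV[R]_n -> R) : (forall m, L2 (P m)) -> (forall m, L2 (Q m)) -> L2 U -> L2 V ->
    bform (P m \- U) (P m \- U) @[m --> \oo] --> (0 : R) -> bform (Q m \- V) (Q m \- V) @[m --> \oo] --> (0 : R) ->
    bform ((fun x => a * P m x + b * Q m x) \- (fun x => a * U x + b * V x))
      ((fun x => a * P m x + b * Q m x) \- (fun x => a * U x + b * V x)) @[m --> \oo] --> (0 : R).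
  move=> LP LQ LU LV c1 c2.
  apply: (@squeeze_cvgr _ _ _ _ (fun=> 0) (fun m => 2 * a ^+ 2 * bform (P m \- U) (P m \- U) + 2 * b ^+ 2 * bform (Q m \- V) (Q m \- V))).
  - apply: nearW => m; rewrite bform_ge0 /=.
    have := bform_lin_le a b (L2B (LP m) LU) (L2B (LQ m) LV).
    suff -> : (fun x => a * P m x + b * Q m x) \- (fun x => a * U x + b * V x) =
      (fun x => a * (P m x - U x) + b * (Q m x - V x)) by [].
    by apply/funext => x /=; ring.
  - exact: cvg_cst.
  - have -> : (0 : R) = 2 * a ^+ 2 * 0 + 2 * b ^+ 2 * 0 by ring.
    by apply: cvgD; apply: cvgMr.
split; [exact: L2_lin|by move=> k; exact: L2_lin|].
exists (fun m x => a * p m x + b * q m x); split.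
- by move=> m; exact: test_lin.
- by apply: lim => // m; exact: test_L2.
- move=> k; have E m : partial k (fun x => a * p m x + b * q m x) = fun x => a * partial k (p m) x + b * partial k (q m) x.
    by have [] := partial_lin a b (((tp m).1 [::]).2 k) (((tq m).1 [::]).2 k).
  under eq_fun do rewrite E.
  by apply: (lim (fun m => partial k (p m)) (fun m => partial k (q m))) => // m; exact: test_partial_L2.
Qed.

Lemma H01_lin (a b : R) u v : H01 u -> H01 v -> H01 (fun x => a * u x + b * v x).
Proof. by move=> [g hg] [h hh]; eexists; exact: H01_gradient_lin hg hh. Qed.

Lemma aformC u v : aform u v = aform v u.
Proof. by apply: eq_bigr => k _; rewrite bformC. Qed.

Lemma aform_ge0 u : 0 <= aform u u.
Proof. by apply: sumr_ge0 => k _; exact: bform_ge0. Qed.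

Lemma aform_linl (a b : R) u v w : H01 u -> H01 v -> H01 w ->
  aform (fun x => a * u x + b * v x) w = a * aform u w + b * aform v w.
Proof.
move=> [g hg] [h hh] [k hk].
rewrite (aformE (H01_gradient_lin a b hg hh) hk) (aformE hg hk) (aformE hh hk) !mulr_sumr -big_split.
apply: eq_bigr => i _; have [_ L1 _] := hg; have [_ L2' _] := hh; have [_ L3 _] := hk.
by rewrite bform_linl.
Qed.

Lemma aform_linr (a b : R) u v w : H01 u -> H01 v -> H01 w ->
  aform w (fun x => a * u x + b * v x) = a * aform w u + b * aform w v.
Proof. by move=> hu hv hw; rewrite aformC (aform_linl a b hu hv hw) (aformC u) (aformC v). Qed.

Lemma eigen_lin (l a b : R) u v : eigen l u -> eigen l v -> eigen l (fun x => a * u x + b * v x).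
Proof.
move=> [hu eu] [hv ev]; split; first exact: H01_lin.
move=> w hw; rewrite (aform_linl a b hu hv hw) (bform_linl a b (H01_L2 hu) (H01_L2 hv) (H01_L2 hw)).
by rewrite (eu w hw) (ev w hw); ring.
Qed.

Lemma eigen_orthogonal (l m : R) u v : eigen l u -> eigen m v -> l != m -> bform u v = 0.
Proof.
move=> [hu eu] [hv ev] lm; have := eu v hv; rewrite aformC (ev u hu) [bform v u]bformC => /eqP.
by rewrite -subr_eq0 -mulrBl mulf_eq0 subr_eq0 eq_sym (negbTE lm) => /eqP.
Qed.

Definition tlam (al : 'I_n -> nat) : R := \sum_(k < n) freq (al k) ^+ 2.

Lemma tphi_gradient (al : 'I_n -> nat) : H01_gradient (@tphi R n al)
  (fun l => tens (repl l (fun k => phi (al k)) (fun k => dphi (al k)))).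
Proof.
have := @H01_tens R n (fun=> 1%N) (fun k => cphi (al k)) (fun k => pws0_phi (al k) (ltn0Sn 0)).
congr H01_gradient; apply/funext => l; congr tens; apply/funext => k; rewrite /repl; case: ifP => // _.
by apply/funext => x; rewrite /pw /cderiv /cphi derive1_phi.
Qed.

Lemma tphi_H01 (al : 'I_n -> nat) : H01 (@tphi R n al).
Proof. by eexists; exact: tphi_gradient. Qed.

Lemma tphi_L2 (al : 'I_n -> nat) : L2 (@tphi R n al).
Proof. exact: H01_L2 (tphi_H01 al). Qed.

(** The boundary condition is carried by [v], so the factor [dphi], which does not vanish at the
    ends, can be integrated by parts against it. *)
Lemma tphi_eigen (al : 'I_n -> nat) : eigen (tlam al) (tphi al).
Proof.
split; first exact: tphi_H01.
move=> v [h hv]; rewrite (aformE (tphi_gradient al) hv) /tlam mulr_suml; apply: eq_bigr => k _.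
pose f := repl k (fun k => @phi R (al k)) (fun k => dphi (al k)).
pose df := repl k (fun k => @dphi R (al k)) (fun k x => - freq (al k) ^+ 2 * phi (al k) x).
have dfi i (x : R) : is_derive x 1 (f i) (df i x).
  by rewrite /f /df /repl; case: ifP => _; [exact: is_derive_dphi|exact: is_derive_phi].
have cdf i : continuous (df i).
  rewrite /df /repl; case: ifP => _; apply: smooth1_continuous; last exact: smooth1_dphi.
  by apply: smooth1M; [exact: smooth1_cst|exact: smooth1_phi].
rewrite bformC (gradient_ibp k hv dfi cdf).
have -> : tens (repl k f df) = fun x => - freq (al k) ^+ 2 * tphi al x.
  apply/funext => x; rewrite /tphi /tens (bigD1 k)//= [in RHS](bigD1 k)//= mulrA.
  congr (_ * _); first by rewrite /repl eqxx /df /repl eqxx.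
  by apply: eq_bigr => i /negbTE ik; rewrite /f /repl ik.
rewrite bformC bformZl; [|exact: tphi_L2|by case: hv].
by rewrite mulNr opprK.
Qed.

Lemma tphi_orthonormal (al be : {ffun 'I_n -> nat}) : bform (@tphi R n al) (tphi be) = (al == be)%:R.
Proof.
rewrite /tphi bform_tens; try by move=> k; exact: bmeas_phi.
under eq_bigr do rewrite phi_orthonormal.
have [->|ab] := eqVneq al be; first by rewrite big1// => k _; rewrite eqxx.
have [k hk] : exists k, al k != be k.
  apply/existsP; rewrite -negb_forall; apply: contra ab => /forallP h.
  by apply/eqP/ffunP => k; apply/eqP.
by rewrite (bigD1 k)//= (negbTE hk) mul0r.
Qed.

Lemma bform_self0 u w : L2 u -> L2 w -> bform u u = 0 -> bform u w = 0.
Proof.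
move=> Lu Lw h; have := bform_CS Lu Lw; rewrite h mul0r => h0.
by apply/eqP; rewrite -sqrf_eq0 eq_le h0 sqr_ge0.
Qed.

Lemma tphi_complete w : L2 w -> (forall al, bform w (@tphi R n al) = 0) -> bform w w = 0.
Proof.
move=> Lw h; have I := L2_integrable Lw.
have /(cube_abs0 I).1 h0 : cube_integral (fun x => `|w x|) = 0 by exact: cube_complete.
have L0 : L2 ((fun=> 0) : 'rV[R]_n -> R) by apply: bmeas_L2; exact: bmeas_cst.
rewrite (ae_bform Lw L0 Lw h0) bformE /cube_integral.
under eq_Rintegral do rewrite mul0r.
by rewrite /Rintegral integral0.
Qed.

End eigenfunctions.

(** * Enumeration of multi-indices by eigenvalue *)

Section enumeration.
Variable d : nat.
Hypothesis d0 : (0 < d)%N.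
Local Notation T := {ffun 'I_d -> nat}.
Local Open Scope nat_scope.

(** The eigenvalue of the sine product in units of [pi ^+ 2]; being an integer, it is compared in
    [nat]. *)
Definition lev (al : T) : nat := \sum_k (al k).+1 ^ 2.

Let box (K : nat) (f : {ffun 'I_d -> 'I_K}) : T := [ffun k => nat_of_ord (f k)].

Definition shell (K : nat) : seq T := [seq al <- [seq box f | f : {ffun 'I_d -> 'I_K}] | lev al == K].

Lemma mem_shell K al : (al \in shell K) = (lev al == K).
Proof.
rewrite mem_filter andb_idr// => /eqP levK.
have hk k : al k < K.
  rewrite -levK /lev (bigD1 k)//=; apply: leq_trans (leq_addr _ _).
  by rewrite expnS expn1 leq_pmulr.
apply/mapP; exists [ffun k => Ordinal (hk k)]; first by rewrite mem_enum.
by apply/ffunP => k; rewrite !ffunE.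
Qed.

Lemma uniq_shell K : uniq (shell K).
Proof.
apply: filter_uniq; rewrite map_inj_uniq ?enum_uniq// => f g /ffunP h.
by apply/ffunP => k; have := h k; rewrite !ffunE => /val_inj.
Qed.

(** Each list is a prefix of the next one, so the position of a multi-index does not depend on
    [K]. *)
Fixpoint ball_seq (K : nat) : seq T := if K is K'.+1 then ball_seq K' ++ shell K' else [::].

Lemma mem_ball K al : (al \in ball_seq K) = (lev al < K).
Proof. by elim: K => // K IH; rewrite mem_cat IH mem_shell ltnS [in RHS]leq_eqVlt orbC. Qed.

Lemma uniq_ball K : uniq (ball_seq K).
Proof.
elim: K => // K IH; rewrite cat_uniq IH uniq_shell andbT /=; apply/hasPn => al.
by rewrite mem_shell mem_ball => /eqP ->; rewrite ltnn.
Qed.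

Lemma size_ball_mono K K' : K <= K' -> size (ball_seq K) <= size (ball_seq K').
Proof.
move=> KK'; apply: uniq_leq_size (uniq_ball K) _ => al; rewrite !mem_ball => h.
exact: leq_trans KK'.
Qed.

Let a0 : T := [ffun=> 0].

Lemma nth_ball K K' i : K <= K' -> i < size (ball_seq K) -> nth a0 (ball_seq K') i = nth a0 (ball_seq K) i.
Proof.
elim: K' => [|K' IH]; first by rewrite leqn0 => /eqP ->.
rewrite leq_eqVlt => /orP[/eqP -> //|]; rewrite ltnS => KK' iK.
by rewrite /= nth_cat (leq_trans iK (size_ball_mono KK')) IH.
Qed.

Lemma size_ball_large i : i < size (ball_seq (d * i.+1 ^ 2).+1).
Proof.
have h : uniq [seq [ffun=> j] : T | j <- iota 0 i.+1].
  rewrite map_inj_uniq ?iota_uniq// => x y /ffunP /(_ (Ordinal d0)).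
  by rewrite !ffunE.
have := uniq_leq_size h; rewrite size_map size_iota; apply => al /mapP[j].
rewrite mem_iota add0n ltnS => /andP[_ ji] ->; rewrite mem_ball ltnS /lev.
under eq_bigr do rewrite ffunE.
by rewrite sum_nat_const card_ord leq_mul2l leq_sqr ltnS ji orbT.
Qed.

(** [d * i.+1 ^ 2] is the level of the constant multi-index [i]; the constant ones up to [i] already
    make the list long enough. *)
Definition enum_level (i : nat) : T := nth a0 (ball_seq (d * i.+1 ^ 2).+1) i.
Local Notation e := enum_level.

Lemma enum_levelE K i : i < size (ball_seq K) -> e i = nth a0 (ball_seq K) i.
Proof.
move=> iK; rewrite /e -(@nth_ball _ (maxn K (d * i.+1 ^ 2).+1)) ?leq_maxr ?size_ball_large//.
by rewrite (@nth_ball K) ?leq_maxl.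
Qed.

Lemma enum_level_inj : injective e.
Proof.
move=> i j; pose K := maxn (d * i.+1 ^ 2).+1 (d * j.+1 ^ 2).+1.
have iK : i < size (ball_seq K) by apply: leq_trans (size_ball_large i) _; rewrite size_ball_mono ?leq_maxl.
have jK : j < size (ball_seq K) by apply: leq_trans (size_ball_large j) _; rewrite size_ball_mono ?leq_maxr.
rewrite (enum_levelE iK) (enum_levelE jK) => /eqP; rewrite nth_uniq ?uniq_ball//.
by move=> /eqP.
Qed.

Lemma enum_level_index K al : lev al < K -> exists2 i, i < size (ball_seq K) & e i = al.
Proof.
rewrite -mem_ball => h; exists (index al (ball_seq K)); first by rewrite index_mem.
by rewrite (@enum_levelE K) ?index_mem// nth_index.
Qed.

Lemma enum_level_surj al : exists i, e i = al.
Proof. by have [i _ <-] := enum_level_index (ltnSn (lev al)); exists i. Qed.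

Lemma enum_level_lt K i : (i < size (ball_seq K)) = (lev (e i) < K).
Proof.
apply/idP/idP => [iK|h]; first by rewrite (enum_levelE iK) -mem_ball mem_nth.
by have [i' i'K /enum_level_inj <-] := enum_level_index h.
Qed.

Lemma enum_level_mono i j : i <= j -> lev (e i) <= lev (e j).
Proof.
move=> ij; rewrite -ltnS -enum_level_lt; apply: leq_ltn_trans ij _.
by rewrite enum_level_lt.
Qed.

End enumeration.

Section eigensystems.
Context {R : realType} (d : nat).
Local Notation V := ('rV[R]_d -> R).
Implicit Types (u v w : 'rV[R]_d -> R).

Definition lcomb (I : Type) (r : seq I) (P : pred I) (y : I -> R) (F : I -> V) : V :=
  fun x => \sum_(i <- r | P i) y i * F i x.

Lemma lcomb_ind (I : Type) (Q : V -> Prop) (r : seq I) (P : pred I) (y : I -> R) (F : I -> V) :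
  Q (fun=> 0) -> (forall i v, P i -> Q v -> Q (fun x => y i * F i x + 1 * v x)) -> Q (lcomb r P y F).
Proof.
move=> Q0 QD; elim: r => [|i r IH].
  by rewrite (_ : lcomb _ _ _ _ = fun=> 0)//; apply/funext => x; rewrite /lcomb big_nil.
have [Pi|nPi] := boolP (P i).
  rewrite (_ : lcomb _ _ _ _ = fun x => y i * F i x + 1 * lcomb r P y F x); first exact: QD.
  by apply/funext => x; rewrite /lcomb big_cons Pi mul1r.
rewrite (_ : lcomb _ _ _ _ = lcomb r P y F)//.
by apply/funext => x; rewrite /lcomb big_cons (negbTE nPi).
Qed.

Lemma H01_0 : H01 ((fun=> 0) : V).
Proof.
have h := @tphi_H01 R d (fun=> 0%N); have := H01_lin 0 0 h h.
by congr H01; apply/funext => x; rewrite !mul0r addr0.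
Qed.

Lemma eigen_0 (l : R) : eigen l ((fun=> 0) : V).
Proof.
split; first exact: H01_0.
move=> w hw; have h := @tphi_H01 R d (fun=> 0%N).
have E : ((fun=> 0) : V) = fun x => 0 * tphi (fun=> 0%N) x + 0 * tphi (fun=> 0%N) x.
  by apply/funext => x; rewrite !mul0r addr0.
rewrite E (aform_linl 0 0 h h hw) (bform_linl 0 0 (H01_L2 h) (H01_L2 h) (H01_L2 hw)).
by rewrite !mul0r !addr0 mulr0.
Qed.

Lemma lcomb_L2 (I : Type) (r : seq I) (P : pred I) (y : I -> R) (F : I -> V) :
  (forall i, P i -> L2 (F i)) -> L2 (lcomb r P y F).
Proof.
move=> LF; apply: lcomb_ind; first exact: H01_L2 H01_0.
by move=> i v Pi Lv; apply: L2_lin => //; exact: LF.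
Qed.

Lemma lcomb_H01 (I : Type) (r : seq I) (P : pred I) (y : I -> R) (F : I -> V) :
  (forall i, P i -> H01 (F i)) -> H01 (lcomb r P y F).
Proof.
move=> LF; apply: lcomb_ind; first exact: H01_0.
by move=> i v Pi Lv; apply: H01_lin => //; exact: LF.
Qed.

Lemma lcomb_eigen (I : Type) (r : seq I) (P : pred I) (y : I -> R) (F : I -> V) (l : R) :
  (forall i, P i -> eigen l (F i)) -> eigen l (lcomb r P y F).
Proof.
move=> LF; apply: lcomb_ind; first exact: eigen_0.
by move=> i v Pi Lv; apply: eigen_lin => //; exact: LF.
Qed.

Lemma bform_0l w : L2 w -> bform ((fun=> 0) : V) w = 0.
Proof.
move=> Lw; have L0 := H01_L2 H01_0.
have E : ((fun=> 0) : V) = fun x => 0 * (fun=> 0 : R) x + 0 * (fun=> 0 : R) x.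
  by apply/funext => x; rewrite !mul0r addr0.
by rewrite E bform_linl// !mul0r addr0.
Qed.

Lemma bform_lcomb (I : Type) (r : seq I) (P : pred I) (y : I -> R) (F : I -> V) w :
  (forall i, P i -> L2 (F i)) -> L2 w ->
  bform (lcomb r P y F) w = \sum_(i <- r | P i) y i * bform (F i) w.
Proof.
move=> LF Lw; elim: r => [|i r IH].
  rewrite big_nil (_ : lcomb _ _ _ _ = fun=> 0) ?bform_0l//.
  by apply/funext => x; rewrite /lcomb big_nil.
have [Pi|nPi] := boolP (P i); rewrite big_cons ?Pi ?(negbTE nPi) -IH.
  rewrite (_ : lcomb _ _ _ _ = fun x => y i * F i x + 1 * lcomb r P y F x).
    by rewrite bform_linl ?mul1r//; [exact: LF|exact: lcomb_L2].
  by apply/funext => x; rewrite /lcomb big_cons Pi mul1r.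
by congr bform; apply/funext => x; rewrite /lcomb big_cons (negbTE nPi).
Qed.

(** If [lam' j < lam j], some combination of the first [j + 1] functions [us'] is orthogonal to the
    first [j] functions [us], and to the later ones because their eigenvalues are larger;
    completeness makes it zero. *)
Lemma eigensystem_le (lam lam' : nat -> R) (us us' : nat -> V) j :
  eigensystem lam us -> eigensystem lam' us' -> lam j <= lam' j.
Proof.
move=> [eu ou mu_ cu] [ev ov mv cv]; rewrite leNgt; apply/negP => lt.
have [y [k0 yk0] hy] := kernel_exists (fun (k : 'I_j.+1) (l : 'I_j) => bform (us' k) (us l)).
have Lu i : L2 (us i) by apply: H01_L2; case: (eu i).
have Lv i : L2 (us' i) by apply: H01_L2; case: (ev i).
(* Completeness speaks of eigenfunctions only, so the combination is restricted to one eigenvalue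
   that occurs with a nonzero coefficient. *)
pose w := lcomb (index_enum 'I_j.+1) (fun k : 'I_j.+1 => lam' k == lam' k0) y (fun k : 'I_j.+1 => us' k).
have ew : eigen (lam' k0) w by apply: lcomb_eigen => k /eqP <-.
have Lw := H01_L2 (proj1 ew).
have wu i : bform w (us i) = 0.
  have [ei|ni] := eqVneq (lam i) (lam' k0); last by rewrite (eigen_orthogonal ew (eu i))// eq_sym.
  have ij : (i < j)%N.
    rewrite ltnNge; apply/negP => /mu_ h; have := mv _ _ (ltn_ord k0 : (k0 <= j)%N); rewrite -ei => h'.
    by have := lt_le_trans lt (le_trans h h'); rewrite ltxx.
  rewrite bform_lcomb//; have := hy (Ordinal ij); rewrite (bigID (fun k : 'I_j.+1 => lam' k == lam' k0)) /=.
  rewrite [X in _ + X]big1 ?addr0// => k nk.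
  by rewrite (eigen_orthogonal (ev k) (eu i)) ?mulr0// ei.
have ww := cu _ _ ew wu.
have := bform_self0 Lw (Lv k0) ww; rewrite bform_lcomb// (bigD1 k0) ?eqxx//= ov eqxx mulr1.
rewrite big1 ?addr0; first by move=> h; move: yk0; rewrite h eqxx.
move=> k /andP[_ kk]; rewrite ov (_ : (nat_of_ord k == k0) = false) ?mulr0//.
by apply/negbTE; apply: contra kk => /eqP/val_inj ->.
Qed.

Lemma eigensystem_unique (lam lam' : nat -> R) (us us' : nat -> V) j :
  eigensystem lam us -> eigensystem lam' us' -> lam j = lam' j.
Proof. by move=> h h'; apply/eqP; rewrite eq_le !(eigensystem_le _ h h', eigensystem_le _ h' h). Qed.

(* Householder reflection exchanging [us j] and [s *: u], where the sign [s] keeps the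
   two vectors apart. *)
Lemma eigensystem_through (lam : nat -> R) (us : nat -> V) j u :
  eigensystem lam us -> eigen (lam j) u -> bform u u = 1 ->
  exists us', eigensystem lam us' /\ us' j = u.
Proof.
move=> [eu ou mu_ cu] eigu uu1.
have Lus i : L2 (us i) by apply: H01_L2; case: (eu i).
have Lu : L2 u by apply: H01_L2; case: eigu.
pose b := bform (us j) u; pose s : R := if b <= 0 then 1 else -1.
have s2 : s * s = 1 by rewrite /s; case: ifP => _; rewrite ?mulr1// mulrNN mulr1.
have sb : s * b <= 0.
  rewrite /s; have [h|h] := leP b 0; first by rewrite mul1r.
  by rewrite mulNr mul1r oppr_le0 ltW.
pose z : V := fun x => 1 * us j x + (- s) * u x.
have ez : eigen (lam j) z by exact: eigen_lin.
have Lz : L2 z by apply: H01_L2; case: ez.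
have bzj : bform z (us j) = 1 - s * b.
  have o : bform (us j) (us j) = 1 by rewrite ou eqxx.
  by rewrite /z bform_linl// o [bform u _]bformC -/b; ring.
have bzu : bform z u = b - s by rewrite /z bform_linl// uu1 -/b; ring.
have bzz : bform z z = 2 * (1 - s * b).
  rewrite {2}/z bform_linr// bzj bzu; have -> : - s * (b - s) = s * s - s * b by ring.
  by rewrite s2; ring.
pose q := bform z z; have q0 : q != 0 by rewrite /q bzz gt_eqF//; lra.
pose H (v : V) : V := fun x => 1 * v x + (- (2 * bform v z / q)) * z x.
have LH v : L2 v -> L2 (H v) by move=> Lv; exact: L2_lin.
have HE v w : L2 v -> L2 w -> bform (H v) w = bform v w - 2 * bform v z / q * bform z w.
  by move=> Lv Lw; rewrite /H bform_linl//; ring.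
have Hsym v w : L2 v -> L2 w -> bform (H v) w = bform v (H w).
  move=> Lv Lw; rewrite HE// [RHS]bformC HE// [bform w v]bformC [bform z w]bformC [bform z v]bformC.
  by ring.
have Hz v : L2 v -> bform (H v) z = - bform v z by move=> Lv; rewrite HE// -/q mulfVK//; ring.
have Hiso v w : L2 v -> L2 w -> bform (H v) (H w) = bform v w.
  move=> Lv Lw; rewrite -Hsym; [|exact: LH|by []].
  rewrite HE; [|exact: LH|by []]; rewrite HE// Hz//; ring.
(* The reflection fixes the other eigenspaces, because [z] is an eigenfunction for [lam j]. *)
have Heig l v : eigen l v -> eigen l (H v).
  move=> ev; have [e|nl] := eqVneq l (lam j).
    by move: ev; rewrite e => ev; exact: eigen_lin.
  rewrite (_ : H v = v)//; apply/funext => x; rewrite /H (eigen_orthogonal ev ez nl).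
  by rewrite mulr0 mul0r oppr0 mul0r addr0 mul1r.
pose us' i : V := fun x => s * H (us i) x + 0 * z x.
have us'E i : us' i = fun x => s * H (us i) x + 0 * H (us i) x.
  by apply/funext => x; rewrite /us' !mul0r.
have bus' i w : L2 w -> bform (us' i) w = s * bform (H (us i)) w.
  by move=> Lw; rewrite us'E bform_linl ?mul0r ?addr0//; exact: LH.
have eus' i : eigen (lam i) (us' i) by rewrite us'E; apply: eigen_lin; exact: Heig.
have Lus' i : L2 (us' i) by apply: H01_L2; case: (eus' i).
exists us'; split; last first.
  apply/funext => x; rewrite /us' /H [bform (us j) z]bformC bzj -/q /q bzz /z.
  have nz : 1 - s * b != 0 by rewrite gt_eqF//; lra.
  rewrite divff; last by rewrite mulf_neq0// pnatr_eq0.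
  by transitivity (s * s * u x); [ring|rewrite s2 mul1r].
split=> //.
- move=> i k; rewrite bus'// bformC bus'; last exact: LH.
  by rewrite mulrA s2 mul1r Hiso// bformC ou.
- move=> l w ew hw; have Lw : L2 w by apply: H01_L2; case: ew.
  rewrite -Hiso//; apply: (cu l); first exact: Heig.
  move=> i; rewrite Hsym//; have := hw i; rewrite bformC bus'// bformC => /eqP.
  rewrite mulf_eq0 => /orP[/eqP h|/eqP //].
  by move: s2; rewrite h mulr0 => /eqP; rewrite eq_sym oner_eq0.
Qed.

Lemma tlamE (al : {ffun 'I_d -> nat}) : tlam al = pi ^+ 2 * (lev al)%:R :> R.
Proof.
rewrite /tlam /lev natr_sum mulr_sumr; apply: eq_bigr => k _.
by rewrite /freq exprMn natrX mulrC.
Qed.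

Lemma sine_eigensystem : (0 < d)%N ->
  eigensystem (fun i => tlam (@enum_level d i)) (fun i => @tphi R d (@enum_level d i)).
Proof.
move=> d0; split.
- by move=> i; exact: tphi_eigen.
- move=> i j; rewrite tphi_orthonormal; congr (_%:R); congr nat_of_bool.
  by apply/eqP/eqP => [/(enum_level_inj d0)|->].
- by move=> i j ij; rewrite !tlamE ler_wpM2l ?sqr_ge0// ler_nat enum_level_mono.
- move=> l w [hw _] h; apply: tphi_complete; first exact: H01_L2.
  move=> al; have [i hi] := enum_level_surj d0 [ffun k => al k].
  rewrite -(h i) hi; congr bform; congr tphi; apply/funext => k; by rewrite ffunE.
Qed.

End eigensystems.

(** * Tensor-product discrete forms *)

Section tensor_forms.
Context {R : realType}.
Variable p : nat.
Variables (d : nat) (N : 'I_d -> nat).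
Local Notation m := (fun k : 'I_d => (N k + p - 2)%N).
Local Notation ix := (Vh_index N p).
Local Notation HH := (fun k : 'I_d => @GH R p (N k)).
Local Notation KK := (fun k : 'I_d => @GK R p (N k)).
Local Notation KKh := (fun k : 'I_d => @GKh R p (N k)).
Local Notation MM := (fun k : 'I_d => @GM R p (N k)).

(** Distributivity over the cells and over the quadrature nodes splits the sum into one-dimensional
    rules. *)
Lemma quadrature_tensor (f : forall k, 'I_(m k) -> nat -> {poly R}) (c c' : ix -> R) :
  @quadrature R d N p (fun e x => (\sum_(i : ix) c i * \prod_(k < d) (f k (i k) (e k)).[x ord0 k]) *
     (\sum_(i : ix) c' i * \prod_(k < d) (f k (i k) (e k)).[x ord0 k])) =
  mform (tform (fun k i j => @cell_rule R p (N k) (fun e => f k i e * f k j e))) c c'.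
Proof.
rewrite /quadrature; set Or := optimal_rule p.
pose X (e : element N) (q : {ffun 'I_d -> 'I_(size Or)}) k := ((e k)%:R + (1 + (nth (0, 0) Or (q k)).1) / 2) / (N k)%:R : R.
pose W (q : {ffun 'I_d -> 'I_(size Or)}) k := (nth (0, 0) Or (q k)).2 / (2 * (N k)%:R) : R.
pose Z (i j : ix) (e : element N) q := (\prod_(k < d) (W q k * ((f k (i k) (e k)).[X e q k] * (f k (j k) (e k)).[X e q k]))) * (c i * c' j).
transitivity (\sum_(e : element N) \sum_(q : {ffun 'I_d -> 'I_(size Or)}) \sum_(i : ix) \sum_(j : ix) Z i j e q).
  apply: eq_bigr => e _; apply: eq_bigr => q _.
  rewrite big_distrlr mulr_sumr; apply: eq_bigr => i _; rewrite mulr_sumr; apply: eq_bigr => j _.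
  rewrite /Z !big_split /=.
  have E (l : ix) : \prod_(k < d) (f k (l k) (e k)).[(\row_k0 (((e k0)%:R + (1 + (nth (0, 0) Or (q k0)).1) / 2) / (N k0)%:R)) ord0 k] =
     \prod_(k < d) (f k (l k) (e k)).[X e q k] by apply: eq_bigr => k _; rewrite mxE.
  rewrite !E -big_split /= -/(\prod_k W q k).
  set a := \prod_(k < d) _; set b := \prod_(k < d) _; set w := \prod_(k < d) _.
  by ring.
transitivity (\sum_(i : ix) \sum_(j : ix) \sum_(e : element N) \sum_(q : {ffun 'I_d -> 'I_(size Or)}) Z i j e q); last first.
  apply: eq_bigr => i _; apply: eq_bigr => j _; rewrite /tform /cell_rule dffun_distr mulr_suml.
  apply: eq_bigr => e _; rewrite bigA_distr_bigA mulr_suml; apply: eq_bigr => q _.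
  by rewrite /Z; congr (_ * _); apply: eq_bigr => k _; rewrite hornerM.
transitivity (\sum_(e : element N) \sum_(i : ix) \sum_(j : ix) \sum_(q : {ffun 'I_d -> 'I_(size Or)}) Z i j e q).
  apply: eq_bigr => e _; rewrite exchange_big; apply: eq_bigr => i _; exact: exchange_big.
by rewrite exchange_big; apply: eq_bigr => i _; exact: exchange_big.
Qed.

Lemma quadrature_sum (F : 'I_d -> element N -> 'rV[R]_d -> R) :
  @quadrature R d N p (fun e x => \sum_l F l e x) = \sum_l @quadrature R d N p (F l).
Proof.
rewrite /quadrature [RHS]exchange_big; apply: eq_bigr => e _; rewrite [RHS]exchange_big; apply: eq_bigr => q _.
by rewrite mulr_sumr.
Qed.

Lemma bform_hE (c c' : ix -> R) : @bform_h R d N p c c' = mform (tform HH) c c'.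
Proof. exact: (quadrature_tensor (fun k i e => bspline_piece p (N k) e p i.+1)). Qed.

Lemma aform_h_tensor (c c' : ix -> R) : @aform_h R d N p c c' = \sum_l mform (tform (tsubst l KKh HH)) c c'.
Proof.
rewrite /aform_h quadrature_sum; apply: eq_bigr => l _.
have := quadrature_tensor (fun k i e => let f := bspline_piece p (N k) e p i.+1 in if k == l then f^`()%R else f) c c'.
move=> h; apply: etrans h _; apply: eq_mformG => i j; apply: eq_bigr => k _; rewrite /tsubst.
by case: ifP.
Qed.

Section with_rule.
Hypothesis hp : (0 < p <= 7)%N.
Variables kap clead : R.
Hypothesis kap0 : 0 < kap.
Hypothesis clead0 : 0 < clead.
Hypothesis hkap : forall f : {poly R}, (size f <= p.*2.+1)%N ->
  rule_sum (optimal_rule p) f = pint (-1) 1 f + kap * f`_p.*2.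
Hypothesis N0 : forall k, (0 < N k)%N.

Lemma GKh_GK k (i j : 'I_(m k)) : @GKh R p (N k) i j = @GK R p (N k) i j.
Proof.
rewrite -mform_basis -[RHS]mform_basis (mform_GKh hp kap0 clead0 hkap (N0 k)).
by rewrite (mform_GK hp kap0 clead0 (N0 k)).
Qed.

Lemma aform_hE (c c' : ix -> R) : @aform_h R d N p c c' =
  mform (fun i j : ix => \sum_l tform (tsubst l KK HH) i j) c c'.
Proof.
rewrite aform_h_tensor mform_sumG; apply: eq_bigr => l _; apply: eq_mformG => i j.
by apply: eq_bigr => k _; rewrite /tsubst; case: ifP => _ //; exact: GKh_GK.
Qed.

Let tB (i : ix) : 'rV[R]_d -> R := tens (fun k => pw (N k) (cB (i k))).
Let tdB l (i : ix) : 'rV[R]_d -> R :=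
  tens (repl l (fun k => pw (N k) (cB (i k))) (fun k => pw (N k) (cderiv (cB (i k))))).

Let pB k i := @pws0_cB R p hp kap clead kap0 clead0 (N k) (N0 k) i.

Lemma tB_gradient (i : ix) : H01_gradient (tB i) (fun l => tdB l i).
Proof. exact: (@H01_tens R d N (fun k => cB (i k)) (fun k => pB (i k))). Qed.

Let tB_L2 i : L2 (tB i) := H01_gradient_L2 (tB_gradient i).

Lemma Vh_funE (c : ix -> R) : @Vh_fun R d N p c = lcomb (index_enum ix) predT c tB.
Proof. by []. Qed.

Lemma Vh_H01 (c : ix -> R) : H01 (@Vh_fun R d N p c).
Proof. by rewrite Vh_funE; apply: lcomb_H01 => i _; eexists; exact: tB_gradient. Qed.

Lemma bform_Vh (c c' : ix -> R) : bform (@Vh_fun R d N p c) (@Vh_fun R d N p c') = mform (tform MM) c c'.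
Proof.
rewrite !Vh_funE bform_lcomb//; last exact: lcomb_L2.
apply: eq_bigr => i _; rewrite bformC bform_lcomb// mulr_sumr; apply: eq_bigr => j _.
rewrite bformC bform_tens; try by move=> k; exact: bmeas_pws0 (pB _).
by rewrite mulrA mulrC.
Qed.

Lemma aform_0l (w : 'rV[R]_d -> R) : H01 w -> aform ((fun=> 0) : 'rV[R]_d -> R) w = 0.
Proof.
move=> hw; have [_ /(_ w hw) ->] := @eigen_0 R d 0; by rewrite mul0r.
Qed.

Lemma aform_lcomb (I : Type) (r : seq I) (P : pred I) (y : I -> R) (F : I -> 'rV[R]_d -> R) w :
  (forall i, P i -> H01 (F i)) -> H01 w ->
  aform (lcomb r P y F) w = \sum_(i <- r | P i) y i * aform (F i) w.
Proof.
move=> LF Lw; elim: r => [|i r IH].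
  rewrite big_nil (_ : lcomb _ _ _ _ = fun=> 0) ?aform_0l//.
  by apply/funext => x; rewrite /lcomb big_nil.
have [Pi|nPi] := boolP (P i); rewrite big_cons ?Pi ?(negbTE nPi) -IH.
  rewrite (_ : lcomb _ _ _ _ = fun x => y i * F i x + 1 * lcomb r P y F x).
    by rewrite (aform_linl (y i) 1 (LF i Pi) (lcomb_H01 r y LF) Lw) mul1r.
  by apply/funext => x; rewrite /lcomb big_cons Pi mul1r.
suff -> : lcomb (i :: r) P y F = lcomb r P y F by [].
by apply/funext => x; rewrite /lcomb big_cons (negbTE nPi).
Qed.

Lemma aform_Vh (c c' : ix -> R) : aform (@Vh_fun R d N p c) (@Vh_fun R d N p c') =
  mform (fun i j : ix => \sum_l tform (tsubst l KK MM) i j) c c'.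
Proof.
have hB i : H01 (tB i) by eexists; exact: tB_gradient.
rewrite !Vh_funE aform_lcomb//; last exact: lcomb_H01.
apply: eq_bigr => i _; rewrite aformC aform_lcomb// mulr_sumr; apply: eq_bigr => j _.
rewrite aformC (aformE (tB_gradient i) (tB_gradient j)) mulrA [RHS]mulrC; congr (_ * _).
apply: eq_bigr => l _; rewrite bform_tens; first last.
- by move=> k; rewrite /repl; case: ifP => _; [exact: bmeas_cderiv (pB _)|exact: bmeas_pws0 (pB _)].
- by move=> k; rewrite /repl; case: ifP => _; [exact: bmeas_cderiv (pB _)|exact: bmeas_pws0 (pB _)].
by apply: eq_bigr => k _; rewrite /tsubst /repl; case: ifP.
Qed.

Lemma Vh_fun_tvec (r : forall k, 'I_(m k) -> R) :
  @Vh_fun R d N p (tvec r) = tens (fun k => pw (N k) (cS (r k))).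
Proof.
apply/funext => x; rewrite /tens.
transitivity (\prod_(k < d) \sum_(i < m k) r k i * pw (N k) (cB i) (x ord0 k)).
  rewrite dffun_distr; apply: eq_bigr => i _; rewrite /tvec -big_split.
  by apply: eq_bigr => k _.
apply: eq_bigr => k _; rewrite /pw /cS /vpol horner_sum; apply: eq_bigr => i _.
by rewrite hornerZ.
Qed.

End with_rule.
End tensor_forms.

(** * Spectral gap and trial functions in several dimensions *)

Section tensor_estimates.
Context {R : realType}.
Local Notation O01 := (`]0%R, 1%R[%classic : set R).
Variable p : nat.
Hypothesis hp : (0 < p <= 7)%N.
Variables kap clead : R.
Hypothesis kap0 : 0 < kap.
Hypothesis clead0 : 0 < clead.
Hypothesis hkap : forall f : {poly R}, (size f <= p.*2.+1)%N ->
  rule_sum (optimal_rule p) f = pint (-1) 1 f + kap * f`_p.*2.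
Hypothesis hlead : forall q : {poly R}, (size q <= p)%N -> clead * q`_p.-1 ^+ 2 <= pint (-1) 1 (q * q).
Variable d : nat.
Hypothesis d0 : (0 < d)%N.

Lemma mform_weighted (I : finType) K (w : 'I_K -> R) (v : 'I_K -> I -> R) y :
  mform (fun i j => \sum_(a < K) w a * (v a i * v a j)) y y = \sum_(a < K) w a * (\sum_i y i * v a i) ^+ 2.
Proof. by rewrite mform_sumG; apply: eq_bigr => a _; rewrite mform_scaleG mform_rank1 expr2. Qed.

Lemma psd_weighted (I : finType) K (w : 'I_K -> R) (v : 'I_K -> I -> R) : (forall a, 0 <= w a) ->
  psd (fun i j => \sum_(a < K) w a * (v a i * v a j)).
Proof. by move=> w0 y; rewrite mform_weighted; apply: sumr_ge0 => a _; rewrite mulr_ge0 ?sqr_ge0. Qed.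

Lemma sym_weighted (I : finType) K (w : 'I_K -> R) (v : 'I_K -> I -> R) :
  sym (fun i j => \sum_(a < K) w a * (v a i * v a j)).
Proof. by move=> i j; apply: eq_bigr => a _; rewrite [v a i * _]mulrC. Qed.

Lemma prod_if (l : 'I_d) (a b : R) : \prod_(k < d) (if k == l then a else b) = a * b ^+ d.-1.
Proof.
rewrite (bigD1 l)//= eqxx; congr (_ * _).
rewrite (eq_bigr (fun=> b)); last by move=> k /negbTE ->.
by rewrite prodr_const cardC1 card_ord.
Qed.

Section fixed_mesh.
Variable N : 'I_d -> nat.
Hypothesis N0 : forall k, (0 < N k)%N.
Local Notation m := (fun k : 'I_d => (N k + p - 2)%N).
Local Notation ix := (Vh_index N p).
Local Notation HH := (fun k : 'I_d => @GH R p (N k)).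
Local Notation KK := (fun k : 'I_d => @GK R p (N k)).

Definition GBt (i j : ix) : R := tform HH i j.
(** Exact stiffness in one direction, which quadrature reproduces, and discrete mass in the
    others. *)
Definition GAt (i j : ix) : R := \sum_l tform (tsubst l KK HH) i j.

Let sH k : sym (@GH R p (N k)) := @sym_GH R p (N k).
Let sK k : sym (@GK R p (N k)) := @sym_GK R p (N k).
Let pH k : psd (@GH R p (N k)) := psd_GH hp kap0 clead0 hkap (N0 k).
Let pK k : psd (@GK R p (N k)) := psd_GK hp kap0 clead0 (N0 k).

Let sym_ts l k : sym (@tsubst R d m l KK HH k).
Proof. by rewrite /tsubst; case: ifP => _; [exact: sK|exact: sH]. Qed.

Let psd_ts l k : psd (@tsubst R d m l KK HH k).
Proof. by rewrite /tsubst; case: ifP => _; [exact: pK|exact: pH]. Qed.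

Lemma sym_GBt : sym GBt. Proof. exact: tform_sym. Qed.

Lemma sym_GAt : sym GAt.
Proof. by move=> i j; apply: eq_bigr => l _; exact: tform_sym. Qed.

Lemma mform_GAt v w : mform GAt v w = \sum_l mform (tform (tsubst l KK HH)) v w.
Proof. exact: mform_sumG. Qed.

Lemma psd_GAt : psd GAt.
Proof. by move=> v; rewrite mform_GAt; apply: sumr_ge0 => l _; exact: tform_psd. Qed.

Lemma tsubst_scale l (c : R) v : mform (tform (tsubst l (fun k i j => c * KK k i j) HH)) v v =
  c * mform (tform (tsubst l KK HH)) v v.
Proof.
rewrite -mform_scaleG; apply: eq_mformG => i j; rewrite /tform (bigD1 l)//= /tsubst eqxx.
rewrite [in RHS](bigD1 l)//= eqxx mulrA; congr (_ * _).
by apply: eq_bigr => k /negbTE ->.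
Qed.

Let poinc0 : 0 <= poincare kap clead.
Proof. by rewrite addr_ge0// ?invr_ge0 ?sqr_ge0 ?exprn_ge0 ?divr_ge0 ?(ltW kap0) ?(ltW clead0)// pi_ge0. Qed.

(** One direction suffices: there the mass is bounded by the stiffness, while the other factors
    agree. *)
Lemma coercive_h v : mform GBt v v <= poincare kap clead * mform GAt v v.
Proof.
pose l0 := Ordinal d0.
apply: (@le_trans _ _ (mform (tform (tsubst l0 (fun k i j => poincare kap clead * KK k i j) HH)) v v)).
  apply: tform_le => //.
  - move=> k; rewrite /tsubst; case: ifP => _; last exact: sH.
    by move=> i j; rewrite sK.
  - move=> k y; rewrite /tsubst; case: ifP => _ //; rewrite mform_scaleG.
    exact: poincare_GH hp _ _ kap0 clead0 hkap hlead _ (N0 k) y.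
rewrite tsubst_scale ler_wpM2l// mform_GAt (bigD1 l0)//= lerDl.
by apply: sumr_ge0 => l _; exact: tform_psd.
Qed.

(* With [Q] the Bessel sum over the first [K] modes, [Q <= GH <= Q + e GK] in each direction; the
   low modes contribute nothing to the tensor power of [Q] at [w]. *)
Lemma tensor_gap (K S : nat) (e : R) (w : ix -> R) : (0 < S)%N ->
  (forall k, ((K%:R + 1/2) * pi) ^- 2 + kap / clead * (N k)%:R ^- 2 <= e) ->
  (forall f : {ffun 'I_d -> 'I_K}, (lev [ffun k => nat_of_ord (f k)] < S)%N ->
     \sum_i w i * tvec (fun k => bt (f k)) i = 0) ->
  mform GBt w w <= ((pi ^+ 2 * S%:R)^-1 + e) * mform GAt w w.
Proof.
move=> S0 he hw.
pose ell (f : {ffun 'I_d -> 'I_K}) : R := \sum_i w i * tvec (fun k => bt (f k)) i.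
pose Q (k : 'I_d) (i j : 'I_(m k)) : R := \sum_(a < K) 1 * (bt a i * bt a j).
have sQ k : sym (Q k) by exact: sym_weighted.
have pQ k : psd (Q k) by apply: psd_weighted => a.
have QH k y : mform (Q k) y y <= mform (HH k) y y.
  rewrite mform_weighted; under eq_bigr do rewrite mul1r.
  exact: bessel_GH hp _ _ kap0 clead0 hkap _ (N0 k) K y.
have h1 : mform GBt w w - mform (tform Q) w w <= e * mform GAt w w.
  rewrite mform_GAt mulr_sumr; under eq_bigr do rewrite -tsubst_scale.
  apply: (@tform_sub_le R d m Q HH (fun k i j => e * KK k i j) w sQ sH _ pQ QH).
    by move=> k i j; rewrite sK.
  move=> k y; rewrite mform_scaleG mform_weighted; under eq_bigr do rewrite mul1r.
  apply: le_trans (gap_GH hp kap0 clead0 hkap hlead (N0 k) K y) _.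
  by rewrite ler_wpM2r// pK.
have h2 : mform (tform Q) w w = \sum_f ell f ^+ 2.
  rewrite (mform_rank1_sum (fun k a => 1) (fun k a => bt a)); apply: eq_bigr => f _.
  by rewrite big1_eq mul1r.
(* Bessel's inequality in each direction, with the weight [freq a ^+ 2] in the direction [l]
   only. *)
have h3 : \sum_(f : {ffun 'I_d -> 'I_K}) tlam (fun k => nat_of_ord (f k)) * ell f ^+ 2 <= mform GAt w w.
  under eq_bigr do rewrite /tlam mulr_suml; rewrite exchange_big mform_GAt; apply: ler_sum => l _.
  have -> : \sum_(f : {ffun 'I_d -> 'I_K}) freq (f l) ^+ 2 * ell f ^+ 2 = mform (tform (fun k (i j : 'I_(m k)) =>
      \sum_(a < K) (if k == l then freq a ^+ 2 else 1) * (bt a i * bt a j))) w w.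
    rewrite (mform_rank1_sum (fun k a => if k == l then freq a ^+ 2 else 1) (fun k a => bt a)).
    apply: eq_bigr => f _; congr (_ * _); rewrite (bigD1 l)//= eqxx big1 ?mulr1// => k /negbTE.
    by move=> ->.
  apply: (@tform_le R d m _ (@tsubst R d m l KK HH) w _ (sym_ts l)).
  - by move=> k; exact: sym_weighted.
  - by move=> k; apply: psd_weighted => a; case: ifP => _ //; exact: sqr_ge0.
  - move=> k y; rewrite mform_weighted /tsubst; case: ifP => _.
      exact: bessel_GK hp _ _ kap0 clead0 _ (N0 k) K y.
    under eq_bigr do rewrite mul1r.
    exact: bessel_GH hp _ _ kap0 clead0 hkap _ (N0 k) K y.
have P0 : 0 < pi ^+ 2 * S%:R :> R by rewrite mulr_gt0 ?exprn_gt0 ?pi_gt0// ltr0n.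
(* The coefficients of level below [S] vanish, and the remaining ones have [tlam] at least
   [pi ^+ 2 * S]. *)
have h4 : (pi ^+ 2 * S%:R) * \sum_f ell f ^+ 2 <= mform GAt w w.
  apply: le_trans h3; rewrite mulr_sumr; apply: ler_sum => f _.
  have [lt|ge] := ltnP (lev [ffun k => nat_of_ord (f k)]) S.
    by rewrite /ell hw// expr0n /= !mulr0.
  rewrite ler_wpM2r ?sqr_ge0// (_ : tlam (fun k => nat_of_ord (f k)) = tlam [ffun k => nat_of_ord (f k)]).
    by rewrite tlamE ler_wpM2l ?sqr_ge0// ler_nat.
  by apply: eq_bigr => k _; rewrite ffunE.
rewrite mulrDl -lerBlDr; move: h1; rewrite h2 => h1.
have h5 : \sum_f ell f ^+ 2 <= (pi ^+ 2 * S%:R)^-1 * mform GAt w w by rewrite ler_pdivlMl.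
by lra.
Qed.

Section trials.
Variables (C eta : R) (K : nat) (r : forall k : 'I_d, nat -> 'I_(m k) -> R).
Arguments r : clear implicits.
Hypothesis C0 : 0 <= C.
Hypothesis hr : forall k, @trial_family R p C (N k) K (r k).
Hypothesis eta0 : 0 <= eta.
Hypothesis eta1 : eta <= 1.
Hypothesis hN : forall k, (N k)%:R ^- p <= eta :> R.

Let e0 k : 0 <= (N k)%:R ^- p :> R. Proof. by rewrite invr_ge0 exprn_ge0. Qed.
Let e1 k : C * (N k)%:R ^- p <= C * eta. Proof. by rewrite ler_wpM2l. Qed.
Let e2 k : C * ((N k)%:R ^- p) ^+ 2 <= C * eta ^+ 2.
Proof. by rewrite ler_wpM2l// lerXn2r ?nnegrE. Qed.
Let Ceta : C * eta <= C. Proof. by rewrite -[leRHS]mulr1 ler_wpM2l. Qed.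

Definition rt (al : {ffun 'I_d -> nat}) : ix -> R := tvec (fun k => r k (al k)).

Let small (al : {ffun 'I_d -> nat}) := forall k, (al k < K)%N.

Let H_le k a : (a < K)%N -> mform (HH k) (r k a) (r k a) <= 1 + C.
Proof.
move=> aK; have := tf_gram (hr k) aK aK; rewrite eqxx => h.
have h' := le_trans h (le_trans (e1 k) Ceta); move: h'; rewrite ler_norml => /andP[_].
by rewrite lerBlDl.
Qed.

Let K_le k a : (a < K)%N -> mform (KK k) (r k a) (r k a) <= 1 + C.
Proof.
move=> aK; rewrite (mform_GK hp kap0 clead0 (N0 k)); apply: le_trans (tf_energy (hr k) aK) _.
by rewrite lerDr.
Qed.

Let C1 : 1 <= 1 + C. Proof. by rewrite lerDl. Qed.

Lemma tensor_gram al be : small al -> small be ->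
  `|mform GBt (rt al) (rt be) - (al == be)%:R| <= d%:R * ((1 + C) ^+ d * C) * eta.
Proof.
move=> sal sbe; rewrite mform_tvec.
pose a k : R := (al k == be k)%:R; pose b k := mform (HH k) (r k (al k)) (r k (be k)).
have -> : (al == be)%:R = \prod_k a k.
  have [e|ab] := eqVneq al be; first by rewrite big1// => k _; rewrite /a e eqxx.
  have [k hk] : exists k, al k != be k.
    apply/existsP; rewrite -negb_forall; apply: contra ab => /forallP h.
    by apply/eqP/ffunP => k; apply/eqP.
  by rewrite (bigD1 k)//= /a (negbTE hk) mul0r.
have ab k : `|b k - a k| <= C * eta by apply: le_trans (tf_gram (hr k) (sal k) (sbe k)) (e1 k).
have a1 k : `|a k| <= 1 + C by rewrite /a normr_nat; apply: le_trans C1; case: (_ == _).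
have b1 k : `|b k| <= 1 + C.
  have -> : b k = (b k - a k) + a k by rewrite subrK.
  apply: le_trans (ler_normD _ _) _; rewrite addrC lerD//.
    by rewrite /a normr_nat; case: (_ == _).
  exact: le_trans (ab k) Ceta.
rewrite prod_telescope; apply: le_trans (ler_norm_sum _ _ _) _.
apply: (@le_trans _ _ (\sum_(l < d) (1 + C) ^+ d * C * eta)); last first.
  by rewrite sumr_const card_ord -[leLHS]mulr_natl !mulrA.
apply: ler_sum => l _; rewrite normr_prod (bigD1 l)//= ltnn eqxx mulrC -mulrA.
apply: ler_pM => //; first exact: prodr_ge0.
apply: (@le_trans _ _ (\prod_(k < d | k != l) (1 + C))).
  apply: ler_prod => k kl; rewrite normr_ge0 /=; case: ifP => [_|_]; first exact: b1.
  by rewrite (negbTE kl); exact: a1.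
  rewrite prodr_const ler_weXn2l//.
  by rewrite -[leqRHS]card_ord max_card.
exact: ab.
Qed.

Lemma tensor_energy al : small al -> mform GAt (rt al) (rt al) <= d%:R * (1 + C) ^+ d.
Proof.
move=> sal; rewrite mform_GAt.
apply: (@le_trans _ _ (\sum_(l < d) (1 + C) ^+ d)); last first.
  by rewrite sumr_const card_ord -[leLHS]mulr_natl.
apply: ler_sum => l _; rewrite mform_tvec.
apply: (@le_trans _ _ (\prod_(k < d) (1 + C))); last by rewrite prodr_const card_ord.
apply: ler_prod => k _; rewrite psd_ts /= /tsubst; case: ifP => _; [exact: K_le|exact: H_le].
Qed.

(** The residual is a sum over directions of product functionals, with the one-dimensional residual
    in one factor. The square of such a functional is a rank-one tensor form, so it is bounded
    factor by factor. *)
Lemma tensor_residual al v : small al ->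
  (mform GAt (rt al) v - tlam al * mform GBt (rt al) v) ^+ 2 <=
  d%:R * ((1 + C) ^+ d * C) * eta ^+ 2 * mform GAt v v.
Proof.
move=> sal.
pose hv k (j : 'I_(m k)) : R := \sum_i HH k i j * r k (al k) i.
pose kv k (j : 'I_(m k)) : R := \sum_i KK k i j * r k (al k) i.
pose rho l k (j : 'I_(m k)) : R := if k == l then kv k j - freq (al k) ^+ 2 * hv k j else hv k j.
have hvE k y : \sum_j y j * hv k j = mform (HH k) (r k (al k)) y.
  rewrite /mform exchange_big; apply: eq_bigr => j _; rewrite mulr_sumr; apply: eq_bigr => i _.
  by rewrite mulrCA [y j * _]mulrC.
have kvE k y : \sum_j y j * kv k j = mform (KK k) (r k (al k)) y.
  rewrite /mform exchange_big; apply: eq_bigr => j _; rewrite mulr_sumr; apply: eq_bigr => i _.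
  by rewrite mulrCA [y j * _]mulrC.
pose f l : R := \sum_j v j * tvec (rho l) j.
have E : mform GAt (rt al) v - tlam al * mform GBt (rt al) v = \sum_(l < d) f l.
  rewrite mform_GAt /tlam mulr_suml -sumrB; apply: eq_bigr => l _.
  rewrite /rt !mform_tvecl mulr_sumr -sumrB; apply: eq_bigr => j _.
  rewrite mulrCA -mulrBr; congr (_ * _); rewrite /tvec (bigD1 l)//= [X in _ - _ * X](bigD1 l)//= [in RHS](bigD1 l)//=.
  have -> : \prod_(k < d | k != l) (\sum_i @tsubst R d m l KK HH k i (j k) * r k (al k) i) = \prod_(k < d | k != l) hv k (j k).
    by apply: eq_bigr => k /negbTE kl; rewrite /tsubst kl.
  have -> : \prod_(k < d | k != l) rho l k (j k) = \prod_(k < d | k != l) hv k (j k).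
    by apply: eq_bigr => k /negbTE kl; rewrite /rho kl.
  by rewrite /rho eqxx /tsubst eqxx mulrA -mulrBl.
have fl l : f l ^+ 2 <= (1 + C) ^+ d * C * eta ^+ 2 * mform (tform (tsubst l KK HH)) v v.
  rewrite expr2 /f -mform_rank1_tensor.
  pose c k : R := if k == l then C * eta ^+ 2 else 1 + C.
  apply: (@le_trans _ _ (mform (tform (fun k i j => c k * @tsubst R d m l KK HH k i j)) v v)).
    apply: tform_le.
    - by move=> k i j; rewrite mulrC.
    - by move=> k i j; rewrite sym_ts.
    - by move=> k y; rewrite mform_rank1 -expr2 sqr_ge0.
    - move=> k y; rewrite mform_rank1 mform_scaleG -expr2 /c /tsubst /rho; case: ifP => kl.
        under eq_bigr do rewrite mulrBr mulrCA; rewrite sumrB -mulr_sumr hvE kvE.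
        apply: le_trans (tf_residual (hr k) y (sal k)) _.
        by rewrite ler_wpM2r ?pK.
      rewrite hvE; apply: (@le_trans _ _ (mform (HH k) (r k (al k)) (r k (al k)) * mform (HH k) y y)).
        by apply: mform_CS; [exact: sH|exact: pH].
      by rewrite ler_wpM2r ?pH ?H_le.
  rewrite tform_scale_all ler_wpM2r ?tform_psd// /c prod_if mulrC -mulrA.
  by rewrite ler_wpM2r ?mulr_ge0 ?sqr_ge0// ler_weXn2l// leq_pred.
rewrite E; apply: le_trans (sum_sqr_le f) _; rewrite card_ord mform_GAt.
rewrite (_ : d%:R * _ * _ = d%:R * ((1 + C) ^+ d * C * eta ^+ 2)); last by rewrite -!mulrA.
rewrite -[leRHS]mulrA ler_wpM2l// mulr_sumr.
by apply: ler_sum => l _; exact: fl.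
Qed.

(** Common bound of the squared norms of the splines, of the sines and of their derivatives that
    enter [tens_close]. *)
Let B : R := 1 + C + (K%:R * pi) ^+ 2.
Let B1 : 1 <= B. Proof. by rewrite /B -addrA lerDl addr_ge0// sqr_ge0. Qed.
Let BC : C <= B.
Proof. by have := sqr_ge0 (K%:R * pi : R); rewrite /B; have := C0; set x := (_ ^+ 2); lra. Qed.

Let f (al : {ffun 'I_d -> nat}) k := pw (N k) (cS (r k (al k))).
Let df (al : {ffun 'I_d -> nat}) k := pw (N k) (cderiv (cS (r k (al k)))).
Let pS al k : pws0 (N k) (cS (r k (al k))) := pws0_cS hp kap0 clead0 (N0 k) (r k (al k)).
Let bf al k : bmeas O01 (f al k). Proof. exact: bmeas_pws0 (pS al k). Qed.
Let bdf al k : bmeas O01 (df al k). Proof. exact: bmeas_cderiv (pS al k). Qed.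

Let sqE (u : R -> R) : (fun t => u t ^+ 2) = (fun t => u t * u t).
Proof. by apply/funext => t; rewrite expr2. Qed.

Let bdphi a : bmeas O01 (@dphi R a).
Proof. by apply: bmeas_continuous; exact: smooth1_continuous (smooth1_dphi a). Qed.

Let dphi_le a : (a < K)%N -> I01 (fun t => @dphi R a t ^+ 2) <= B.
Proof.
move=> aK; rewrite sqE.
have -> : I01 (fun t => @dphi R a t * dphi a t) = apw 1 (cphi a) (cphi a).
  by rewrite /apw /bpw; congr I01; apply/funext => t; rewrite /pw /cmul /cderiv /cphi derive1_phi.
rewrite apw_phi_phi//; apply: (@le_trans _ _ ((K%:R * pi) ^+ 2)); last first.
  by rewrite /B lerDr addr_ge0.
by rewrite lerXn2r ?nnegrE ?(ltW (freq_gt0 _))// ?mulr_ge0 ?pi_ge0// /freq ler_wpM2r ?pi_ge0// ler_nat.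
Qed.

Let phi_le a : I01 (fun t => @phi R a t ^+ 2) <= B.
Proof. by rewrite sqE phi_orthonormal eqxx. Qed.

Let f_le al k : small al -> I01 (fun t => f al k t ^+ 2) <= B.
Proof. by move=> sal; rewrite sqE; apply: le_trans (tf_norm (hr k) (sal k)) _. Qed.

Let df_le al k : small al -> I01 (fun t => df al k t ^+ 2) <= B.
Proof. by move=> sal; rewrite sqE; apply: le_trans (tf_energy (hr k) (sal k)) _. Qed.

Let f_close al k : small al -> I01 (fun t => (f al k t - phi (al k) t) ^+ 2) <= C * eta ^+ 2.
Proof. by move=> sal; rewrite sqE; apply: le_trans (le_trans (tf_l2 (hr k) (sal k)) (e2 k)). Qed.

Let df_close al k : small al -> I01 (fun t => (df al k t - dphi (al k) t) ^+ 2) <= C * eta ^+ 2.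
Proof.
move=> sal; rewrite sqE; apply: le_trans (le_trans (tf_h1 (hr k) (sal k)) (e2 k)).
rewrite /apw cderiv_csub; first last.
- by move=> e; exact: smooth1_phi.
- exact: pws0_smooth (pS al k).
by rewrite /bpw le_eqVlt; apply/orP; left; apply/eqP; congr I01; apply/funext => t; rewrite /pw /cmul /csub /cderiv /cphi derive1_phi.
Qed.

Let Vr al : Vh_fun (rt al) = tens (f al) := Vh_fun_tvec (fun k => r k (al k)).

Definition gapf al : 'rV[R]_d -> R := fun x => 1 * Vh_fun (rt al) x + (- 1) * tphi al x.

Let linE (u v : 'rV[R]_d -> R) : (fun x => 1 * u x + (- 1) * v x) = u \- v.
Proof. by apply/funext => x /=; rewrite mul1r mulN1r. Qed.

Lemma tensor_close_b al : small al -> bform (gapf al) (gapf al) <= d%:R ^+ 2 * B ^+ d * (C * eta ^+ 2).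
Proof.
move=> sal; rewrite /gapf linE Vr; apply: tens_close => //.
- by rewrite mulr_ge0 ?sqr_ge0.
- by move=> k; exact: bmeas_phi.
- by move=> k; exact: f_le.
- by move=> k; exact: f_close.
Qed.

Lemma tensor_close_a al : small al -> aform (gapf al) (gapf al) <= d%:R * (d%:R ^+ 2 * B ^+ d * (C * eta ^+ 2)).
Proof.
move=> sal.
have hg := H01_gradient_lin 1 (-1) (@H01_tens R d N (fun k => cS (r k (al k))) (pS al)) (tphi_gradient al).
have -> : gapf al = fun x => 1 * tens (fun k => pw (N k) (cS (r k (al k)))) x + (- 1) * tphi al x.
  by rewrite /gapf Vr.
rewrite (aformE hg hg).
apply: (@le_trans _ _ (\sum_(l < d) d%:R ^+ 2 * B ^+ d * (C * eta ^+ 2))); last first.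
  by rewrite sumr_const card_ord -[leLHS]mulr_natl.
apply: ler_sum => l _; rewrite linE; apply: tens_close => //.
- by rewrite mulr_ge0 ?sqr_ge0.
- by move=> k; rewrite /repl; case: ifP => _; [exact: bdf|exact: bf].
- by move=> k; rewrite /repl; case: ifP => _; [exact: bdphi|exact: bmeas_phi].
- by move=> k; rewrite /repl; case: ifP => _; [exact: df_le|exact: f_le].
- by move=> k; rewrite /repl; case: ifP => _; [exact: dphi_le|exact: phi_le].
- by move=> k; rewrite /repl; case: ifP => _; [exact: df_close|exact: f_close].
Qed.

End trials.
End fixed_mesh.
End tensor_estimates.

(** * Convergence *)

Section final_estimates.
Context {R : realType} (d : nat).
Local Notation V := ('rV[R]_d -> R).
Implicit Types (u v w : 'rV[R]_d -> R).

Lemma aform_lin_le (a b : R) u v : H01 u -> H01 v ->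
  aform (fun x => a * u x + b * v x) (fun x => a * u x + b * v x) <=
  2 * a ^+ 2 * aform u u + 2 * b ^+ 2 * aform v v.
Proof.
move=> [g hg] [h hh]; have hl := H01_gradient_lin a b hg hh.
rewrite (aformE hl hl) (aformE hg hg) (aformE hh hh) !mulr_sumr -big_split /=.
by apply: ler_sum => k _; apply: bform_lin_le; [case: hg|case: hh].
Qed.

Lemma cross_le (a b c M : R) : a <= M -> c <= M -> 0 <= a + 2 * b + c -> 0 <= a - 2 * b + c -> `|b| <= M.
Proof. by move=> h1 h2 h3 h4; rewrite ler_norml; apply/andP; split; lra. Qed.

Lemma aform_cross (M : R) u v : H01 u -> H01 v -> aform u u <= M -> aform v v <= M -> `|aform u v| <= M.
Proof.
move=> hu hv uM vM.
have E (s : R) : aform (fun x => 1 * u x + s * v x) (fun x => 1 * u x + s * v x) =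
    aform u u + 2 * s * aform u v + s ^+ 2 * aform v v.
  have hs : H01 (fun x => 1 * u x + s * v x) by exact: H01_lin.
  rewrite (aform_linl 1 s hu hv hs) (aform_linr 1 s hu hv hu) (aform_linr 1 s hu hv hv) (aformC v u).
  by move: (aform u u) (aform u v) (aform v v) => x y z; ring.
apply: (cross_le uM vM).
  have := aform_ge0 (fun x => 1 * u x + 1 * v x); rewrite E.
  by rewrite expr1n mul1r mulr1.
have := aform_ge0 (fun x => 1 * u x + (-1) * v x); rewrite E.
by rewrite sqrrN expr1n mul1r mulrN1 mulNr.
Qed.

Lemma bform_cross (M : R) u v : L2 u -> L2 v -> bform u u <= M -> bform v v <= M -> `|bform u v| <= M.
Proof.
move=> hu hv uM vM.
have E (s : R) : bform (fun x => 1 * u x + s * v x) (fun x => 1 * u x + s * v x) =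
    bform u u + 2 * s * bform u v + s ^+ 2 * bform v v.
  have hs : L2 (fun x => 1 * u x + s * v x) by exact: L2_lin.
  rewrite (bform_linl 1 s hu hv hs) (bform_linr 1 s hu hv hu) (bform_linr 1 s hu hv hv) (bformC v u).
  by move: (bform u u) (bform u v) (bform v v) => x y z; ring.
apply: (cross_le uM vM).
  have := bform_ge0 (fun x => 1 * u x + 1 * v x); rewrite E.
  by rewrite expr1n mul1r mulr1.
have := bform_ge0 (fun x => 1 * u x + (-1) * v x); rewrite E.
by rewrite sqrrN expr1n mul1r mulrN1 mulNr.
Qed.

Lemma aform_lcomb_le J (y : 'I_J -> R) (F : 'I_J -> V) (M : R) : (forall k, H01 (F k)) ->
  (forall k, aform (F k) (F k) <= M) ->
  aform (lcomb (index_enum 'I_J) predT y F) (lcomb (index_enum 'I_J) predT y F) <= J%:R * M * \sum_k y k ^+ 2.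
Proof.
move=> hF hM; have hS : H01 (lcomb (index_enum 'I_J) predT y F) by exact: lcomb_H01.
have E : aform (lcomb (index_enum 'I_J) predT y F) (lcomb (index_enum 'I_J) predT y F) =
    \sum_k \sum_l aform (F k) (F l) * (y k * y l).
  rewrite aform_lcomb//; apply: eq_bigr => k _; rewrite aformC aform_lcomb// mulr_sumr.
  by apply: eq_bigr => l _; rewrite (aformC (F l)) mulrA mulrC.
rewrite E; apply: le_trans (ler_norm _) _; apply: quad_pert => k l.
exact: aform_cross.
Qed.

Lemma bform_lcomb_le J (y : 'I_J -> R) (F : 'I_J -> V) (M : R) : (forall k, L2 (F k)) ->
  (forall k, bform (F k) (F k) <= M) ->
  bform (lcomb (index_enum 'I_J) predT y F) (lcomb (index_enum 'I_J) predT y F) <= J%:R * M * \sum_k y k ^+ 2.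
Proof.
move=> hF hM; have hS : L2 (lcomb (index_enum 'I_J) predT y F) by exact: lcomb_L2.
have E : bform (lcomb (index_enum 'I_J) predT y F) (lcomb (index_enum 'I_J) predT y F) =
    \sum_k \sum_l bform (F k) (F l) * (y k * y l).
  rewrite bform_lcomb//; apply: eq_bigr => k _; rewrite bformC bform_lcomb// mulr_sumr.
  by apply: eq_bigr => l _; rewrite (bformC (F l)) mulrA mulrC.
rewrite E; apply: le_trans (ler_norm _) _; apply: quad_pert => k l.
exact: bform_cross.
Qed.

(** Here [b], [q], [r] and [D] stand for [bform v v], [bform v w], [bform w w] and the squared norm
    of [uh - t u]. Two expansions of [bform uh uh] give the last equation; so [t ^+ 2] is close to
    1, and [t] as well because it is positive. *)
Lemma theta_bound (C eta b q r t D : R) : 0 <= eta -> eta <= 1 -> 0 <= C -> 0 < t -> 0 <= b ->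
  `|b - 1| <= C * eta -> q ^+ 2 <= b * (C * eta ^+ 2) -> 0 <= r -> r <= C * eta ^+ 2 ->
  0 <= D -> D <= C * eta ^+ 2 -> t ^+ 2 = b + 2 * q + r - D ->
  (1 - t) ^+ 2 <= ((5 * C + 2) * eta) ^+ 2.
Proof.
move=> e0 e1 C0 t0 bge0; rewrite ler_norml => /andP[b1 b2] hq r0 hr D0 hD ht.
have ee : eta ^+ 2 <= eta by rewrite expr2 -[leRHS]mul1r ler_wpM2r.
have Ce : C * eta ^+ 2 <= C * eta by rewrite ler_wpM2l.
have CeC : C * eta <= C by rewrite -[leRHS]mulr1 ler_wpM2l.
have Ce0 : 0 <= C * eta by rewrite mulr_ge0.
have hq2 : `|q| <= (1 + C) * eta.
  have X0 : 0 <= (1 + C) * eta by rewrite mulr_ge0 ?addr_ge0.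
  rewrite -(@ler_pXn2r _ 2) ?nnegrE// real_normK ?num_real//.
  apply: le_trans hq _; have -> : ((1 + C) * eta) ^+ 2 = (1 + C) * ((1 + C) * eta ^+ 2) by ring.
  apply: ler_pM; [by []|by rewrite mulr_ge0 ?sqr_ge0|lra|].
  by rewrite ler_wpM2r ?sqr_ge0// lerDr.
move: hq2; rewrite ler_norml => /andP[q1 q2].
have M0 : 0 <= (5 * C + 2) * eta by rewrite mulr_ge0// addr_ge0// mulr_ge0.
have ht2 : `|1 - t ^+ 2| <= (5 * C + 2) * eta.
  have Mx : (5 * C + 2) * eta = 5 * (C * eta) + 2 * eta by ring.
  have qx : (1 + C) * eta = eta + C * eta by ring.
  rewrite Mx; rewrite qx in q1 q2; rewrite ler_norml; apply/andP; split; rewrite ht; lra.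
suff h : `|1 - t| <= (5 * C + 2) * eta.
  by rewrite -real_normK ?num_real// lerXn2r ?nnegrE.
apply: le_trans ht2; have -> : 1 - t ^+ 2 = (1 - t) * (1 + t) by ring.
by rewrite normrM ler_peMr ?normr_ge0// ger0_norm ?lerDl ?addr_ge0 ?(ltW t0).
Qed.

(* By the pairing, [uh - t u] with [t = b(u, uh)] is orthogonal to the whole eigenspace, in both
   forms, hence at most as large as [uh - v]. *)
Lemma final_estimate (la C eta : R) u uh v : 0 <= la -> 0 <= C -> 0 <= eta -> eta <= 1 ->
  eigen la u -> bform u u = 1 -> H01 uh -> paired la u uh ->
  eigen la v -> `|bform v v - 1| <= C * eta ->
  let w := fun x => 1 * uh x + (- 1) * v x in
  aform w w <= C * eta ^+ 2 -> bform w w <= C * eta ^+ 2 ->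
  aform (u \- uh) (u \- uh) <= (la * (5 * C + 2) ^+ 2 + C) * eta ^+ 2.
Proof.
move=> la0 C0 e0 e1 eu uu huh [t0 hp] ev hv w aw bw.
have hu := proj1 eu; have hv' := proj1 ev.
have Lu := H01_L2 hu; have Luh := H01_L2 huh; have Lv := H01_L2 hv'.
pose t := bform u uh; pose D : V := fun x => 1 * uh x + (- t) * u x.
have hD : H01 D by exact: H01_lin.
have LD := H01_L2 hD.
have bD z : eigen la z -> bform D z = 0.
  move=> ez; have Lz := H01_L2 (proj1 ez).
  (* The pairing applies to the part of [z] that is orthogonal to [u]. *)
  have ez' : eigen la (fun x => 1 * z x + (- bform u z) * u x) by exact: eigen_lin.
  have := hp _ ez'; rewrite !bform_linr// uu => h.
  have h0 : 1 * bform u z + - bform u z * 1 = 0 by ring.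
  have := h h0; rewrite [bform uh u]bformC -/t => h1.
  rewrite /D bform_linl//; have <- : 1 * bform uh z + - bform u z * t = 0 by [].
  by ring.
have aD z : eigen la z -> aform D z = 0.
  by move=> ez; rewrite aformC (ez.2 _ hD) bformC bD// mulr0.
pose z : V := fun x => t * u x + (- 1) * v x.
have ez : eigen la z by exact: eigen_lin.
have hz := proj1 ez; have Lz := H01_L2 hz.
have wE : w = fun x => 1 * D x + 1 * z x.
  by apply/funext => x; rewrite /w /D /z; ring.
have hw : H01 w by rewrite wE; exact: H01_lin.
have Lw := H01_L2 hw.
have bww : bform w w = bform D D + bform z z.
  rewrite wE in Lw *; rewrite (bform_linl 1 1 LD Lz Lw) (bform_linr 1 1 LD Lz LD) (bform_linr 1 1 LD Lz Lz).
  by rewrite (bformC z D) (bD z ez); move: (bform D D) (bform z z) => x y; ring.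
have aww : aform w w = aform D D + aform z z.
  rewrite wE in hw *; rewrite (aform_linl 1 1 hD hz hw) (aform_linr 1 1 hD hz hD) (aform_linr 1 1 hD hz hz).
  by rewrite (aformC z D) (aD z ez); move: (aform D D) (aform z z) => x y; ring.
have bDD : bform D D <= C * eta ^+ 2 by apply: le_trans bw; rewrite bww lerDl bform_ge0.
have aDD : aform D D <= C * eta ^+ 2 by apply: le_trans aw; rewrite aww lerDl aform_ge0.
have t2 : t ^+ 2 = bform v v + 2 * bform v w + bform w w - bform D D.
  have uhE : uh = fun x => 1 * v x + 1 * w x by apply/funext => x; rewrite /w; ring.
  have b1 : bform uh uh = bform v v + 2 * bform v w + bform w w.
    rewrite {1 2}uhE bform_linl//; last exact: L2_lin.
    rewrite (bform_linr 1 1 Lv Lw Lv) (bform_linr 1 1 Lv Lw Lw) (bformC w v).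
    by move: (bform v v) (bform v w) (bform w w) => x y y'; ring.
  rewrite -b1 {1}/D bform_linl// (bformC u D) (bD u eu) mulr0 addr0 mul1r /D bform_linr// (bformC uh u) -/t.
  by ring.
have ht := @theta_bound C eta (bform v v) (bform v w) (bform w w) t (bform D D) e0 e1 C0 t0 (bform_ge0 v) hv.
have {}ht : (1 - t) ^+ 2 <= ((5 * C + 2) * eta) ^+ 2.
  apply: ht => //; [|exact: bform_ge0|exact: bform_ge0].
  apply: le_trans (bform_CS Lv Lw) _; apply: ler_wpM2l => //; exact: bform_ge0.
have -> : u \- uh = fun x => (1 - t) * u x + (- 1) * D x.
  by apply/funext => x; rewrite /D /=; ring.
have hr : H01 (fun x => (1 - t) * u x + (- 1) * D x) by exact: H01_lin.
rewrite (aform_linl (1 - t) (-1) hu hD hr) (aform_linr (1 - t) (-1) hu hD hu) (aform_linr (1 - t) (-1) hu hD hD).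
rewrite (aformC u D) (aD u eu) (eu.2 u hu) uu.
move: (aform D D) aDD => aDD haDD.
have -> : (1 - t) * ((1 - t) * (la * 1) + -1 * 0) + -1 * ((1 - t) * 0 + -1 * aDD) = la * (1 - t) ^+ 2 + aDD by ring.
have h1 : la * (1 - t) ^+ 2 <= la * ((5 * C + 2) * eta) ^+ 2 by rewrite ler_wpM2l.
have -> : (la * (5 * C + 2) ^+ 2 + C) * eta ^+ 2 = la * ((5 * C + 2) * eta) ^+ 2 + C * eta ^+ 2 by ring.
exact: lerD.
Qed.

(** The candidate is the normalized projection of [uh] on the eigenspace, nonzero because [uh] is
    not orthogonal to [v]; [eigensystem_through] puts it at position [j]. The bound [J] makes the
    eigenspace a finite span. *)
Lemma pairing_exists (lam : nat -> R) (us : nat -> V) j J uh v : eigensystem lam us ->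
  (forall i, lam i = lam j -> (i < J)%N) -> L2 uh -> eigen (lam j) v -> bform uh v != 0 ->
  exists u, eigenpair j (lam j) u /\ paired (lam j) u uh.
Proof.
move=> es hJ Luh ev uhv; have [eu ou _ cu] := es.
have Lus i : L2 (us i) by apply: H01_L2; case: (eu i).
pose P (i : 'I_J) := lam i == lam j.
pose pr (w : V) : V := lcomb (index_enum 'I_J) P (fun i => bform w (us i)) (fun i : 'I_J => us i).
have epr w : eigen (lam j) (pr w) by apply: lcomb_eigen => i /eqP <-.
have bpr w z : L2 z -> bform (pr w) z = \sum_(i < J | P i) bform w (us i) * bform (us i) z.
  by move=> Lz; rewrite bform_lcomb.
have prE w z : eigen (lam j) w -> L2 z -> bform z w = bform (pr w) z.
  move=> ew Lz; have Lw := H01_L2 (proj1 ew); have Lp := H01_L2 (proj1 (epr w)).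
  pose r : V := fun x => 1 * w x + (- 1) * pr w x.
  have er : eigen (lam j) r by exact: eigen_lin.
  have Lr := H01_L2 (proj1 er).
  have rr : bform r r = 0.
    apply: (cu _ _ er) => i; have [li|li] := eqVneq (lam i) (lam j); last first.
      by apply: (eigen_orthogonal er (eu i)); rewrite eq_sym.
    rewrite /r bform_linl// bpr// (bigD1 (Ordinal (hJ i li))) ?/P ?li//=.
    rewrite ou eqxx big1 ?addr0; first by rewrite mulr1; ring.
    move=> k /andP[_ ki]; rewrite ou (_ : (nat_of_ord k == i) = false) ?mulr0//.
    by apply/negbTE; apply: contra ki => /eqP ki; apply/eqP/val_inj.
  have := bform_self0 Lr Lz rr; rewrite /r bform_linl// mul1r mulN1r => /eqP.
  by rewrite subr_eq0 bformC => /eqP.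
pose c := bform (pr uh) (pr uh).
have Lpu := H01_L2 (proj1 (epr uh)).
have uhE w : eigen (lam j) w -> bform uh w = bform (pr uh) w.
  move=> ew; have Lw := H01_L2 (proj1 ew); rewrite (prE w uh ew Luh) !bpr//.
  by apply: eq_bigr => i _; rewrite (bformC (us i) uh) mulrC (bformC w).
have c0 : 0 < c.
  rewrite lt_neqAle bform_ge0 andbT eq_sym; apply: contra uhv => /eqP c0.
  by rewrite uhE// (bform_self0 Lpu (H01_L2 (proj1 ev)) c0).
have s0 : 0 < Num.sqrt c by rewrite sqrtr_gt0.
pose u : V := fun x => (Num.sqrt c)^-1 * pr uh x + 0 * pr uh x.
have eigu : eigen (lam j) u by exact: eigen_lin.
have bu w : L2 w -> bform u w = (Num.sqrt c)^-1 * bform (pr uh) w.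
  by move=> Lw; rewrite /u bform_linl// mul0r addr0.
have Lu := H01_L2 (proj1 eigu).
have uu : bform u u = 1.
  rewrite bu// bformC bu// -/c mulrA -invfM -expr2 sqr_sqrtr ?ltW// mulVf// gt_eqF//.
have [us' [es' usj]] := eigensystem_through es eigu uu.
exists u; split; first by exists lam, us'.
split.
  by rewrite bu// (bformC _ uh) (uhE _ (epr uh)) -/c mulr_gt0 ?invr_gt0.
move=> w ew; have Lw := H01_L2 (proj1 ew); rewrite bu// uhE// => /eqP.
by rewrite mulf_eq0 invr_eq0 gt_eqF//= => /eqP.
Qed.

End final_estimates.

Section convergence.
Context {R : realType}.
Variable p : nat.
Hypothesis hp : (0 < p <= 7)%N.
Variables kap clead : R.
Hypothesis kap0 : 0 < kap.
Hypothesis clead0 : 0 < clead.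
Hypothesis hkap : forall f : {poly R}, (size f <= p.*2.+1)%N ->
  rule_sum (optimal_rule p) f = pint (-1) 1 f + kap * f`_p.*2.
Hypothesis hlead : forall q : {poly R}, (size q <= p)%N -> clead * q`_p.-1 ^+ 2 <= pint (-1) 1 (q * q).
Variable d : nat.
Hypothesis d0 : (0 < d)%N.
Local Notation e := (@enum_level d).

Record good_trials (C eta : R) (K : nat) (N : 'I_d -> nat)
    (r : {ffun 'I_d -> nat} -> Vh_index N p -> R) : Prop := GoodTrials {
  gt_gram : forall al be : {ffun 'I_d -> nat}, (forall k, (al k < K)%N) -> (forall k, (be k < K)%N) ->
    `|mform (@GBt R p d N) (r al) (r be) - (al == be)%:R| <= C * eta;
  gt_energy : forall al : {ffun 'I_d -> nat}, (forall k, (al k < K)%N) ->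
    mform (@GAt R p d N) (r al) (r al) <= C;
  gt_residual : forall al : {ffun 'I_d -> nat}, (forall k, (al k < K)%N) -> forall v,
    (mform (@GAt R p d N) (r al) v - tlam al * mform (@GBt R p d N) (r al) v) ^+ 2 <=
    (C * eta) ^+ 2 * mform (@GAt R p d N) v v;
  gt_close : forall al : {ffun 'I_d -> nat}, (forall k, (al k < K)%N) ->
    let g := fun x => 1 * Vh_fun (r al) x + (- 1) * tphi al x in
    aform g g <= C * eta ^+ 2 /\ bform g g <= C * eta ^+ 2 }.

Lemma summand_le4 (a b c f : R) : 0 <= a -> 0 <= b -> 0 <= c -> 0 <= f ->
  [/\ 1 <= 1 + a + b + c + f, a <= 1 + a + b + c + f, b <= 1 + a + b + c + f,
      c <= 1 + a + b + c + f & f <= 1 + a + b + c + f].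
Proof. by move=> *; split; lra. Qed.

(** The estimates depend on the mesh through [eta] alone, which dominates all the [N k ^- p], so the
    constant is independent of the ratios of the mesh sizes. *)
Lemma tensor_trials K : exists2 C : R, 1 <= C & forall (N : 'I_d -> nat) (eta : R),
  (forall k, (0 < N k)%N) -> 0 <= eta -> eta <= 1 -> (forall k, (N k)%:R ^- p <= eta) ->
  exists r, @good_trials C eta K N r.
Proof.
have [C C0 hC] := trial_family_exists hp kap0 clead0 hkap hlead K.
pose B : R := 1 + C + (K%:R * pi) ^+ 2.
pose X1 : R := d%:R * ((1 + C) ^+ d * C); pose X2 : R := d%:R * (1 + C) ^+ d.
pose X3 : R := d%:R ^+ 2 * B ^+ d * C; pose X4 : R := d%:R * X3.
have C1 : 0 <= (1 + C) ^+ d by rewrite exprn_ge0// addr_ge0.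
have B0 : 0 <= B ^+ d by rewrite exprn_ge0// addr_ge0 ?sqr_ge0// addr_ge0.
have X10 : 0 <= X1 by apply: mulr_ge0 => //; exact: mulr_ge0.
have X20 : 0 <= X2 by exact: mulr_ge0.
have X30 : 0 <= X3 by apply: mulr_ge0 => //; apply: mulr_ge0 => //; exact: sqr_ge0.
have X40 : 0 <= X4 by exact: mulr_ge0.
have [Y1 h1 h2 h3 h4] := summand_le4 X10 X20 X30 X40.
exists (1 + X1 + X2 + X3 + X4) => // N eta N0 e0 e1 hN.
set Y := 1 + X1 + X2 + X3 + X4 in Y1 h1 h2 h3 h4 *.
have Y0 : 0 <= Y := le_trans ler01 Y1.
have /fin_all_exists[r hr] := fun k => hC (N k) (N0 k).
exists (rt r); split.
- move=> al be sal sbe; apply: le_trans (tensor_gram C0 hr e1 hN sal sbe) _.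
  by rewrite ler_wpM2r.
- by move=> al sal; apply: le_trans (tensor_energy hp kap0 clead0 hkap N0 C0 hr e1 hN sal) _.
- move=> al sal v; apply: le_trans (tensor_residual hp kap0 clead0 hkap N0 C0 hr e0 e1 hN v sal) _.
  rewrite ler_wpM2r ?(psd_GAt hp kap0 clead0 hkap N0)// exprMn ler_wpM2r ?sqr_ge0//.
  apply: le_trans h1 _; rewrite expr2; exact: ler_peMl.
- move=> al sal g; split.
    apply: le_trans (tensor_close_a hp kap0 clead0 N0 C0 hr e0 hN sal) _.
    rewrite -/B (_ : d%:R * _ = X4 * eta ^+ 2); last by rewrite /X4 /X3 !mulrA.
    by rewrite ler_wpM2r ?sqr_ge0.
  apply: le_trans (tensor_close_b hp kap0 clead0 N0 C0 hr e0 hN sal) _.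
  rewrite -/B (_ : _ * (C * eta ^+ 2) = X3 * eta ^+ 2); last by rewrite /X3 !mulrA.
  by rewrite ler_wpM2r ?sqr_ge0.
Qed.

Lemma double_sum_le (x y a b b' f : R) : 0 <= a -> 0 <= b' -> x <= b -> y <= f ->
  2 * x + 2 * y <= a + 2 * b + 2 * b' + 2 * f.
Proof. by move=> *; lra. Qed.

Lemma upper_of_perturbed (x a b L g : R) : x * (1 - a) <= L + b -> a * (L + g) + b <= g -> a < 1 -> x <= L + g.
Proof.
move=> h1 h2 a1; have h3 : 0 < 1 - a by rewrite subr_gt0.
rewrite -(ler_pM2r h3); apply: le_trans h1 _.
have -> : (L + g) * (1 - a) = L + g - a * (L + g) by ring.
lra.
Qed.

Lemma entry_lt (al : {ffun 'I_d -> nat}) k : (al k < lev al)%N.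
Proof.
by rewrite /lev (bigD1 k)//=; apply: leq_trans (leq_addr _ _); rewrite expnS expn1 leq_pmulr.
Qed.

Lemma lev_gt0 (al : {ffun 'I_d -> nat}) : (0 < lev al)%N.
Proof. exact: leq_ltn_trans (leq0n _) (entry_lt al (Ordinal d0)). Qed.

Section one_eigenvalue.
Variable s : nat.
Hypothesis s0 : (0 < s)%N.
Local Notation J0 := (size (ball_seq d s)).
Local Notation J := (size (ball_seq d s.+1)).
Let la : R := pi ^+ 2 * s%:R.
(** The exact eigenvalues are integer multiples of [pi ^+ 2], so within this distance of [la] there
    is no other one. *)
Let g : R := pi ^+ 2 / 2.

Let pi2 : 0 < pi ^+ 2 :> R. Proof. by rewrite exprn_gt0 ?pi_gt0. Qed.
Let la0 : 0 < la. Proof. by rewrite mulr_gt0// ltr0n. Qed.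
Let g0 : 0 < g. Proof. by rewrite divr_gt0. Qed.

Section fixed_mesh.
(** [eta] will be the [p]-th power of the mesh size. [ep] is the tolerance of the lower bounds: [Kg]
    modes in each direction and a fine mesh bring the error term of [tensor_gap] below it. *)
Variables (N : 'I_d -> nat) (C eta ep : R).
Hypothesis N0 : forall k, (0 < N k)%N.
Hypothesis C1 : 1 <= C.
Hypothesis eta0 : 0 <= eta.
Hypothesis eta1 : eta <= 1.
Hypothesis smalleta : J%:R * (C * eta * C) * (2 * la + g + 1) <= g.
Local Notation ix := (Vh_index N p).
Local Notation GA := (@GAt R p d N).
Local Notation GB := (@GBt R p d N).
Variable r : {ffun 'I_d -> nat} -> ix -> R.
Hypothesis hr : good_trials C eta s.+1 r.
Variable Kg : nat.
Hypothesis hKg : forall k, ((Kg%:R + 1/2) * pi) ^- 2 + kap / clead * (N k)%:R ^- 2 <= ep.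
Hypothesis hep : (pi ^+ 2 * s.+1%:R)^-1 + ep <= (la + g)^-1.
Variables (c : 'I_#|ix| -> ix -> R) (lh : 'I_#|ix| -> R).
Hypothesis eigc : forall i v, mform GA (c i) v = lh i * mform GB (c i) v.
Hypothesis orth : forall i j, mform GB (c i) (c j) = (i == j)%:R.
Hypothesis lh_mono : {homo lh : i j / (i <= j)%N >-> i <= j}.

Let C0 : 0 <= C. Proof. exact: le_trans ler01 C1. Qed.
Let Ce0 : 0 <= C * eta. Proof. exact: mulr_ge0. Qed.

Let small k : (k < J)%N -> forall i, (e k i < s.+1)%N.
Proof. by rewrite enum_level_lt// => h i; apply: leq_trans h; rewrite ltnS ltnW// entry_lt. Qed.

Let tl_le k : (k < J)%N -> tlam (e k) <= la.
Proof. by rewrite enum_level_lt// ltnS => h; rewrite tlamE ler_wpM2l ?(ltW pi2)// ler_nat. Qed.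

Let tl_low k : (k < J0)%N -> tlam (e k) <= la - 2 * g.
Proof.
rewrite enum_level_lt// => h; rewrite tlamE /la /g.
have -> : pi ^+ 2 * s%:R - 2 * (pi ^+ 2 / 2) = pi ^+ 2 * (s%:R - 1) :> R by field.
by rewrite ler_wpM2l ?(ltW pi2)// lerBrDr natr1 ler_nat.
Qed.

Let tl_ge0 k : 0 <= tlam (e k) :> R. Proof. by apply: sumr_ge0 => i _; exact: sqr_ge0. Qed.

Let eq_e (k l : nat) : (e k == e l) = (k == l).
Proof. by apply/eqP/eqP => [/(enum_level_inj d0)|->]. Qed.

Let gramA k l : (k < J)%N -> (l < J)%N ->
  `|mform GA (r (e k)) (r (e l)) - tlam (e k) * (k == l)%:R| <= C * eta * (1 + la) * C.
Proof.
move=> kJ lJ.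
have h1 := gt_residual hr (small kJ) (r (e l)); have h2 := gt_energy hr (small lJ).
have h3 := gt_gram hr (small kJ) (small lJ); rewrite eq_e in h3.
set A := mform GA _ _ in h1 *; set B := mform GB _ _ in h1 h3 *; set t := tlam _ in h1 *.
have h4 : `|A - t * B| <= C * eta * C.
  have CC : 0 <= C * eta * C by exact: mulr_ge0.
  rewrite -(@ler_pXn2r _ 2) ?nnegrE// real_normK ?num_real//; apply: le_trans h1 _.
  rewrite [leRHS]exprMn; apply: ler_wpM2l; first exact: sqr_ge0.
  by apply: le_trans h2 _; rewrite expr2 ler_peMl.
have -> : A - t * (k == l)%:R = (A - t * B) + t * (B - (k == l)%:R) by ring.
apply: le_trans (ler_normD _ _) _.
have -> : C * eta * (1 + la) * C = C * eta * C + la * (C * eta * C) by ring.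
apply: lerD => //; rewrite normrM; apply: ler_pM => //.
  by rewrite ger0_norm ?tl_ge0// tl_le.
by apply: le_trans h3 _; rewrite ler_peMr.
Qed.

Lemma lh_nonneg i : 0 <= lh i.
Proof.
have := psd_GAt hp kap0 clead0 hkap N0 (c i).
by rewrite eigc orth eqxx mulr1.
Qed.

Let CC : C * eta <= C * eta * C. Proof. by rewrite ler_peMr. Qed.

Let upper_eig (i : 'I_#|ix|) L : (i < J)%N -> L <= la -> (forall k, (k <= i)%N -> tlam (e k) <= L) ->
  lh i <= L + g.
Proof.
move=> iJ Lla hL.
have kJ (k : 'I_i.+1) : (k < J)%N by exact: leq_trans (ltn_ord k) iJ.
have := @minmax_upper R _ GA GB (@sym_GAt R p d N) (@sym_GBt R p d N) c lh eigc orth lh_mono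
  i i (fun k : 'I_i.+1 => r (e k)) L (C * eta) (C * eta * (1 + la) * C) erefl (lh_nonneg i).
have h1 (k l : 'I_i.+1) : `|mform GB (r (e k)) (r (e l)) - (k == l)%:R| <= C * eta.
  by have := gt_gram hr (small (kJ k)) (small (kJ l)); rewrite eq_e.
have h2 (k l : 'I_i.+1) : `|mform GA (r (e k)) (r (e l)) - tlam (e k) * (k == l)%:R| <= C * eta * (1 + la) * C.
  exact: gramA.
have hk (k : 'I_i.+1) : tlam (e k) <= L by apply: hL; exact: ltn_ord k.
move=> /(_ h1) h; have {h} := h (ex_intro2 _ _ (fun k : 'I_i.+1 => tlam (e k)) hk h2).
set n := i.+1%:R; move=> h.
have nJ : n <= J%:R by rewrite ler_nat.
have n0 : 0 <= n by exact: ler0n.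
have C2 : 0 <= C * eta * C by exact: mulr_ge0.
have na : n * (C * eta) <= J%:R * (C * eta * C) by exact: ler_pM.
have q0 : 0 <= J%:R * (C * eta * C) by exact: mulr_ge0.
apply: (upper_of_perturbed h).
  apply: le_trans smalleta.
  have -> : J%:R * (C * eta * C) * (2 * la + g + 1) = J%:R * (C * eta * C) * (la + g) + J%:R * (C * eta * C) * (1 + la) by ring.
  apply: lerD.
    apply: (@le_trans _ _ (n * (C * eta) * (la + g))).
      by apply: ler_wpM2l; [exact: mulr_ge0|rewrite lerD2r].
    by apply: ler_wpM2r => //; exact: addr_ge0 (ltW la0) (ltW g0).
  have -> : n * (C * eta * (1 + la) * C) = n * (C * eta * C) * (1 + la) by ring.
  by apply: ler_wpM2r; [exact: addr_ge0 ler01 (ltW la0)|exact: ler_wpM2r].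
apply: le_lt_trans na _.
rewrite -[ltRHS](@divff _ (2 * la + g + 1)); last by rewrite gt_eqF// !addr_gt0// mulr_gt0.
rewrite ltr_pdivlMr; last by rewrite !addr_gt0// mulr_gt0.
by apply: le_lt_trans smalleta _; have := la0; lra.
Qed.

Let low (i : 'I_#|ix|) : (i < J0)%N -> lh i <= la - g.
Proof.
move=> iJ0; have iJ : (i < J)%N by apply: leq_trans iJ0 _; exact: size_ball_mono.
(* The exact eigenvalues below the cluster are at most [la - 2 * g], and the discrete ones exceed
   this bound by at most [g]. *)
have -> : la - g = (la - 2 * g) + g by ring.
apply: upper_eig => //; first by have := g0; lra.
by move=> k ki; apply: tl_low; exact: leq_ltn_trans iJ0.
Qed.

Let mid (i : 'I_#|ix|) : (i < J)%N -> lh i <= la + g.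
Proof. by move=> iJ; apply: upper_eig => // k ki; apply: tl_le; exact: leq_ltn_trans iJ. Qed.

(** The functionals are the coefficients on the [J] sine products of level at most [s]; on their
    common kernel [tensor_gap] applies with the next level. *)
Let high (i : 'I_#|ix|) : (J <= i)%N -> la + g <= lh i.
Proof.
move=> Ji; pose i0 := Ordinal (leq_ltn_trans Ji (ltn_ord i)).
apply: (@le_trans _ _ (lh i0)); last exact: lh_mono.
apply: (@minmax_lower R _ GA GB (@sym_GAt R p d N) (@sym_GBt R p d N) c lh eigc orth lh_mono
  J i0 (fun (k : 'I_J) => tvec (fun l => bt (e k l)))) => //.
move=> w hw.
have lg0 : 0 < la + g by rewrite addr_gt0.
have h : mform GB w w <= ((pi ^+ 2 * s.+1%:R)^-1 + ep) * mform GA w w.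
  apply: (tensor_gap hp kap0 clead0 hkap hlead N0 (ltn0Sn s) hKg) => f hf.
  have [k kJ ek] := enum_level_index d0 hf; apply: etrans (hw (Ordinal kJ)).
  apply: eq_bigr => a _; congr (_ * _); rewrite /tvec; apply: eq_bigr => l _.
  by rewrite /= ek ffunE.
rewrite -ler_pdivlMl//; apply: le_trans h _.
by apply: ler_wpM2r => //; exact: (psd_GAt hp kap0 clead0 hkap N0).
Qed.

Let P : R := poincare kap clead.
Let P0 : 0 < P.
Proof.
rewrite /P /poincare addr_gt0 ?divr_gt0//.
by rewrite invr_gt0 exprn_gt0// divr_gt0// pi_gt0.
Qed.

(** This and the next two are the constants of [cluster_approx] once the powers of [eta] are taken
    out. *)
Let kp : R := (la + g) / g.
Let C1' : R := C + (C * kp) ^+ 2 * P.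
Let C2' : R := (la + g) * J%:R ^+ 3 * C1' ^+ 2 + (1 + J%:R * C1') * J%:R * (C * kp) ^+ 2.

Let C10 : 0 <= C1'.
Proof. by rewrite addr_ge0// mulr_ge0 ?sqr_ge0// ltW. Qed.

Let C20 : 0 <= C2'.
Proof.
rewrite addr_ge0// mulr_ge0 ?sqr_ge0//.
  by rewrite mulr_ge0 ?exprn_ge0//; exact: addr_ge0 (ltW la0) (ltW g0).
by rewrite mulr_ge0// addr_ge0// mulr_ge0.
Qed.

Let tl_eq k : (J0 <= k)%N -> (k < J)%N -> tlam (e k) = la.
Proof.
rewrite leqNgt !enum_level_lt// => h1 h2; rewrite tlamE; congr (_ * _%:R).
by apply/eqP; rewrite eqn_leq -ltnS h2 leqNgt h1.
Qed.

Let remainder (j : 'I_#|ix|) : (J0 <= j < J)%N -> exists beta : 'I_J -> R,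
  [/\ forall k : 'I_J, (k < J0)%N -> beta k = 0,
     `|\sum_k beta k ^+ 2 - 1| <= J%:R * C1' * eta &
     mform GA (fun a => c j a - \sum_k beta k * r (e k) a)
       (fun a => c j a - \sum_k beta k * r (e k) a) <= C2' * eta ^+ 2].
Proof.
move=> hj.
have coer v : P^-1 * mform GB v v <= mform GA v v.
  by rewrite ler_pdivrMl//; exact: (coercive_h hp kap0 clead0 hkap hlead d0 N0).
have gram (k l : 'I_J) : `|mform GB (r (e k)) (r (e l)) - (k == l)%:R| <= C * eta.
  by have := gt_gram hr (small (ltn_ord k)) (small (ltn_ord l)); rewrite eq_e.
have resid (k : 'I_J) : (J0 <= k)%N -> forall v,
    (mform GA (r (e k)) v - la * mform GB (r (e k)) v) ^+ 2 <= (C * eta) ^+ 2 * mform GA v v.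
  by move=> kJ0 v; rewrite -(tl_eq kJ0 (ltn_ord k)); exact: (gt_residual hr (small (ltn_ord k))).
have Pi0 : 0 < P^-1 by rewrite invr_gt0.
have [beta [b0 b1 b2]] := @cluster_approx R _ GA GB (@sym_GBt R p d N) c lh eigc orth J0 J
  (fun k : 'I_J => r (e k)) la P^-1 g (C * eta) (C * eta) Pi0 la0 g0 coer low mid high gram resid j hj.
exists beta; split=> //.
  apply: le_trans b1 _; rewrite invrK -/kp -mulrA ler_wpM2l//.
  have -> : C * eta + (C * eta * kp) ^+ 2 * P = C * eta + (C * kp) ^+ 2 * P * eta ^+ 2 by ring.
  rewrite /C1' mulrDl lerD2l ler_wpM2l//; first by rewrite mulr_ge0 ?sqr_ge0// ltW.
  by rewrite expr2 ler_piMl.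
apply: le_trans b2 _; rewrite invrK -/kp.
set E := C * eta + _.
have E0 : 0 <= E by rewrite /E addr_ge0// mulr_ge0 ?sqr_ge0// ltW.
have E1 : E <= C1' * eta.
  have -> : E = C * eta + (C * kp) ^+ 2 * P * eta ^+ 2 by rewrite /E; ring.
  rewrite /C1' mulrDl lerD2l ler_wpM2l//; first by rewrite mulr_ge0 ?sqr_ge0// ltW.
  by rewrite expr2 ler_piMl.
have E2 : E <= C1' by apply: le_trans E1 _; rewrite -[leRHS]mulr1 ler_wpM2l.
have -> : C2' * eta ^+ 2 = (la + g) * J%:R ^+ 3 * (C1' * eta) ^+ 2 + (1 + J%:R * C1') * J%:R * (C * eta * kp) ^+ 2.
  by rewrite /C2'; ring.
apply: lerD.
  apply: ler_wpM2l; last by rewrite lerXn2r ?nnegrE// mulr_ge0.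
  by rewrite mulr_ge0 ?exprn_ge0//; exact: addr_ge0 (ltW la0) (ltW g0).
apply: ler_wpM2r; first exact: sqr_ge0.
by apply: ler_wpM2r => //; rewrite lerD2l; exact: ler_wpM2l.
Qed.

Let GM_le k y : mform (@GM R p (N k)) y y <= mform (@GH R p (N k)) y y.
Proof. exact: GM_le_GH hp _ _ kap0 clead0 hkap _ (N0 k) y. Qed.
Let psdM k : psd (@GM R p (N k)). Proof. exact: psd_GM hp _ _ kap0 clead0 _ (N0 k). Qed.
Let psdK k : psd (@GK R p (N k)). Proof. exact: psd_GK hp _ _ kap0 clead0 _ (N0 k). Qed.
Let sM k : sym (@GM R p (N k)). Proof. exact: sym_GM. Qed.
Let sH k : sym (@GH R p (N k)). Proof. exact: sym_GH. Qed.
Let sK k : sym (@GK R p (N k)). Proof. exact: sym_GK. Qed.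

Lemma bform_Vh_le (y : ix -> R) : bform (Vh_fun y) (Vh_fun y) <= P * mform GA y y.
Proof.
rewrite (bform_Vh hp kap0 clead0 N0).
apply: le_trans (coercive_h hp kap0 clead0 hkap hlead d0 N0 y).
apply: (@tform_le R d (fun k => (N k + p - 2)%N) (fun k => @GM R p (N k)) (fun k => @GH R p (N k)) y sM sH psdM GM_le).
Qed.

Lemma aform_Vh_le (y : ix -> R) : aform (Vh_fun y) (Vh_fun y) <= mform GA y y.
Proof.
rewrite (aform_Vh hp kap0 clead0 N0) mform_sumG mform_GAt; apply: ler_sum => l _.
apply: tform_le.
- by move=> k; rewrite /tsubst; case: ifP => _; [exact: sK|exact: sM].
- by move=> k; rewrite /tsubst; case: ifP => _; [exact: sK|exact: sH].
- by move=> k; rewrite /tsubst; case: ifP => _; [exact: psdK|exact: psdM].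
- by move=> k z; rewrite /tsubst; case: ifP => _.
Qed.

Definition cluster_cst : R := J%:R * C1' + 2 * (1 + P) * C2' + 2 * (J%:R * C * (1 + J%:R * C1')).

Lemma cluster_cst_ge0 : 0 <= cluster_cst.
Proof.
have h1 : 0 <= J%:R * C1' by exact: mulr_ge0.
have h2 : 0 <= (1 + P) * C2' by rewrite mulr_ge0// addr_ge0// ltW.
have h3 : 0 <= J%:R * C * (1 + J%:R * C1') by rewrite mulr_ge0 ?addr_ge0// mulr_ge0.
rewrite /cluster_cst; have -> : 2 * (1 + P) * C2' = 2 * ((1 + P) * C2') by ring.
by lra.
Qed.

(** The coefficients of [remainder] are put on the exact eigenfunctions. The difference to [c j] is
    then the spline remainder plus a combination of the gaps between trial functions and sine
    products. *)
Lemma cluster_function (j : 'I_#|ix|) : (J0 <= j < J)%N -> exists v : 'rV[R]_d -> R,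
  [/\ eigen la v, `|bform v v - 1| <= cluster_cst * eta &
   let w := fun x => 1 * Vh_fun (c j) x + (- 1) * v x in
   aform w w <= cluster_cst * eta ^+ 2 /\ bform w w <= cluster_cst * eta ^+ 2].
Proof.
move=> hj; have [beta [b0 b1 b2]] := remainder hj.
pose ph (k : 'I_J) := @tphi R d (e k).
pose v := lcomb (index_enum 'I_J) predT beta ph.
have Lph k : L2 (ph k) by exact: tphi_L2.
have ev : eigen la v.
  have -> : v = lcomb (index_enum 'I_J) (fun k : 'I_J => (J0 <= k)%N) beta ph.
    apply/funext => x; rewrite /v /lcomb [RHS]big_mkcond; apply: eq_bigr => k _.
    by case: leqP => // kJ; rewrite (b0 k kJ) mul0r.
  by apply: lcomb_eigen => k kJ; rewrite -(tl_eq kJ (ltn_ord k)); exact: tphi_eigen.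
have Lv : L2 v by exact: lcomb_L2.
have vv : bform v v = \sum_k beta k ^+ 2.
  rewrite {1}/v bform_lcomb//; apply: eq_bigr => k _; rewrite bformC bform_lcomb// (bigD1 k)//=.
  rewrite tphi_orthonormal eqxx big1 ?addr0 ?mulr1 ?expr2// => l lk.
  by rewrite tphi_orthonormal eq_e (_ : (nat_of_ord l == k) = false) ?mulr0//; apply/negbTE.
have eta2 : 0 <= eta ^+ 2 by exact: sqr_ge0.
have h1 : 0 <= J%:R * C1' by exact: mulr_ge0.
have h2 : 0 <= P * C2' by rewrite mulr_ge0// ltW.
have h3 : 0 <= J%:R * C * (1 + J%:R * C1') by rewrite mulr_ge0 ?addr_ge0// mulr_ge0.
exists v; split=> //.
  rewrite vv; apply: le_trans b1 _; apply: ler_wpM2r => //; rewrite /cluster_cst -addrA lerDl.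
  by rewrite addr_ge0 ?mulr_ge0// addr_ge0// ltW.
have bs : \sum_k beta k ^+ 2 <= 1 + J%:R * C1'.
  have := le_trans (ler_norm _) b1; rewrite lerBlDl => h; apply: le_trans h _.
  by rewrite lerD2l -[leRHS]mulr1 ler_wpM2l.
pose y : ix -> R := fun a => c j a - \sum_k beta k * r (e k) a.
pose gp (k : 'I_J) : 'rV[R]_d -> R := fun x => 1 * Vh_fun (r (e k)) x + (- 1) * tphi (e k) x.
have hV z : H01 (@Vh_fun R d N p z) by exact: (Vh_H01 hp kap0 clead0 N0).
have hg k : H01 (gp k) by apply: H01_lin; [exact: hV|exact: tphi_H01].
pose G := lcomb (index_enum 'I_J) predT beta gp.
have hG : H01 G by exact: lcomb_H01.
have -> : (fun x => 1 * Vh_fun (c j) x + (- 1) * v x) = (fun x => 1 * Vh_fun y x + 1 * G x).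
  apply/funext => x; rewrite /v /G /lcomb /gp /ph !mul1r mulN1r.
  have -> : \sum_k beta k * (1 * Vh_fun (r (e k)) x + - 1 * tphi (e k) x) =
      \sum_(k < J) beta k * Vh_fun (r (e k)) x - \sum_(k < J) beta k * tphi (e k) x.
    by rewrite -sumrB; apply: eq_bigr => k _; rewrite mul1r mulN1r mulrBr.
  rewrite addrA; congr (_ - _).
  have -> : \sum_(k < J) beta k * Vh_fun (r (e k)) x =
      \sum_(i : ix) (\sum_(k < J) beta k * r (e k) i) * \prod_(l < d) bspline p (N l) (i l).+1 (x ord0 l).
    rewrite /Vh_fun; under eq_bigr do rewrite mulr_sumr.
    rewrite exchange_big; apply: eq_bigr => i _; rewrite mulr_suml; apply: eq_bigr => k _.
    by rewrite mulrA.
  rewrite /Vh_fun -big_split; apply: eq_bigr => i _ /=.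
  by rewrite -mulrDl /y subrK.
have aG : aform G G <= J%:R * C * (1 + J%:R * C1') * eta ^+ 2.
  have := aform_lcomb_le beta hg (fun k => (gt_close hr (small (ltn_ord k))).1) => h; apply: le_trans h _.
  have -> : J%:R * C * (1 + J%:R * C1') * eta ^+ 2 = J%:R * (C * eta ^+ 2) * (1 + J%:R * C1') by ring.
  by apply: ler_wpM2l => //; rewrite mulr_ge0// mulr_ge0.
have bG : bform G G <= J%:R * C * (1 + J%:R * C1') * eta ^+ 2.
  have := bform_lcomb_le beta (fun k => H01_L2 (hg k)) (fun k => (gt_close hr (small (ltn_ord k))).2) => h; apply: le_trans h _.
  have -> : J%:R * C * (1 + J%:R * C1') * eta ^+ 2 = J%:R * (C * eta ^+ 2) * (1 + J%:R * C1') by ring.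
  by apply: ler_wpM2l => //; rewrite mulr_ge0// mulr_ge0.
have ay : aform (Vh_fun y) (Vh_fun y) <= C2' * eta ^+ 2 := le_trans (aform_Vh_le y) b2.
have by_ : bform (Vh_fun y) (Vh_fun y) <= P * C2' * eta ^+ 2.
  by apply: le_trans (bform_Vh_le y) _; rewrite -mulrA; apply: ler_wpM2l b2; exact: ltW.
have cE : cluster_cst * eta ^+ 2 = J%:R * C1' * eta ^+ 2 + 2 * (C2' * eta ^+ 2) + 2 * (P * C2' * eta ^+ 2) + 2 * (J%:R * C * (1 + J%:R * C1') * eta ^+ 2).
  by rewrite /cluster_cst; ring.
have z1 : 0 <= J%:R * C1' * eta ^+ 2 by exact: mulr_ge0.
have z2 : 0 <= C2' * eta ^+ 2 by exact: mulr_ge0.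
have z3 : 0 <= P * C2' * eta ^+ 2 by exact: mulr_ge0.
split; rewrite cE.
  apply: le_trans (aform_lin_le 1 1 (hV y) hG) _; rewrite expr1n !mulr1.
  exact: double_sum_le z1 z3 ay aG.
apply: le_trans (bform_lin_le 1 1 (H01_L2 (hV y)) (H01_L2 hG)) _; rewrite expr1n !mulr1.
apply: le_trans (double_sum_le z1 z2 by_ bG) _.
by rewrite (addrAC (J%:R * C1' * eta ^+ 2)).
Qed.

End fixed_mesh.
End one_eigenvalue.
End convergence.

(** * Mesh size and the error estimate *)

Section mesh.
Context {R : realType} (d : nat).

Lemma mesh_size_ge (N : 'I_d -> nat) k : (N k)%:R^-1 <= mesh_size N :> R.
Proof.
rewrite /mesh_size -[leLHS]ger0_norm ?invr_ge0// -sqrtr_sqr ler_wsqrtr// exprVn.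
rewrite (bigD1 k)//= lerDl; apply: sumr_ge0 => i _.
by rewrite invr_ge0 exprn_ge0.
Qed.

Lemma expn_le_self (p : nat) (h : R) : (0 < p)%N -> 0 <= h -> h <= 1 -> h ^+ p <= h.
Proof. by case: p => // p _ h0 h1; rewrite exprS ler_piMr// exprn_ile1. Qed.

Lemma spectral_cutoff (x : R) : 0 < x -> exists K : nat, ((K%:R + 1/2) * pi) ^- 2 <= x :> R.
Proof.
move=> x0; exists (Num.truncn x^-1); set K := Num.truncn _.
have h1 := @half_freq_ge R K; set z := (_ * pi) in h1 *.
have h2 : x^-1 <= K.+1%:R by apply: ltW; exact: truncnS_gt.
have z1 : 1 <= z by apply: le_trans h1; rewrite ler1n.
have z0 : 0 < z by exact: lt_le_trans z1.
apply: (@le_trans _ _ z^-1).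
  by rewrite lef_pV2 ?posrE ?exprn_gt0// expr2 ler_peMr// ltW.
rewrite -[leRHS]invrK lef_pV2 ?posrE ?invr_gt0//.
exact: le_trans h2 h1.
Qed.

Lemma scaled_le (a b h : R) : 0 <= a -> 0 < b -> 0 <= h -> h < b / (a + 1) -> a * h <= b.
Proof.
move=> a0 b0 h0; rewrite ltr_pdivlMr ?ltr_wpDl// => h1.
by apply: le_trans (ltW h1); rewrite mulrC ler_wpM2l// lerDl.
Qed.

(** Orthogonality would give [bform v v <= bform w w <= 1/4] by Cauchy-Schwarz, against
    [bform v v >= 3/4]. *)
Lemma bform_neq0 (uh v : 'rV[R]_d -> R) (x : R) : L2 uh -> L2 v -> x <= 1/4 -> `|bform v v - 1| <= x ->
  (let w := fun x => 1 * uh x + (- 1) * v x in bform w w <= 1/4) -> bform uh v != 0.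
Proof.
move=> Luh Lv x4 hv /= hw; apply/negP => /eqP h0.
have Lw : L2 (fun x => 1 * uh x + (- 1) * v x) by exact: L2_lin.
have := bform_CS Lw Lv; rewrite [X in X ^+ 2](bform_linl 1 (-1) Luh Lv Lv) h0.
move: hw; set W := bform _ _; set y := bform v v in hv * => hw h.
have hy : 3/4 <= y by have := le_trans hv x4; rewrite ler_norml => /andP[]; lra.
have y0 : 0 < y by lra.
have : y * y <= W * y by apply: le_trans h; rewrite mulr0 add0r mulN1r sqrrN expr2.
by rewrite ler_pM2r//; lra.
Qed.

End mesh.

(* [eigenpair] and [discrete_eigenpair] count from 0. *)
Theorem theorem3 (R : realType) (d p j : nat)
    (hd : (0 < d <= 3)%N) (hp : (0 < p <= 7)%N) :
  exists C h0 : R, 0 < h0 /\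
    forall N : 'I_d -> nat, (forall k, 0 < N k)%N -> mesh_size N < h0 ->
    forall (lh : R) (uh : Vh N p), discrete_eigenpair j lh uh ->
      (exists l u, eigenpair j l u /\ paired l u (Vh_fun uh)) /\
      (forall l u, eigenpair j l u -> paired l u (Vh_fun uh) ->
         H1_seminorm (u \- Vh_fun uh) <= C * mesh_size N ^+ p).
Proof.
have /andP[d0 _] := hd; have /andP[p0 _] := hp.
have [kap kap0 hkap] := @optimal_rule_defect R p hp.
have [clead clead0 hlead'] := @pint_sqr_lead R p.-1.
have hlead (q : {poly R}) : (size q <= p)%N -> clead * q`_p.-1 ^+ 2 <= pint (-1) 1 (q * q).
  by move=> sq; apply: hlead'; rewrite prednK.
pose e := @enum_level d; pose s := lev (e j); have s0 : (0 < s)%N by exact: lev_gt0.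
(* The indices of the eigenvalue of level [s] run from [J0] to [J - 1], and [j] is among them. *)
pose J0 := size (ball_seq d s); pose J := size (ball_seq d s.+1).
have hJ : (J0 <= j < J)%N.
  by rewrite leqNgt !enum_level_lt// ltnn ltnSn.
pose la : R := pi ^+ 2 * s%:R; pose g : R := pi ^+ 2 / 2.
have pi2 : 0 < pi ^+ 2 :> R by rewrite exprn_gt0 ?pi_gt0.
have la0 : 0 < la by rewrite mulr_gt0// ltr0n.
have g0 : 0 < g by rewrite divr_gt0.
have laE : tlam (e j) = la by rewrite tlamE.
have [C C1 hC] := tensor_trials hp kap0 clead0 hkap hlead d s.+1.
have C0 : 0 <= C := le_trans ler01 C1.
(* The room between the reciprocal of the next eigenvalue and the required [1 / (la + g)]; one half
   is spent on the cutoff [Kg], the other on the mass defect. *)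
pose dl : R := (la + g)^-1 - (pi ^+ 2 * s.+1%:R)^-1.
have dl0 : 0 < dl.
  have ps0 : 0 < pi ^+ 2 * s.+1%:R :> R by apply: mulr_gt0 => //; rewrite ltr0n.
  rewrite subr_gt0 ltf_pV2 ?posrE//; last exact: addr_gt0.
  have -> : pi ^+ 2 * s.+1%:R = la + pi ^+ 2 :> R by rewrite -natr1 mulrDr mulr1.
  by rewrite ltrD2l /g; lra.
have dl2 : 0 < dl / 2 by rewrite divr_gt0.
have [Kg hKg] := spectral_cutoff dl2.
pose Cc := @cluster_cst R kap clead d s C.
have Cc0 : 0 <= Cc by exact: cluster_cst_ge0.
pose B1 : R := J%:R * (C * C) * (2 * la + g + 1).
have B10 : 0 <= B1.
  have la0' := ltW la0; have g0' := ltW g0.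
  apply: mulr_ge0; first by apply: mulr_ge0 => //; exact: mulr_ge0.
  by apply: addr_ge0 => //; apply: addr_ge0 => //; exact: mulr_ge0.
have kc0 : 0 <= kap / clead := divr_ge0 (ltW kap0) (ltW clead0).
have q4 : (0 : R) < 1/4 by lra.
(* The four terms provide, in this order, [eta <= h <= 1], the upper bounds of the discrete
   eigenvalues, their lower bounds, and the nonzero product of [uh] and [v]. *)
pose h0 : R := Num.min (Num.min 1 (g / (B1 + 1))) (Num.min ((dl / 2) / (kap / clead + 1)) ((1/4) / (Cc + 1))).
exists (Num.sqrt (la * (5 * Cc + 2) ^+ 2 + Cc)), h0; split.
  by rewrite !lt_min ltr01 !divr_gt0// ltr_wpDl.
move=> N N0; set h := mesh_size N; rewrite !lt_min => /andP[/andP[h1 hB1] /andP[hdl hCc]] lh uh.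
have hge k : (N k)%:R^-1 <= h := mesh_size_ge N k.
have h_ge0 : 0 <= h by rewrite sqrtr_ge0.
have h_le1 := ltW h1.
pose eta := h ^+ p.
have eta0 : 0 <= eta by exact: exprn_ge0.
have eta_h : eta <= h by exact: expn_le_self.
have eta1 : eta <= 1 := le_trans eta_h h_le1.
have hN k : (N k)%:R ^- p <= eta.
  by rewrite -exprVn /eta lerXn2r ?nnegrE ?invr_ge0.
have [r hr] := hC N eta N0 eta0 eta1 hN.
have small1 : J%:R * (C * eta * C) * (2 * la + g + 1) <= g.
  apply: le_trans (scaled_le B10 g0 h_ge0 hB1).
  have -> : J%:R * (C * eta * C) * (2 * la + g + 1) = B1 * eta by rewrite /B1; ring.
  exact: ler_wpM2l.
have small2 k : ((Kg%:R + 1/2) * pi) ^- 2 + kap / clead * (N k)%:R ^- 2 <= dl.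
  rewrite [leRHS](splitr dl); apply: lerD => //.
  apply: le_trans (scaled_le kc0 dl2 h_ge0 hdl); apply: ler_wpM2l => //.
  apply: le_trans (hge k); rewrite -exprVn expr2 ler_piMl ?invr_ge0//.
  by rewrite invf_le1 ?ltr0n// ler1n.
have small3 : (pi ^+ 2 * s.+1%:R)^-1 + dl <= (la + g)^-1 by rewrite /dl addrC subrK.
have CcE : Cc * eta <= 1/4.
  by apply: le_trans (scaled_le Cc0 q4 h_ge0 hCc); exact: ler_wpM2l.
have CcE2 : Cc * eta ^+ 2 <= 1/4.
  by apply: le_trans CcE; rewrite ler_wpM2l// expr2 ler_piMl.
move=> [lam [c [i [[eigc orth mono] ij lami ci]]]].
have eigc' a v : mform (@GAt R p d N) (c a) v = lam a * mform (@GBt R p d N) (c a) v.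
  have := eigc a v; rewrite bform_hE (aform_hE hp kap0 clead0 hkap N0); exact.
have orth' a b : mform (@GBt R p d N) (c a) (c b) = (a == b)%:R.
  by have := orth a b; rewrite bform_hE.
have iJ : (J0 <= i < J)%N by rewrite ij.
have [v [ev vv [aw bw]]] := cluster_function hp kap0 clead0 hkap hlead d0 s0 N0 C1 eta0 eta1 small1 hr small2 small3 eigc' orth' mono iJ.
rewrite ci in aw bw.
have hU : H01 (Vh_fun uh) by exact: (Vh_H01 hp kap0 clead0 N0).
have es := @sine_eigensystem R d d0.
split.
  have hi a : tlam (e a) = tlam (e j) :> R -> (a < J)%N.
    rewrite !tlamE => /(mulfI (lt0r_neq0 pi2)) /eqP; rewrite eqr_nat => /eqP ea.
    by rewrite enum_level_lt// -/e ea.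
  have ev' : eigen (tlam (e j)) v by rewrite laE.
  have nz : bform (Vh_fun uh) v != 0.
    by apply: (bform_neq0 (H01_L2 hU) (H01_L2 (proj1 ev)) CcE vv); exact: le_trans bw CcE2.
  have [u [h2 h3]] := pairing_exists es hi (H01_L2 hU) ev' nz.
  by exists (tlam (e j)), u.
move=> l u [lam' [us' [es' lj uj]]] hpair.
(* Eigenvalues do not depend on the eigensystem, so [l] is the one computed from the sine
   products. *)
have ll : l = la by rewrite -lj -laE; exact: (eigensystem_unique j es' es).
have [eu ou _ _] := es'.
have eigu : eigen la u by rewrite -ll -lj -uj; exact: eu.
have uu : bform u u = 1 by rewrite -uj ou eqxx.
rewrite ll in hpair.
have := final_estimate (ltW la0) Cc0 eta0 eta1 eigu uu hU hpair ev vv aw bw.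
rewrite /H1_seminorm => hf; apply: le_trans (ler_wsqrtr hf) _.
have F0 : 0 <= la * (5 * Cc + 2) ^+ 2 + Cc by rewrite addr_ge0// mulr_ge0 ?sqr_ge0// ltW.
by rewrite sqrtrM// sqrtr_sqr ger0_norm.
Qed.
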